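(* Let $\Omega$ be an irreducible symmetric cone of rank $r$ in $\mathbb R^n$, let $T_\Omega=\mathbb R^n+i\Omega$, and let $\nu\in\mathbb R$. Let $1<p\leq\infty$ and $1\leq q\leq\infty$. (1) For $\nu\leq\frac nr-1$, the Bergman-Lorentz space $A_\nu(p,q)$ is trivial, i.e. $A_\nu(p,q)=\{0\}$. (2) Suppose $\nu>\frac nr-1$. Equipped with the norm $\|\cdot\|_{p,q}$ induced by the Lorentz space $L_\nu(p,q)$, the Bergman-Lorentz space $A_\nu(p,q)$ is a Banach space.
   Context: $\Omega\subset\mathbb R^n$ is an irreducible symmetric cone (open, convex, self-dual with respect to an inner product, homogeneous, irreducible) of rank $r$, with determinant $\Delta$ (the determinant polynomial of the associated Euclidean Jordan algebra, whose cone of squares has interior $\Omega$). $T_\Omega=\mathbb R^n+i\Omega\subset\mathbb C^n$ is the tube domain over $\Omega$. For $\nu\in\mathbb R$, $\mu$ is the measure on $T_\Omega$ given by $d\mu(x+iy)=\Delta^{\nu-\frac nr}(y)\,dx\,dy$. For a measurable function $f$ on $T_\Omega$: $\mu_f(\lambda)=\mu(\{|f|>\lambda\})$, $f^\star(t)=\inf\{\lambda\ge0:\mu_f(\lambda)\le t\}$, $f^{\star\star}(t)=\frac1t\int_0^t f^\star(u)\,du$. The Lorentz space $L_\nu(p,q)$ is the space of (classes of) measurable functions $f$ on $(T_\Omega,\mu)$ such that $\int_0^\infty (t^{1/p}f^{\star}(t))^q\frac{dt}{t}<\infty$ if $q<\infty$, respectively $\sup_{t>0}t^{1/p}f^{\star}(t)<\infty$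 if $q=\infty$ (with $t^{1/\infty}=1$). For $p=\infty$, $q<\infty$ this is the zero space, and $L_\nu(\infty,\infty)=L^\infty(T_\Omega,\mu)$. For $1<p\le\infty$ it is normed by $\|f\|_{p,q}=\left(\int_0^\infty (t^{1/p}f^{\star\star}(t))^q\frac{dt}{t}\right)^{1/q}$ if $q<\infty$, and $\|f\|_{p,\infty}=\sup_{t>0}t^{1/p}f^{\star\star}(t)$ if $q=\infty$. The Bergman-Lorentz space $A_\nu(p,q)$ is the subspace of $L_\nu(p,q)$ consisting of holomorphic functions on $T_\Omega$.
   Formalization: Part (1) is stated with the single pair p = q = ∞ excluded, because there A_ν(∞,∞) consists of the bounded holomorphic functions and contains the constant function 1, so it is never {0}; part (2) keeps the full range. *)

(* Defs.v *)
From HB Require Import structures.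
From mathcomp Require Import all_boot all_order all_algebra.
From mathcomp Require Import all_classical all_reals all_analysis.
From mathcomp Require Import complex.
From mathcomp Require mpoly.

Set Implicit Arguments.
Unset Strict Implicit.
Unset Printing Implicit Defensive.

Import Order.TTheory GRing.Theory Num.Theory.
Import numFieldNormedType.Exports.

Local Open Scope classical_set_scope.
Local Open Scope ring_scope.

Definition inner_product (R : realType) (V : lmodType R) (ip : V -> V -> R) :=
  [/\ forall a x y z, ip (a *: x + y) z = a * ip x z + ip y z,
      forall x y, ip x y = ip y x &
      forall x, x != 0 -> 0 < ip x x].

Definition dual_cone (R : realType) (n : nat) (ip : 'rV[R]_n -> 'rV[R]_n -> R)
    (U : {vspace 'rV[R]_n}) (W : set 'rV[R]_n) : set 'rV[R]_n :=
  [set y | y \in U /\ forall x, closure W x -> x != 0 -> 0 < ip x y].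

(* [W] is a symmetric cone in the subspace [U], for the restriction of [ip] to
   [U].  Subspaces are needed for the definition of irreducibility; since [U]
   is finite-dimensional, [g @: U = U] makes [g] an automorphism of [U]. *)
Definition symmetric_cone (R : realType) (n : nat)
    (ip : 'rV[R]_n -> 'rV[R]_n -> R) (U : {vspace 'rV[R]_n})
    (W : set 'rV[R]_n) :=
  [/\ W !=set0 /\ (exists2 O : set 'rV[R]_n, open O & W = O `&` [set` U]),
      forall t x, 0 < t -> W x -> W (t *: x),
      forall t x y, 0 <= t <= 1 -> W x -> W y -> W (t *: x + (1 - t) *: y),
      W = dual_cone ip U W &
      forall x y, W x -> W y -> exists g : 'End('rV[R]_n),
        [/\ (g @: U)%VS = U, g @` W = W & g x = y]].

Definition irreducible_symmetric_cone (R : realType) (n : nat)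
    (Omega : set 'rV[R]_n) :=
  (0 < n)%N /\
  exists ip : 'rV[R]_n -> 'rV[R]_n -> R,
    [/\ inner_product ip,
        symmetric_cone ip fullv Omega &
        ~ exists (U1 U2 : {vspace 'rV[R]_n}) (W1 W2 : set 'rV[R]_n),
          [/\ [/\ U1 != 0%VS, U2 != 0%VS & (U1 + U2)%VS = fullv],
              forall x y, x \in U1 -> y \in U2 -> ip x y = 0,
              symmetric_cone ip U1 W1, symmetric_cone ip U2 W2 &
              Omega = [set x + y | x in W1 & y in W2]]].

Definition euclidean_jordan_algebra (R : realType) (V : lmodType R)
    (mul : V -> V -> V) (e : V) :=
  [/\ forall a x y z, mul (a *: x + y) z = a *: mul x z + mul y z,
      forall x y, mul x y = mul y x,
      forall x y, mul (mul x x) (mul x y) = mul x (mul (mul x x) y),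
      forall x, mul e x = x &
      exists2 ip : V -> V -> R, inner_product ip &
        forall x y z, ip (mul x y) z = ip y (mul x z)].

Definition jordan_pow (R : realType) (V : lmodType R) (mul : V -> V -> V)
    (e x : V) (k : nat) : V := iter k (mul x) e.

Definition jordan_horner (R : realType) (V : lmodType R) (mul : V -> V -> V)
    (e x : V) (P : {poly R}) : V :=
  \sum_(k < size P) P`_k *: jordan_pow mul e x k.

Definition jordan_minpoly (R : realType) (V : lmodType R) (mul : V -> V -> V)
    (e x : V) (P : {poly R}) :=
  [/\ P \is monic, jordan_horner mul e x P = 0 &
      forall Q : {poly R}, Q != 0 -> jordan_horner mul e x Q = 0 ->
        (size P <= size Q)%N].

Definition jordan_rank (R : realType) (V : lmodType R) (mul : V -> V -> V)
    (e : V) (r : nat) :=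
  (forall x P, jordan_minpoly mul e x P -> ((size P).-1 <= r)%N) /\
  (exists x P, jordan_minpoly mul e x P /\ (size P).-1 = r).

Definition mpoly_eval (R : realType) (n : nat) (D : mpoly.mpoly n R)
    (y : 'rV[R]_n) : R := mpoly.meval (fun i => y 0 i) D.

(* The minimal polynomial of a regular [x] (one whose minimal polynomial has
   degree [r]) is X^r - tr(x) X^(r-1) + ... + (-1)^r det(x); this determines
   the polynomial [D] because the regular elements are dense. *)
Definition jordan_determinant (R : realType) (n : nat)
    (mul : 'rV[R]_n -> 'rV[R]_n -> 'rV[R]_n) (e : 'rV[R]_n) (r : nat)
    (D : mpoly.mpoly n R) :=
  forall x P, jordan_minpoly mul e x P -> (size P).-1 = r ->
    mpoly_eval D x = (-1) ^+ r * P`_0.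

(* [mul], [e] is a Euclidean Jordan algebra associated with [Omega], of rank
   [r] and determinant [D].  It is unique up to the choice of its unit [e] in
   [Omega], which only changes [D] by a positive factor. *)
Definition jordan_structure (R : realType) (n : nat) (Omega : set 'rV[R]_n)
    (mul : 'rV[R]_n -> 'rV[R]_n -> 'rV[R]_n) (e : 'rV[R]_n) (r : nat)
    (D : mpoly.mpoly n R) :=
  [/\ euclidean_jordan_algebra mul e,
      Omega = interior [set mul x x | x in setT],
      jordan_rank mul e r &
      jordan_determinant mul e r D].

(* Lebesgue measure on R^n: iterated product of the Lebesgue measure on R. *)
Fixpoint lebesgue_tuple (R : realType) (n : nat) :
    set (n.-tuple (measurableTypeR R)) -> \bar R :=
  match n with
  | 0 => \d_ [tuple]
  | m.+1 => pushforward ((@lebesgue_measure R) \x (@lebesgue_tuple R m))%E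
              (fun u => [tuple of u.1 :: u.2])
  end.

Definition row_of_tuple (R : realType) (n : nat) (y : n.-tuple R) : 'rV[R]_n :=
  \row_j tnth y j.

Definition tube_point (R : realType) (n : nat)
    (w : n.-tuple (measurableTypeR R) * n.-tuple (measurableTypeR R)) :
    'rV[R[i]^o]_n :=
  \row_j (Complex (tnth w.1 j) (tnth w.2 j)).

Definition tube (R : realType) (n : nat) (Omega : set 'rV[R]_n) :
    set 'rV[R[i]^o]_n :=
  [set z | Omega (map_mx (@complex.Im R) z)].

Definition tube_measure (R : realType) (n r : nat) (Omega : set 'rV[R]_n)
    (D : mpoly.mpoly n R) (nu : R) (E : set 'rV[R[i]^o]_n) : \bar R :=
  (\int[(@lebesgue_tuple R n) \x (@lebesgue_tuple R n)]_(w in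
        @tube_point R n @^-1` (tube Omega `&` E))
     (mpoly_eval D (row_of_tuple w.2) `^ (nu - n%:R / r%:R))%:E)%E.

Section lorentz.
Local Open Scope ereal_scope.

Definition distribution_function (R : realType) (X : Type)
    (mu : set X -> \bar R) (f : X -> R[i]) (l : R) : \bar R :=
  mu [set z | (l < complex.Re `|f z|)%R].

Definition rearrangement (R : realType) (X : Type)
    (mu : set X -> \bar R) (f : X -> R[i]) (t : R) : \bar R :=
  ereal_inf [set l%:E | l in
    [set l : R | (0 <= l)%R /\ distribution_function mu f l <= t%:E]].

Definition maximal_rearrangement (R : realType) (X : Type)
    (mu : set X -> \bar R) (f : X -> R[i]) (t : R) : \bar R :=
  (t^-1)%:E * \int[@lebesgue_measure R]_(u in `]0%R, t]) rearrangement mu f u.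

(* 1/p, with 1/oo = 0 *)
Definition inv_exponent (R : realType) (p : \bar R) : R :=
  if p is a%:E then (a^-1)%R else 0%R.

Definition lorentz_integral (R : realType) (p : \bar R) (q : R)
    (g : R -> \bar R) : \bar R :=
  \int[@lebesgue_measure R]_(t in `]0%R, +oo[)
     (((t `^ inv_exponent p)%:E * g t) `^ q * (t^-1)%:E).

Definition lorentz_sup (R : realType) (p : \bar R) (g : R -> \bar R) : \bar R :=
  ereal_sup [set (t `^ inv_exponent p)%:E * g t | t in `]0%R, +oo[].

Definition lorentz_finite (R : realType) (X : Type) (mu : set X -> \bar R)
    (p q : \bar R) (f : X -> R[i]) : Prop :=
  if q is a%:E then lorentz_integral p a (rearrangement mu f) < +oo
  else lorentz_sup p (rearrangement mu f) < +oo.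

Definition lorentz_norm (R : realType) (X : Type) (mu : set X -> \bar R)
    (p q : \bar R) (f : X -> R[i]) : \bar R :=
  if q is a%:E then
    lorentz_integral p a (maximal_rearrangement mu f) `^ (a^-1)
  else lorentz_sup p (maximal_rearrangement mu f).

End lorentz.

Definition tube_measurable (R : realType) (n : nat) (Omega : set 'rV[R]_n)
    (f : 'rV[R[i]^o]_n -> R[i]^o) :=
  let T := @tube_point R n @^-1` tube Omega in
  measurable_fun T
    (fun w => complex.Re (f (tube_point w)) : measurableTypeR R) /\
  measurable_fun T
    (fun w => complex.Im (f (tube_point w)) : measurableTypeR R).

(* [differentiable] is over the field R[i]: complex Frechet differentiability *)
Definition holomorphic_on (R : realType) (n : nat) (T : set 'rV[R[i]^o]_n)
    (f : 'rV[R[i]^o]_n -> R[i]^o) :=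
  forall z, T z -> differentiable f z.

(* A function on the tube is represented by its extension by 0 to C^n, so that
   equality of functions on the tube is equality.  A holomorphic function is
   the only continuous element of its class modulo equality almost everywhere,
   so no quotient is needed. *)
Definition bergman_lorentz (R : realType) (n r : nat) (Omega : set 'rV[R]_n)
    (D : mpoly.mpoly n R) (nu : R) (p q : \bar R) :
    set ('rV[R[i]^o]_n -> R[i]^o) :=
  [set f | [/\ forall z, ~ tube Omega z -> f z = 0,
               holomorphic_on (tube Omega) f,
               tube_measurable Omega f &
               lorentz_finite (tube_measure r Omega D nu) p q f]].

(* [phi] transports the linear and normed structure of [B] to [A]; the equation
   for [N] includes its finiteness on [A], since [Re `|b|] is a real number. *)
Definition banach_space (R : realType) (V : lmodType R[i]) (A : set V)
    (N : V -> \bar R) :=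
  exists (B : completeNormedModType R[i]) (phi : {linear B -> V}),
    [/\ injective phi, phi @` setT = A &
        forall b, N (phi b) = (complex.Re `|b|)%:E].

(* Main.v *)
(* Spectral theory identifies Omega with the elements x for which the operator
   y |-> x y is positive definite, so Omega is an open convex cone on which the
   determinant is positive and continuous.

   Completeness.  The mean value property over boxes bounds |f(x + iy)| by
   C(y) ||f||_{p,q}, with C locally bounded on Omega.  A Cauchy sequence thus
   converges locally uniformly to a holomorphic function, and Fatou's lemma for
   f** puts the limit in the space.  For the Lorentz space itself one needs
   f** = inf_a (a + t^-1 int (|f| - a)_+), which gives the triangle inequality,
   and Hardy's inequality, in a dyadic form, to pass from f* to f**.

   Triviality.  If p = oo and q < oo then f* = 0, because dt/t has infinite mass
   at 0.  If p < oo and f(x0 + iv) <> 0, Cauchy's theorem on the strip between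
   heights 0 and 1 of t |-> f(x + tv + iy), against a power of
   4 / (4 + (z - i)^2), which is an approximate identity at height 1, gives
   1 <= C int |f(x + tv + iy)| dt / (1 + t^2) for x near x0 and all small y in
   Omega.  Integrating over a product B x E and using translation invariance
   yields 1 <= C' f**(tau), hence tau^{1/p} <= C'' ||f||, where tau is the
   measure of B x E.  But tau is unbounded: when nu - n/r <= -1, the slabs
   {y in Omega : rho e - y in Omega, y - 2^{-k-1} e in Omega, y - 2^{-k} e not in
   Omega} have volume at least c 2^{-k} and Delta <= C 2^{-k} on them, so each
   contributes a fixed amount to int Delta(y)^{nu - n/r} dy. *)

Require Import Defs.
From HB Require Import structures.
From mathcomp Require Import all_boot all_order all_algebra.
From mathcomp Require Import all_classical all_reals all_analysis.
From mathcomp Require Import measurable_realfun.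
From mathcomp Require Import complex.
From mathcomp Require Import ring lra.
From mathcomp Require mpoly.
Set Implicit Arguments.
Unset Strict Implicit.
Unset Printing Implicit Defensive.
Import Order.TTheory GRing.Theory Num.Theory.
Import numFieldNormedType.Exports.
Local Open Scope classical_set_scope.
Local Open Scope ring_scope.

(** * Green and Cauchy theorems for rectangles *)

(** The analytic input is Cauchy's theorem for pairs [(u, v)] of real functions that are merely
    differentiable at each point; no continuity of the derivatives is assumed, so Green's theorem
    comes from Goursat's bisection. Squares replace circles in mean values: with z = s (1 + i t) the
    form dz / z has rational coefficients, and quarter turns carry the four sides of a square to
    one. Exact constants never matter, which permits [|Re| + |Im|] for the modulus.

    The delicate point of the triviality proof is uniformity. The bound for point evaluations
    degenerates near the boundary of the cone, so the bound of f on the strip depends on y, while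
    the final constant must not, since y ranges over sets of ever larger measure. In the strip
    estimate that qualitative bound therefore only decides where the strip is cut off; the constant
    depends on f at height 1 alone. No boundary values of f are taken: f at height 1 is compared
    with its integral at a small height y, which the norm controls over any set of finite
    measure. *)

Section bisection.
Variable R : realType.
Implicit Types (a b c d : R) (Phi : R -> R -> R -> R -> R).

Lemma nested_intervals (a b : nat -> R) :
  (forall n, a n <= a n.+1) -> (forall n, b n.+1 <= b n) ->
  (forall n, a n <= b n) -> exists p, forall n, a n <= p <= b n.
Proof.
move=> ai bd ab.
have ai' : {homo a : m n / (m <= n)%N >-> m <= n}.
  by apply: homo_leq => // ? ? ?; exact: le_trans.
have bd' : {homo b : m n / (m <= n)%N >-> n <= m}.
  by apply: homo_leq => // x y z xy yz; exact: le_trans yz xy.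
have amb m n : a m <= b n.
  apply: (le_trans (ai' _ (maxn m n) (leq_maxl _ _))).
  exact: (le_trans (ab _) (bd' _ _ (leq_maxr _ _))).
exists (sup (range a)) => n; apply/andP; split.
  apply: ub_le_sup; last by exists n.
  by exists (b 0%N) => _ [m _ <-].
by apply: ge_sup; [exists (a 0%N), 0%N|move=> _ [m _ <-]].
Qed.

Lemma midP a b : a <= b ->
  [/\ a <= (a + b) / 2, (a + b) / 2 <= b,
   (a + b) / 2 - a = (b - a) / 2 & b - (a + b) / 2 = (b - a) / 2].
Proof. by move=> ab; split; lra. Qed.

(** Goursat's argument for additive functions of rectangles. By additivity some quarter carries at
    least a fourth of the value, so iteration yields rectangles shrinking to a point [(p, q)] on
    which [Phi] is at least a fixed multiple of the squared side length, contrary to the local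
    hypothesis there. That hypothesis is pointwise: [del] may depend on [p] and [q]. *)
Lemma rectangle_bisection Phi a b c d : a <= b -> c <= d ->
  (forall a' b' c' d' m, a <= a' -> a' <= m -> m <= b' -> b' <= b ->
     c <= c' -> c' <= d' -> d' <= d ->
     Phi a' b' c' d' = Phi a' m c' d' + Phi m b' c' d') ->
  (forall a' b' c' d' m, a <= a' -> a' <= b' -> b' <= b ->
     c <= c' -> c' <= m -> m <= d' -> d' <= d ->
     Phi a' b' c' d' = Phi a' b' c' m + Phi a' b' m d') ->
  (forall p q, a <= p <= b -> c <= q <= d -> forall eps, 0 < eps ->
     exists2 del, 0 < del & forall a' b' c' d',
       a <= a' -> a' <= p -> p <= b' -> b' <= b ->
       c <= c' -> c' <= q -> q <= d' -> d' <= d ->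
       b' - a' < del -> d' - c' < del ->
       `|Phi a' b' c' d'| <= eps * ((b' - a') + (d' - c')) ^+ 2) ->
  Phi a b c d = 0.
Proof.
move=> ab cd addx addy loc; apply/eqP; apply: contraT => Phi0.
pose P4 (x : R * R * (R * R)) := `|Phi x.1.1 x.1.2 x.2.1 x.2.2|.
pose mx (x : R * R * (R * R)) := (x.1.1 + x.1.2) / 2.
pose my (x : R * R * (R * R)) := (x.2.1 + x.2.2) / 2.
pose q1 x := ((x.1.1, mx x), (x.2.1, my x)).
pose q2 x := ((mx x, x.1.2), (x.2.1, my x)).
pose q3 x := ((x.1.1, mx x), (my x, x.2.2)).
pose q4 x := ((mx x, x.1.2), (my x, x.2.2)).
pose good x y := P4 x <= 4 * P4 y.
(* The last branch is safe: if the first three quarters fail, the triangle inequality forces the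
   fourth to be good. *)
pose step x := if good x (q1 x) then q1 x else if good x (q2 x) then q2 x else
  if good x (q3 x) then q3 x else q4 x.
pose sub (x : R * R * (R * R)) :=
  [/\ a <= x.1.1, x.1.1 <= x.1.2, x.1.2 <= b & [/\ c <= x.2.1, x.2.1 <= x.2.2 & x.2.2 <= d]].
have stepP x : sub x -> [/\ sub (step x), good x (step x),
  x.1.1 <= (step x).1.1, (step x).1.2 <= x.1.2 &
  [/\ x.2.1 <= (step x).2.1, (step x).2.2 <= x.2.2,
   (step x).1.2 - (step x).1.1 = (x.1.2 - x.1.1) / 2 &
   (step x).2.2 - (step x).2.1 = (x.2.2 - x.2.1) / 2]].
  case=> ax x11 xb [cx x22 xd].
  have goodE : good x (step x).
    rewrite /step; case: ifPn => // /negP n1; case: ifPn => // /negP n2.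
    case: ifPn => // /negP n3; apply: contraT => /negP n4.
    have E : Phi x.1.1 x.1.2 x.2.1 x.2.2 =
      Phi x.1.1 (mx x) x.2.1 (my x) + Phi (mx x) x.1.2 x.2.1 (my x) +
      (Phi x.1.1 (mx x) (my x) x.2.2 + Phi (mx x) x.1.2 (my x) x.2.2).
      have [/= ux1 ux2 _ _] := midP x11; have [/= vx1 vx2 _ _] := midP x22.
      have vx5 := le_trans cx vx1; have vx6 := le_trans vx2 xd.
      by rewrite (addy _ _ _ _ (my x))// (addx _ _ _ _ (mx x))// [X in _ + X](addx _ _ _ _ (mx x)).
    have := ler_normD (Phi x.1.1 (mx x) x.2.1 (my x) + Phi (mx x) x.1.2 x.2.1 (my x))
       (Phi x.1.1 (mx x) (my x) x.2.2 + Phi (mx x) x.1.2 (my x) x.2.2).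
    rewrite -E.
    have := ler_normD (Phi x.1.1 (mx x) x.2.1 (my x)) (Phi (mx x) x.1.2 x.2.1 (my x)).
    have := ler_normD (Phi x.1.1 (mx x) (my x) x.2.2) (Phi (mx x) x.1.2 (my x) x.2.2).
    move: n1 n2 n3 n4; rewrite /good /P4 /q1 /q2 /q3 /q4 /=.
    by do 4 (move/negP; rewrite -ltNge => ?); lra.
  have [/= ux1 ux2 ux3 ux4] := midP x11; have [/= vx1 vx2 vx3 vx4] := midP x22.
  have ux5 := le_trans ax ux1; have ux6 := le_trans ux2 xb.
  have vx5 := le_trans cx vx1; have vx6 := le_trans vx2 xd.
  by rewrite /step /sub; split => //; do 3? case: ifP => _.
pose x0 := ((a, b), (c, d)).
pose x n := iter n step x0.
have subx n : sub (x n).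
  elim: n => [|n ih]; first by rewrite /sub /=.
  by have [] := stepP _ ih.
have [p hp] : exists p, forall n, (x n).1.1 <= p <= (x n).1.2.
  by apply: nested_intervals => n; have [] := stepP _ (subx n); have [] := subx n.
have [q hq] : exists p, forall n, (x n).2.1 <= p <= (x n).2.2.
  by apply: nested_intervals => n; have [? ? ? ? []] := stepP _ (subx n); have [? ? ? []] := subx n.
have len1 n : (x n).1.2 - (x n).1.1 = (b - a) / 2 ^+ n.
  elim: n => [|n ih]; first by rewrite expr0 divr1.
  have [_ _ _ _ [_ _ -> _]] := stepP _ (subx n).
  by rewrite ih exprS; field; rewrite ?expf_neq0.
have len2 n : (x n).2.2 - (x n).2.1 = (d - c) / 2 ^+ n.
  elim: n => [|n ih]; first by rewrite expr0 divr1.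
  have [_ _ _ _ [_ _ _ ->]] := stepP _ (subx n).
  by rewrite ih exprS; field; rewrite ?expf_neq0.
have PhiN n : `|Phi a b c d| / 4 ^+ n <= P4 (x n).
  elim: n => [|n ih]; first by rewrite expr0 divr1.
  have [_ + _ _ _] := stepP _ (subx n); rewrite /good => h.
  rewrite exprS invfM mulrCA ler_pdivrMl ?ltr0n//.
  exact: le_trans h.
set S := (b - a) + (d - c).
have S0 : 0 <= S by rewrite /S; lra.
(* Adding 1 covers the degenerate rectangle [S = 0] and makes [eps * S ^+ 2] strictly smaller than
   the absolute value of [Phi a b c d]. *)
pose eps := `|Phi a b c d| / (S ^+ 2 + 1).
have S1 : 0 < S ^+ 2 + 1 by rewrite ltr_wpDl// sqr_ge0.
have eps0 : 0 < eps by rewrite divr_gt0// normr_gt0.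
have [del del0 H] := loc p q (hp 0%N) (hq 0%N) eps eps0.
have [n Hn] : exists n, S / 2 ^+ n < del.
  have h := upper_nthrootP (leqnn (Num.bound (S / del))).
  exists (Num.bound (S / del)); rewrite ltr_pdivrMr ?exprn_gt0// mulrC -ltr_pdivrMr//.
have [ax x11 xb [cx x22 xd]] := subx n.
have /andP[hp1 hp2] := hp n; have /andP[hq1 hq2] := hq n.
have := H _ _ _ _ ax hp1 hp2 xb cx hq1 hq2 xd.
have i0 : 0 < (2 ^+ n)^-1 :> R by rewrite invr_gt0 exprn_gt0.
rewrite !len1 !len2 => /(_ _ _)/wrap[].
- by apply: le_lt_trans Hn; rewrite ler_pM2r// /S; lra.
- by apply: le_lt_trans Hn; rewrite ler_pM2r// /S; lra.
rewrite -mulrDl -/S expr_div_n => /(le_trans (PhiN n)).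
have -> : (2 ^+ n) ^+ 2 = 4 ^+ n :> R by rewrite exprAC -natrX.
rewrite mulrA ler_pM2r ?invr_gt0 ?exprn_gt0//.
rewrite /eps mulrAC ler_pdivlMr// mulrDr mulr1 gerDl.
by rewrite leNgt normr_gt0 Phi0.
Qed.

End bisection.

(** * Integrals of continuous functions over compact intervals *)

Section interval_integral.
Variable R : realType.
Implicit Types (a b m : R) (f g : R -> R).

Definition itg a b f : R := \int[@lebesgue_measure R]_(x in `[a, b]) f x.

(** Continuity is two-sided at the endpoints too: the integrands are traces of functions
    differentiable in full neighbourhoods. *)
Definition cont_on a b f := forall x, a <= x <= b -> {for x, continuous f}.

Lemma cont_on_sub a b a' b' f : a <= a' -> b' <= b -> cont_on a b f -> cont_on a' b' f.
Proof.
move=> aa bb cf x /andP[ax xb]; apply: cf.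
by rewrite (le_trans aa ax) (le_trans xb bb).
Qed.

Lemma cont_on_integrable a b f : cont_on a b f ->
  (@lebesgue_measure R).-integrable `[a, b] (EFin \o f).
Proof.
move=> cf; apply: continuous_compact_integrable; first exact: segment_compact.
apply: continuous_in_subspaceT => x /set_mem /=.
by rewrite in_itv /= => /cf.
Qed.

Lemma itg_eq a b f g : (forall x, a <= x <= b -> f x = g x) -> itg a b f = itg a b g.
Proof. by move=> fg; apply: eq_Rintegral => x; rewrite inE /= in_itv /= => /fg. Qed.

Lemma itgB a b f g : cont_on a b f -> cont_on a b g ->
  itg a b (fun x => f x - g x) = itg a b f - itg a b g.
Proof. by move=> cf cg; apply: RintegralB => //; exact: cont_on_integrable. Qed.

Lemma itgD a b f g : cont_on a b f -> cont_on a b g ->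
  itg a b (fun x => f x + g x) = itg a b f + itg a b g.
Proof. by move=> cf cg; apply: RintegralD => //; exact: cont_on_integrable. Qed.

Lemma itg_cst a b c : a <= b -> itg a b (fun=> c) = c * (b - a).
Proof.
move=> ab; rewrite /itg Rintegral_cst//; congr (_ * _).
have /= -> := lebesgue_measure_itv `[a, b]; rewrite lte_fin.
by case: ltgtP ab => //= [-> _]; rewrite subrr.
Qed.

Lemma itg_split a m b f : a <= m -> m <= b -> cont_on a b f ->
  itg a b f = itg a m f + itg m b f.
Proof.
move=> am mb cf; have := @Rintegral_itvB _ f (BLeft a) (BRight b) m (cont_on_integrable cf).
rewrite !bnd_simp => /(_ am mb) h; rewrite /itg; rewrite -[RHS]addrC.
rewrite -[X in _ = X + _]Rintegral_itv_obnd_cbnd ?{1}/itg; last first.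
  have := cont_on_integrable (cont_on_sub am (lexx b) cf).
  by apply: integrableS => //; apply: subset_itvr; rewrite bnd_simp.
by rewrite -h subrK.
Qed.

Lemma itg_bound a b f M : a <= b -> cont_on a b f ->
  (forall x, a <= x <= b -> `|f x| <= M) -> `|itg a b f| <= M * (b - a).
Proof.
move=> ab cf fM; apply: le_trans.
  by apply: le_normr_Rintegral => //; exact: cont_on_integrable.
rewrite -itg_cst//; apply: le_Rintegral => //.
- have := cont_on_integrable cf => /integrable_norm h.
  by apply: eq_integrable h.
- by apply: cont_on_integrable => x _; exact: cst_continuous.
Qed.

Lemma itg_le a b f g : cont_on a b f -> cont_on a b g ->
  (forall x, a <= x <= b -> f x <= g x) -> itg a b f <= itg a b g.
Proof.
move=> cf cg fg; apply: le_Rintegral => //; try exact: cont_on_integrable.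
Qed.

End interval_integral.

(** * Differentials in two real variables and Green's theorem for closed forms *)

Section gradients.
Variable R : realType.
Implicit Types (A B X Y : R -> R -> R) (s t : R).

(** Frechet differentiability of [A] at [(s, t)] with partial derivatives [a1] and [a2], for the l1
    norm of the increment. *)
Definition has_grad A s t a1 a2 := forall eps : R, 0 < eps ->
  exists2 del : R, 0 < del & forall s' t', `|s' - s| < del -> `|t' - t| < del ->
   `|A s' t' - A s t - a1 * (s' - s) - a2 * (t' - t)| <=
      eps * (`|s' - s| + `|t' - t|).

Lemma has_gradD A B s t a1 a2 b1 b2 : has_grad A s t a1 a2 -> has_grad B s t b1 b2 ->
  has_grad (fun s t => A s t + B s t) s t (a1 + b1) (a2 + b2).
Proof.
move=> hA hB eps e0; have e20 : 0 < eps / 2 by rewrite divr_gt0.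
have [d d0 dA] := hA _ e20; have [d' d'0 dB] := hB _ e20.
exists (Num.min d d'); first by rewrite lt_min d0 d'0.
move=> s' t'; rewrite !lt_min => /andP[u1 u2] /andP[v1 v2].
have := lerD (dA _ _ u1 v1) (dB _ _ u2 v2).
rewrite -mulrDl -splitr; apply: le_trans; apply: le_trans (ler_normD _ _).
by rewrite le_eqVlt; apply/orP; left; apply/eqP; congr `|_|; ring.
Qed.

Lemma has_grad_lip A s t a1 a2 : has_grad A s t a1 a2 ->
  exists2 del : R, 0 < del & exists2 C : R, 0 < C &
   forall s' t', `|s' - s| < del -> `|t' - t| < del ->
   `|A s' t' - A s t| <= C * (`|s' - s| + `|t' - t|).
Proof.
move=> /(_ 1 ltr01)[d d0 H]; exists d => //; exists (1 + `|a1| + `|a2|).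
  by rewrite -addrA ltr_pwDl// addr_ge0.
move=> s' t' hs ht; have := H _ _ hs ht; set e := A s' t' - A s t.
move=> h.
have -> : e = (e - a1 * (s' - s) - a2 * (t' - t)) + a1 * (s' - s) + a2 * (t' - t) by ring.
apply: le_trans (ler_normD _ _) _; rewrite normrM.
apply: le_trans (lerD (ler_normD _ _) (lexx _)) _; rewrite normrM.
apply: le_trans (lerD (lerD h (lexx _)) (lexx _)) _.
rewrite !mulrDl !mulrDr -!addrA !mul1r lerD2l lerD2l lerD2l.
by rewrite addrA lerDr addr_ge0 ?mulr_ge0.
Qed.

(** Error budget: a remainder of relative size [eps / (3 * y)], multiplied by a coefficient of size
    at most [y], still fits into a third of [eps]. *)
Lemma absorb (x y e eps n : R) : 0 <= x -> x <= y -> 0 < y -> 0 <= n -> 0 < eps ->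
  e <= eps / (3 * y) * n -> x * e <= eps / 3 * n.
Proof.
move=> x0 xy y0 n0 e0 h; apply: (@le_trans _ _ (y * (eps / (3 * y) * n))).
  by apply: (le_trans (ler_wpM2l x0 h)); rewrite ler_wpM2r// mulr_ge0 ?divr_ge0// ltW// mulr_gt0.
by rewrite le_eqVlt; apply/orP; left; apply/eqP; field; rewrite gt_eqF.
Qed.

Lemma has_gradM A B s t a1 a2 b1 b2 : has_grad A s t a1 a2 -> has_grad B s t b1 b2 ->
  has_grad (fun s t => A s t * B s t) s t
    (A s t * b1 + B s t * a1) (A s t * b2 + B s t * a2).
Proof.
move=> hA hB eps e0.
have [d1 d10 [C C0 lA]] := has_grad_lip hA; have [d2 d20 [C' C'0 lB]] := has_grad_lip hB.
pose K := 3 * (`|A s t| + `|B s t| + 1).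
have K0 : 0 < K by rewrite mulr_gt0// ltr_wpDl// addr_ge0.
have e'0 : 0 < eps / K by rewrite divr_gt0.
have [d3 d30 dA] := hA _ e'0; have [d4 d40 dB] := hB _ e'0.
(* The product of the two increments is at most [C * C' * n ^+ 2] with [n <= 2 * d5], hence at most
   [eps / 3 * n]. *)
pose d5 := eps / (6 * C * C').
have d50 : 0 < d5 by rewrite divr_gt0// !mulr_gt0.
exists (Num.min d1 (Num.min d2 (Num.min d3 (Num.min d4 d5)))).
  by rewrite !lt_min d10 d20 d30 d40 d50.
move=> s' t'; rewrite !lt_min => /and5P[u1 u2 u3 u4 u5] /and5P[v1 v2 v3 v4 v5].
have {}lA := lA _ _ u1 v1; have {}lB := lB _ _ u2 v2.
have {}dA := dA _ _ u3 v3; have {}dB := dB _ _ u4 v4.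
have aE : A s t = A s t by []; move: @K K0 e'0 dA dB lA lB.
set a := A s t; set b := B s t => K K0 e'0 dA dB lA lB {aE}.
set a' := A s' t' in lA dA *; set b' := B s' t' in lB dB *.
set h := s' - s in lA lB dA dB u1 u2 u3 u4 u5 *; set k := t' - t in lA lB dA dB v1 v2 v3 v4 v5 *.
set n := `|h| + `|k| in lA lB dA dB *.
have -> : a' * b' - a * b - (a * b1 + b * a1) * h - (a * b2 + b * a2) * k =
  a * (b' - b - b1 * h - b2 * k) + b * (a' - a - a1 * h - a2 * k) +
  (a' - a) * (b' - b) by ring.
apply: le_trans (ler_normD _ _) _; rewrite normrM.
apply: le_trans (lerD (ler_normD _ _) (lexx _)) _; rewrite !normrM.
have n0 : 0 <= n by rewrite addr_ge0.
have n5 : n <= 2 * d5 by rewrite mulr2n mulrDl mul1r lerD// ltW.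
have H1 : `|a| * `|b' - b - b1 * h - b2 * k| <= eps / 3 * n.
  apply: (absorb (y := `|a| + `|b| + 1)) => //.
    by rewrite -addrA lerDl addr_ge0.
have H2 : `|b| * `|a' - a - a1 * h - a2 * k| <= eps / 3 * n.
  apply: (absorb (y := `|a| + `|b| + 1)) => //.
    by rewrite [`|a| + _]addrC -addrA lerDl addr_ge0.
have H3 : `|a' - a| * `|b' - b| <= eps / 3 * n.
  apply: (@le_trans _ _ (C * n * (C' * n))); first by rewrite ler_pM.
  rewrite [X in X <= _](_ : _ = C * C' * n * n); last by ring.
  rewrite ler_wpM2r//.
  apply: (@le_trans _ _ (C * C' * (2 * d5))); first by rewrite ler_wpM2l// mulr_ge0// ltW.
  rewrite le_eqVlt; apply/orP; left; apply/eqP; rewrite /d5; field.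
  by rewrite !gt_eqF.
apply: (le_trans (lerD (lerD H1 H2) H3)).
by rewrite le_eqVlt; apply/orP; left; apply/eqP; field.
Qed.

Lemma has_grad_comp A X Y s t a1 a2 x1 x2 y1 y2 :
  has_grad A (X s t) (Y s t) a1 a2 -> has_grad X s t x1 x2 -> has_grad Y s t y1 y2 ->
  has_grad (fun s t => A (X s t) (Y s t)) s t (a1 * x1 + a2 * y1) (a1 * x2 + a2 * y2).
Proof.
move=> hA hX hY eps e0.
have [d1 d10 [C C0 lX]] := has_grad_lip hX; have [d2 d20 [C' C'0 lY]] := has_grad_lip hY.
pose K := 3 * (`|a1| + `|a2| + 1).
have K0 : 0 < K by rewrite mulr_gt0// ltr_wpDl// addr_ge0.
have e'0 : 0 < eps / K by rewrite divr_gt0.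
have [d3 d30 dX] := hX _ e'0; have [d4 d40 dY] := hY _ e'0.
have CC0 : 0 < C + C' by rewrite addr_gt0.
have e''0 : 0 < eps / (3 * (C + C')) by rewrite divr_gt0// mulr_gt0.
have [d5 d50 dA] := hA _ e''0.
pose d6 := d5 / (3 * (C + C')).
have d60 : 0 < d6 by rewrite divr_gt0// mulr_gt0.
exists (Num.min d1 (Num.min d2 (Num.min d3 (Num.min d4 d6)))).
  by rewrite !lt_min d10 d20 d30 d40 d60.
move=> s' t'; rewrite !lt_min => /and5P[u1 u2 u3 u4 u6] /and5P[v1 v2 v3 v4 v6].
have {}lX := lX _ _ u1 v1; have {}lY := lY _ _ u2 v2.
have {}dX := dX _ _ u3 v3; have {}dY := dY _ _ u4 v4.
set h := s' - s in lX lY dX dY u1 u2 u3 u4 u6 *; set k := t' - t in lX lY dX dY v1 v2 v3 v4 v6 *.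
set n := `|h| + `|k| in lX lY dX dY *.
have n0 : 0 <= n by rewrite addr_ge0.
have n6 : n < 2 * d6 by rewrite mulr2n mulrDl mul1r ltrD.
have n65 : (C + C') * n < d5.
  apply: (@lt_trans _ _ ((C + C') * (2 * d6))); first by rewrite ltr_pM2l.
  have -> : (C + C') * (2 * d6) = d5 * (2 / 3) by rewrite /d6; field; rewrite gt_eqF.
  by rewrite -[ltRHS]mulr1 ltr_pM2l//; lra.
have Xd : `|X s' t' - X s t| < d5.
  by apply: le_lt_trans lX _; apply: le_lt_trans n65; rewrite ler_wpM2r// lerDl ltW.
have Yd : `|Y s' t' - Y s t| < d5.
  by apply: le_lt_trans lY _; apply: le_lt_trans n65; rewrite ler_wpM2r// lerDr ltW.
have {}dA := dA _ _ Xd Yd.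
set x' := X s' t' in lX dX dA Xd *; set y' := Y s' t' in lY dY dA Yd *.
set x := X s t in lX dX dA Xd *; set y := Y s t in lY dY dA Yd *.
have -> : A x' y' - A x y - (a1 * x1 + a2 * y1) * h - (a1 * x2 + a2 * y2) * k =
  a1 * (x' - x - x1 * h - x2 * k) + a2 * (y' - y - y1 * h - y2 * k) +
  (A x' y' - A x y - a1 * (x' - x) - a2 * (y' - y)) by ring.
apply: le_trans (ler_normD _ _) _.
apply: le_trans (lerD (ler_normD _ _) (lexx _)) _; rewrite !normrM.
have H1 : `|a1| * `|x' - x - x1 * h - x2 * k| <= eps / 3 * n.
  apply: (absorb (y := `|a1| + `|a2| + 1)) => //.
    by rewrite -addrA lerDl addr_ge0.
have H2 : `|a2| * `|y' - y - y1 * h - y2 * k| <= eps / 3 * n.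
  apply: (absorb (y := `|a1| + `|a2| + 1)) => //.
    by rewrite [`|a1| + _]addrC -addrA lerDl addr_ge0.
have H3 : `|A x' y' - A x y - a1 * (x' - x) - a2 * (y' - y)| <= eps / 3 * n.
  apply: (le_trans dA).
  apply: (@le_trans _ _ (eps / (3 * (C + C')) * ((C + C') * n))).
    by rewrite ler_pM2l// mulrDl lerD.
  by rewrite le_eqVlt; apply/orP; left; apply/eqP; field; rewrite gt_eqF.
apply: (le_trans (lerD (lerD H1 H2) H3)).
by rewrite le_eqVlt; apply/orP; left; apply/eqP; field.
Qed.

Lemma has_grad_cst c s t : has_grad (fun _ _ => c) s t 0 0.
Proof.
move=> e e0; exists 1 => // s' t' _ _.
by rewrite !mul0r subrr !subr0 normr0 mulr_ge0 ?addr_ge0// ltW.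
Qed.

Lemma has_grad_fst s t : has_grad (fun s _ => s) s t 1 0.
Proof.
move=> e e0; exists 1 => // s' t' _ _.
by rewrite mul0r mul1r subrr !subr0 normr0 mulr_ge0 ?addr_ge0// ltW.
Qed.

Lemma has_grad_snd s t : has_grad (fun _ t => t) s t 0 1.
Proof.
move=> e e0; exists 1 => // s' t' _ _.
by rewrite mul0r mul1r subr0 subrr normr0 mulr_ge0 ?addr_ge0// ltW.
Qed.

Lemma has_gradN A s t a1 a2 : has_grad A s t a1 a2 ->
  has_grad (fun s t => - A s t) s t (- a1) (- a2).
Proof.
move=> hA e e0; have [d d0 H] := hA e e0; exists d => // s' t' hs ht.
apply: le_trans (H _ _ hs ht); rewrite -normrN le_eqVlt; apply/orP; left; apply/eqP.
by congr `|_|; ring.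
Qed.

Lemma has_gradV A s t a1 a2 : A s t != 0 -> has_grad A s t a1 a2 ->
  has_grad (fun s t => (A s t)^-1) s t (- a1 / A s t ^+ 2) (- a2 / A s t ^+ 2).
Proof.
move=> A0 hA; set x := A s t in A0 *.
suff hi : has_grad (fun u _ => u^-1) x 0 (- (x ^+ 2)^-1) 0.
  have /= := has_grad_comp hi hA (has_grad_cst 0 s t).
  have -> : - (x ^+ 2)^-1 * a1 + 0 * 0 = - a1 / x ^+ 2 by ring.
  by have -> : - (x ^+ 2)^-1 * a2 + 0 * 0 = - a2 / x ^+ 2 by ring.
move=> e e0; have x0 : 0 < `|x| by rewrite normr_gt0.
exists (Num.min (`|x| / 2) (e * `|x| ^+ 3 / 2)).
  by rewrite lt_min divr_gt0//= divr_gt0// mulr_gt0// exprn_gt0.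
move=> u t'; rewrite !lt_min => /andP[u1 u2] _.
have ux : `|x| / 2 <= `|u|.
  by have := lerB_dist x u; rewrite distrC; lra.
have u0 : u != 0 by rewrite -normr_gt0 (lt_le_trans _ ux)// divr_gt0.
have -> : u^-1 - x^-1 - - (x ^+ 2)^-1 * (u - x) - 0 * (t' - 0) =
   (u - x) / (u * x ^+ 2) * (u - x) by field; rewrite u0 A0.
rewrite normrM mulrDr ler_wpDr ?mulr_ge0// ?(ltW e0)// ler_wpM2r//.
rewrite normrM normfV ler_pdivrMr ?normr_gt0 ?mulf_neq0 ?expf_neq0//.
apply: (le_trans (ltW u2)); rewrite normrM normrX -mulrA ler_pM2l//.
by rewrite exprS mulrAC ler_wpM2r ?exprn_ge0.
Qed.

Lemma has_grad_eq A s t a1 a2 b1 b2 : has_grad A s t a1 a2 -> a1 = b1 -> a2 = b2 ->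
  has_grad A s t b1 b2.
Proof. by move=> + <- <-. Qed.

Lemma has_grad_cvg A s t a1 a2 : has_grad A s t a1 a2 -> forall eps, 0 < eps ->
  exists2 del : R, 0 < del & forall s' t', `|s' - s| < del -> `|t' - t| < del ->
   `|A s' t' - A s t| < eps.
Proof.
move=> /has_grad_lip[d d0 [C C0 H]] e e0.
pose d' := e / (3 * C); have d'0 : 0 < d' by rewrite divr_gt0// mulr_gt0.
exists (Num.min d d'); first by rewrite lt_min d0.
move=> s' t'; rewrite !lt_min => /andP[u1 u2] /andP[v1 v2].
apply: (le_lt_trans (H _ _ u1 v1)).
apply: (@lt_trans _ _ (C * (d' + d'))); first by rewrite ltr_pM2l// ltrD.
have -> : C * (d' + d') = e * (2 / 3) by rewrite /d'; field; rewrite gt_eqF.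
by rewrite -[ltRHS]mulr1 ltr_pM2l//; lra.
Qed.

Lemma has_grad_cont1 A s t a1 a2 : has_grad A s t a1 a2 -> {for s, continuous (A ^~ t)}.
Proof.
move=> /has_grad_cvg H; apply/cvgrPdist_lt => e /H[d d0 h].
near=> s'; rewrite distrC; apply: h; last by rewrite subrr normr0.
by rewrite distrC; near: s'; exact: cvgr_dist_lt.
Unshelve. all: by end_near. Qed.

Lemma has_grad_cont2 A s t a1 a2 : has_grad A s t a1 a2 -> {for t, continuous (A s)}.
Proof.
move=> /has_grad_cvg H; apply/cvgrPdist_lt => e /H[d d0 h].
near=> s'; rewrite distrC; apply: h; first by rewrite subrr normr0.
by rewrite distrC; near: s'; exact: cvgr_dist_lt.
Unshelve. all: by end_near. Qed.

(** The form A ds + B dt is closed because [k] is both dA/dt and dB/ds. Its integral around the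
    boundary is an additive function of rectangles, small near each point because the affine parts
    of [A] and [B] integrate to zero; [rectangle_bisection] concludes. *)
Lemma green_closed A B a b c d : a <= b -> c <= d ->
  (forall s t, a <= s <= b -> c <= t <= d ->
     exists a1 k b2, has_grad A s t a1 k /\ has_grad B s t k b2) ->
  itg a b (A ^~ c) - itg a b (A ^~ d) + (itg c d (B b) - itg c d (B a)) = 0.
Proof.
move=> ab cd H.
have cA t : c <= t <= d -> cont_on a b (A ^~ t).
  by move=> ht s hs; have [? [? [? [h _]]]] := H _ _ hs ht; exact: has_grad_cont1 h.
have cB s : a <= s <= b -> cont_on c d (B s).
  by move=> hs t ht; have [? [? [? [_ h]]]] := H _ _ hs ht; exact: has_grad_cont2 h.
pose Phi a b c d := itg a b (A ^~ c) - itg a b (A ^~ d) + (itg c d (B b) - itg c d (B a)).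
apply: (rectangle_bisection (Phi := Phi) ab cd).
- move=> a' b' c' d' m aa am mb bb cc' ccd dd.
  have ct : c <= c' <= d by rewrite cc' (le_trans ccd dd).
  have dt : c <= d' <= d by rewrite dd (le_trans cc' ccd).
  rewrite /Phi (itg_split am mb (cont_on_sub aa bb (cA _ ct))).
  rewrite (itg_split am mb (cont_on_sub aa bb (cA _ dt))); ring.
- move=> a' b' c' d' m aa am mb bb cc' ccd dd.
  have ct : a <= a' <= b by rewrite aa (le_trans am mb).
  have dt : a <= b' <= b by rewrite mb (le_trans aa am).
  rewrite /Phi (itg_split cc' ccd (cont_on_sub bb dd (cB _ ct))).
  rewrite (itg_split cc' ccd (cont_on_sub bb dd (cB _ dt))); ring.
- move=> p q hp hq eps e0; have [a1 [k [b2 [hA hB]]]] := H _ _ hp hq.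
  have e20 : 0 < eps / 2 by rewrite divr_gt0.
  have [d1 d10 dA] := hA _ e20; have [d2 d20 dB] := hB _ e20.
  exists (Num.min d1 d2); first by rewrite lt_min d10.
  move=> a' b' c' d' aa ap pb bb cc' cq qd dd ba dc.
  have ab' := le_trans ap pb; have cd' := le_trans cq qd.
  have ca' : c <= c' <= d by rewrite cc' (le_trans cd' dd).
  have da' : c <= d' <= d by rewrite dd (le_trans cc' cd').
  have aa' : a <= a' <= b by rewrite aa (le_trans ab' bb).
  have ba' : a <= b' <= b by rewrite bb (le_trans aa ab').
  have clo (x y z l : R) : y <= x <= z -> y <= l <= z -> `|x - l| <= z - y.
    by move=> /andP[? ?] /andP[? ?]; rewrite ler_norml; apply/andP; split; lra.
  set L := (b' - a') + (d' - c').
  have L0 : 0 <= L by rewrite addr_ge0 ?subr_ge0.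
  have loc E e1 e2 : (forall s t, `|s - p| < Num.min d1 d2 -> `|t - q| < Num.min d1 d2 ->
     `|E s t - E p q - e1 * (s - p) - e2 * (t - q)| <= eps / 2 * (`|s - p| + `|t - q|)) ->
     forall s t, a' <= s <= b' -> c' <= t <= d' ->
      `|E s t - E p q - e1 * (s - p) - e2 * (t - q)| <= eps / 2 * L.
    move=> h s t hs ht.
    have h1 : `|s - p| <= b' - a' by apply: clo => //; rewrite ap.
    have h2 : `|t - q| <= d' - c' by apply: clo => //; rewrite cq.
    apply: (le_trans (h _ _ (le_lt_trans h1 ba) (le_lt_trans h2 dc))).
    by rewrite ler_pM2l// lerD.
  have lA : forall s t, a' <= s <= b' -> c' <= t <= d' ->
     `|A s t - A p q - a1 * (s - p) - k * (t - q)| <= eps / 2 * L.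
    apply: loc => s t; rewrite !lt_min => /andP[u1 u2] /andP[v1 v2]; exact: dA.
  have lB : forall s t, a' <= s <= b' -> c' <= t <= d' ->
     `|B s t - B p q - k * (s - p) - b2 * (t - q)| <= eps / 2 * L.
    apply: loc => s t; rewrite !lt_min => /andP[u1 u2] /andP[v1 v2]; exact: dB.
  have ct x y c1 : cont_on x y (fun=> c1) by move=> ? _; exact: cst_continuous.
  have cAc := cont_on_sub aa bb (cA _ ca'); have cAd := cont_on_sub aa bb (cA _ da').
  have cBa := cont_on_sub cc' dd (cB _ aa'); have cBb := cont_on_sub cc' dd (cB _ ba').
  have cAB : cont_on a' b' (fun s => A s c' - A s d').
    by move=> x hx; apply: cvgB; [exact: cAc|exact: cAd].
  have cBB : cont_on c' d' (fun t => B b' t - B a' t).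
    by move=> x hx; apply: cvgB; [exact: cBb|exact: cBa].
  (* The two subtracted constants contribute opposite multiples of [k * (b' - a') * (d' - c')], so
     the sum is unchanged. *)
  have -> : Phi a' b' c' d' =
      itg a' b' (fun s => A s c' - A s d' - k * (c' - d')) +
      itg c' d' (fun t => B b' t - B a' t - k * (b' - a')).
    rewrite !itgB// !itg_cst// /Phi; ring.
  apply: le_trans (ler_normD _ _) _.
  apply: (@le_trans _ _ (eps * L * (b' - a') + eps * L * (d' - c'))); last first.
    by rewrite -mulrDr -/L expr2 mulrA.
  have twoE : eps * L = eps / 2 * L + eps / 2 * L by field.
  apply: lerD; apply: itg_bound => //.
  + by move=> x hx; apply: cvgB; [exact: cAB|exact: cvg_cst].
  + move=> s hs.
    have h1 := lA s c' hs; rewrite lexx cd' in h1; have {}h1 := h1 isT.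
    have h2 := lA s d' hs; rewrite lexx cd' in h2; have {}h2 := h2 isT.
    rewrite twoE; apply: le_trans (lerD h1 h2); apply: le_trans (ler_normB _ _).
    by rewrite le_eqVlt; apply/orP; left; apply/eqP; congr `|_|; ring.
  + by move=> x hx; apply: cvgB; [exact: cBB|exact: cvg_cst].
  + move=> t ht.
    have h1 := lB b' t _ ht; rewrite lexx ab' in h1; have {}h1 := h1 isT.
    have h2 := lB a' t _ ht; rewrite lexx ab' in h2; have {}h2 := h2 isT.
    rewrite twoE; apply: le_trans (lerD h1 h2); apply: le_trans (ler_normB _ _).
    by rewrite le_eqVlt; apply/orP; left; apply/eqP; congr `|_|; ring.
Qed.

End gradients.

(** * Lebesgue measure on tuples *)

Section sigma_finite_package.
Context d (T : measurableType d) (R : realType) (mu : set T -> \bar R).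
Hypotheses (mu0 : mu set0 = 0%E) (mu_ge0 : forall A, (0 <= mu A)%E)
  (muA : semi_sigma_additive mu) (muF : sigma_finite setT mu).

Definition bundled := mu.
#[local] HB.instance Definition _ := isMeasure.Build d T R bundled mu0 mu_ge0 muA.
#[local] HB.instance Definition _ := Measure_isSigmaFinite.Build d T R bundled muF.

(** Converts a bare set function, such as the recursively defined [lebesgue_tuple], into a bundled
    measure to which Tonelli's theorem applies. *)
Lemma sigma_finite_package :
  exists m : {sigma_finite_measure set T -> \bar R}, m = mu :> (set T -> \bar R).
Proof. by exists bundled. Qed.

End sigma_finite_package.

Section lebesgue_affine.
Variable R : realType.
Local Notation leb := (@lebesgue_measure R).

Lemma measurable_affine (a b : R) :
  measurable_fun [set: measurableTypeR R] (fun x : measurableTypeR R => a * x + b : measurableTypeR R).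
Proof. by apply: measurable_funD => //; apply: measurable_funM. Qed.

(** Uniqueness of Lebesgue measure: [|a|] times its pushforward under x -> a x + b has the right
    value on half-open intervals. For [a < 0] the preimages are closed at the other end, which does
    not change their length. *)
Lemma lebesgue_affine (a b : R) (f : measurableTypeR R -> \bar R) : a != 0 ->
  measurable_fun setT f -> (forall x, (0 <= f x)%E) ->
  (\int[leb]_x f (a * x + b)%R = `|a|^-1%:E * \int[leb]_x f x)%E.
Proof.
move=> a0 mf f0; have a0' : 0 < `|a| by rewrite normr_gt0.
have mab := measurable_affine a b.
pose nu := [the measure _ _ of mscale (NngNum (ltW a0'))
  (measure_function_pushforward__canonical__measure_function_Measure leb mab)].
have nuE A : measurable A -> leb A = nu A.
  move=> mA; apply: lebesgue_measure_unique => //= _ [[c e] _ <-] /=.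
  rewrite /mscale/= /pushforward lebesgue_measure_itv /= lte_fin.
  have := a0; rewrite neq_lt => /orP[an|ap].
    have -> : ((fun x : R => a * x + b) @^-1` `]c, e]) = `[(e - b) / a, (c - b) / a[%classic.
      by apply/seteqP; split=> x /=; rewrite !in_itv /= ler_ndivrMr// ltr_ndivlMr// lerBrDr ltrBlDr [x * a]mulrC andbC.
    rewrite lebesgue_measure_itv /= lte_fin ltr_nM2r ?invr_lt0// ltrD2r.
    case: ifPn => _; last by rewrite mule0.
    rewrite -!EFinB -EFinM ltr0_norm//; congr EFin; field; by rewrite lt_eqF.
  have -> : ((fun x : R => a * x + b) @^-1` `]c, e]) = `](c - b) / a, (e - b) / a]%classic.
    by apply/seteqP; split=> x /=; rewrite !in_itv /= ler_pdivlMr// ltr_pdivrMr// ltrBlDr lerBrDr [x * a]mulrC.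
  rewrite lebesgue_measure_itv /= lte_fin ltr_pM2r ?invr_gt0// ltrD2r.
  case: ifPn => _; last by rewrite mule0.
  rewrite -!EFinB -EFinM gtr0_norm//; congr EFin; field; by rewrite gt_eqF.
rewrite [X in (_ * X)%E](eq_measure_integral nu); last by move=> A mA _; exact: nuE.
rewrite ge0_integral_mscale//= muleA -EFinM mulVf ?gt_eqF// mul1e.
by rewrite ge0_integral_pushforward.
Qed.

End lebesgue_affine.

Section lebesgue_tuple_measure.
Variable R : realType.
Local Notation leb := (@lebesgue_measure R).
Local Notation T n := (n.-tuple (measurableTypeR R)).

Lemma measurable_tuple_cons n : measurable_fun setT
  (fun u : measurableTypeR R * T n => [tuple of u.1 :: u.2] : T n.+1).
Proof. exact: measurable_cons. Qed.

Lemma lebesgue_tuple_package n : exists m : {sigma_finite_measure set (T n) -> \bar R},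
  m = @lebesgue_tuple R n :> (set (T n) -> \bar R).
Proof.
elim: n => [|n [m mE]]; first by exists (\d_ [tuple]).
pose nu := [the measure _ _ of (measure_function_pushforward__canonical__measure_function_Measure
  (leb \x m)%E (@measurable_tuple_cons n))].
have nuE : nu = @lebesgue_tuple R n.+1 :> (set (T n.+1) -> \bar R).
  by rewrite /= -mE.
rewrite -nuE; apply: sigma_finite_package => //.
- exact: measure_semi_sigma_additive.
- have /sigma_finiteP[F [FT ndF F1]] := sigma_finiteT leb.
  have /sigma_finiteP[G [GT ndG G1]] := sigma_finiteT m.
  (* Splitting off the head is a measurable inverse of consing; it pulls products of exhausting sets
     back to an exhaustion of the tuples. *)
  pose g (t : T n.+1) : measurableTypeR R * T n := (thead t, [tuple of behead t]).
  have mg : measurable_fun setT g.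
    apply: measurable_fun_pair => /=; first exact: measurable_tnth.
    exact: measurable_behead.
  exists (fun k => g @^-1` (F k `*` G k)).
    apply/seteqP; split => // t _.
    have : [set: measurableTypeR R] (g t).1 by []; rewrite FT => -[k _ Fk].
    have : [set: T n] (g t).2 by []; rewrite GT => -[l _ Gl].
    exists (maxn k l) => //; split.
    + by move: Fk; apply/subsetPset/ndF/leq_maxl.
    + by move: Gl; apply/subsetPset/ndG/leq_maxr.
  move=> k; have [mF Ff] := F1 k; have [mG Gf] := G1 k.
  have mFG := measurableX mF mG.
  split; first by rewrite -[X in measurable X]setTI; exact: mg.
  rewrite /= /pushforward; rewrite [X in (_ \x _)%E X](_ : _ = F k `*` G k); last first.
    apply/seteqP; split => -[x y]; rewrite /= /g theadE;
      by have -> : [tuple of behead [tuple of x :: y]] = y by apply/val_inj.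
  by rewrite product_measure1E// lte_mul_pinfty// ge0_fin_numE.
Qed.

Definition ltm n : {sigma_finite_measure set (T n) -> \bar R} :=
  sval (cid (lebesgue_tuple_package n)).

Lemma ltmE n : ltm n = @lebesgue_tuple R n :> (set (T n) -> \bar R).
Proof. exact: svalP (cid (lebesgue_tuple_package n)). Qed.

Lemma ltm0_int (f : T 0 -> \bar R) : measurable_fun setT f -> (forall x, (0 <= f x)%E) ->
  (\int[ltm 0]_x f x = f [tuple])%E.
Proof. by move=> mf f0; rewrite ltmE /= integral_dirac// diracT mul1e. Qed.

Lemma ltmS_int n (f : T n.+1 -> \bar R) : measurable_fun setT f -> (forall x, (0 <= f x)%E) ->
  (\int[ltm n.+1]_x f x = \int[leb]_x \int[ltm n]_y f [tuple of x :: y])%E.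
Proof.
move=> mf f0; rewrite ltmE /= -ltmE.
rewrite ge0_integral_pushforward//; last exact: measurable_tuple_cons.
rewrite preimage_setT (@fubini_tonelli1 _ _ _ _ _ leb (ltm n))//.
- by apply: measurableT_comp => //; exact: measurable_tuple_cons.
- by move=> x; exact: f0.
Qed.

Lemma measurable_ltmS_int n (f : T n.+1 -> \bar R) :
  measurable_fun setT f -> (forall x, (0 <= f x)%E) ->
  measurable_fun setT (fun x : measurableTypeR R => \int[ltm n]_y f [tuple of x :: y])%E.
Proof.
move=> mf f0.
have := @measurable_fun_fubini_tonelli_F _ _ _ _ _ (ltm n)
  (fun u : measurableTypeR R * T n => f [tuple of u.1 :: u.2]).
by apply => //; apply: measurableT_comp => //; exact: measurable_tuple_cons.
Qed.

Definition aff n (a : R) (b x : T n) : T n := [tuple a * tnth x i + tnth b i | i < n].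

Lemma measurable_aff n a (b : T n) : measurable_fun setT (aff a b).
Proof.
apply/measurable_fun_tnthP => i; rewrite (_ : _ \o _ = fun x => a * tnth x i + tnth b i).
  apply: (@measurableT_comp _ _ _ _ _ _ (fun y : measurableTypeR R => a * y + tnth b i)).
    exact: measurable_affine.
  exact: measurable_tnth.
by apply/funext => x /=; rewrite tnth_mktuple.
Qed.

Lemma ltm_affine n (a : R) (b : T n) (f : T n -> \bar R) : a != 0 ->
  measurable_fun setT f -> (forall x, (0 <= f x)%E) ->
  (\int[ltm n]_x f (aff a b x) = (`|a| ^- n)%:E * \int[ltm n]_x f x)%E.
Proof.
move=> a0; elim: n b f => [|n ih] b f mf f0.
  rewrite !ltm0_int//; last first.
    by apply: measurableT_comp => //; exact: measurable_aff.
  by rewrite expr0 invr1 mul1e; rewrite [aff _ _ _]tuple0.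
rewrite !ltmS_int//; last first.
  by apply: measurableT_comp => //; exact: measurable_aff.
have mf2 := measurable_ltmS_int mf f0.
have consE (x : measurableTypeR R) (y : T n) : aff a b [tuple of x :: y] =
    [tuple of (a * x + thead b) :: aff a [tuple of behead b] y].
  apply: eq_from_tnth => i; rewrite tnth_mktuple.
  case: (unliftP ord0 i) => [j|] ->; last by rewrite !tnth0.
  by rewrite !tnthS tnth_mktuple [in LHS](tuple_eta b) tnthS.
transitivity (\int[leb]_x ((`|a| ^- n)%:E * (\int[ltm n]_y f [tuple of (a * x + thead b)%R :: y])))%E.
  apply: eq_integral => x _; rewrite -(ih [tuple of behead b])//; last first.
    by apply: measurableT_comp => //; exact: measurable_cons.
  by apply: eq_integral => y _; rewrite consE.
rewrite ge0_integralZl; last 4 first.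
- exact: measurableT.
- by apply: (measurableT_comp mf2); exact: measurable_affine.
- by move=> x _; apply: integral_ge0.
- by rewrite lee_fin invr_ge0 exprn_ge0.
rewrite (lebesgue_affine (thead b) a0 mf2); last by move=> x; apply: integral_ge0.
by rewrite muleA -EFinM exprSr invfM.
Qed.

End lebesgue_tuple_measure.

(** * Mean values and the Cauchy estimate over squares *)

Section cauchy_riemann.
Variable R : realType.
Implicit Types (u v : R -> R -> R) (x y s t : R).

(** Complex differentiability of u + i v at x + i y, with derivative a + i b. *)
Definition cr_at u v x y :=
  exists a b, has_grad u x y a (- b) /\ has_grad v x y b a.

Definition cont2 u x y := forall eps : R, 0 < eps -> exists2 del : R, 0 < del &
  forall x' y', `|x' - x| < del -> `|y' - y| < del -> `|u x' y' - u x y| < eps.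

Lemma has_grad_cont2v u x y a b : has_grad u x y a b -> cont2 u x y.
Proof. exact: has_grad_cvg. Qed.

Lemma cr_cont2 u v x y : cr_at u v x y -> cont2 u x y /\ cont2 v x y.
Proof. by move=> [a [b [h1 h2]]]; split; [exact: has_grad_cont2v h1|exact: has_grad_cont2v h2]. Qed.

(** Composition with multiplication by i. *)
Definition qturn u x y := u (- y) x.

Lemma cr_qturn u v x y : cr_at u v (- y) x -> cr_at (qturn u) (qturn v) x y.
Proof.
move=> [a [b [hu hv]]]; exists (- b), a.
have h2 := has_gradN (has_grad_snd x y); have h1 := has_grad_fst x y.
split; [apply: has_grad_eq (has_grad_comp hu h2 h1) _ _ |
        apply: has_grad_eq (has_grad_comp hv h2 h1) _ _]; ring.
Qed.

Lemma cont2_qturn u : cont2 u 0 0 -> cont2 (qturn u) 0 0.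
Proof.
move=> h e e0; have [d d0 H] := h e e0; exists d => // x y hx hy; rewrite /qturn oppr0.
by apply: H => //; rewrite !subr0 normrN in hy *.
Qed.

(* The integral of (u + i v) dz / z along the right-hand side of the square of
   half-width s has imaginary part sector u v s; sectors adds the four sides. *)
Definition sector u v s := itg (-1) 1 (fun t => (u s (s * t) + t * v s (s * t)) / (1 + t ^+ 2)).

Lemma leN11 : -1 <= 1 :> R.
Proof. by rewrite (@le_trans _ _ 0)// oppr_le0. Qed.

Lemma sqr1_gt0 t : 0 < 1 + t ^+ 2.
Proof. by rewrite ltr_pwDl// sqr_ge0. Qed.

(** With z = s (1 + i t), the imaginary part of (u + i v) dz / z is v / s ds + (u + t v) / (1 + t^2)
    dt; it is closed because u + i v is holomorphic. *)
Lemma sector_grad u v s t : 0 < s -> cr_at u v s (s * t) ->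
  exists a1 k b2, has_grad (fun s t => v s (s * t) / s) s t a1 k /\
    has_grad (fun s t => (u s (s * t) + t * v s (s * t)) / (1 + t ^+ 2)) s t k b2.
Proof.
move=> s0 [a [b [hu hv]]].
have hst := has_gradM (has_grad_fst s t) (has_grad_snd s t).
have hus := has_grad_comp hu (has_grad_fst s t) hst.
have hvs := has_grad_comp hv (has_grad_fst s t) hst.
have hsv : has_grad (fun s _ => s^-1) s t _ _ := has_gradV (A := fun s _ => s) (lt0r_neq0 s0) (has_grad_fst s t).
have hA := has_gradM hvs hsv.
have h1 := has_gradD (has_grad_cst 1 s t) (has_gradM (has_grad_snd s t) (has_grad_snd s t)).
have h1v := has_gradV (A := fun _ t => 1 + t ^+ 2) (lt0r_neq0 (sqr1_gt0 t)) h1.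
have hB := has_gradM (has_gradD hus (has_gradM (has_grad_snd s t) hvs)) h1v.
do 3 eexists; split.
  by apply: has_grad_eq hA _ _.
apply: has_grad_eq hB _ _; last by [].
by field; rewrite !gt_eqF//= sqr1_gt0.
Qed.

(** Green's theorem on a trapezoid between two concentric squares. The right-hand side collects its
    oblique sides, which lie on the diagonals t = 1 and t = -1. *)
Lemma sector_green u v s1 s2 : 0 < s1 -> s1 <= s2 ->
  (forall s t, s1 <= s <= s2 -> -1 <= t <= 1 -> cr_at u v s (s * t)) ->
  sector u v s2 - sector u v s1 =
  itg s1 s2 (fun s => v s s / s) - itg s1 s2 (fun s => v s (- s) / s).
Proof.
move=> s10 s12 H.
have := @green_closed R (fun s t => v s (s * t) / s)
  (fun s t => (u s (s * t) + t * v s (s * t)) / (1 + t ^+ 2)) s1 s2 (-1) 1 s12.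
move=> /(_ _ _)/wrap[]; first exact: leN11.
  move=> s t hs ht; apply: sector_grad; last exact: H.
  by have /andP[+ _] := hs; exact: lt_le_trans.
rewrite (itg_eq (g := fun s => v s (- s) / s)); last by move=> x _; rewrite mulrN1.
rewrite [X in _ - X + _](itg_eq (g := fun s => v s s / s)); last by move=> x _; rewrite mulr1.
by rewrite /sector => /eqP; rewrite addrC addr_eq0 opprB => /eqP.
Qed.

Definition sectors u v s := sector u v s + sector (qturn u) (qturn v) s +
  sector (qturn (qturn u)) (qturn (qturn v)) s + sector (qturn (qturn (qturn u))) (qturn (qturn (qturn v))) s.

(** The four trapezoids share their oblique sides, so the integrals along the diagonals cancel in
    pairs. The centre is left out of the differentiability hypothesis, which admits a removable
    singularity there. *)
Lemma sectors_const u v s1 s2 : 0 < s1 -> s1 <= s2 ->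
  (forall x y, `|x| <= s2 -> `|y| <= s2 -> (x != 0) || (y != 0) -> cr_at u v x y) ->
  sectors u v s1 = sectors u v s2.
Proof.
move=> s10 s12 H.
have bnd s t : s1 <= s <= s2 -> -1 <= t <= 1 ->
   [/\ `|s| <= s2, `|s * t| <= s2 & s != 0].
  move=> /andP[h1 h2] ht; have s0 := lt_le_trans s10 h1.
  rewrite normrM (gtr0_norm s0) gt_eqF//; split => //.
  apply: le_trans h2; rewrite -[leRHS]mulr1 ler_pM2l//.
  by rewrite ler_norml.
apply/eqP; rewrite eq_sym -subr_eq0 /sectors; apply/eqP.
have E0 := @sector_green u v s1 s2 s10 s12.
have E1 := @sector_green (qturn u) (qturn v) s1 s2 s10 s12.
have E2 := @sector_green (qturn (qturn u)) (qturn (qturn v)) s1 s2 s10 s12.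
have E3 := @sector_green (qturn (qturn (qturn u))) (qturn (qturn (qturn v))) s1 s2 s10 s12.
have {}E0 := E0 (fun s t hs ht => let: And3 a b c := bnd s t hs ht in H _ _ a b (introT orP (or_introl c))).
have {}E1 := E1 (fun s t hs ht => let: And3 a b c := bnd s t hs ht in cr_qturn (H _ _ (etrans (congr1 (fun z => z <= s2) (normrN _)) b) a (introT orP (or_intror c)))).
have {}E2 : sector (qturn (qturn u)) (qturn (qturn v)) s2 - sector (qturn (qturn u)) (qturn (qturn v)) s1 =
  itg s1 s2 (fun s => qturn (qturn v) s s / s) - itg s1 s2 (fun s => qturn (qturn v) s (- s) / s).
  apply: E2 => s t hs ht; have [a b c] := bnd s t hs ht.
  by apply/cr_qturn/cr_qturn/H; rewrite ?normrN// oppr_eq0 c.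
have {}E3 : sector (qturn (qturn (qturn u))) (qturn (qturn (qturn v))) s2 - sector (qturn (qturn (qturn u))) (qturn (qturn (qturn v))) s1 =
  itg s1 s2 (fun s => qturn (qturn (qturn v)) s s / s) - itg s1 s2 (fun s => qturn (qturn (qturn v)) s (- s) / s).
  apply: E3 => s t hs ht; have [a b c] := bnd s t hs ht.
  by apply/cr_qturn/cr_qturn/cr_qturn/H; rewrite ?opprK ?normrN// oppr_eq0 c orbT.
rewrite (_ : _ - _ = (sector u v s2 - sector u v s1) +
  (sector (qturn u) (qturn v) s2 - sector (qturn u) (qturn v) s1) +
  (sector (qturn (qturn u)) (qturn (qturn v)) s2 - sector (qturn (qturn u)) (qturn (qturn v)) s1) +
  (sector (qturn (qturn (qturn u))) (qturn (qturn (qturn v))) s2 -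
    sector (qturn (qturn (qturn u))) (qturn (qturn (qturn v))) s1)); last by ring.
rewrite E0 E1 E2 E3 /qturn.
rewrite (itg_eq (f := fun s => v (- - s) s / s) (g := fun s => v s s / s)); last by move=> *; rewrite opprK.
rewrite (itg_eq (f := fun s => v (- s) (- - s) / s) (g := fun s => v (- s) s / s)); last by move=> *; rewrite opprK.
rewrite (itg_eq (f := fun s => v (- - s) (- s) / s) (g := fun s => v s (- s) / s)); last by move=> *; rewrite opprK.
rewrite (itg_eq (f := fun s => v (- - - s) (- s) / s) (g := fun s => v (- s) (- s) / s)); last by move=> *; rewrite opprK.
ring.
Qed.

Lemma itg_odd (f : R -> R) : (forall x, {for x, continuous f}) -> (forall x, f (- x) = - f x) ->
  itg (-1) 1 f = 0.
Proof.
move=> cf odd; apply/eqP; rewrite -[_ == 0](_ : (itg (-1) 1 f == - itg (-1) 1 f) = _); last first.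
  by rewrite -addr_eq0 -mulr2n mulrn_eq0.
have N1 := leN11.
have := @integration_by_substitution_oppr R f (-1) 1 N1.
rewrite opprK => /(_ _)/wrap[].
  by apply: continuous_in_subspaceT => x _; exact: cf.
have c0 a b : cont_on a b (fun _ : R => 0 : R) by move=> x _; exact: cst_continuous.
have -> : - itg (-1) 1 f = itg (-1) 1 (fun x => 0 - f x).
  by rewrite itgB// ?itg_cst// ?mul0r ?sub0r// => x _; exact: cf.
rewrite {2}/itg /Rintegral {1}/itg /Rintegral => ->; apply/eqP; congr fine.
by apply: eq_integral => x _; rewrite /= odd sub0r.
Qed.

Lemma cont_on_inv1 a b : cont_on a b (fun t : R => (1 + t ^+ 2)^-1).
Proof.
move=> t _.
have h1 := has_gradD (has_grad_cst 1 t t) (has_gradM (has_grad_fst t t) (has_grad_fst t t)).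
have h1v := has_gradV (A := fun t _ => 1 + t ^+ 2) (lt0r_neq0 (sqr1_gt0 t)) h1.
exact: has_grad_cont1 h1v.
Qed.

Lemma cont_on_M a b (f g : R -> R) : cont_on a b f -> cont_on a b g -> cont_on a b (fun t => f t * g t).
Proof. by move=> cf cg x hx; apply: cvgM; [exact: cf|exact: cg]. Qed.

Lemma cont_on_D a b (f g : R -> R) : cont_on a b f -> cont_on a b g -> cont_on a b (fun t => f t + g t).
Proof. by move=> cf cg x hx; apply: cvgD; [exact: cf|exact: cg]. Qed.

Lemma cont_on_id a b : cont_on a b (fun t : R => t).
Proof. by move=> x _; exact: cvg_id. Qed.

Lemma cont_on_cst a b c : cont_on a b (fun t : R => c).
Proof. by move=> x _; exact: cvg_cst. Qed.

(** Equal to pi / 2; all that is used of it is that it is at least 1. *)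
Definition inv1int : R := itg (-1) 1 (fun t => (1 + t ^+ 2)^-1).

Lemma inv1int_ge1 : 1 <= inv1int.
Proof.
have -> : 1 = itg (-1) 1 (fun=> 2^-1) :> R by rewrite itg_cst ?leN11//; field.
apply: itg_le => [||t /andP[h1 h2]]; [exact: cont_on_cst|exact: cont_on_inv1|].
rewrite lef_pV2 ?posrE ?sqr1_gt0// -lerBrDl (_ : 2 - 1 = 1); last by ring.
by rewrite -real_normK ?num_real// expr_le1// ler_norml h1.
Qed.

Lemma div1_bound (a b t : R) : -1 <= t <= 1 -> `|(a + t * b) / (1 + t ^+ 2)| <= `|a| + `|b|.
Proof.
move=> ht; rewrite normrM normfV [X in _ / X]gtr0_norm ?sqr1_gt0// ler_pdivrMr ?sqr1_gt0//.
apply: (@le_trans _ _ (`|a| + `|b|)); last by rewrite ler_peMr ?addr_ge0// lerDl sqr_ge0.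
apply: le_trans (ler_normD _ _) _; rewrite lerD2l normrM ler_piMl//.
by rewrite ler_norml.
Qed.

Lemma cont_on_ray u v s : 0 < s ->
  (forall t, -1 <= t <= 1 -> cr_at u v s (s * t)) ->
  cont_on (-1) 1 (fun t => u s (s * t)) /\ cont_on (-1) 1 (fun t => v s (s * t)).
Proof.
move=> s0 H; split=> t /H [a [b [hu hv]]].
- have h := has_grad_comp (X := fun _ _ => s) (Y := fun t' _ => s * t') (s := t) (t := t) hu
    (has_grad_cst s t t) (has_gradM (has_grad_cst s t t) (has_grad_fst t t)).
  exact: has_grad_cont1 h.
- have h := has_grad_comp (X := fun _ _ => s) (Y := fun t' _ => s * t') (s := t) (t := t) hv
    (has_grad_cst s t t) (has_gradM (has_grad_cst s t t) (has_grad_fst t t)).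
  exact: has_grad_cont1 h.
Qed.

Lemma cont_on_sector u v s : 0 < s ->
  (forall t, -1 <= t <= 1 -> cr_at u v s (s * t)) ->
  cont_on (-1) 1 (fun t => (u s (s * t) + t * v s (s * t)) / (1 + t ^+ 2)).
Proof.
move=> s0 /(cont_on_ray s0)[cu cv]; apply: (cont_on_M _ (@cont_on_inv1 _ _)).
by apply: cont_on_D => //; apply: cont_on_M => //; exact: cont_on_id.
Qed.

(** On small squares the integrand is uniformly close to the one with [u] and [v] frozen at the
    origin, and there the part with [v 0 0] is odd in [t]. *)
Lemma sector_lim u v rho : 0 < rho ->
  (forall x y, `|x| <= rho -> `|y| <= rho -> (x != 0) || (y != 0) -> cr_at u v x y) ->
  cont2 u 0 0 -> cont2 v 0 0 -> forall eps, 0 < eps ->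
  exists2 del, 0 < del & forall s, 0 < s -> s < del ->
   `|sector u v s - inv1int * u 0 0| <= eps.
Proof.
move=> rho0 H cu cv eps e0; have e40 : 0 < eps / 4 by rewrite divr_gt0.
have [d1 d10 h1] := cu _ e40; have [d2 d20 h2] := cv _ e40.
exists (Num.min rho (Num.min d1 d2)); first by rewrite !lt_min rho0 d10.
move=> s s0; rewrite !lt_min => /and3P[sr s1 s2].
have bnd t : -1 <= t <= 1 -> `|s * t| <= s.
  by move=> ht; rewrite normrM (gtr0_norm s0) ler_piMr ?(ltW s0)// ler_norml.
have H' t : -1 <= t <= 1 -> cr_at u v s (s * t).
  move=> /bnd ht; apply: H; first by rewrite (gtr0_norm s0) ltW.
    by rewrite (le_trans ht)// ltW.
  by rewrite gt_eqF.
have cS := cont_on_sector s0 H'.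
have odd0 : itg (-1) 1 (fun t : R => t * (1 + t ^+ 2)^-1) = 0.
  apply: itg_odd => [x|x]; last by rewrite sqrrN mulNr.
  by apply: (@cont_on_M x x); rewrite ?lexx//; [exact: cont_on_id|exact: cont_on_inv1].
have cK : cont_on (-1) 1 (fun t : R => (u 0 0 + t * v 0 0) / (1 + t ^+ 2)).
  apply: (cont_on_M _ (@cont_on_inv1 _ _)); apply: cont_on_D; first exact: cont_on_cst.
  by apply: cont_on_M; [exact: cont_on_id|exact: cont_on_cst].
have -> : inv1int * u 0 0 = itg (-1) 1 (fun t => (u 0 0 + t * v 0 0) / (1 + t ^+ 2)).
  have cZ c f : cont_on (-1) 1 f -> itg (-1) 1 (fun t => f t * c) = itg (-1) 1 f * c.
    by move=> cf; apply: RintegralZr => //; exact: cont_on_integrable.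
  rewrite (itg_eq (g := fun t => (1 + t ^+ 2)^-1 * u 0 0 + t * (1 + t ^+ 2)^-1 * v 0 0)); last first.
    by move=> x _; ring.
  have c1 := @cont_on_inv1 (-1) 1; have c2 := cont_on_M (@cont_on_id (-1) 1) c1.
  rewrite itgD; [|by apply: cont_on_M => //; exact: cont_on_cst
                 |by apply: cont_on_M => //; exact: cont_on_cst].
  by rewrite !cZ// odd0 mul0r addr0.
rewrite -itgB//; apply: le_trans (itg_bound (M := eps / 2) leN11 _ _) _.
- by move=> x hx; apply: cvgB; [exact: cS|exact: cK].
- move=> t ht.
  rewrite (_ : _ - _ = ((u s (s * t) - u 0 0) + t * (v s (s * t) - v 0 0)) / (1 + t ^+ 2)); last by ring.
  apply: (le_trans (div1_bound _ _ ht)).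
  have b1 : `|s - 0| < d1 by rewrite subr0 gtr0_norm.
  have b2 : `|s - 0| < d2 by rewrite subr0 gtr0_norm.
  have b3 : `|s * t - 0| < d1 by rewrite subr0 (le_lt_trans (bnd _ ht)).
  have b4 : `|s * t - 0| < d2 by rewrite subr0 (le_lt_trans (bnd _ ht)).
  rewrite (_ : eps / 2 = eps / 4 + eps / 4); last by field.
  by apply: lerD; apply: ltW; [exact: h1|exact: h2].
- by rewrite le_eqVlt; apply/orP; left; apply/eqP; field.
Qed.

Lemma cr_box_qturn u v rho :
  (forall x y, `|x| <= rho -> `|y| <= rho -> (x != 0) || (y != 0) -> cr_at u v x y) ->
  (forall x y, `|x| <= rho -> `|y| <= rho -> (x != 0) || (y != 0) -> cr_at (qturn u) (qturn v) x y).
Proof.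
by move=> h x y hx hy xy; apply/cr_qturn/h; rewrite ?normrN// oppr_eq0 orbC.
Qed.

Lemma sectors_val u v rho : 0 < rho ->
  (forall x y, `|x| <= rho -> `|y| <= rho -> (x != 0) || (y != 0) -> cr_at u v x y) ->
  cont2 u 0 0 -> cont2 v 0 0 -> sectors u v rho = 4 * inv1int * u 0 0.
Proof.
move=> r0 H cu cv.
have H1 := cr_box_qturn H; have H2 := cr_box_qturn H1; have H3 := cr_box_qturn H2.
have [cu1 cv1] := (cont2_qturn cu, cont2_qturn cv); have [cu2 cv2] := (cont2_qturn cu1, cont2_qturn cv1).
have [cu3 cv3] := (cont2_qturn cu2, cont2_qturn cv2).
apply/eqP; rewrite -subr_eq0 -normr_le0; apply/ler_addgt0Pr => e e0; rewrite add0r.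
have e4 : 0 < e / 4 by rewrite divr_gt0.
have [d0 d00 h0] := sector_lim r0 H cu cv e4; have [d1 d10 h1] := sector_lim r0 H1 cu1 cv1 e4.
have [d2 d20 h2] := sector_lim r0 H2 cu2 cv2 e4; have [d3 d30 h3] := sector_lim r0 H3 cu3 cv3 e4.
pose m := Num.min rho (Num.min d0 (Num.min d1 (Num.min d2 d3))).
have m0 : 0 < m by rewrite !lt_min r0 d00 d10 d20.
have s0 : 0 < m / 2 by rewrite divr_gt0.
have : m / 2 < m by rewrite ltr_pdivrMr// ltr_pMr// ltr1n.
rewrite {2}/m !lt_min => /and5P[sr sd0 sd1 sd2 sd3].
rewrite -(sectors_const s0 (ltW sr) H) /sectors.
have := lerD (lerD (h0 _ s0 sd0) (h1 _ s0 sd1)) (lerD (h2 _ s0 sd2) (h3 _ s0 sd3)).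
rewrite (_ : e / 4 + e / 4 + (e / 4 + e / 4) = e); last by field.
apply: le_trans; rewrite /qturn !oppr0.
apply: le_trans (lerD (ler_normD _ _) (ler_normD _ _)); apply: le_trans (ler_normD _ _).
by rewrite le_eqVlt; apply/orP; left; apply/eqP; congr `|_|; ring.
Qed.

Definition abs2 u v x y := `|u x y| + `|v x y|.

(** Sub-mean-value property over the boundary of a square: [sectors_val] represents [u 0 0] through
    the four sides, whose integrands are bounded by [abs2]. *)
Lemma square_mean u v rho : 0 < rho ->
  (forall x y, `|x| <= rho -> `|y| <= rho -> (x != 0) || (y != 0) -> cr_at u v x y) ->
  cont2 u 0 0 -> cont2 v 0 0 ->
  2 * abs2 u v 0 0 <= itg (-1) 1 (fun t => abs2 u v rho (rho * t)) +
    itg (-1) 1 (fun t => qturn (abs2 u v) rho (rho * t)) +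
    itg (-1) 1 (fun t => qturn (qturn (abs2 u v)) rho (rho * t)) +
    itg (-1) 1 (fun t => qturn (qturn (qturn (abs2 u v))) rho (rho * t)).
Proof.
move=> r0.
(* A bound on the real part is enough: -i (u + i v) = v - i u has real part [v] and the same [abs2].
   Adding the two bounds turns the factor 4 into 2. *)
suff S u' v' : (forall x y, `|x| <= rho -> `|y| <= rho -> (x != 0) || (y != 0) -> cr_at u' v' x y) ->
  cont2 u' 0 0 -> cont2 v' 0 0 -> 4 * `|u' 0 0| <= itg (-1) 1 (fun t => abs2 u' v' rho (rho * t)) +
    itg (-1) 1 (fun t => qturn (abs2 u' v') rho (rho * t)) +
    itg (-1) 1 (fun t => qturn (qturn (abs2 u' v')) rho (rho * t)) +
    itg (-1) 1 (fun t => qturn (qturn (qturn (abs2 u' v'))) rho (rho * t)).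
  move=> H cu cv; have h1 := S _ _ H cu cv.
  have : 4 * `|v 0 0| <= itg (-1) 1 (fun t => abs2 u v rho (rho * t)) +
    itg (-1) 1 (fun t => qturn (abs2 u v) rho (rho * t)) +
    itg (-1) 1 (fun t => qturn (qturn (abs2 u v)) rho (rho * t)) +
    itg (-1) 1 (fun t => qturn (qturn (qturn (abs2 u v))) rho (rho * t)).
    have -> : abs2 u v = abs2 v (fun x y => - u x y).
      by apply/funext => x; apply/funext => y; rewrite /abs2 normrN addrC.
    apply: S => //.
    - move=> x y hx hy /(H _ _ hx hy)[a [b [hu hv]]]; exists b, (- a); rewrite opprK; split => //.
      by apply: has_grad_eq (has_gradN hu) _ _ => //; rewrite opprK.
    - move=> e e0; have [d d0 h] := cu e e0; exists d => // x y hx hy.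
      by rewrite -opprD normrN; exact: h.
  by move: h1; rewrite /abs2 mulrDr; set T := itg _ _ _ + _ + _ + _ => h1 h2; lra.
move=> H cu cv.
have H1 := cr_box_qturn H; have H2 := cr_box_qturn H1; have H3 := cr_box_qturn H2.
have SB (w z : R -> R -> R) :
  (forall x y, `|x| <= rho -> `|y| <= rho -> (x != 0) || (y != 0) -> cr_at w z x y) ->
  `|sector w z rho| <= itg (-1) 1 (fun t => abs2 w z rho (rho * t)).
  move=> h.
  have h' t : -1 <= t <= 1 -> cr_at w z rho (rho * t).
    move=> ht; apply: h; [by rewrite (gtr0_norm r0)| |by rewrite gt_eqF].
    by rewrite normrM (gtr0_norm r0) ler_piMr ?(ltW r0)// ler_norml.
  have cS := cont_on_sector r0 h'; have [cu' cv'] := cont_on_ray r0 h'.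
  rewrite /sector; apply: le_trans.
    by apply: le_normr_Rintegral => //; exact: cont_on_integrable.
  have cn f : cont_on (-1) 1 f -> cont_on (-1) 1 (fun t => `|f t|).
    by move=> cf x hx; apply: cvg_norm; exact: cf.
  apply: itg_le => [||t ht]; first exact: cn.
    by apply: cont_on_D; exact: cn.
  exact: div1_bound.
have := sectors_val r0 H cu cv => /(congr1 Num.norm) => E.
apply: (@le_trans _ _ `|4 * inv1int * u' 0 0|).
  rewrite !normrM (ger0_norm (ler0n _ 4)) -!mulrA ler_pM2l// ler_peMl//.
  by rewrite ger0_norm ?inv1int_ge1// (le_trans ler01 inv1int_ge1).
rewrite -E /sectors.
apply: le_trans (ler_normD _ _) _; apply: lerD; last exact: SB.
apply: le_trans (ler_normD _ _) _; apply: lerD; last exact: SB.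
apply: le_trans (ler_normD _ _) _; apply: lerD; exact: SB.
Qed.

End cauchy_riemann.

Section cauchy_estimate.
Variable R : realType.
Implicit Types (u v : R -> R -> R) (x y s t a b : R).

Lemma has_grad_local A B s t a b (d : R) : 0 < d ->
  (forall s' t', `|s' - s| < d -> `|t' - t| < d -> A s' t' = B s' t') ->
  has_grad A s t a b -> has_grad B s t a b.
Proof.
move=> d0 AB hA e e0; have [d' d'0 H] := hA e e0.
exists (Num.min d d'); first by rewrite lt_min d0.
move=> s' t'; rewrite !lt_min => /andP[u1 u2] /andP[v1 v2].
by rewrite -!AB ?subrr ?normr0//; exact: H.
Qed.

Lemma cr_atM u1 v1 u2 v2 x y : cr_at u1 v1 x y -> cr_at u2 v2 x y ->
  cr_at (fun x y => u1 x y * u2 x y - v1 x y * v2 x y)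
        (fun x y => u1 x y * v2 x y + v1 x y * u2 x y) x y.
Proof.
move=> [a1 [b1 [hu1 hv1]]] [a2 [b2 [hu2 hv2]]].
have h1 := has_gradD (has_gradM hu1 hu2) (has_gradN (has_gradM hv1 hv2)).
have h2 := has_gradD (has_gradM hu1 hv2) (has_gradM hv1 hu2).
exists (u1 x y * a2 + a1 * u2 x y - (v1 x y * b2 + b1 * v2 x y)).
exists (u1 x y * b2 + v1 x y * a2 + (a1 * v2 x y + b1 * u2 x y)).
by split; [apply: has_grad_eq h1 _ _|apply: has_grad_eq h2 _ _]; ring.
Qed.

Lemma sqr2_gt0 x y : (x != 0) || (y != 0) -> 0 < x ^+ 2 + y ^+ 2.
Proof.
move=> xy; rewrite lt_neqAle addr_ge0 ?sqr_ge0// andbT eq_sym paddr_eq0 ?sqr_ge0//.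
by rewrite !sqrf_eq0 negb_and.
Qed.

Lemma cr_inv x y : (x != 0) || (y != 0) ->
  cr_at (fun x y => x / (x ^+ 2 + y ^+ 2)) (fun x y => - y / (x ^+ 2 + y ^+ 2)) x y.
Proof.
move=> /sqr2_gt0 n0.
have hx := has_grad_fst x y; have hy := has_grad_snd x y.
have hn := has_gradV (A := fun x y => x ^+ 2 + y ^+ 2) (lt0r_neq0 n0)
  (has_gradD (has_gradM hx hx) (has_gradM hy hy)).
have h1 := has_gradM hx hn; have h2 := has_gradM (has_gradN hy) hn.
exists ((y ^+ 2 - x ^+ 2) / (x ^+ 2 + y ^+ 2) ^+ 2), (2 * x * y / (x ^+ 2 + y ^+ 2) ^+ 2).
by split; [apply: has_grad_eq h1 _ _|apply: has_grad_eq h2 _ _]; field; rewrite gt_eqF.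
Qed.

Lemma cr_sub_cst u v x y c d : cr_at u v x y ->
  cr_at (fun x y => u x y - c) (fun x y => v x y - d) x y.
Proof.
move=> [a [b [hu hv]]]; exists a, b; split.
- by apply: has_grad_eq (has_gradD hu (has_grad_cst (- c) x y)) _ _; rewrite addr0.
- by apply: has_grad_eq (has_gradD hv (has_grad_cst (- d) x y)) _ _; rewrite addr0.
Qed.

Lemma norm_sqr2 x y : (`|x| + `|y|) ^+ 2 <= 2 * (x ^+ 2 + y ^+ 2).
Proof.
rewrite -(real_normK (num_real x)) -(real_normK (num_real y)) -subr_ge0.
rewrite (_ : _ - _ = (`|x| - `|y|) ^+ 2) ?sqr_ge0//; ring.
Qed.

(** The difference quotient (f(z) - f(0)) / z, with value f'(0) = a + i b at the origin, is
    holomorphic off the origin and continuous at it. So [square_mean] bounds its central value by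
    its size on the boundary of the square, where z has modulus at least [rho]. *)
Lemma cauchy_estimate u v a b rho M : 0 < rho ->
  (forall x y, `|x| <= rho -> `|y| <= rho -> cr_at u v x y) ->
  (forall x y, `|x| <= rho -> `|y| <= rho -> abs2 u v x y <= M) ->
  has_grad u 0 0 a (- b) -> has_grad v 0 0 b a -> `|a| + `|b| <= 16 * M / rho.
Proof.
move=> r0 H HM hu hv.
pose du x y := u x y - u 0 0; pose dv x y := v x y - v 0 0.
pose ix x y : R := x / (x ^+ 2 + y ^+ 2); pose iy x y : R := - y / (x ^+ 2 + y ^+ 2).
pose U0 x y := du x y * ix x y - dv x y * iy x y.
pose V0 x y := du x y * iy x y + dv x y * ix x y.
pose U x y := if (x == 0) && (y == 0) then a else U0 x y.
pose V x y := if (x == 0) && (y == 0) then b else V0 x y.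
have crUV x y : `|x| <= rho -> `|y| <= rho -> (x != 0) || (y != 0) -> cr_at U V x y.
  move=> hx hy xy.
  have := cr_atM (cr_sub_cst (u 0 0) (v 0 0) (H _ _ hx hy)) (cr_inv xy).
  have [d d0 dP] : exists2 d, 0 < d & forall s t, `|s - x| < d -> `|t - y| < d -> (s == 0) && (t == 0) = false.
    move: xy => /orP[x0|y0].
    - exists `|x|; first by rewrite normr_gt0.
      by move=> s t hs _; apply: contraTF hs => /andP[/eqP-> _]; rewrite sub0r normrN ltxx.
    - exists `|y|; first by rewrite normr_gt0.
      by move=> s t _ hs; apply: contraTF hs => /andP[_ /eqP->]; rewrite sub0r normrN ltxx.
  move=> [a' [b' [h1 h2]]]; exists a', b'; split.
  - by apply: (has_grad_local d0 _ h1) => s t hs ht; rewrite /U (dP _ _ hs ht).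
  - by apply: (has_grad_local d0 _ h2) => s t hs ht; rewrite /V (dP _ _ hs ht).
have key e x y (p q : R) : `|p| <= e * (`|x| + `|y|) -> `|q| <= e * (`|x| + `|y|) -> 0 < e ->
   (x != 0) || (y != 0) -> `|(p * x + q * y) / (x ^+ 2 + y ^+ 2)| <= 2 * e.
  move=> hp hq e0 /sqr2_gt0 n0; rewrite normrM normfV (gtr0_norm n0) ler_pdivrMr//.
  apply: le_trans (ler_normD _ _) _; rewrite !normrM.
  apply: (@le_trans _ _ (e * (`|x| + `|y|) * `|x| + e * (`|x| + `|y|) * `|y|)).
    by rewrite lerD// ler_wpM2r.
  rewrite -mulrDr -mulrA -expr2 [2 * e]mulrC -mulrA ler_pM2l//.
  exact: norm_sqr2.
have cU : cont2 U 0 0 /\ cont2 V 0 0.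
  split=> e e0; have e4 : 0 < e / 4 by rewrite divr_gt0.
  - have [d1 d10 h1] := hu _ e4; have [d2 d20 h2] := hv _ e4.
    exists (Num.min d1 d2); first by rewrite lt_min d10.
    move=> x y; rewrite !lt_min => /andP[x1 x2] /andP[y1 y2].
    rewrite {2}/U !eqxx /= /U; case: ifPn => [_|]; first by rewrite subrr normr0.
    rewrite negb_and => xy; have n0 := sqr2_gt0 xy.
    rewrite (_ : _ - _ = ((du x y - a * x - (- b) * y) * x + (dv x y - b * x - a * y) * y) / (x ^+ 2 + y ^+ 2)).
      apply: (@le_lt_trans _ _ (2 * (e / 4))); last first.
        rewrite (_ : 2 * (e / 4) = e / 2); last by field.
        by rewrite ltr_pdivrMr// ltr_pMr// ltr1n.
      by apply: key => //; [have := h1 _ _ x1 y1|have := h2 _ _ x2 y2]; rewrite !subr0.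
    by rewrite /U0 /ix /iy; field; rewrite gt_eqF.
  - have [d1 d10 h1] := hu _ e4; have [d2 d20 h2] := hv _ e4.
    exists (Num.min d1 d2); first by rewrite lt_min d10.
    move=> x y; rewrite !lt_min => /andP[x1 x2] /andP[y1 y2].
    rewrite {2}/V !eqxx /= /V; case: ifPn => [_|]; first by rewrite subrr normr0.
    rewrite negb_and => xy; have n0 := sqr2_gt0 xy.
    rewrite (_ : _ - _ = ((dv x y - b * x - a * y) * x + (- (du x y - a * x - (- b) * y)) * y) / (x ^+ 2 + y ^+ 2)).
      apply: (@le_lt_trans _ _ (2 * (e / 4))); last first.
        rewrite (_ : 2 * (e / 4) = e / 2); last by field.
        by rewrite ltr_pdivrMr// ltr_pMr// ltr1n.
      by apply: key => //; rewrite ?normrN; [have := h2 _ _ x2 y2|have := h1 _ _ x1 y1]; rewrite !subr0.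
    by rewrite /V0 /ix /iy; field; rewrite gt_eqF.
have [cU1 cV1] := cU.
have := square_mean r0 crUV cU1 cV1.
have -> : abs2 U V 0 0 = `|a| + `|b| by rewrite /abs2 /U /V !eqxx.
set rhs := (X in _ <= X) => h.
suff hr : rhs <= 32 * M / rho.
  have := le_trans h hr; rewrite (_ : 32 * M / rho = 2 * (16 * M / rho)) ?ler_pM2l//.
  by field; rewrite gt_eqF.
have M0 : 0 <= M by apply: le_trans (HM 0 0 _ _); rewrite ?normr0 ?(ltW r0)// addr_ge0.
(* On the boundary [abs2] of f(z) - f(0) is at most [2 * M], each part of 1 / z is at most [rho^-1],
   and the product costs a factor 2. Four sides of parameter length 2 then give [32 * M / rho],
   twice the bound sought. *)
have bd x y : `|x| <= rho -> `|y| <= rho -> (`|x| == rho) || (`|y| == rho) -> abs2 U V x y <= 4 * M / rho.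
  move=> hx hy xy.
  have xy0 : (x != 0) || (y != 0).
    by rewrite -negb_and; apply: contraTN xy => /andP[/eqP-> /eqP->]; rewrite normr0 lt_eqF.
  have n0 := sqr2_gt0 xy0.
  have nr : rho ^+ 2 <= x ^+ 2 + y ^+ 2.
    rewrite -(real_normK (num_real x)) -(real_normK (num_real y)).
    by case/orP : xy => /eqP ->; rewrite ?lerDl ?lerDr sqr_ge0.
  have ibd (w : R) : `|w| <= rho -> `|w / (x ^+ 2 + y ^+ 2)| <= rho^-1.
    move=> hw; rewrite normrM normfV (gtr0_norm n0) ler_pdivrMr// ler_pdivlMl//.
    by apply: le_trans nr; rewrite expr2 ler_wpM2l// ltW.
  have b1 : `|ix x y| <= rho^-1 by exact: ibd.
  have b2 : `|iy x y| <= rho^-1 by apply: ibd; rewrite normrN.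
  have s1 : `|du x y| + `|dv x y| <= 2 * M.
    have := lerD (HM _ _ hx hy) (HM 0 0 _ _); rewrite normr0 (ltW r0) => /(_ isT isT).
    rewrite mulr2n mulrDl mul1r; apply: le_trans; rewrite /abs2 addrACA.
    by apply: lerD; exact: ler_normB.
  rewrite /abs2 /U /V; rewrite -negb_and in xy0; rewrite (negbTE xy0) /U0 /V0.
  apply: (@le_trans _ _ (2 * ((`|du x y| + `|dv x y|) * rho^-1))); last first.
    rewrite (_ : 4 * M / rho = 2 * ((2 * M) / rho)); last by field; rewrite gt_eqF.
    by rewrite ler_pM2l// ler_wpM2r// invr_ge0 ltW.
  have g (p q z w : R) : `|z| <= rho^-1 -> `|w| <= rho^-1 -> `|p * z + q * w| <= (`|p| + `|q|) * rho^-1.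
    move=> hz hw; apply: le_trans (ler_normD _ _) _; rewrite !normrM mulrDl.
    by rewrite lerD// ler_wpM2l.
  rewrite [leRHS]mulr_natl mulr2n; apply: lerD.
  - by have := g (du x y) (- dv x y) _ _ b1 b2; rewrite mulNr normrN.
  - exact: g.
have H1 := cr_box_qturn crUV; have H2 := cr_box_qturn H1; have H3 := cr_box_qturn H2.
have ib (w z : R -> R -> R) :
    (forall x y, `|x| <= rho -> `|y| <= rho -> (x != 0) || (y != 0) -> cr_at w z x y) ->
    (forall t, -1 <= t <= 1 -> abs2 w z rho (rho * t) <= 4 * M / rho) ->
    itg (-1) 1 (fun t => abs2 w z rho (rho * t)) <= 8 * M / rho.
  move=> hc hb.
  have h' t : -1 <= t <= 1 -> cr_at w z rho (rho * t).
    move=> ht; apply: hc; [by rewrite (gtr0_norm r0)| |by rewrite gt_eqF].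
    by rewrite normrM (gtr0_norm r0) ler_piMr ?(ltW r0)// ler_norml.
  have [cu' cv'] := cont_on_ray r0 h'.
  have cn f : cont_on (-1) 1 f -> cont_on (-1) 1 (fun t => `|f t|).
    by move=> cf x hx; apply: cvg_norm; exact: cf.
  rewrite (_ : 8 * M / rho = itg (-1) 1 (fun=> 4 * M / rho)).
    by apply: itg_le => //; [apply: cont_on_D; exact: cn|exact: cont_on_cst].
  by rewrite itg_cst ?leN11//; field; rewrite gt_eqF.
have bt t : -1 <= t <= 1 -> `|rho * t| <= rho.
  by move=> ht; rewrite normrM (gtr0_norm r0) ler_piMr ?(ltW r0)// ler_norml.
rewrite (_ : 32 * M / rho = 8 * M / rho + 8 * M / rho + 8 * M / rho + 8 * M / rho); last by field; rewrite gt_eqF.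
rewrite /rhs; apply: lerD; last first.
  by apply: (ib _ _ H3) => t ht; apply: (bd (- - (rho * t)) (- rho)); rewrite ?normrN ?opprK ?bt ?(gtr0_norm r0)// ?eqxx ?orbT.
apply: lerD; last first.
  by apply: (ib _ _ H2) => t ht; apply: (bd (- rho) (- (rho * t))); rewrite ?normrN ?opprK ?bt ?(gtr0_norm r0)// ?eqxx ?orbT.
apply: lerD; last first.
  by apply: (ib _ _ H1) => t ht; apply: (bd (- (rho * t)) rho); rewrite ?normrN ?opprK ?bt ?(gtr0_norm r0)// ?eqxx ?orbT.
by apply: (ib _ _ crUV) => t ht; apply: bd; rewrite ?normrN ?opprK ?bt ?(gtr0_norm r0)// ?eqxx ?orbT.
Qed.

End cauchy_estimate.

(** * Holomorphic functions and their locally uniform limits *)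

Section complex_norm.
Variable R : realType.
Local Open Scope complex_scope.
Implicit Types (c : R[i]) (m : R).

(* An equivalent norm, used instead of `|c| to avoid square roots. *)
Definition abs1 c : R := `|complex.Re c| + `|complex.Im c|.

Lemma abs1_ge0 c : 0 <= abs1 c. Proof. exact: addr_ge0. Qed.

Lemma abs1D c d : abs1 (c + d) <= abs1 c + abs1 d.
Proof. by case: c d => [a b] [a' b'] /=; rewrite /abs1 /= addrACA lerD// ler_normD. Qed.

Lemma abs1N c : abs1 (- c) = abs1 c.
Proof. by case: c => [a b]; rewrite /abs1 /= !normrN. Qed.

Lemma abs1M c d : abs1 (c * d) <= abs1 c * abs1 d.
Proof.
case: c d => [a b] [a' b'] /=; rewrite /abs1 /=.
have -> : (`|a| + `|b|) * (`|a'| + `|b'|) = (`|a * a'| + `|b * b'|) + (`|a * b'| + `|b * a'|).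
  by rewrite !normrM; ring.
by rewrite lerD// ?ler_normB// addrC (mulrC b) addrC ler_normD.
Qed.

Lemma normc_le_abs1 c : `|c| <= (abs1 c)%:C.
Proof.
rewrite normc_def lecR -[leRHS](ger0_norm (abs1_ge0 c)) -sqrtr_sqr ler_wsqrtr//.
rewrite /abs1 sqrrD !real_normK ?num_real// addrAC lerDl mulrn_wge0// mulr_ge0//.
Qed.

Lemma abs1_le_normc c : abs1 c <= 2 * complex.Re `|c|.
Proof.
rewrite normc_def /= mulr2n mulrDl mul1r; apply: lerD.
  by rewrite -sqrtr_sqr ler_wsqrtr// lerDl sqr_ge0.
by rewrite -sqrtr_sqr ler_wsqrtr// lerDr sqr_ge0.
Qed.

Lemma Re_norm_le_abs1 c : complex.Re `|c| <= abs1 c.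
Proof. by have := normc_le_abs1 c; rewrite lecE /= => /andP[]. Qed.

Lemma Re_norm_ge0 c : 0 <= complex.Re `|c|.
Proof. by have := normr_ge0 c; rewrite lecE /= => /andP[]. Qed.

Lemma normcRe c : `|c| = (complex.Re `|c|)%:C.
Proof. by rewrite normc_def. Qed.

Lemma normc_lt_abs1 c m : abs1 c < m -> `|c| < m%:C.
Proof. by move=> h; apply: le_lt_trans (normc_le_abs1 c) _; rewrite ltcR. Qed.

Lemma abs1_lt_normc c m : `|c| < (m / 2)%:C -> abs1 c < m.
Proof.
rewrite normcRe ltcR => h; apply: le_lt_trans (abs1_le_normc c) _.
by rewrite mulrC -ltr_pdivlMr.
Qed.

Lemma posc e : 0 < e :> R[i] -> e = (complex.Re e)%:C /\ 0 < complex.Re e.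
Proof. by case: e => a b; rewrite ltcE /= => /andP[/eqP -> ->]. Qed.

Lemma rv_norm_le n (h : 'rV[R[i]^o]_n) m : 0 <= m ->
  (forall j, abs1 (h 0 j) <= m) -> `|h| <= m%:C.
Proof.
move=> m0 H; have mc0 : 0 <= m%:C by rewrite ler0c.
rewrite [leLHS]/Num.norm /= mx_normE -[m%:C]/((NngNum mc0)%:num) num_le.
apply/bigmax_leP; split; first by rewrite -num_le.
move=> [i j] _; rewrite -num_le /= ord1; apply: le_trans (normc_le_abs1 _) _.
by rewrite lecR.
Qed.

Lemma rv_normRe n (h : 'rV[R[i]^o]_n) : `|h| = (complex.Re `|h|)%:C.
Proof. by have := normr_ge0 h; rewrite lecE /= => /andP[/eqP]; case: `|h| => a b /= ->. Qed.

Lemma rv_coord_le n (h : 'rV[R[i]^o]_n) j : complex.Re `|h 0 j| <= complex.Re `|h|.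
Proof.
apply/ler_addgt0Pr => e e0.
have : ball (0 : 'rV[R[i]^o]_n) (complex.Re `|h| + e)%:C h.
  by rewrite mx_norm_ball /ball_ /= sub0r normrN {1}rv_normRe ltcR ltrDl.
move=> [_ /(_ 0 j)]; rewrite mxE -ball_normE /= sub0r normrN normcRe ltcR.
exact: ltW.
Qed.

Lemma Re_remainder (a b l : R[i]) (p q : R) : complex.Re (a - b - (p +i* q) * l) =
  complex.Re a - complex.Re b - complex.Re l * p - - complex.Im l * q.
Proof. by case: a b l => [a1 a2] [b1 b2] [l1 l2] /=; ring. Qed.

Lemma Im_remainder (a b l : R[i]) (p q : R) : complex.Im (a - b - (p +i* q) * l) =
  complex.Im a - complex.Im b - complex.Im l * p - complex.Re l * q.
Proof. by case: a b l => [a1 a2] [b1 b2] [l1 l2] /=; ring. Qed.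

End complex_norm.

Section holomorphic_eps.
Variables (R : realType) (n : nat).
Local Open Scope complex_scope.
Implicit Types (f : 'rV[R[i]^o]_n -> R[i]^o) (z h w : 'rV[R[i]^o]_n).

(** Complex Frechet differentiability with real error bounds: norms take values in [R[i]], so the
    size of [h] enters through a real majorant [m] of its coordinates. *)
Definition has_cdiff f z (L : 'rV[R[i]^o]_n -> R[i]^o) := forall eps : R, 0 < eps ->
  exists2 del : R, 0 < del & forall h m, 0 <= m -> m < del ->
    (forall j, abs1 (h 0 j) <= m) -> abs1 (f (h + z) - f z - L h) <= eps * m.

Lemma differentiable_has_cdiff f z : differentiable f z -> has_cdiff f z ('d f z).
Proof.
move=> /diff_locally /eqaddoP H e e0.
have e20 : 0 < (e / 2)%:C by rewrite ltcR divr_gt0.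
have := H _ e20 => /nbhs_ballP [d /= /posc[-> d0] hd].
exists (complex.Re d) => // h m m0 md hm.
have hn := rv_norm_le m0 hm.
have := hd h; rewrite mx_norm_ball /ball_ /= sub0r normrN => /(_ (le_lt_trans hn _)).
rewrite ltcR => /(_ md); rewrite !fctE /= => hh.
apply: (le_trans (abs1_le_normc _)); rewrite opprD addrA in hh.
have := le_trans hh (ler_wpM2l (ltW e20) hn); rewrite normcRe -rmorphM lecR.
by rewrite -ler_pdivlMl// => /le_trans; apply; rewrite le_eqVlt; apply/orP; left; apply/eqP; field.
Qed.

Lemma abs1_sum (I : Type) (s : seq I) (F : I -> R[i]) : abs1 (\sum_(j <- s) F j) <= \sum_(j <- s) abs1 (F j).
Proof.
elim/big_ind2 : _ => [|x x' y y' hx hy|//].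
  by rewrite /abs1 /= normr0 addr0.
exact: le_trans (abs1D _ _) (lerD hx hy).
Qed.

Lemma rv_ball_abs1 h m : `|h| < (m / 2)%:C -> forall j, abs1 (h 0 j) < m.
Proof.
move=> hh j; apply: abs1_lt_normc; apply: le_lt_trans hh.
by rewrite normcRe rv_normRe lecR rv_coord_le.
Qed.

Lemma linear_abs1_bound (L : {linear 'rV[R[i]^o]_n -> R[i]^o}) : exists2 C, 0 < C &
  forall h m, 0 <= m -> (forall j, abs1 (h 0 j) <= m) -> abs1 (L h) <= m * C.
Proof.
pose C := 1 + \sum_(j < n) abs1 (L (delta_mx 0 j)).
have C0 : 0 < C by rewrite ltr_pwDl// sumr_ge0// => j _; exact: abs1_ge0.
exists C => // h m m0 hm; rewrite {1}(row_sum_delta h) raddf_sum /C mulrDr mulr1 ler_wpDl//.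
apply: le_trans (abs1_sum _ _) _; rewrite mulr_sumr; apply: ler_sum => j _.
have E : L (h 0 j *: delta_mx 0 j) = h 0 j * L (delta_mx 0 j) by exact: linearZ_LR.
apply: (@le_trans _ _ (abs1 (h 0 j * L (delta_mx 0 j)))); first by rewrite -E.
by apply: le_trans (abs1M _ _) _; rewrite ler_wpM2r// abs1_ge0.
Qed.

Lemma linear_continuous_rv (L : {linear 'rV[R[i]^o]_n -> R[i]^o}) : continuous L.
Proof.
have [C C0 LC] := linear_abs1_bound L.
move=> h A /nbhs_ballP[e /= /posc[eE e0] eA].
apply/nbhs_ballP; exists (complex.Re e / (2 * C) / 2)%:C => /=.
  by rewrite ltcR !divr_gt0// mulr_gt0.
move=> k; rewrite mx_norm_ball /ball_ /= => /rv_ball_abs1 hk.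
apply: eA; rewrite -ball_normE /ball_ /= -linearB eE; apply: normc_lt_abs1.
apply: (@le_lt_trans _ _ (complex.Re e / (2 * C) * C)).
  by apply: LC => [|j]; [rewrite divr_ge0// ltW// mulr_gt0|rewrite ltW].
rewrite (_ : complex.Re e / (2 * C) * C = complex.Re e / 2); last by field; rewrite gt_eqF.
by rewrite ltr_pdivrMr// ltr_pMr// ltr1n.
Qed.

Lemma has_cdiff_differentiable f z (L : {linear 'rV[R[i]^o]_n -> R[i]^o}) :
  has_cdiff f z L -> differentiable f z.
Proof.
move=> H; have cL := @linear_continuous_rv L.
have HL : f \o shift z = cst (f z) + L +o_ (0 : 'rV[R[i]^o]_n) id.
  apply/eqaddoP => e /posc[-> e0].
  have [d d0 hd] := H _ (divr_gt0 e0 (ltr0n R 2)).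
  apply/nbhs_ballP; exists (d / 2)%:C => /=; first by rewrite ltcR divr_gt0.
  move=> h; rewrite mx_norm_ball /ball_ /= sub0r normrN => hh.
  pose m := 2 * complex.Re `|h|.
  have hE := rv_normRe h.
  have m0 : 0 <= m.
    by rewrite mulr_ge0//; have := normr_ge0 h; rewrite lecE => /andP[].
  have md : m < d by rewrite /m mulrC -ltr_pdivlMr// -ltcR -hE.
  have hm j : abs1 (h 0 j) <= m.
    apply: le_trans (abs1_le_normc _) _; rewrite ler_pM2l//.
    exact: rv_coord_le.
  have := hd h m m0 md hm; rewrite !fctE /= opprD addrA => hb.
  apply: le_trans (normc_le_abs1 _) _; rewrite hE -rmorphM lecR.
  by apply: (le_trans hb); rewrite /m le_eqVlt; apply/orP; left; apply/eqP; field.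
have E := diff_unique cL HL.
by apply/diff_locallyP; rewrite E.
Qed.

Lemma has_cdiff_line f z w (L : {linear 'rV[R[i]^o]_n -> R[i]^o}) (x y : R) :
  has_cdiff f (z + (x +i* y) *: w) L ->
  has_grad (fun x y => complex.Re (f (z + (x +i* y) *: w))) x y
    (complex.Re (L w)) (- complex.Im (L w)) /\
  has_grad (fun x y => complex.Im (f (z + (x +i* y) *: w))) x y
    (complex.Im (L w)) (complex.Re (L w)).
Proof.
move=> H.
pose W := 1 + \sum_j abs1 (w 0 j).
have W0 : 0 < W by rewrite ltr_pwDl// sumr_ge0// => j _; exact: abs1_ge0.
have wW j : abs1 (w 0 j) <= W.
  rewrite /W (bigD1 j)//= addrCA lerDl addr_ge0// sumr_ge0// => k _; exact: abs1_ge0.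
have key eps : 0 < eps -> exists2 del, 0 < del & forall s t, `|s - x| < del -> `|t - y| < del ->
  abs1 (f (z + (s +i* t) *: w) - f (z + (x +i* y) *: w) - ((s - x) +i* (t - y)) * L w)
  <= eps * (`|s - x| + `|t - y|).
  move=> e0; have [d d0 hd] := H _ (divr_gt0 e0 W0).
  exists (d / (2 * W)); first by rewrite divr_gt0// mulr_gt0.
  move=> s t hs ht.
  pose h := ((s - x) +i* (t - y)) *: w; pose m := (`|s - x| + `|t - y|) * W.
  have hm j : abs1 (h 0 j) <= m.
    rewrite /h !mxE; apply: le_trans (abs1M _ _) _.
    by apply: ler_pM; rewrite ?abs1_ge0.
  have := hd h m (mulr_ge0 (addr_ge0 (normr_ge0 _) (normr_ge0 _)) (ltW W0)) _ hm.
  have -> : h + (z + (x +i* y) *: w) = z + (s +i* t) *: w.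
    rewrite addrCA -scalerDl; congr (_ + _ *: _).
    by apply/eqP; rewrite eq_complex /= !subrK !eqxx.
  have -> : L h = ((s - x) +i* (t - y)) * L w by exact: linearZ_LR.
  have -> : eps / W * m = eps * (`|s - x| + `|t - y|) by rewrite /m; field; rewrite gt_eqF.
  apply; rewrite /m -ltr_pdivlMr//.
  have -> : d / W = d / (2 * W) + d / (2 * W) by field; rewrite gt_eqF.
  exact: ltrD.
split=> e e0; have [d d0 hd] := key e e0; exists d => // s t hs ht.
- apply: le_trans (hd _ _ hs ht); rewrite /abs1.
  set c := (X in `|complex.Re X|); have -> : complex.Re c =
    complex.Re (f (z + (s +i* t) *: w)) - complex.Re (f (z + (x +i* y) *: w)) -
      complex.Re (L w) * (s - x) - - complex.Im (L w) * (t - y).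
    exact: Re_remainder.
  by rewrite lerDl.
- apply: le_trans (hd _ _ hs ht); rewrite /abs1.
  set c := (X in _ + `|complex.Im X|); have -> : complex.Im c =
    complex.Im (f (z + (s +i* t) *: w)) - complex.Im (f (z + (x +i* y) *: w)) -
      complex.Im (L w) * (s - x) - complex.Re (L w) * (t - y).
    exact: Im_remainder.
  by rewrite lerDr.
Qed.

End holomorphic_eps.

(** * Cauchy estimates in several variables and locally uniform limits *)

Section locally_uniform_limit.
Variables (R : realType) (n : nat).
Local Open Scope complex_scope.
Implicit Types (f g : 'rV[R[i]^o]_n -> R[i]^o) (z h w : 'rV[R[i]^o]_n).

Definition cbox z (rho : R) : set 'rV[R[i]^o]_n :=
  [set w | forall j, abs1 (w 0 j - z 0 j) <= rho].

Lemma cbox_center z rho : 0 <= rho -> cbox z rho z.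
Proof. by move=> r0 j; rewrite subrr /abs1 /= normr0 addr0. Qed.

Lemma real_cauchy_limit (u : nat -> R) :
  (forall e, 0 < e -> exists N, forall k l, (N <= k)%N -> (N <= l)%N -> `|u k - u l| <= e) ->
  exists l, forall e, 0 < e -> exists N, forall k, (N <= k)%N -> `|u k - l| <= e.
Proof.
move=> H; have : cvg (u @ \oo).
  apply/cauchy_cvgP/cauchy_exP => e e0.
  have [N HN] := H _ (divr_gt0 e0 (ltr0n R 2)).
  exists (u N); exists N => // k Nk; rewrite /= -ball_normE /=.
  apply: le_lt_trans (HN _ _ (leqnn N) Nk) _.
  by rewrite ltr_pdivrMr// ltr_pMr// ltr1n.
move=> /cvg_ex[l /cvgrPdist_le ul]; exists l => e e0.
have [N _ HN] := ul _ e0; exists N => k Nk; rewrite distrC; exact: HN.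
Qed.

Lemma eq_le_abs1 (a b : R[i]) : a = b -> abs1 a <= abs1 b.
Proof. by move=> ->. Qed.

(** Used in [holomorphic_limit]: the remainder of the limit (letter f) is compared, through a late
    member of the sequence (letter l), with that of a fixed member (letter n). *)
Lemma abs1_six_terms (f1 f0 r l1 l0 n1 n0 Ll Ln : R[i]) (e1 e2 e3 e4 e5 e6 : R) :
  abs1 (l1 - f1) <= e1 -> abs1 (l0 - f0) <= e2 -> abs1 (Ll - r) <= e3 ->
  abs1 ((l1 - n1) - (l0 - n0)) <= e4 -> abs1 (n1 - n0 - Ln) <= e5 ->
  abs1 (Ll - Ln) <= e6 -> abs1 (f1 - f0 - r) <= e1 + e2 + e3 + e4 + e5 + e6.
Proof.
move=> b1 b2 b3 b4 b5 b6.
rewrite (_ : f1 - f0 - r = - (l1 - f1) + (l0 - f0) + (Ll - r) +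
  ((l1 - n1) - (l0 - n0)) + (n1 - n0 - Ln) + - (Ll - Ln)); last by ring.
apply: le_trans (abs1D _ _) _; apply: lerD; last by rewrite abs1N.
do 4 (apply: le_trans (abs1D _ _) _; apply: lerD => //).
by rewrite abs1N.
Qed.

Lemma complex_cauchy_limit (u : nat -> R[i]) :
  (forall e, 0 < e -> exists N, forall k l, (N <= k)%N -> (N <= l)%N -> abs1 (u k - u l) <= e) ->
  exists l, forall e, 0 < e -> exists N, forall k, (N <= k)%N -> abs1 (u k - l) <= e.
Proof.
move=> H.
have [a Ha] : exists l, forall e, 0 < e -> exists N, forall k, (N <= k)%N -> `|complex.Re (u k) - l| <= e.
  apply: real_cauchy_limit => e e0; have [N HN] := H _ e0; exists N => k l hk hl.
  apply: le_trans (HN _ _ hk hl); rewrite /abs1.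
  by case: (u k) (u l) => [? ?] [? ?] /=; rewrite lerDl.
have [b Hb] : exists l, forall e, 0 < e -> exists N, forall k, (N <= k)%N -> `|complex.Im (u k) - l| <= e.
  apply: real_cauchy_limit => e e0; have [N HN] := H _ e0; exists N => k l hk hl.
  apply: le_trans (HN _ _ hk hl); rewrite /abs1.
  by case: (u k) (u l) => [? ?] [? ?] /=; rewrite lerDr.
exists (a +i* b) => e e0; have e20 : 0 < e / 2 by rewrite divr_gt0.
have [N HN] := Ha _ e20; have [M HM] := Hb _ e20.
exists (maxn N M) => k; rewrite geq_max => /andP[/HN h1 /HM h2].
have := lerD h1 h2; rewrite -splitr; apply: le_trans; rewrite /abs1.
by case: (u k) => ? ?.
Qed.

Lemma cdiff_bound f z rho M h m (L : {linear 'rV[R[i]^o]_n -> R[i]^o}) : 0 < rho -> 0 < m ->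
  (forall w, cbox z rho w -> differentiable f w) ->
  (forall w, cbox z rho w -> abs1 (f w) <= M) ->
  (forall j, abs1 (h 0 j) <= m) -> has_cdiff f z L -> abs1 (L h) <= 32 * M * m / rho.
Proof.
move=> r0 m0 df fM hm fL.
(* If x and y are at most [r] in absolute value, [(x +i* y) *: h] has coordinates of size at most
   [2 * r * m], which is [rho]; this turns the constant 16 into 32. *)
pose r := rho / (2 * m); have rr0 : 0 < r by rewrite divr_gt0// mulr_gt0.
have inb x y : `|x| <= r -> `|y| <= r -> cbox z rho (z + (x +i* y) *: h).
  move=> hx hy j; rewrite !mxE addrAC subrr add0r; apply: le_trans (abs1M _ _) _.
  apply: (@le_trans _ _ ((r + r) * m)); first by rewrite ler_pM ?abs1_ge0// lerD.
  by rewrite le_eqVlt; apply/orP; left; apply/eqP; rewrite /r; field; rewrite gt_eqF.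
have zE : z + (0 +i* 0) *: h = z by rewrite (_ : 0 +i* 0 = 0)// scale0r addr0.
have := @has_cdiff_line R n f z h L 0 0; rewrite zE => /(_ fL)[h1 h2].
have := @cauchy_estimate R (fun x y => complex.Re (f (z + (x +i* y) *: h)))
  (fun x y => complex.Im (f (z + (x +i* y) *: h))) _ _ r M rr0 _ _ h1 h2.
have -> : 16 * M / r = 32 * M * m / rho by rewrite /r; field; rewrite !gt_eqF.
apply=> [x y hx hy|x y hx hy]; last exact/fM/inb.
have [h3 h4] := has_cdiff_line (differentiable_has_cdiff (df _ (inb _ _ hx hy))).
by eexists; eexists; split; [exact: h3|exact: h4].
Qed.

Lemma grad_lipschitz (F : R -> R -> R) K :
  (forall x, 0 <= x <= 1 -> exists a b, has_grad F x 0 a b /\ `|a| <= K) ->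
  `|F 1 0 - F 0 0| <= K.
Proof.
move=> H.
have /choice[df dfP] : forall x, exists a, 0 <= x <= 1 -> exists b, has_grad F x 0 a b /\ `|a| <= K.
  move=> x; have [hx|hx] := boolP (0 <= x <= 1); last by exists 0.
  by have [a [b hab]] := H _ hx; exists a => _; exists b.
have cF x : 0 <= x <= 1 -> {for x, continuous (F ^~ 0)}.
  by move=> /dfP[b [h _]]; exact: has_grad_cont1 h.
have [||c] := @MVT R (F ^~ 0) df 0 1 ltr01.
- move=> x; rewrite in_itv /= => /andP[x0 x1].
  have [|b [h _]] := dfP x; first by rewrite !ltW.
  have lim : (t^-1 *: (F (t *: (1 : R) + x) 0 - F x 0)) @[t --> (0 : R)^'] --> df x.
    apply/cvgrPdist_le => e e0; have [d d0 hd] := h e e0; near=> t.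
    have t0 : t != 0 by near: t; exact: nbhs_dnbhs_neq.
    have td : `|t| < d by near: t; exact: dnbhs0_lt.
    rewrite [t *: 1]mulr1 distrC.
    have := hd (t + x) 0; rewrite addrK subrr normr0 mulr0 subr0 addr0 => /(_ td d0) hh.
    rewrite (_ : _ - df x = t^-1 * (F (t + x) 0 - F x 0 - df x * t)).
      by rewrite normrM normfV mulrC ler_pdivrMr// normr_gt0.
    by rewrite [RHS]mulrBr [X in _ = _ - X]mulrCA mulVf// mulr1.
  by apply: DeriveDef; [exact: cvgP lim|exact: cvg_lim lim].
- by apply: continuous_in_subspaceT => x /set_mem; rewrite /= in_itv /=; exact: cF.
rewrite in_itv /= subr0 mulr1 => /andP[c0 c1] ->.
by have [|b []] := dfP c; first by rewrite !ltW.
Unshelve. all: by end_near. Qed.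

(** Mean value theorem for the real and the imaginary part along the segment from [z] to [h + z]. As
    [m <= rho / 2], the box of radius [rho / 2] about each of its points lies in the given one;
    halving the radius and adding the two parts turn 32 into 128. *)
Lemma cdiff_lipschitz f z rho M h m : 0 < rho -> 0 < m -> m <= rho / 2 ->
  (forall w, cbox z rho w -> differentiable f w) ->
  (forall w, cbox z rho w -> abs1 (f w) <= M) ->
  (forall j, abs1 (h 0 j) <= m) -> abs1 (f (h + z) - f z) <= 128 * M * m / rho.
Proof.
move=> r0 m0 mr df fM hm.
have r20 : 0 < rho / 2 by rewrite divr_gt0.
pose u x y := complex.Re (f (z + (x +i* y) *: h)).
pose v x y := complex.Im (f (z + (x +i* y) *: h)).
have G x : 0 <= x <= 1 -> exists a b, [/\ has_grad u x 0 a (- b), has_grad v x 0 b a & `|a| + `|b| <= 64 * M * m / rho].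
  move=> /andP[x0 x1]; pose w := z + (x +i* 0) *: h.
  have hw j : abs1 (w 0 j - z 0 j) <= rho / 2.
    rewrite !mxE addrAC subrr add0r; apply: le_trans (abs1M _ _) _.
    rewrite /abs1 /= normr0 addr0 (ger0_norm x0) -[leRHS]mul1r.
    by apply: ler_pM => //; exact: le_trans (hm j) mr.
  have sub w' : cbox w (rho / 2) w' -> cbox z rho w'.
    move=> hw' j; rewrite (_ : w' 0 j - z 0 j = (w' 0 j - w 0 j) + (w 0 j - z 0 j)); last by rewrite addrA subrK.
    by apply: le_trans (abs1D _ _) _; rewrite [rho]splitr; apply: lerD.
  have dw := differentiable_has_cdiff (df _ (sub _ (cbox_center w (ltW r20)))).
  have [h1 h2] := has_cdiff_line dw.
  eexists; eexists; split; [exact: h1|exact: h2|].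
  have := cdiff_bound r20 m0 (fun w' hw' => df _ (sub _ hw')) (fun w' hw' => fM _ (sub _ hw')) hm dw.
  by rewrite (_ : 64 * M * m / rho = 32 * M * m / (rho / 2))//; field; rewrite gt_eqF.
have hu : `|u 1 0 - u 0 0| <= 64 * M * m / rho.
  apply: grad_lipschitz => x /G[a [b [hu _ ab]]]; exists a, (- b); split => //.
  by apply: le_trans ab; rewrite lerDl.
have hv : `|v 1 0 - v 0 0| <= 64 * M * m / rho.
  apply: grad_lipschitz => x /G[a [b [_ hv ab]]]; exists b, a; split => //.
  by apply: le_trans ab; rewrite lerDr.
have := lerD hu hv; rewrite (_ : 64 * M * m / rho + _ = 128 * M * m / rho); last by ring.
rewrite /u /v (_ : z + (0 +i* 0) *: h = z); last by rewrite (_ : 0 +i* 0 = 0)// scale0r addr0.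
rewrite (_ : z + (1 +i* 0) *: h = h + z); last by rewrite (_ : 1 +i* 0 = 1)// scale1r addrC.
apply: le_trans; rewrite /abs1.
by case: (f (h + z)) (f z) => [? ?] [? ?].
Qed.

Definition row_form (c : 'I_n -> R[i]) (h : 'rV[R[i]^o]_n) : R[i]^o := \sum_j h 0 j * c j.

Lemma row_form_linear c : linear (row_form c).
Proof.
move=> a x y; rewrite /row_form scaler_sumr -big_split /=; apply: eq_bigr => j _.
by rewrite !mxE mulrDl -[a *: (_ * _)]/(a * _) mulrA.
Qed.

HB.instance Definition _ c := GRing.isLinear.Build R[i] 'rV[R[i]^o]_n R[i]^o _ (row_form c) (row_form_linear c).

Lemma linear_row_form (L : {linear 'rV[R[i]^o]_n -> R[i]^o}) h :
  L h = row_form (fun j => L (delta_mx 0 j)) h.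
Proof.
rewrite {1}(row_sum_delta h) raddf_sum; apply: eq_bigr => j _; exact: linearZ_LR.
Qed.

(** The differentials at [z] converge by the Cauchy estimate applied to [F k - F l], and the same
    estimate makes these differences Lipschitz near [z] with small constants. Hence the remainder of
    [f] is that of one fixed [F N] up to a small multiple of [m]. *)
Lemma holomorphic_limit (F : nat -> 'rV[R[i]^o]_n -> R[i]^o) f z rho : 0 < rho ->
  (forall k w, cbox z rho w -> differentiable (F k) w) ->
  (forall e, 0 < e -> exists N, forall k w, (N <= k)%N -> cbox z rho w ->
     abs1 (F k w - f w) <= e) ->
  differentiable f z.
Proof.
move=> r0 dF Ff.
have FF e : 0 < e -> exists N, forall k l w, (N <= k)%N -> (N <= l)%N -> cbox z rho w ->
     abs1 ((F k \- F l) w) <= e.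
  move=> e0; have [N HN] := Ff _ (divr_gt0 e0 (ltr0n R 2)).
  exists N => k l w kN lN hw; have := lerD (HN _ _ kN hw) (HN _ _ lN hw).
  rewrite -splitr; apply: le_trans.
  rewrite -[X in _ + X]abs1N; apply: le_trans (abs1D _ _).
  by rewrite (_ : F k w - f w - (F l w - f w) = (F k \- F l) w)//= opprB addrA subrK.
have dFB k l w : cbox z rho w -> differentiable (F k \- F l) w.
  by move=> hw; apply: differentiableB; exact: dF.
pose L k := 'd (F k) z.
have zin : cbox z rho z by apply: cbox_center; exact: ltW.
have LB k l h m e : 0 < m -> (forall j, abs1 (h 0 j) <= m) ->
    (forall w, cbox z rho w -> abs1 ((F k \- F l) w) <= e) ->
    abs1 (L k h - L l h) <= 32 * e * m / rho.
  move=> m0 hm he.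
  have D := differentiable_has_cdiff (dFB k l z zin).
  have := cdiff_bound r0 m0 (dFB k l) he hm D.
  have E : 'd (F k \- F l) z = L k \- L l :> (_ -> _) := diffB (dF k z zin) (dF l z zin).
  have Eh : 'd (F k \- F l) z h = L k h - L l h := congr1 (fun g => g h) E.
  move=> B; apply: le_trans B.
  by apply: eq_le_abs1; symmetry.
have /choice[c Hc] : forall j, exists l, forall e, 0 < e -> exists N, forall k, (N <= k)%N ->
    abs1 (L k (delta_mx 0 j) - l) <= e.
  move=> j; apply: complex_cauchy_limit => e e0.
  have [|N HN] := FF (e * rho / 32); first by rewrite divr_gt0// mulr_gt0.
  exists N => k l kN lN.
  have := LB k l (delta_mx 0 j) 1 (e * rho / 32) ltr01 _ (fun w => HN k l w kN lN).
  rewrite (_ : 32 * (e * rho / 32) * 1 / rho = e); last by field; rewrite gt_eqF.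
  apply => i; rewrite mxE /abs1 eqxx /=; case: (i == j) => /=; rewrite normr0 addr0 ?normr1 ?normr0//.
have Lc h : forall e, 0 < e -> exists N, forall k, (N <= k)%N -> abs1 (L k h - row_form c h) <= e.
  move=> e e0; pose S := 1 + \sum_j abs1 (h 0 j).
  have S0 : 0 < S by rewrite ltr_pwDl// sumr_ge0// => j _; exact: abs1_ge0.
  have /choice[N HN] : forall j, exists N, forall k, (N <= k)%N -> abs1 (L k (delta_mx 0 j) - c j) <= e / S.
    by move=> j; apply: Hc; rewrite divr_gt0.
  exists (\max_j N j)%N => k hk.
  rewrite (linear_row_form (L k)) /row_form -sumrB; apply: le_trans (abs1_sum _ _) _.
  apply: (@le_trans _ _ (\sum_j abs1 (h 0 j) * (e / S))).
    apply: ler_sum => j _; rewrite -mulrBr; apply: le_trans (abs1M _ _) _.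
    rewrite ler_wpM2l ?abs1_ge0//; apply: HN; apply: leq_trans hk; exact: leq_bigmax.
  by rewrite -mulr_suml mulrCA ler_piMr ?(ltW e0)// ler_pdivrMr// mul1r /S lerDr.
apply: (@has_cdiff_differentiable _ _ _ _ (row_form c)) => e e0.
(* With this value the Lipschitz term is [e * m / 6] and the difference of differentials
   [e * m / 24]; with [e * m / 3] from [F N] they stay below [e * m]. *)
pose eps := e * rho / (3 * 256).
have eps0 : 0 < eps by rewrite /eps !(divr_gt0, mulr_gt0).
have [N HN] := FF _ eps0.
have [d d0 hd] := differentiable_has_cdiff (dF N z zin) (divr_gt0 e0 (ltr0n R 3)).
exists (Num.min d (rho / 2)); first by rewrite lt_min d0 divr_gt0.
move=> h m m0; rewrite lt_min => /andP[md mr] hm.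
have hin : cbox z rho (h + z).
  move=> j; rewrite mxE addrK; apply: le_trans (hm j) _; apply: ltW; apply: lt_le_trans mr _.
  by rewrite ler_pdivrMr// ler_peMr ?(ltW r0)// ler1n.
have [m00|mp] := leP m 0.
  have h0 : h = 0.
    apply/rowP => j; have := hm j; rewrite mxE; have -> : m = 0 by apply/eqP; rewrite eq_le m00.
    case: (h 0 j) => a b; rewrite /abs1 /= => hab.
    have : `|a| + `|b| == 0 by rewrite eq_le hab addr_ge0.
    by rewrite paddr_eq0// !normr_eq0 => /andP[/eqP-> /eqP->].
  rewrite h0 add0r subrr linear0 subr0 /abs1 /= normr0 addr0 mulr_ge0 ?(ltW e0)//.
(* The index [l] below depends on [h] and [eta]. This is harmless: the bounds involving it are
   either uniform in [l] or at most [eta / 3]. *)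
apply/ler_addgt0Pr => eta eta0.
have eta30 : 0 < eta / 3 by rewrite divr_gt0.
have [N1 H1] := Ff _ eta30.
have [N2 H2] := Lc h _ eta30.
pose l := maxn N (maxn N1 N2).
have lN : (N <= l)%N by exact: leq_maxl.
have lN1 : (N1 <= l)%N by rewrite /l !leq_max leqnn orbT.
have lN2 : (N2 <= l)%N by rewrite /l !leq_max leqnn !orbT.
have b1 := H1 l (h + z) lN1 hin; have b2 := H1 l z lN1 zin; have b3 := H2 l lN2.
have b4 := cdiff_lipschitz r0 mp (ltW mr) (dFB l N) (fun w => HN l N w lN (leqnn N)) hm.
have b5 := hd h m m0 md hm.
have b6 := LB l N h m eps mp hm (fun w => HN l N w lN (leqnn N)).
apply: le_trans (abs1_six_terms b1 b2 b3 b4 b5 b6) _.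
have -> : 128 * eps * m / rho = e * m / 6 by rewrite /eps; field; rewrite gt_eqF.
have -> : 32 * eps * m / rho = e * m / 24 by rewrite /eps; field; rewrite gt_eqF.
have em : 0 <= e * m by rewrite mulr_ge0// ltW.
lra.
Qed.

End locally_uniform_limit.

(** * Lorentz functionals and rearrangements *)

Section lorentz_functional.
Variable R : realType.
Local Open Scope ereal_scope.
Local Notation leb := (@lebesgue_measure R).
Implicit Types (p q : \bar R) (g h : R -> \bar R) (a e t : R).

Local Notation D := (`]0%R, +oo[%classic : set (measurableTypeR R)).

(* LN p q (mrea m) is ||f||_{p,q} when m is the distribution function of f. *)
Definition LN p q g : \bar R :=
  if q is a%:E then lorentz_integral p a g `^ (a^-1) else lorentz_sup p g.

Lemma Dgt0 t : D t = (0 < t)%R.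
Proof. by rewrite /= in_itv /= andbT. Qed.

Lemma measurable_wpow e : measurable_fun D (fun t => (t `^ e)%:E : \bar R).
Proof. by apply/measurable_EFinP/measurable_funTS; exact: measurable_powR. Qed.

Lemma measurable_invD : measurable_fun D (fun t => (t^-1)%R : R).
Proof.
apply: (eq_measurable_fun (fun t : R => t `^ (- 1))%R).
  by move=> t /set_mem; rewrite -[X in X -> _]/(D t) Dgt0 => t0; rewrite powR_inv1// ltW.
by apply: measurable_funTS; exact: measurable_powR.
Qed.

Lemma lorentz_sup_ge p g t : (0 < t)%R ->
  (t `^ inv_exponent p)%:E * g t <= lorentz_sup p g.
Proof. by move=> t0; apply: ereal_sup_ubound; exists t => //; rewrite Dgt0. Qed.

Lemma measurable_winv : measurable_fun D (fun t => (t^-1)%:E : \bar R).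
Proof. by apply/measurable_EFinP; exact: measurable_invD. Qed.

Definition lint p a g t := ((t `^ inv_exponent p)%:E * g t) `^ a * (t^-1)%:E.

Lemma measurable_lint p a g : measurable_fun D g -> measurable_fun D (lint p a g).
Proof.
move=> mg; apply: emeasurable_funM; last exact: measurable_winv.
apply: (@measurableT_comp _ _ _ _ _ _ (fun x => x `^ a)); first exact: measurable_poweR.
by apply: emeasurable_funM => //; exact: measurable_wpow.
Qed.

Lemma lint_ge0 p a g t : D t -> 0 <= lint p a g t.
Proof. by rewrite Dgt0 => t0; rewrite mule_ge0 ?poweR_ge0// lee_fin invr_ge0 ltW. Qed.

Lemma le_lint p a g h t : (0 <= a)%R -> D t -> 0 <= g t -> g t <= h t ->
  lint p a g t <= lint p a h t.
Proof.
rewrite Dgt0 => a0 t0 g0 gh; rewrite lee_wpmul2r ?lee_fin ?invr_ge0 ?(ltW t0)//.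
have w0 : 0 <= (t `^ inv_exponent p)%:E by rewrite lee_fin powR_ge0.
apply: gt0_ler_poweR => //; rewrite ?in_itv /= ?leey ?andbT ?mule_ge0//.
  exact: le_trans g0 gh.
by rewrite lee_wpmul2l.
Qed.

Lemma LN_ge0 p q g : (forall t, (0 < t)%R -> 0 <= g t) -> 0 <= LN p q g.
Proof.
move=> g0; have sup0 : 0 <= lorentz_sup p g.
  apply: le_trans (lorentz_sup_ge p g (ltr01 : (0 < 1 :> R)%R)).
  by rewrite mule_ge0 ?lee_fin ?powR_ge0 ?g0.
by rewrite /LN; case: q => //= a; exact: poweR_ge0.
Qed.

Lemma LN_mono p q g h : 1 <= q -> measurable_fun D g -> measurable_fun D h ->
  (forall t, (0 < t)%R -> 0 <= g t) -> (forall t, (0 < t)%R -> g t <= h t) ->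
  LN p q g <= LN p q h.
Proof.
move=> q1 mg mh g0 gh; rewrite /LN.
case: q q1 => [a|_|//]; last first.
  apply: ge_ereal_sup => _ [t Dt <-]; have t0 : (0 < t)%R by rewrite -Dgt0.
  apply: le_trans (lorentz_sup_ge p h t0).
  by rewrite lee_wpmul2l ?gh// lee_fin powR_ge0.
rewrite lee_fin => a1; have a0 : (0 <= a)%R by exact: le_trans a1.
have ii s : 0 <= \int[leb]_(t in D) lint p a s t by apply: integral_ge0 => *; exact: lint_ge0.
apply: gt0_ler_poweR; rewrite ?invr_ge0// ?in_itv /= ?leey ?andbT ?ii//.
apply: ge0_le_integral => //.
- by move=> t Dt; exact: lint_ge0.
- exact: measurable_lint.
- exact: measurable_lint.
- by move=> t Dt; move: (Dt); rewrite Dgt0 => t0; apply: le_lint => //; [exact: g0|exact: gh].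
Qed.

(** The factor 1 / t goes inside the power, so that the Lorentz functional becomes an L^a norm for
    Lebesgue measure and Minkowski's inequality applies. *)
Lemma lintE p a g t : (0 < a)%R -> (0 < t)%R -> 0 <= g t ->
  lint p a g t = ((t `^ inv_exponent p * (t^-1) `^ (a^-1))%:E * g t) `^ a.
Proof.
move=> a0 t0 g0; rewrite /lint EFinM muleAC.
rewrite [RHS]poweRM ?mule_ge0 ?lee_fin ?powR_ge0//; congr (_ * _).
by rewrite poweR_EFin -powRrM mulVf ?gt_eqF// powRr1// invr_ge0 ltW.
Qed.

Lemma LN_add p q g h : 1 <= q -> measurable_fun D g -> measurable_fun D h ->
  (forall t, (0 < t)%R -> 0 <= g t) -> (forall t, (0 < t)%R -> 0 <= h t) ->
  (forall t, (0 < t)%R -> g t < +oo) -> (forall t, (0 < t)%R -> h t < +oo) ->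
  LN p q (fun t => g t + h t) <= LN p q g + LN p q h.
Proof.
move=> q1 mg mh g0 h0 gf hf; rewrite /LN.
case: q q1 => [a|_|//]; last first.
  apply: ge_ereal_sup => _ [t Dt <-]; have t0 : (0 < t)%R by rewrite -Dgt0.
  rewrite ge0_muleDr ?g0 ?h0//.
  by apply: leeD; apply: ereal_sup_ubound; exists t.
rewrite lee_fin => a1; have a0 : (0 < a)%R by exact: lt_le_trans a1.
pose V t := (t `^ inv_exponent p * (t^-1) `^ (a^-1))%R.
(* Minkowski's inequality is applied to real functions on the whole line: [fine] loses nothing
   because [g] and [h] are finite for [0 < t], and the extension by 0 adds nothing. *)
pose rr s t := (if (0 < t)%R then V t * fine (s t) else 0)%R.
have mD : measurable D by exact: measurable_itv.
have mr s : measurable_fun D s -> measurable_fun [set: measurableTypeR R] (rr s : measurableTypeR R -> R).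
  move=> ms; rewrite (_ : rr s = (fun t => V t * fine (s t))%R \_ D); last first.
    by apply/funext => t; rewrite patchE mem_setE in_itv /= andbT.
  apply/(measurable_restrictT _ _).1 => //; apply: measurable_funM.
    apply: measurable_funM; first by apply: measurable_funTS; exact: measurable_powR.
    apply: (@measurableT_comp _ _ _ _ _ _ (fun x => x `^ a^-1)%R); first exact: measurable_powR.
    exact: measurable_invD.
  by apply: (@measurableT_comp _ _ _ _ _ _ fine) => //; exact: fine_measurable.
have V0 t : (0 <= V t)%R by rewrite mulr_ge0 ?powR_ge0.
have rrE s : (forall t, (0 < t)%R -> 0 <= s t) -> (forall t, (0 < t)%R -> s t < +oo) ->
    lorentz_integral p a s `^ a^-1 = Lnorm leb a%:E (EFin \o rr s).
  move=> s0 sf; rewrite unlock; congr (_ `^ _).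
  rewrite [LHS](_ : _ = \int[leb]_(t in D) (lint p a s t))//.
  rewrite [LHS]integral_mkcond; apply: eq_integral => t _.
  rewrite patchE mem_setE in_itv /= andbT /rr; case: ifPn => t0; last first.
    by rewrite /= normr0 powR0// gt_eqF.
  rewrite lintE// ?s0//; rewrite -{1}[s t]fineK ?ge0_fin_numE ?s0 ?sf//.
  rewrite -EFinM /= ger0_norm// mulr_ge0// fine_ge0// s0//.
rewrite !rrE//; last 2 first.
- by move=> t t0; rewrite adde_ge0 ?g0 ?h0.
- by move=> t t0; rewrite lte_add_pinfty ?gf ?hf.
rewrite (_ : rr (fun t => g t + h t) = (rr g \+ rr h)%R); last first.
  apply/funext => t; rewrite /= /rr; case: ifPn => [t0|_]; last by rewrite addr0.
  by rewrite fineD ?mulrDr// ge0_fin_numE ?g0 ?h0 ?gf ?hf.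
by apply: minkowski_EFin => //; exact: mr.
Qed.

Lemma LN_scale p q g (c : R) : 1 <= q -> (0 <= c)%R -> measurable_fun D g ->
  (forall t, (0 < t)%R -> 0 <= g t) ->
  LN p q (fun t => c%:E * g t) = c%:E * LN p q g.
Proof.
move=> q1 c0 mg g0; rewrite /LN; case: q q1 => [a|_|//].
  rewrite lee_fin => a1; have a0 : (0 < a)%R by exact: lt_le_trans a1.
  rewrite [lorentz_integral _ _ _](_ : _ = \int[leb]_(t in D) ((c `^ a)%:E * lint p a g t)).
    rewrite ge0_integralZl ?lee_fin ?powR_ge0//.
    - rewrite poweRM ?lee_fin ?powR_ge0//; last by apply: integral_ge0 => *; exact: lint_ge0.
      by rewrite poweR_EFin -powRrM mulfV ?gt_eqF// powRr1.
    - exact: measurable_lint.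
    - by move=> t Dt; exact: lint_ge0.
  apply: eq_integral => t /set_mem; rewrite -[X in X -> _]/(D t) Dgt0 => t0.
  rewrite -/(lint p a (fun t => c%:E * g t) t) /lint muleCA.
  rewrite [_ `^ a]poweRM ?lee_fin// ?mule_ge0 ?lee_fin ?powR_ge0 ?g0//.
  by rewrite poweR_EFin muleA.
rewrite /lorentz_sup -ereal_supZl//; last first.
  by apply/set0P; eexists; exists 1%R => //; rewrite Dgt0.
congr ereal_sup; apply/seteqP; split => [_ [t Dt <-]|_ [_ [t Dt <-] <-]].
  by eexists; [exists t => //|rewrite muleCA].
by exists t => //; rewrite muleCA.
Qed.

(** The measure dt / t is invariant under dilation, so only the weight t^(1/p) contributes. *)
Lemma LN_dilate p q g : 1 <= q -> measurable_fun D g ->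
  (forall t, (0 < t)%R -> 0 <= g t) ->
  LN p q (fun t => g (t / 2)%R) = (2 `^ inv_exponent p)%:E * LN p q g.
Proof.
move=> q1 mg g0; rewrite /LN; case: q q1 => [a|_|//]; last first.
  rewrite /lorentz_sup -ereal_supZl ?powR_ge0//; last first.
    by apply/set0P; eexists; exists 1%R => //; rewrite Dgt0.
  congr ereal_sup; apply/seteqP; split => [_ [t Dt <-]|_ [_ [t Dt <-] <-]].
    eexists; first by exists (t / 2)%R => //; move: Dt; rewrite !Dgt0 => ?; rewrite divr_gt0.
    rewrite muleA -EFinM -powRM//; last by rewrite divr_ge0// ltW// -Dgt0.
    by rewrite mulrCA mulfV// mulr1.
  exists (2 * t)%R; first by move: Dt; rewrite !Dgt0 => ?; rewrite mulr_gt0.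
  rewrite muleA -EFinM -powRM//; last by rewrite ltW// -Dgt0.
  by rewrite [(2 * t)%R]mulrC mulfK.
rewrite lee_fin => a1; have a0 : (0 < a)%R by exact: lt_le_trans a1.
pose F t := if (0 < t)%R then ((2 `^ inv_exponent p) `^ a / 2)%:E * lint p a g t else 0.
have mF : measurable_fun [set: measurableTypeR R] F.
  rewrite (_ : F = (fun t => ((2 `^ inv_exponent p) `^ a / 2)%:E * lint p a g t) \_ D); last first.
    by apply/funext => t; rewrite patchE mem_setE in_itv /= andbT.
  apply/(measurable_restrictT _ _).1 => //.
  by apply: emeasurable_funM => //; exact: measurable_lint.
have F0 t : 0 <= F t.
  rewrite /F; case: ifPn => // t0; rewrite mule_ge0 ?lee_fin ?divr_ge0 ?powR_ge0//.
  by apply: lint_ge0; rewrite Dgt0.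
have E1 : lorentz_integral p a (fun t => g (t / 2)%R) = \int[leb]_t F (2^-1 * t + 0)%R.
  rewrite [LHS]integral_mkcond; apply: eq_integral => t _.
  rewrite patchE mem_setE in_itv /= andbT addr0 /F pmulr_rgt0//; case: ifPn => // t0.
  rewrite /lint [(2^-1 * t)%R]mulrC.
  have -> : (t `^ inv_exponent p = 2 `^ inv_exponent p * (t / 2) `^ inv_exponent p)%R.
    by rewrite -powRM// ?divr_ge0 ?(ltW t0)// mulrCA mulfV// mulr1.
  have t20 : (0 < t / 2)%R by rewrite divr_gt0.
  rewrite EFinM -muleA; set G := (_%:E * g _).
  have G0 : 0 <= G by rewrite /G mule_ge0 ?lee_fin ?powR_ge0 ?g0.
  rewrite [LHS](_ : _ = ((2 `^ inv_exponent p)%:E `^ a * G `^ a) * (t^-1)%:E); last first.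
    by rewrite poweRM// lee_fin powR_ge0.
  rewrite poweR_EFin [in RHS]EFinM -!muleA; congr (_ * _); rewrite muleCA; congr (_ * _).
  by rewrite -EFinM; congr EFin; field; rewrite gt_eqF.
have E2 : \int[leb]_t F t = ((2 `^ inv_exponent p) `^ a / 2)%:E * lorentz_integral p a g.
  rewrite -[in RHS]ge0_integralZl ?lee_fin ?divr_ge0 ?powR_ge0//.
  - rewrite [RHS]integral_mkcond; apply: eq_integral => t _.
    by rewrite patchE mem_setE in_itv /= andbT /F.
  - exact: measurable_lint.
  - by move=> t Dt; exact: lint_ge0.
rewrite E1 (lebesgue_affine 0 _ mF F0) ?invr_eq0// E2 muleA -EFinM.
rewrite normfV invrK ger0_norm// mulrCA mulfV// mulr1.
rewrite poweRM ?lee_fin ?powR_ge0//; last by apply: integral_ge0 => *; exact: lint_ge0.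
by rewrite poweR_EFin -powRrM mulfV ?gt_eqF// powRr1// powR_ge0.
Qed.

Lemma poweR_le_galois (x y : \bar R) a : (0 < a)%R -> 0 <= x -> 0 <= y ->
  (x `^ a <= y) = (x <= y `^ a^-1).
Proof.
move=> a0 x0 y0; apply/idP/idP => h.
- have := @gt0_ler_poweR R a^-1 _ (x `^ a) y; rewrite !in_itv /= !leey !andbT poweR_ge0 y0 invr_ge0 (ltW a0).
  by move=> /(_ isT isT isT h); rewrite -poweRrM mulfV ?gt_eqF// poweRe1.
- have := @gt0_ler_poweR R a (ltW a0) x (y `^ a^-1); rewrite !in_itv /= !leey !andbT poweR_ge0 x0.
  by move=> /(_ isT isT h); rewrite -poweRrM mulVf ?gt_eqF// poweRe1.
Qed.

Lemma limn_einfE_sup (u : nat -> \bar R) : limn_einf u = ereal_sup (range (einfs u)).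
Proof. by rewrite limn_einf_lim; apply/cvg_lim => //; exact: cvg_einfs_sup. Qed.

Lemma limn_einf_le (u : nat -> \bar R) M : (forall k, u k <= M) -> limn_einf u <= M.
Proof.
move=> uM; rewrite limn_einfE_sup; apply: ge_ereal_sup => _ [n _ <-].
by apply: le_trans (uM n); apply: ereal_inf_lbound; exists n => /=.
Qed.

Lemma limn_einf_ge (u : nat -> \bar R) M N : (forall k, (N <= k)%N -> M <= u k) -> M <= limn_einf u.
Proof.
move=> uM; rewrite limn_einfE_sup; apply: le_trans (ereal_sup_ubound _); last by exists N.
by apply: le_ereal_inf_tmp => _ [k Nk <-]; exact: uM.
Qed.

Lemma mine_limn_einf (u : nat -> \bar R) x :
  mine x (limn_einf u) <= limn_einf (fun k => mine x (u k)).
Proof.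
rewrite !limn_einfE_sup leNgt; apply/negP => h.
have : ereal_sup (range (einfs (fun k => mine x (u k)))) < ereal_sup (range (einfs u)).
  by apply: lt_le_trans h _; rewrite ge_min lexx orbT.
move=> /ereal_sup_gt[_ [n _ <-]] hn.
have : mine x (einfs u n) <= ereal_sup (range (einfs (fun k => mine x (u k)))).
  apply: le_trans (ereal_sup_ubound _); last by exists n.
  apply: le_ereal_inf_tmp => _ [k nk <-]; rewrite le_min ge_min lexx /=.
  by rewrite ge_min; apply/orP; right; apply: ereal_inf_lbound; exists k.
rewrite leNgt => /negP; apply.
by rewrite lt_min hn andbT; apply: lt_le_trans h _; rewrite ge_min lexx.
Qed.

Lemma LN_fatou p q (gk : nat -> R -> \bar R) g (C : \bar R) : 1 <= q -> 0 <= C ->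
  (forall k, measurable_fun D (gk k)) -> measurable_fun D g ->
  (forall t, (0 < t)%R -> 0 <= g t) ->
  (forall k t, (0 < t)%R -> 0 <= gk k t) ->
  (forall t, (0 < t)%R -> g t <= limn_einf (gk ^~ t)) ->
  (forall k, LN p q (gk k) <= C) -> LN p q g <= C.
Proof.
move=> q1 C0 mgk mg g0 gk0 glim gC.
rewrite /LN in gC *; case: q q1 gC => [a|_|//]; last first.
  move=> gC; apply: ge_ereal_sup => _ [t Dt <-]; move: Dt; rewrite Dgt0 => t0.
  have w0 : (0 < t `^ inv_exponent p)%R by rewrite powR_gt0.
  rewrite muleC -lee_pdivlMr//; apply: le_trans (glim _ t0) _; apply: limn_einf_le => k.
  rewrite lee_pdivlMr// muleC; exact: le_trans (lorentz_sup_ge p (gk k) t0) (gC k).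
rewrite lee_fin => a1; have a0 : (0 < a)%R by exact: lt_le_trans a1.
move=> gC.
have ii s : 0 <= \int[leb]_(t in D) lint p a s t by apply: integral_ge0 => *; exact: lint_ge0.
have ai : (0 < a^-1)%R by rewrite invr_gt0.
have gC' k : lorentz_integral p a (gk k) <= C `^ a.
  by have := gC k; rewrite poweR_le_galois// ?invrK//; exact: ii.
rewrite poweR_le_galois//; last exact: ii.
rewrite invrK; apply: (@le_trans _ _ (\int[leb]_(t in D) limn_einf (fun k => lint p a (gk k) t))).
  apply: ge0_le_integral => //.
  - by move=> t Dt; exact: lint_ge0.
  - exact: measurable_lint.
  - apply: (eq_measurable_fun (fun t => - limn_esup (fun k => - lint p a (gk k) t))).
      by move=> t _; rewrite limn_esupN oppeK.
    apply: measurableT_comp => //; apply: measurable_fun_limn_esup => k.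
    by apply: measurableT_comp => //; exact: measurable_lint.
  - move=> t Dt; move: (Dt); rewrite Dgt0 => t0.
    set M := limn_einf _; have w0 : (0 < t `^ inv_exponent p)%R by rewrite powR_gt0.
    have infs_ge0 n : 0 <= einfs (gk ^~ t) n.
      by apply: le_ereal_inf_tmp => _ [k _ <-]; exact: gk0.
    have M0 : 0 <= M.
      rewrite /M limn_einfE_sup; apply: le_trans (ereal_sup_ubound _); last by exists 0%N.
      by apply: le_ereal_inf_tmp => _ [k _ <-]; exact: lint_ge0.
    (* Solving for [x] turns the comparison of integrands into an upper bound on [x] itself. The
       limit inferior of [gk] being a supremum of infima, it is enough to check that bound on each
       infimum, with no continuity of the power. *)
    have gal x : 0 <= x -> (((t `^ inv_exponent p)%:E * x) `^ a * (t^-1)%:E <= M) =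
        (x <= (M * t%:E) `^ a^-1 * ((t `^ inv_exponent p)^-1)%:E).
      move=> x0; rewrite [RHS]lee_pdivlMr// [LHS]lee_pdivrMr// [RHS](_ : _ = ((t `^ inv_exponent p)%:E * x <= (M * t%:E) `^ a^-1)); last first.
        by rewrite muleC.
      by rewrite poweR_le_galois// mule_ge0// lee_fin ?powR_ge0// ltW.
    rewrite /lint gal ?g0//; apply: le_trans (glim _ t0) _.
    rewrite limn_einfE_sup; apply: ge_ereal_sup => _ [n _ <-]; rewrite -gal//.
    rewrite /M limn_einfE_sup; apply: le_trans (ereal_sup_ubound _); last by exists n.
    apply: le_ereal_inf_tmp => _ [k nk <-].
    apply: (@le_lint p a (fun=> einfs (gk ^~ t) n) (gk k)) => //; first exact: ltW.
    by apply: ereal_inf_lbound; exists k.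
apply: le_trans (fatou _ _ _ _) _ => //.
- by move=> k; exact: measurable_lint.
- by move=> k t; exact: lint_ge0.
- by apply: limn_einf_le => k; exact: gC'.
Qed.

(** The interval []s, 2 * s]] has mass at least 1/2 for dt / t. The resulting factor 2^(1/a) is at
    most 2 because [1 <= a], so the constant is the same for all [q]. *)
Lemma LN_lower p q g (s : R) (c : \bar R) : 1 <= q -> (0 < s)%R -> 0 <= c ->
  (0 <= inv_exponent p)%R -> measurable_fun D g ->
  (forall t, (0 < t)%R -> 0 <= g t) ->
  (forall t, (s < t <= 2 * s)%R -> c <= g t) ->
  (s `^ inv_exponent p)%:E * c <= 2%:E * LN p q g.
Proof.
move=> q1 s0 c0 e0 mg g0 gc; rewrite /LN; case: q q1 => [a|_|//]; last first.
  have s2 : (0 < 2 * s)%R by rewrite mulr_gt0.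
  have ss : (s <= 2 * s)%R by rewrite ler_peMl ?(ltW s0)// ler1n.
  have := lorentz_sup_ge p g s2; set S := lorentz_sup p g => h.
  have h1 : (s `^ inv_exponent p)%:E * c <= S.
    apply: le_trans h; apply: lee_pmul; rewrite ?lee_fin ?powR_ge0//.
      by rewrite ge0_ler_powR// nnegrE ?(ltW s0) ?(ltW s2).
    by apply: gc; rewrite ltr_pMl// ltr1n lexx.
  apply: (le_trans h1); rewrite -[leLHS]mul1e; apply: lee_wpmul2r; last by rewrite lee_fin ler1n.
  by apply: le_trans h1; rewrite mule_ge0// lee_fin powR_ge0.
rewrite lee_fin => a1; have a0 : (0 < a)%R by exact: lt_le_trans a1.
set I := lorentz_integral p a g.
have I0 : 0 <= I by apply: integral_ge0 => *; exact: lint_ge0.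
have S0 : 0 <= (s `^ inv_exponent p)%:E * c by rewrite mule_ge0// lee_fin powR_ge0.
have key : ((s `^ inv_exponent p)%:E * c) `^ a * (2^-1)%:E <= I.
  have -> : ((s `^ inv_exponent p)%:E * c) `^ a * (2^-1)%:E =
     \int[leb]_(t in `]s, (2 * s)%R]) (((s `^ inv_exponent p)%:E * c) `^ a * ((2 * s)^-1)%:E).
    rewrite integral_cst//= lebesgue_measure_itv /= lte_fin ltr_pMl// ltr1n.
    rewrite -muleA; congr (_ * _); rewrite -EFinB -EFinM; congr EFin; field; by rewrite gt_eqF.
  apply: (@le_trans _ _ (\int[leb]_(t in `]s, (2 * s)%R]) lint p a g t)).
    apply: ge0_le_integral => //.
    - by move=> t _; rewrite mule_ge0 ?poweR_ge0// lee_fin invr_ge0 mulr_ge0// ltW.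
    - apply: measurable_funS (measurable_lint p a mg) => // t; rewrite /= !in_itv /= => /andP[st _].
      by rewrite (lt_trans s0 st).
    - move=> t; rewrite /= in_itv /= => hst; have /andP[st ts] := hst.
      have t0 := lt_trans s0 st.
      rewrite /lint; apply: lee_pmul; rewrite ?poweR_ge0// ?lee_fin ?invr_ge0 ?mulr_ge0 ?(ltW s0)//.
        apply: gt0_ler_poweR; rewrite ?(ltW a0)// ?in_itv /= ?leey ?andbT//.
          by rewrite mule_ge0 ?lee_fin ?powR_ge0 ?g0.
        apply: lee_pmul; rewrite ?lee_fin ?powR_ge0// ?gc//.
        by rewrite ge0_ler_powR// ?nnegrE ltW.
      by rewrite lef_pV2 ?posrE// mulr_gt0.
  apply: ge0_subset_integral => //.
  - exact: measurable_lint.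
  - by move=> t Dt; exact: lint_ge0.
  - by move=> t; rewrite /= !in_itv /= => /andP[st _]; rewrite (lt_trans s0 st).
have : ((s `^ inv_exponent p)%:E * c) `^ a <= I * 2%:E by rewrite -lee_pdivrMr.
rewrite poweR_le_galois ?(mule_ge0 I0)// => /le_trans; apply.
rewrite poweRM// muleC; apply: lee_wpmul2r; first exact: poweR_ge0.
rewrite poweR_EFin lee_fin -[leRHS]powRr1//; apply: ler_powR; first by rewrite ler1n.
by rewrite invf_le1.
Qed.

End lorentz_functional.

(** * Rearrangements of an abstract distribution function and Hardy's inequality *)

Section rearrangement_of_distribution.
Variable R : realType.
Local Open Scope ereal_scope.
Local Notation leb := (@lebesgue_measure R).
Local Notation MR := (measurableTypeR R).
Local Notation D := (`]0%R, +oo[%classic : set (measurableTypeR R)).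
Implicit Types (m : R -> \bar R) (t l u : R) (p q : \bar R).

Lemma measurable_nonincreasing (f : R -> \bar R) :
  (forall x y, (x <= y)%R -> f y <= f x) -> measurable_fun [set: MR] (f : MR -> \bar R).
Proof.
move=> ni; apply: (measurability (@ErealGenOInfty.G R) (ErealGenOInfty.measurableE R)) => _ [_ [r ->] <-].
rewrite setTI; apply: is_interval_measurable => x y /=; rewrite !in_itv /= !andbT => fx fy z /andP[_ zy].
by rewrite in_itv /= andbT; apply: lt_le_trans fy _; exact: ni.
Qed.

Lemma measurable_nondecreasing (f : R -> \bar R) :
  (forall x y, (x <= y)%R -> f x <= f y) -> measurable_fun [set: MR] (f : MR -> \bar R).
Proof.
move=> ni; apply: (measurability (@ErealGenOInfty.G R) (ErealGenOInfty.measurableE R)) => _ [_ [r ->] <-].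
rewrite setTI; apply: is_interval_measurable => x y /=; rewrite !in_itv /= !andbT => fx fy z /andP[xz _].
by rewrite in_itv /= andbT; apply: lt_le_trans fx _; exact: ni.
Qed.

(** What is needed of a distribution function, without a measure space; the last clause is
    right-continuity of a nonincreasing function, stated without limits. *)
Definition dfun m := [/\ forall l, 0 <= m l, forall l l', (l <= l')%R -> m l' <= m l &
  forall l c, (forall e, (0 < e)%R -> m (l + e)%R <= c) -> m l <= c].

(* rea m and mrea m are f* and f** when m is the distribution function of f. *)
Definition rea m t := ereal_inf [set l%:E | l in [set l : R | (0 <= l)%R /\ m l <= t%:E]].

Definition mrea m t := (t^-1)%:E * \int[leb]_(u in `]0%R, t]) rea m u.

Variable m : R -> \bar R.
Hypothesis dm : dfun m.
Let m0 := let: And3 h _ _ := dm in h.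
Let mni := let: And3 _ h _ := dm in h.
Let mrc := let: And3 _ _ h := dm in h.

(** [rea m] is the generalized inverse of [m]; right-continuity makes the infimum in its definition
    attained when finite. *)
Lemma rea_le t l : (0 <= l)%R -> (rea m t <= l%:E) = (m l <= t%:E).
Proof.
move=> l0; apply/idP/idP => h; last by apply: ereal_inf_lbound; exists l.
apply: mrc => e e0.
have : rea m t < (l + e)%:E by apply: le_lt_trans h _; rewrite lte_fin ltrDl.
move=> /ereal_inf_lt[_ [l' [l'0 ml'] <-]]; rewrite lte_fin => /ltW l'le.
exact: le_trans (mni l'le) ml'.
Qed.

Lemma rea_ge0 t : 0 <= rea m t.
Proof. by apply: le_ereal_inf_tmp => _ [l [l0 _] <-]; rewrite lee_fin. Qed.

Lemma rea_ni t u : (t <= u)%R -> rea m u <= rea m t.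
Proof.
move=> tu; apply: le_ereal_inf => _ [l [l0 ml] <-]; exists l => //; split => //.
by apply: le_trans ml _; rewrite lee_fin.
Qed.

Lemma measurable_rea : measurable_fun [set: MR] (rea m : MR -> \bar R).
Proof. by apply: measurable_nonincreasing => x y; exact: rea_ni. Qed.

Lemma measurable_dfun : measurable_fun [set: MR] (m : MR -> \bar R).
Proof. exact: measurable_nonincreasing. Qed.

Lemma leb_itv0 (x : \bar R) : 0 <= x -> leb [set l : R | (0 < l)%R /\ l%:E < x] = x.
Proof.
case: x => [r|_|//]; first rewrite lee_fin => r0.
  rewrite [X in leb X](_ : _ = `]0%R, r[%classic).
    rewrite lebesgue_measure_itv /= lte_fin; case: ltgtP r0 => // [_ _|<- //].
    by rewrite sube0.
  by apply/seteqP; split => l /=; rewrite in_itv /= lte_fin; [by move=> [-> ->]|by move/andP].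
rewrite [X in leb X](_ : _ = `]0%R, +oo[%classic); first by rewrite lebesgue_measure_itv /= ltry.
by apply/seteqP; split => l /=; rewrite in_itv /= andbT ltry; [by move=> []|].
Qed.

Lemma leb_itv0t (x : \bar R) t : (0 < t)%R -> 0 <= x ->
  leb [set l : R | (0 < l <= t)%R /\ l%:E < x] = mine t%:E x.
Proof.
move=> t0 x0; have [tx|xt] := ltP t%:E x.
  rewrite [X in leb X](_ : _ = `]0%R, t]%classic).
    by rewrite lebesgue_measure_itv /= lte_fin t0 sube0.
  apply/seteqP; split => l /=; rewrite in_itv /=; first by move=> [].
  move=> lt; split => //.
  by apply: le_lt_trans tx; rewrite lee_fin; case/andP : lt.
rewrite -[RHS](leb_itv0 x0); congr (leb _); apply/seteqP; split => l /=; first by move=> [/andP[-> _]].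
by move=> [-> lx]; split => //; rewrite -lee_fin; apply/ltW/(lt_le_trans lx).
Qed.

(** Both sides are the area of the region 0 < u <= t, 0 < l < f*(u), which by [rea_le] is also
    described by u < m(l). *)
Lemma int_rea t : (0 < t)%R ->
  \int[leb]_(u in `]0%R, t]) rea m u = \int[leb]_(l in D) mine t%:E (m l).
Proof.
move=> t0.
pose A : set (MR * MR) := [set ul | (0 < ul.1 <= t)%R /\ (0 < ul.2)%R /\ ul.1%:E < m ul.2].
have mA : measurable A.
  rewrite (_ : A = (fst @^-1` (`]0%R, t]%classic : set MR)) `&` ((snd @^-1` D) `&`
     [set ul : MR * MR | (EFin \o fst) ul < (m \o snd) ul])); last first.
    by apply/seteqP; split => -[u l] /=; rewrite !in_itv /= andbT.
  apply: measurableI.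
    by rewrite -[X in measurable X]setTI; apply: measurable_fst.
  apply: measurableI.
    by rewrite -[X in measurable X]setTI; apply: measurable_snd.
  rewrite -[X in measurable X]setTI; apply: measurable_lte => //.
    by apply: measurableT_comp => //; exact: measurable_fst.
  by apply: (measurableT_comp measurable_dfun); exact: measurable_snd.
have mK : measurable_fun [set: MR * MR] (fun ul => (\1_A ul)%:E : \bar R).
  by apply/measurable_EFinP; exact: measurable_indic.
have := @fubini_tonelli _ _ MR MR R leb leb (fun ul => (\1_A ul)%:E) mK.
move=> /(_ _)/wrap[]; first by move=> x; rewrite lee_fin.
have E1 u : \int[leb]_l (\1_A (u, l))%:E = if (0 < u <= t)%R then rea m u else 0.
  have -> : (fun l => (\1_A (u, l))%:E : \bar R) = (fun l => (\1_[set l | A (u, l)] l)%:E).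
    by apply/funext => l; rewrite !indicE; congr (_%:R)%:E; apply/idP/idP; rewrite !inE.
  have mAu : measurable [set l : MR | A (u, l)].
    by have := measurable_xsection u mA; rewrite /xsection; under eq_set do rewrite inE.
  rewrite integral_indic// setIT; case: ifPn => ut.
    rewrite -[RHS](leb_itv0 (rea_ge0 u)); congr (leb _); apply/seteqP; split => l /=.
      by move=> [_ [l0 uml]]; split => //; rewrite ltNge rea_le ?(ltW l0)// -ltNge.
    by move=> [l0]; rewrite ltNge rea_le ?(ltW l0)// -ltNge.
  rewrite (_ : [set l | _] = set0) ?measure0//; apply/seteqP; split => l //= [h _].
  by rewrite h in ut.
have E2 l : \int[leb]_u (\1_A (u, l))%:E = if (0 < l)%R then mine t%:E (m l) else 0.
  have -> : (fun u => (\1_A (u, l))%:E : \bar R) = (fun u => (\1_[set u | A (u, l)] u)%:E).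
    by apply/funext => u; rewrite !indicE; congr (_%:R)%:E; apply/idP/idP; rewrite !inE.
  have mAl : measurable [set u : MR | A (u, l)].
    by have := measurable_ysection l mA; rewrite /ysection; under eq_set do rewrite inE.
  rewrite integral_indic// setIT; case: ifPn => l0.
    rewrite -leb_itv0t//; congr (leb _); apply/seteqP; split => u /=; first by move=> [? []].
    by move=> [].
  rewrite (_ : [set u | _] = set0) ?measure0//; apply/seteqP; split => u //= [_ [h _]].
  by rewrite h in l0.
rewrite /fubini_F /fubini_G.
under eq_integral do rewrite E1.
under [X in _ = X -> _]eq_integral do rewrite E2.
move=> H; rewrite integral_mkcond [RHS]integral_mkcond.
transitivity (\int[leb]_u (if (0 < u <= t)%R then rea m u else 0)).
  by apply: eq_integral => u _; rewrite patchE mem_setE in_itv.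
rewrite H; apply: eq_integral => l _.
by rewrite patchE mem_setE in_itv /= andbT.
Qed.

Lemma mrea_mul t : (0 < t)%R -> t%:E * mrea m t = \int[leb]_(l in D) mine t%:E (m l).
Proof.
move=> t0; rewrite /mrea muleA -EFinM mulfV ?gt_eqF// mul1e; exact: int_rea.
Qed.

Lemma measurable_mint t : measurable_fun [set: MR] (fun l => mine t%:E (m l) : \bar R).
Proof. by apply: measurable_mine => //; exact: measurable_dfun. Qed.

Lemma split_mint t a : (0 < t)%R -> (0 <= a)%R ->
  \int[leb]_(l in D) mine t%:E (m l) =
  \int[leb]_(l in `]0%R, a[) mine t%:E (m l) + \int[leb]_(l in `[a, +oo[) mine t%:E (m l).
Proof.
move=> t0; rewrite le_eqVlt => /predU1P[<-|a0].
  rewrite (_ : [set` `]0%R, 0%R[] = set0); last by rewrite set_itv_ge ?bnd_simp.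
  rewrite integral_set0 add0e integral_itv_obnd_cbnd//.
  by apply: measurable_funTS; exact: measurable_mint.
rewrite -ge0_integral_setU//=.
- congr (integral _ _ _); apply/seteqP; split => l /=; rewrite !in_itv /= !andbT.
    by move=> l0; have [la|al] := ltP l a; [left; rewrite l0|right].
  by move=> [/andP[]//|]; exact: lt_le_trans.
- by apply: measurable_funTS; exact: measurable_mint.
- by move=> l _; rewrite le_min lee_fin (ltW t0) m0.
- by apply/disj_setPRL => l /=; rewrite !in_itv /= andbT => al /andP[_]; rewrite ltNge al.
Qed.

Lemma int_cst_itv0 t a : (0 <= a)%R -> \int[leb]_(l in `]0%R, a[) t%:E = (t * a)%:E.
Proof.
move=> a0; rewrite integral_cst//= lebesgue_measure_itv /= lte_fin.
by case: ltgtP a0 => // [_ _|<- _]; rewrite ?mulr0 ?mule0// sube0.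
Qed.

Lemma mint_upper t a : (0 < t)%R -> (0 <= a)%R ->
  \int[leb]_(l in D) mine t%:E (m l) <= (t * a)%:E + \int[leb]_(l in `[a, +oo[) m l.
Proof.
move=> t0 a0; rewrite (split_mint t0 a0) -int_cst_itv0//; apply: leeD.
- apply: ge0_le_integral => //.
  + by move=> l _; rewrite le_min lee_fin (ltW t0) m0.
  + by apply: measurable_funTS; exact: measurable_mint.
  + by move=> l _; rewrite ge_min lexx.
- apply: ge0_le_integral => //.
  + by move=> l _; rewrite le_min lee_fin (ltW t0) m0.
  + by apply: measurable_funTS; exact: measurable_mint.
  + by apply: measurable_funTS; exact: measurable_dfun.
  + by move=> l _; rewrite ge_min lexx orbT.
Qed.

(** At the level a = f*(t) the minimum changes branch: [m] exceeds [t] below [a] and is at most [t]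
    from [a] on. So the bound [mint_upper] is attained at this level. *)
Lemma mint_attained t a : (0 < t)%R -> rea m t = a%:E ->
  (t * a)%:E + \int[leb]_(l in `[a, +oo[) m l <= \int[leb]_(l in D) mine t%:E (m l).
Proof.
move=> t0 ra; have a0 : (0 <= a)%R by rewrite -lee_fin -ra rea_ge0.
rewrite (split_mint t0 a0) -int_cst_itv0//; apply: leeD.
- apply: ge0_le_integral => //.
  + by move=> l _; rewrite lee_fin ltW.
  + by apply: measurable_funTS; exact: measurable_mint.
  + move=> l; rewrite /= in_itv /= => /andP[l0 la]; rewrite le_min lexx /=.
    by apply: ltW; rewrite ltNge -rea_le ?(ltW l0)// ra -ltNge lte_fin.
- apply: ge0_le_integral => //.
  + by apply: measurable_funTS; exact: measurable_dfun.
  + by apply: measurable_funTS; exact: measurable_mint.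
  + move=> l; rewrite /= in_itv /= andbT => al; rewrite le_min lexx andbT.
    by rewrite -rea_le ?(le_trans a0)// ra lee_fin.
Qed.

Lemma rea_le_mrea t : (0 < t)%R -> rea m t <= mrea m t.
Proof.
move=> t0; rewrite /mrea muleC lee_pdivlMr//.
have -> : rea m t * t%:E = \int[leb]_(u in `]0%R, t]) rea m t.
  by rewrite integral_cst//= lebesgue_measure_itv /= lte_fin t0 sube0.
apply: ge0_le_integral => //.
- by move=> u _; exact: rea_ge0.
- by apply: measurable_funTS; exact: measurable_rea.
- by move=> u; rewrite /= in_itv /= => /andP[_]; exact: rea_ni.
Qed.

Lemma mrea_ge0 t : (0 < t)%R -> 0 <= mrea m t.
Proof. by move=> t0; exact: le_trans (rea_ge0 t) (rea_le_mrea t0). Qed.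

Lemma int_rea_le t s : (t <= s)%R ->
  \int[leb]_(u in `]0%R, t]) rea m u <= \int[leb]_(u in `]0%R, s]) rea m u.
Proof.
move=> ts; apply: ge0_subset_integral => //.
- by apply: measurable_funTS; exact: measurable_rea.
- by move=> u _; exact: rea_ge0.
- by move=> u; rewrite /= !in_itv /= => /andP[-> /le_trans]; exact.
Qed.

Lemma measurable_mrea : measurable_fun D (mrea m : MR -> \bar R).
Proof.
apply: emeasurable_funM; first exact: measurable_winv.
by apply: measurable_funTS; apply: measurable_nondecreasing => x y; exact: int_rea_le.
Qed.

Lemma mrea_lower t s : (0 < t)%R -> (t <= s <= 2 * t)%R -> (2^-1)%:E * mrea m t <= mrea m s.
Proof.
move=> t0 /andP[ts s2]; have s0 := lt_le_trans t0 ts.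
rewrite /mrea muleA -EFinM; apply: lee_pmul.
- by rewrite lee_fin mulr_ge0// invr_ge0 ltW.
- by apply: integral_ge0 => u _; exact: rea_ge0.
- by rewrite lee_fin -invfM lef_pV2 ?posrE ?mulr_gt0.
- exact: int_rea_le.
Qed.

Lemma inv_exponent_ge0 p : 1 < p -> (0 <= inv_exponent p)%R.
Proof. by case: p => //= a; rewrite lte_fin => a1; rewrite invr_ge0 (le_trans _ (ltW a1)). Qed.

Lemma inv_exponent_lt1 p : 1 < p -> (inv_exponent p < 1)%R.
Proof. by case: p => [a|_|//] /=; rewrite ?ltr01// lte_fin => a1; rewrite invf_lt1// (lt_trans _ a1). Qed.

(** Embedding in the weak space with one constant for all [q]: a factor 2 comes from [LN_lower],
    another from [mrea_lower]. The pointwise bounds on holomorphic functions rest on it. *)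
Lemma mrea_bound p q t : 1 < p -> 1 <= q -> (0 < t)%R ->
  (t `^ inv_exponent p)%:E * mrea m t <= 4%:E * LN p q (mrea m).
Proof.
move=> p1 q1 t0.
have mt0 := mrea_ge0 t0.
have c0 : 0 <= (2^-1)%:E * mrea m t by rewrite mule_ge0// lee_fin.
have := @LN_lower R p q (mrea m) t ((2^-1)%:E * mrea m t) q1 t0 c0 (inv_exponent_ge0 p1) measurable_mrea.
move=> /(_ _ _)/wrap[].
- by move=> s s0; exact: mrea_ge0.
- by move=> s /andP[ts s2]; apply: mrea_lower => //; rewrite (ltW ts).
rewrite muleCA => h.
have := lee_wpmul2l (ltac:(rewrite lee_fin; exact: ler0n) : 0 <= 2%:E :> \bar R) h.
have -> : 2%:E * (2%:E * LN p q (mrea m)) = 4%:E * LN p q (mrea m).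
  by rewrite muleA -EFinM -natrM.
by rewrite muleA -EFinM mulfV// mul1e.
Qed.

Lemma rea_fin p q t : 1 < p -> 1 <= q -> LN p q (rea m) < +oo -> (0 < t)%R -> rea m t < +oo.
Proof.
move=> p1 q1 Nf t0; have t20 : (0 < t / 2)%R by rewrite divr_gt0.
have := @LN_lower R p q (rea m) (t / 2) (rea m t) q1 t20 (rea_ge0 t) (inv_exponent_ge0 p1).
move=> /(_ _ _ _)/wrap[].
- by apply: measurable_funTS; exact: measurable_rea.
- by move=> s _; exact: rea_ge0.
- by move=> s /andP[_]; rewrite mulrCA mulfV// mulr1; exact: rea_ni.
move=> h; have w0 : (0 < (t / 2) `^ inv_exponent p)%R by rewrite powR_gt0.
have : ((t / 2) `^ inv_exponent p)%:E * rea m t < +oo.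
  by apply: le_lt_trans h _; rewrite lte_mul_pinfty// lee_fin.
by have := rea_ge0 t; case: (rea m t) => [?||]// _; rewrite ?ltry// gt0_muley ?ltxx// lte_fin.
Qed.

(* Iterating mrea(t) <= (mrea(t/2) + rea(t/2)) / 2 bounds mrea by the dyadic
   averages hardy_sum, whose norms stay bounded because 2^{1/p} / 2 < 1. *)
Fixpoint hardy_sum (K : nat) (t : R) : \bar R :=
  if K is K'.+1 then (2^-1)%:E * (hardy_sum K' (t / 2)%R + rea m (t / 2)%R) else 0.

Lemma hardy_sum_ge0 K t : 0 <= hardy_sum K t.
Proof.
elim: K t => [//|K ih] t /=; rewrite mule_ge0 ?lee_fin ?invr_ge0//.
by rewrite adde_ge0// rea_ge0.
Qed.

Lemma measurable_half (g : MR -> \bar R) : measurable_fun [set: MR] g ->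
  measurable_fun [set: MR] (fun t : MR => g (t / 2)%R).
Proof.
move=> mg; apply: (measurableT_comp mg).
by apply: measurable_funM.
Qed.

Lemma measurable_hardy_sum K : measurable_fun [set: MR] (hardy_sum K : MR -> \bar R).
Proof.
elim: K => [|K ih]; first exact: measurable_cst.
apply: emeasurable_funM => //; apply: emeasurable_funD.
  exact: (measurable_half ih).
exact: (measurable_half measurable_rea).
Qed.

(** On []t / 2, t]] the rearrangement is at most its value at [t / 2]; what remains is the same
    statement for [t / 2]. *)
Lemma mrea_hardy_sum K t : (0 < t)%R ->
  \int[leb]_(u in `](t / 2 ^+ K)%R, t]) rea m u <= t%:E * hardy_sum K t.
Proof.
elim: K t => [|K ih] t t0.
  by rewrite expr0 divr1 set_itv_ge ?bnd_simp ?ltxx// integral_set0 mule0.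
have t20 : (0 < t / 2)%R by rewrite divr_gt0.
have E : (t / 2 ^+ K.+1 = t / 2 / 2 ^+ K)%R by rewrite exprS invfM mulrA.
have le1 : (t / 2 / 2 ^+ K <= t / 2)%R.
  by rewrite ler_pdivrMr ?exprn_gt0// ler_peMr ?(ltW t20)// exprn_ege1// ler1n.
have le2 : (t / 2 <= t)%R by rewrite ler_pdivrMr// ler_peMr ?(ltW t0)// ler1n.
rewrite E (@itv_bndbnd_setU _ _ _ (BRight (t / 2)%R)) ?bnd_simp//.
rewrite ge0_integral_setU//=; last 3 first.
- by apply: measurable_funTS; exact: measurable_rea.
- by move=> u _; exact: rea_ge0.
- by apply/disj_setPRL => u /=; rewrite !in_itv /= => /andP[tu _] /andP[_]; rewrite leNgt tu.
have -> : t%:E * ((2^-1)%:E * (hardy_sum K (t / 2)%R + rea m (t / 2)%R)) =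
  (t / 2)%:E * hardy_sum K (t / 2)%R + (t / 2)%:E * rea m (t / 2)%R.
  by rewrite muleA -EFinM ge0_muleDr ?hardy_sum_ge0 ?rea_ge0.
apply: leeD; first exact: ih.
have -> : (t / 2)%:E * rea m (t / 2)%R = \int[leb]_(u in `](t / 2)%R, t]) rea m (t / 2)%R.
  rewrite integral_cst//= lebesgue_measure_itv /= lte_fin ltr_pdivrMr// ltr_pMr// ltr1n.
  by rewrite muleC -EFinB; congr (_ * _%:E); field.
apply: ge0_le_integral => //.
- by move=> u _; exact: rea_ge0.
- by apply: measurable_funTS; exact: measurable_rea.
- by move=> u; rewrite /= in_itv /= => /andP[tu _]; apply: rea_ni; exact: ltW.
Qed.

Lemma hardy_sum_nd t : nondecreasing_seq (hardy_sum ^~ t).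
Proof.
apply/nondecreasing_seqP => K; elim: K t => [|K ih] t; first exact: (hardy_sum_ge0 1).
rewrite [X in X <= _]/= [X in _ <= X]/=; apply: lee_wpmul2l; first by rewrite lee_fin invr_ge0.
by apply: leeD => //; exact: ih.
Qed.

Lemma mrea_le_hardy t : (0 < t)%R -> mrea m t <= limn_einf (hardy_sum ^~ t).
Proof.
move=> t0.
have cH := ereal_nondecreasing_cvgn (@hardy_sum_nd t).
rewrite is_cvg_limn_einfE; last by apply/cvg_ex; eexists; exact: cH.
rewrite (cvg_lim _ cH)//; set S := ereal_sup _.
rewrite /mrea muleC lee_pdivrMr//.
pose F K : set MR := `](t / 2 ^+ K)%R, t]%classic.
have ndF : nondecreasing_seq F.
  move=> i j ij; rewrite subsetEset => u; rewrite /F /=; rewrite !in_itv /= => /andP[iu ->]; rewrite andbT.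
  apply: le_lt_trans iu; rewrite ler_pM2l// lef_pV2 ?posrE ?exprn_gt0//.
  by rewrite ler_weXn2l// ler1n.
have UF : \bigcup_K F K = `]0%R, t]%classic.
  apply/seteqP; split => u /=.
    move=> [K _]; rewrite /F /= !in_itv /= => /andP[Ku ->]; rewrite andbT.
    by apply: lt_trans Ku; rewrite divr_gt0// exprn_gt0.
  rewrite in_itv /= => /andP[u0 ut].
  have [K hK] : exists K : nat, (t / u < 2 ^+ K)%R.
    have [K hK] : exists K : nat, (t / u < K%:R)%R.
      by exists (Num.truncn (t / u)).+1; exact: truncnS_gt.
    by exists K; apply: lt_le_trans hK _; rewrite -natrX ler_nat ltnW// ltn_expl.
  exists K => //; rewrite /F /= in_itv /= ut andbT.
  by rewrite ltr_pdivrMr ?exprn_gt0// mulrC -ltr_pdivrMr.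
have := @ge0_nondecreasing_set_cvg_integral _ MR R F (rea m) leb ndF.
move=> /(_ _ _ _)/wrap[].
- by move=> K; exact: measurable_itv.
- by move=> K; apply: measurable_funTS; exact: measurable_rea.
- by move=> K u _; exact: rea_ge0.
rewrite UF => cF; rewrite -(cvg_lim _ cF)//; apply: lime_le; first by apply/cvg_ex; eexists; exact: cF.
near=> K; apply: le_trans (mrea_hardy_sum K t0) _.
rewrite muleC; apply: lee_wpmul2r; first by rewrite lee_fin ltW.
by apply: ereal_sup_ubound; exists K.
Unshelve. all: by end_near. Qed.

Lemma hardy_sum_fin p q K t : 1 < p -> 1 <= q -> LN p q (rea m) < +oo -> (0 < t)%R ->
  hardy_sum K t < +oo.
Proof.
move=> p1 q1 Nf; elim: K t => [|K ih] t t0 /=; first by rewrite ltry.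
have t20 : (0 < t / 2)%R by rewrite divr_gt0.
rewrite lte_mul_pinfty ?lee_fin ?invr_ge0// lte_add_pinfty ?ih//.
exact: rea_fin Nf _.
Qed.

Lemma two_powR_lt1 p : 1 < p -> (2 `^ (inv_exponent p - 1) < 1 :> R)%R.
Proof.
move=> p1; rewrite /powR pnatr_eq0 /= expR_lt1 pmulr_llt0 ?ln_gt0 ?ltr1n//.
by rewrite subr_lt0 inv_exponent_lt1.
Qed.

(** By Minkowski and dilation the norms x_K satisfy x_{K+1} <= th (x_K + N), where N is the norm of
    [rea m] and th = 2^(1/p - 1) < 1. The bound th / (1 - th) N is the fixed point of this
    recursion. *)
Lemma hardy_sum_bound p q K : 1 < p -> 1 <= q -> LN p q (rea m) < +oo ->
  LN p q (hardy_sum K) <=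
  (2 `^ (inv_exponent p - 1) / (1 - 2 `^ (inv_exponent p - 1)))%:E * LN p q (rea m).
Proof.
move=> p1 q1 Nf; set th := (2 `^ _)%R.
have th0 : (0 < th)%R by rewrite powR_gt0.
have th1 : (th < 1)%R by exact: two_powR_lt1.
have thE : (2^-1 * 2 `^ inv_exponent p = th)%R.
  rewrite /th powRB ?pnatr_eq0 ?implybT// powRr1 ?ler0n//.
  by rewrite mulrC.
have d1 : (0 < 1 - th)%R by rewrite subr_gt0.
have L0 : 0 <= LN p q (rea m) by apply: LN_ge0 => t _; exact: rea_ge0.
elim: K => [|K ih].
  rewrite (_ : hardy_sum 0 = (fun t => 0%:E * (cst 0 t))); last first.
    by apply/funext => t; rewrite mul0e.
  rewrite LN_scale//.
  by rewrite mul0e mule_ge0// lee_fin divr_ge0// ltW.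
have mR := measurable_half measurable_rea.
have mH := measurable_half (measurable_hardy_sum K).
have half0 t : (0 < t)%R -> (0 < t / 2)%R by move=> t0; rewrite divr_gt0.
rewrite [hardy_sum K.+1](_ : _ =
    (fun t => (2^-1)%:E * (hardy_sum K (t / 2)%R + rea m (t / 2)%R)))//.
rewrite (@LN_scale R p q (fun t => hardy_sum K (t / 2)%R + rea m (t / 2)%R)) ?invr_ge0//; last 2 first.
- by apply: measurable_funTS; apply: emeasurable_funD.
- by move=> t _; rewrite adde_ge0 ?rea_ge0// hardy_sum_ge0.
have := @LN_add R p q (fun t => hardy_sum K (t / 2)%R) (fun t => rea m (t / 2)%R) q1.
move=> /(_ _ _ _ _ _ _)/wrap[].
- exact: measurable_funTS.
- exact: measurable_funTS.
- by move=> t _; exact: hardy_sum_ge0.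
- by move=> t _; exact: rea_ge0.
- by move=> t t0; exact: hardy_sum_fin Nf (half0 _ t0).
- by move=> t t0; exact: rea_fin Nf (half0 _ t0).
rewrite (@LN_dilate R p q (hardy_sum K)) ?(@LN_dilate R p q (rea m))//; last 4 first.
- by apply: measurable_funTS; exact: measurable_rea.
- by move=> t _; exact: rea_ge0.
- by apply: measurable_funTS; exact: measurable_hardy_sum.
- by move=> t _; exact: hardy_sum_ge0.
move=> h; have h2 := lee_wpmul2l (ltac:(rewrite lee_fin invr_ge0; exact: ler0n) : 0 <= (2^-1)%:E :> \bar R) h.
apply: le_trans h2 _.
have H0 : 0 <= LN p q (hardy_sum K) by apply: LN_ge0 => t _; exact: hardy_sum_ge0.
have c0 : (0 <= th / (1 - th))%R by rewrite divr_ge0// ltW.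
rewrite ge0_muleDr; last 2 first.
- by rewrite mule_ge0// lee_fin powR_ge0.
- by rewrite mule_ge0// lee_fin powR_ge0.
rewrite !muleA -!EFinM thE.
have h3 : th%:E * LN p q (hardy_sum K) <= th%:E * ((th / (1 - th))%:E * LN p q (rea m)).
  by apply: lee_wpmul2l => //; rewrite lee_fin ltW.
apply: le_trans (leeD2r _ h3) _.
have -> : th%:E * ((th / (1 - th))%:E * LN p q (rea m)) + th%:E * LN p q (rea m) =
    (th * (th / (1 - th)) + th)%:E * LN p q (rea m).
  rewrite EFinD ge0_muleDl; first by rewrite EFinM muleA.
  - by rewrite lee_fin; exact: mulr_ge0 (ltW th0) c0.
  - by rewrite lee_fin ltW.
by rewrite (_ : (th * (th / (1 - th)) + th = th / (1 - th))%R)//; field; rewrite gt_eqF.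
Qed.

Theorem hardy p q : 1 < p -> 1 <= q -> LN p q (rea m) < +oo -> LN p q (mrea m) < +oo.
Proof.
move=> p1 q1 Nf; have L0 : 0 <= LN p q (rea m) by apply: LN_ge0 => t _; exact: rea_ge0.
have C0 K : 0 <= LN p q (hardy_sum K) by apply: LN_ge0 => t _; exact: hardy_sum_ge0.
have := @LN_fatou R p q hardy_sum (mrea m) _ q1 (le_trans (C0 0%N) (hardy_sum_bound 0 p1 q1 Nf)).
move=> /(_ _ _ _ _ _ _)/wrap[].
- by move=> k; apply: measurable_funTS; exact: measurable_hardy_sum.
- exact: measurable_mrea.
- by move=> t; exact: mrea_ge0.
- by move=> k t _; exact: hardy_sum_ge0.
- by move=> t; exact: mrea_le_hardy.
- by move=> K; exact: hardy_sum_bound.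
move=> /le_lt_trans; apply; rewrite lte_mul_pinfty// lee_fin.
rewrite divr_ge0 ?powR_ge0// subr_ge0 ltW//; exact: two_powR_lt1.
Qed.

Lemma LN_rea_fin p q : 1 < p -> 1 <= q -> (LN p q (mrea m) < +oo) = (LN p q (rea m) < +oo).
Proof.
move=> p1 q1; apply/idP/idP; last exact: hardy.
apply: le_lt_trans; apply: LN_mono => //.
- by apply: measurable_funTS; exact: measurable_rea.
- exact: measurable_mrea.
- by move=> t _; exact: rea_ge0.
- by move=> t; exact: rea_le_mrea.
Qed.

End rearrangement_of_distribution.

(** * Maximal rearrangements of measurable functions *)

Section distribution.
Context d (X : measurableType d) (R : realType).
Variable mu : {sigma_finite_measure set X -> \bar R}.
Local Open Scope ereal_scope.
Local Notation leb := (@lebesgue_measure R).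
Local Notation MR := (measurableTypeR R).
Local Notation D := (`]0%R, +oo[%classic : set (measurableTypeR R)).
Implicit Types (F G H : X -> R) (t l : R) (p q : \bar R).

Definition dist G l := mu [set x | (l < G x)%R].

Definition mfn G := measurable_fun [set: X] (G : X -> MR).

Lemma measurable_above G l : mfn G -> measurable [set x | (l < G x)%R].
Proof.
move=> mG; have -> : [set x | (l < G x)%R] = G @^-1` `]l, +oo[%classic.
  by apply/seteqP; split => x /=; rewrite in_itv /= andbT.
by rewrite -[X in measurable X]setTI; exact: mG.
Qed.

Lemma dfun_dist G : mfn G -> dfun (dist G).
Proof.
move=> mG; split=> [l|l l' ll'|l c h]; first exact: measure_ge0.
- apply: le_measure; rewrite ?inE; [exact: measurable_above|exact: measurable_above|].
  by move=> x /=; exact: le_lt_trans.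
- pose F k := [set x | (l + k.+1%:R^-1 < G x)%R].
  have UF : \bigcup_k F k = [set x | (l < G x)%R].
    apply/seteqP; split => x /=.
      by move=> [k _]; apply: le_lt_trans; rewrite lerDl invr_ge0.
    move=> lx; have := truncnS_gt (G x - l)^-1; set k := Num.truncn _ => hk.
    exists k => //; rewrite /F /= -ltrBrDl -[ltRHS]invrK ltf_pV2// posrE ?invr_gt0 ?subr_gt0//.
  have mF k : measurable (F k) by exact: measurable_above.
  have ndF : nondecreasing_seq F.
    move=> i j ij; rewrite subsetEset => x; rewrite /F /=; apply: le_lt_trans.
    by rewrite lerD2l lef_pV2 ?posrE// ler_nat.
  have := @nondecreasing_cvg_mu _ _ _ mu _ mF (bigcup_measurable (fun k _ => mF k)) ndF.
  rewrite /dist -UF => cF; rewrite -(cvg_lim _ cF)//; apply: lime_le.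
    by apply/cvg_ex; eexists; exact: cF.
  by near=> k; apply: h; rewrite invr_gt0.
Unshelve. all: by end_near. Qed.

Lemma mfn_excess G a : mfn G -> mfn (fun x => Num.max (G x - a) 0)%R.
Proof.
move=> mG; apply: measurable_maxr; last exact: measurable_cst.
by apply: measurable_funB => //; exact: measurable_cst.
Qed.

(** Layer-cake formula: Tonelli on the set of pairs [(x, l)] with [a <= l < G x]. *)
Lemma excess_dist G a : mfn G ->
  \int[mu]_x (Num.max (G x - a) 0)%R%:E = \int[leb]_(l in `[a, +oo[) dist G l.
Proof.
move=> mG.
pose A : set (X * MR) := [set xl | (a <= xl.2)%R /\ (xl.2 < G xl.1)%R].
have mA : measurable A.
  rewrite (_ : A = (snd @^-1` (`[a, +oo[%classic : set MR)) `&`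
     [set xl : X * MR | (EFin \o snd) xl < (EFin \o (G \o fst)) xl]); last first.
    by apply/seteqP; split => -[u l] /=; rewrite !in_itv /= andbT lte_fin.
  apply: measurableI.
    by rewrite -[X in measurable X]setTI; apply: measurable_snd.
  rewrite -[X in measurable X]setTI; apply: measurable_lte => //.
    by apply/measurable_EFinP; exact: measurable_snd.
  by apply/measurable_EFinP; apply: (measurableT_comp mG); exact: measurable_fst.
have mK : measurable_fun [set: X * MR] (fun xl => (\1_A xl)%:E : \bar R).
  by apply/measurable_EFinP; exact: measurable_indic.
have := @fubini_tonelli _ _ X MR R mu leb (fun xl => (\1_A xl)%:E) mK.
move=> /(_ _)/wrap[]; first by move=> x; rewrite lee_fin.
have E1 x : \int[leb]_l (\1_A (x, l))%:E = (Num.max (G x - a) 0)%R%:E.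
  have -> : (fun l => (\1_A (x, l))%:E : \bar R) = (fun l => (\1_(`[a, G x[%classic) l)%:E).
    apply/funext => l; rewrite !indicE mem_setE in_itv /=; congr (_%:R)%:E.
    have [/andP h|h] := boolP (a <= l < G x)%R; first by rewrite mem_set.
    by rewrite memNset// => -[/= al lG]; rewrite al lG in h.
  rewrite integral_indic// setIT.
  transitivity (leb (`[a, G x[%classic : set R)); first by [].
  rewrite lebesgue_measure_itv /= lte_fin.
  have [aG|Ga] := ltP a (G x); first by rewrite -EFinB max_l// subr_ge0 ltW.
  by rewrite max_r// subr_le0.
have E2 l : \int[mu]_x (\1_A (x, l))%:E = if (a <= l)%R then dist G l else 0.
  have -> : (fun x => (\1_A (x, l))%:E : \bar R) = (fun x => (\1_[set x | A (x, l)] x)%:E).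
    by apply/funext => x; rewrite !indicE; congr (_%:R)%:E; apply/idP/idP; rewrite !inE.
  have mAl : measurable [set x | A (x, l)].
    by have := measurable_ysection l mA; rewrite /ysection; under eq_set do rewrite inE.
  rewrite integral_indic// setIT; case: ifPn => al.
    by rewrite /dist; congr (mu _); apply/seteqP; split => x /=; [case|].
  rewrite (_ : [set x | _] = set0) ?measure0//; apply/seteqP; split => x //= [h _].
  by rewrite h in al.
rewrite /fubini_F /fubini_G.
under eq_integral do rewrite E1.
under [X in _ = X -> _]eq_integral do rewrite E2.
move=> ->; rewrite [RHS]integral_mkcond; apply: eq_integral => l _.
by rewrite patchE mem_setE in_itv /= andbT.
Qed.

Lemma excess_mul G t a : mfn G -> (0 < t)%R -> rea (dist G) t = a%:E ->
  (t * a)%:E + \int[mu]_x (Num.max (G x - a) 0)%R%:E <= t%:E * mrea (dist G) t.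
Proof.
move=> mG t0 ra; rewrite mrea_mul//; last exact: dfun_dist.
by rewrite excess_dist//; apply: mint_attained => //; exact: dfun_dist.
Qed.

Lemma mul_excess G t a : mfn G -> (0 < t)%R -> (0 <= a)%R ->
  t%:E * mrea (dist G) t <= (t * a)%:E + \int[mu]_x (Num.max (G x - a) 0)%R%:E.
Proof.
move=> mG t0 a0; rewrite mrea_mul//; last exact: dfun_dist.
by rewrite excess_dist//; apply: mint_upper => //; exact: dfun_dist.
Qed.

(** With a = G*(t) and b = H*(t), where the infimum formula is attained, the excess of [F] over
    [a + b] is at most the sum of the excesses of [G] over [a] and of [H] over [b]. If G*(t) or
    H*(t) is infinite, so is the right-hand side. *)
Lemma mrea_subadditive F G H t : mfn F -> mfn G -> mfn H ->
  (0 < t)%R -> (forall x, (F x <= G x + H x)%R) ->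
  mrea (dist F) t <= mrea (dist G) t + mrea (dist H) t.
Proof.
move=> mF mG mH t0 FGH; have dG := dfun_dist mG; have dH := dfun_dist mH.
have G0 := mrea_ge0 (dist G) t0; have H0 := mrea_ge0 (dist H) t0.
have [Goo|] := eqVneq (rea (dist G) t) +oo.
  have := rea_le_mrea (dist G) t0; rewrite Goo leye_eq => /eqP ->.
  by rewrite addye ?leey// gt_eqF// (lt_le_trans _ H0).
rewrite -ltey => Gf.
have [Hoo|] := eqVneq (rea (dist H) t) +oo.
  have := rea_le_mrea (dist H) t0; rewrite Hoo leye_eq => /eqP ->.
  by rewrite addey ?leey// gt_eqF// (lt_le_trans _ G0).
rewrite -ltey => Hf.
have /fineK ra : rea (dist G) t \is a fin_num by rewrite ge0_fin_numE// rea_ge0.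
have /fineK rb : rea (dist H) t \is a fin_num by rewrite ge0_fin_numE// rea_ge0.
move: ra rb; set a := fine _; set b := fine _ => /esym ra /esym rb.
have a0 : (0 <= a)%R by rewrite -lee_fin -ra rea_ge0.
have b0 : (0 <= b)%R by rewrite -lee_fin -rb rea_ge0.
rewrite -(@lee_pmul2l _ t%:E) ?lte_fin// ge0_muleDr//.
apply: le_trans (leeD (excess_mul mG t0 ra) (excess_mul mH t0 rb)).
apply: le_trans (mul_excess mF t0 (addr_ge0 a0 b0)) _.
rewrite addeACA -EFinD -mulrDr; apply: leeD2l.
have mE := fun G a mG => proj2 (measurable_EFinP _ _) (@mfn_excess G a mG).
rewrite -ge0_integralD//; last 4 first.
- by move=> x _; rewrite lee_fin le_max lexx orbT.
- exact: mE.
- by move=> x _; rewrite lee_fin le_max lexx orbT.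
- exact: mE.
apply: ge0_le_integral => //.
- by move=> x _; rewrite lee_fin le_max lexx orbT.
- exact: mE.
- by apply: emeasurable_funD; exact: mE.
- move=> x _; rewrite -EFinD lee_fin.
  have le1 : (G x - a <= Num.max (G x - a) 0)%R by rewrite le_max lexx.
  have le2 : (H x - b <= Num.max (H x - b) 0)%R by rewrite le_max lexx.
  have le3 : (0 <= Num.max (G x - a) 0)%R by rewrite le_max lexx orbT.
  have le4 : (0 <= Num.max (H x - b) 0)%R by rewrite le_max lexx orbT.
  rewrite ge_max addr_ge0// andbT.
  have := FGH x; lra.
Qed.

Lemma mrea_scale G (c : R) t : mfn G -> (0 <= c)%R -> (forall x, (0 <= G x)%R) -> (0 < t)%R ->
  mrea (dist (fun x => c * G x)%R) t = c%:E * mrea (dist G) t.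
Proof.
move=> mG c0 G0 t0; have dG := dfun_dist mG.
have mcG : mfn (fun x => c * G x)%R by apply: measurable_funM => //; exact: measurable_cst.
have dcG := dfun_dist mcG.
have rE u : (0 < u)%R -> rea (dist (fun x => c * G x)%R) u = c%:E * rea (dist G) u \/ c = 0%R.
  move=> u0; move: c0; rewrite le_eqVlt => /predU1P[<-|c0]; [by right|left].
  have dE l : dist (fun x => c * G x)%R l = dist G (l / c)%R.
    by rewrite /dist; congr (mu _); apply/seteqP; split => x /=; rewrite ltr_pdivrMr// mulrC.
  rewrite /rea -ereal_inf_pZl//; congr ereal_inf; apply/seteqP; split => [_ [l [l0 hl] <-]|].
    exists (l / c)%:E; last by rewrite -EFinM mulrCA divff ?gt_eqF// mulr1.
    by exists (l / c)%R => //; split; [rewrite divr_ge0// ltW|rewrite -dE].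
  move=> _ [_ [l [l0 hl] <-] <-]; exists (c * l)%R => //.
  by split; [rewrite mulr_ge0// ltW|rewrite dE mulrAC divff ?gt_eqF// mul1r].
(* Level sets rescale only for [c > 0]; for [c = 0] the upper estimate at level 0 gives the value
   0. *)
move: c0; rewrite le_eqVlt => /predU1P[c0|c0].
  subst c; rewrite mul0e; apply/eqP; rewrite eq_le mrea_ge0// andbT.
  rewrite -(@lee_pmul2l _ t%:E) ?lte_fin// mule0.
  apply: le_trans (mul_excess _ t0 (lexx 0%R)) _; first by [].
  by rewrite mulr0 add0e integral0_eq// => x _; rewrite mul0r subr0 maxxx.
rewrite /mrea muleCA; congr (_ * _).
rewrite -ge0_integralZl//; last 3 first.
- by apply: measurable_funTS; exact: measurable_rea.
- by move=> u _; exact: rea_ge0.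
- by rewrite lee_fin ltW.
apply: eq_integral => u; rewrite inE /= in_itv /= => /andP[u0 _].
by case: (rE u u0) => // c00; rewrite c00 ltxx in c0.
Qed.

(** Indicators of strict superlevel sets are lower semicontinuous under pointwise convergence, so
    Fatou's lemma applies once to them and once to the integral of min(t, m). *)
Lemma mrea_fatou (Gk : nat -> X -> R) G t : (forall k, mfn (Gk k)) -> mfn G -> (0 < t)%R ->
  (forall x, Gk ^~ x @ \oo --> G x) ->
  mrea (dist G) t <= limn_einf (fun k => mrea (dist (Gk k)) t).
Proof.
move=> mGk mG t0 cG; have dG := dfun_dist mG; have dGk k := dfun_dist (mGk k).
have distle l : dist G l <= limn_einf (fun k => dist (Gk k) l).
  have iE (H : X -> R) : mfn H -> dist H l = \int[mu]_x (\1_[set x | (l < H x)%R] x)%:E.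
    by move=> mH; rewrite integral_indic ?setIT//; exact: measurable_above.
  have mI (H : X -> R) : mfn H -> measurable_fun [set: X] (fun x => (\1_[set x | (l < H x)%R] x)%:E : \bar R).
    by move=> mH; apply/measurable_EFinP; apply: measurable_indic; exact: measurable_above.
  rewrite iE//; under [X in _ <= limn_einf X]eq_fun do rewrite iE//.
  apply: le_trans (fatou mu _ _ _) => //; last by move=> k; exact: mI.
  apply: ge0_le_integral => //.
  - exact: mI.
  - apply: (eq_measurable_fun (fun x => - limn_esup (fun k => - (\1_[set x | (l < Gk k x)%R] x)%:E))).
      by move=> x _; rewrite limn_esupN oppeK.
    apply: measurableT_comp => //; apply: measurable_fun_limn_esup => k.
    by apply: measurableT_comp => //; exact: mI.
  - move=> x _; rewrite indicE; have [|_] := boolP (x \in _); last first.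
      by apply: (@limn_einf_ge _ _ _ 0%N) => k _; rewrite lee_fin.
    rewrite inE /= => lx.
    have : \forall k \near \oo, (l < Gk k x)%R by apply: cvgr_gt lx; exact: cG.
    move=> [N _ hN]; apply: (@limn_einf_ge _ _ _ N) => k Nk.
    by rewrite lee_fin indicE mem_set//; exact: hN.
have tE H : mfn H -> mrea (dist H) t = (t^-1)%:E * \int[leb]_(l in D) mine t%:E (dist H l).
  move=> mH; rewrite -mrea_mul//; last exact: dfun_dist.
  by rewrite muleA -EFinM mulVf ?mul1e ?gt_eqF.
have mM k : measurable_fun D (fun l => mine t%:E (dist (Gk k) l) : \bar R).
  by apply: measurable_funTS; exact: measurable_mint.
rewrite -(@lee_pmul2l _ t%:E) ?lte_fin// mrea_mul//.
apply: le_trans (_ : limn_einf (fun k => \int[leb]_(l in D) mine t%:E (dist (Gk k) l)) <= _).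
  apply: le_trans (fatou leb _ _ _) => //; last first.
    by move=> k l _; rewrite le_min lee_fin (ltW t0)/=; case: (dGk k) => ->.
  apply: ge0_le_integral => //.
  - by move=> l _; rewrite le_min lee_fin (ltW t0)/=; case: dG => ->.
  - by apply: measurable_funTS; exact: measurable_mint.
  - apply: (eq_measurable_fun (fun l => - limn_esup (fun k => - mine t%:E (dist (Gk k) l)))).
      by move=> x _; rewrite limn_esupN oppeK.
    apply: measurableT_comp => //; apply: measurable_fun_limn_esup => k.
    by apply: measurableT_comp => //; exact: mM.
  - move=> l _; apply: le_trans (mine_limn_einf _ _).
    by apply: le_min2 => //; exact: distle.
rewrite muleC -lee_pdivrMr//.
rewrite muleC limn_einfE_sup; rewrite -lee_pdivlMl ?invr_gt0// invrK.
apply: ge_ereal_sup => _ [n _ <-].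
rewrite muleC -lee_pdivrMr//; apply: (@limn_einf_ge _ _ _ n) => k nk.
rewrite tE// muleC; apply: lee_wpmul2l; first by rewrite lee_fin invr_ge0 ltW.
by apply: ereal_inf_lbound; exists k.
Qed.

(** Integrates G <= a + (G - a)_+ over [E] with a = G*(t). Through it the norm controls integrals
    over sets of known measure. *)
Lemma integral_le_mrea G (E : set X) t : mfn G -> (forall x, (0 <= G x)%R) ->
  measurable E -> (0 < t)%R -> mu E <= t%:E ->
  \int[mu]_(x in E) (G x)%:E <= t%:E * mrea (dist G) t.
Proof.
move=> mG G0 mE t0 Et; have dG := dfun_dist mG.
have [Goo|] := eqVneq (rea (dist G) t) +oo.
  have := rea_le_mrea (dist G) t0; rewrite Goo leye_eq => /eqP ->.
  by rewrite gt0_muley ?leey// lte_fin.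
rewrite -ltey => Gf.
have /fineK ra : rea (dist G) t \is a fin_num by rewrite ge0_fin_numE// rea_ge0.
move: ra; set a := fine _ => /esym ra.
have a0 : (0 <= a)%R by rewrite -lee_fin -ra rea_ge0.
apply: le_trans (excess_mul mG t0 ra).
have mx : measurable_fun [set: X] (fun x => (Num.max (G x - a) 0)%R%:E).
  by apply/measurable_EFinP; exact: mfn_excess.
have mx0 x : 0 <= (Num.max (G x - a) 0)%R%:E by rewrite lee_fin le_max lexx orbT.
apply: (@le_trans _ _ (\int[mu]_(x in E) (a%:E + (Num.max (G x - a) 0)%R%:E))).
  apply: ge0_le_integral => //.
  - by move=> x _; rewrite lee_fin.
  - by apply: measurable_funTS; exact/measurable_EFinP.
  - by apply: emeasurable_funD => //; exact: measurable_funTS.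
  - move=> x _; rewrite -EFinD lee_fin.
    have : (G x - a <= Num.max (G x - a) 0)%R by rewrite le_max lexx.
    lra.
rewrite ge0_integralD//; last exact: measurable_funTS.
apply: leeD.
  by rewrite integral_cst// muleC EFinM; apply: lee_wpmul2r; rewrite ?lee_fin.
by apply: ge0_subset_integral.
Qed.

End distribution.

(** * Mean values over boxes *)

Section area_mean.
Variable R : realType.
Local Open Scope ereal_scope.
Local Notation leb := (@lebesgue_measure R).
Local Notation MR := (measurableTypeR R).
Implicit Types (Phi : MR * MR -> \bar R) (phi : R -> R -> R) (u v : R -> R -> R).

(** [itg] takes the finite part of the integral, hence is 0 when the integral is infinite; the
    inequality survives in that case. *)
Lemma itg_le_integral a b (f : R -> R) : (forall x, 0 <= f x)%R ->
  (itg a b f)%:E <= \int[leb]_(x in `[a, b]) (f x)%:E.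
Proof.
move=> f0; rewrite /itg /Rintegral; set I := integral _ _ _.
have I0 : 0 <= I by apply: integral_ge0 => x _; rewrite lee_fin.
have [Ioo|] := eqVneq I +oo; first by rewrite Ioo leey.
by rewrite -ltey => Ifin; rewrite fineK// ge0_fin_numE.
Qed.

Lemma measurable_slice Phi s : measurable_fun [set: MR * MR] Phi ->
  measurable_fun [set: MR] (fun t => Phi (s, t)).
Proof. by move=> mP; apply: (measurableT_comp mP). Qed.

Definition mass Phi := \int[leb]_s \int[leb]_t Phi (s, t).

Lemma measurable_rot : measurable_fun [set: MR * MR] (fun st : MR * MR => (- st.2, st.1)%R : MR * MR).
Proof.
apply: measurable_fun_pair => /=; last exact: measurable_fst.
by apply: measurableT_comp => //; exact: measurable_snd.
Qed.

Lemma mass_rot Phi : measurable_fun [set: MR * MR] Phi -> (forall x, 0 <= Phi x) ->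
  mass (fun st => Phi (- st.2, st.1)%R) = mass Phi.
Proof.
move=> mP P0; rewrite /mass /=.
transitivity (\int[leb]_s \int[leb]_t Phi (t, s)).
  apply: eq_integral => s _.
  have := @lebesgue_affine R (-1) 0 (fun t => Phi (t, s)).
  move=> /(_ _ _ _)/wrap[].
  - by rewrite oppr_eq0 oner_eq0.
  - by apply: (measurableT_comp mP).
  - by [].
  by rewrite normrN1 invr1 mul1e => <-; apply: eq_integral => t _; rewrite mulN1r addr0.
by have := @fubini_tonelli _ _ MR MR R leb leb Phi mP P0; rewrite /fubini_F /fubini_G => ->.
Qed.

Definition square_cut rho phi (st : MR * MR) : \bar R :=
  if (`|st.1| <= rho)%R && (`|st.2| <= rho)%R then (phi st.1 st.2)%:E else 0.

Lemma cut_ge0 rho phi st : (forall x y, 0 <= phi x y)%R -> 0 <= square_cut rho phi st.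
Proof. by move=> p0; rewrite /square_cut; case: ifP => // _; rewrite lee_fin. Qed.

Lemma measurable_cut rho phi : measurable_fun [set: MR * MR] (fun st => phi st.1 st.2 : MR) ->
  measurable_fun [set: MR * MR] (square_cut rho phi).
Proof.
move=> mp; apply: measurable_fun_ifT.
- apply: measurable_and; apply: measurable_fun_ler => //.
  + by apply: measurableT_comp => //; exact: measurable_fst.
  + by apply: measurableT_comp => //; exact: measurable_snd.
- exact/measurable_EFinP.
- exact: measurable_cst.
Qed.

Lemma cut_qturn rho phi : square_cut rho (qturn phi) = (fun st => square_cut rho phi (- st.2, st.1)%R).
Proof. by apply/funext => -[s t]; rewrite /square_cut /= normrN andbC. Qed.

Lemma measurable_qturn phi : measurable_fun [set: MR * MR] (fun st => phi st.1 st.2 : MR) ->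
  measurable_fun [set: MR * MR] (fun st => qturn phi st.1 st.2 : MR).
Proof. by move=> mp; exact: (measurableT_comp mp measurable_rot). Qed.

(** The point [(s, s * t)] runs through the right-hand side of the square of half-width [s], and the
    substitution has slope [s]. *)
Lemma ray_le_slice rho s phi : (0 < s <= rho)%R ->
  measurable_fun [set: MR * MR] (fun st => phi st.1 st.2 : MR) -> (forall x y, 0 <= phi x y)%R ->
  s%:E * (itg (-1) 1 (fun t => phi s (s * t)%R))%:E <= \int[leb]_t square_cut rho phi (s, t).
Proof.
move=> /andP[s0 sr] mp p0.
have mC : measurable_fun [set: MR] (fun t => square_cut rho phi (s, t)).
  by apply: measurable_slice; exact: measurable_cut.
have C0 t : 0 <= square_cut rho phi (s, t) by exact: cut_ge0.
have := @lebesgue_affine R s 0 (fun t => square_cut rho phi (s, t)) (lt0r_neq0 s0) mC C0.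
rewrite gtr0_norm// => h.
have -> : \int[leb]_t square_cut rho phi (s, t) = s%:E * ((s^-1)%:E * \int[leb]_t square_cut rho phi (s, t)).
  by rewrite muleA -EFinM divff ?gt_eqF// mul1e.
rewrite -h.
apply: lee_wpmul2l; first by rewrite lee_fin ltW.
apply: le_trans (itg_le_integral _ _ _) _; first by move=> t; exact: p0.
have mCs : measurable_fun [set: MR] (fun t => square_cut rho phi (s, (s * t + 0)%R)).
  by apply: (measurableT_comp mC); exact: measurable_affine.
apply: (@le_trans _ _ (\int[leb]_(t in `[(-1)%R, 1%R]) square_cut rho phi (s, (s * t + 0)%R))); last first.
  by apply: ge0_subset_integral => //= t _; exact: C0.
apply: ge0_le_integral => //.
- by move=> t _; rewrite lee_fin.
- apply/measurable_funTS/measurable_EFinP.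
  apply: (measurableT_comp mp (_ : measurable_fun _ (fun t : MR => (s, s * t)%R : MR * MR))).
  by apply: measurable_fun_pair => //=; exact: measurable_funM.
- exact: measurable_funTS.
- move=> t; rewrite /= in_itv /= => ht; rewrite /square_cut /= addr0 normrM (gtr0_norm s0) sr /=.
  have t1 : (`|t| <= 1)%R by rewrite ler_norml.
  by rewrite (le_trans _ sr)// ler_piMr// ltW.
Qed.

Lemma measurable_slices f rho : measurable_fun [set: MR * MR] (fun st => f st.1 st.2 : MR) ->
  (forall x y, 0 <= f x y)%R -> measurable_fun [set: MR] (fun s => \int[leb]_t square_cut rho f (s, t)).
Proof.
move=> mf f0; apply: (@measurable_fun_fubini_tonelli_F _ _ _ _ _ leb); first exact: measurable_cut.
by move=> st; exact: cut_ge0.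
Qed.

Lemma slices_ge0 f rho s : (forall x y, 0 <= f x y)%R -> 0 <= \int[leb]_t square_cut rho f (s, t).
Proof. by move=> f0; apply: integral_ge0 => t _; exact: cut_ge0. Qed.

Lemma mass_ge0 f rho : (forall x y, 0 <= f x y)%R -> 0 <= mass (square_cut rho f).
Proof. by move=> f0; apply: integral_ge0 => s _; exact: slices_ge0. Qed.

(** Integrates the means over squares with respect to the half-width. On [[rho / 2, rho]] the factor
    [s] is at least [rho / 2], which gives [rho ^+ 2 * c / 2] in all. *)
Lemma slices_mass (I : seq nat) (f : nat -> R -> R -> R) (c : R) rho : (0 < rho)%R -> (0 <= c)%R ->
  (forall k, measurable_fun [set: MR * MR] (fun st => f k st.1 st.2 : MR)) ->
  (forall k x y, (0 <= f k x y)%R) ->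
  (forall s, (0 < s <= rho)%R -> (2 * c <= \sum_(k <- I) itg (-1) 1 (fun t => f k s (s * t)))%R) ->
  (rho ^+ 2 * c)%:E <= 2%:E * \sum_(k <- I) mass (square_cut rho (f k)).
Proof.
move=> r0 c0 mI I0 H.
have r20 : (0 < rho / 2)%R by exact: divr_gt0.
have h2 : (rho / 2 < rho)%R by rewrite ltr_pdivrMr// ltr_pMr// ltr1n.
have key s : (rho / 2 <= s <= rho)%R -> (rho * c)%:E <= \sum_(k <- I) \int[leb]_t square_cut rho (f k) (s, t).
  move=> /andP[rs sr]; have s0 : (0 < s)%R by exact: lt_le_trans rs.
  have hs : (0 < s <= rho)%R by rewrite s0.
  apply: (@le_trans _ _ (s * \sum_(k <- I) itg (-1) 1 (fun t => f k s (s * t)))%:E).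
    rewrite lee_fin; apply: le_trans (ler_wpM2l (ltW s0) (H s hs)).
    by rewrite mulrA ler_wpM2r// -ler_pdivrMr.
  rewrite big_distrr /= -sumEFin; apply: lee_sum => k _.
  by rewrite EFinM; exact: ray_le_slice.
have mS : measurable_fun [set: MR] (fun s => \sum_(k <- I) \int[leb]_t square_cut rho (f k) (s, t)).
  by apply: emeasurable_sum => k; exact: measurable_slices.
have S0 s : 0 <= \sum_(k <- I) \int[leb]_t square_cut rho (f k) (s, t).
  by apply: sume_ge0 => k _; exact: slices_ge0.
have : \int[leb]_(s in `[(rho / 2)%R, rho]) (rho * c)%:E <= \sum_(k <- I) mass (square_cut rho (f k)).
  apply: (@le_trans _ _ (\int[leb]_s \sum_(k <- I) \int[leb]_t square_cut rho (f k) (s, t))).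
    apply: (@le_trans _ _ (\int[leb]_(s in `[(rho / 2)%R, rho]) \sum_(k <- I) \int[leb]_t square_cut rho (f k) (s, t))).
      apply: ge0_le_integral => //.
      - by move=> s _; rewrite lee_fin mulr_ge0// ltW.
      - exact: measurable_funTS.
    by apply: ge0_subset_integral.
  rewrite ge0_integral_sum//; first by move=> k; exact: measurable_slices.
  by move=> k s _; exact: slices_ge0.
rewrite integral_cst//= lebesgue_measure_itv /= lte_fin h2 => h.
have := lee_wpmul2l (ltac:(rewrite lee_fin; exact: ler0n) : 0 <= 2%:E :> \bar R) h.
move=> /(le_trans _); apply.
by rewrite -EFinB -!EFinM lee_fin le_eqVlt; apply/orP; left; apply/eqP; field.
Qed.

Lemma mass_qturn f rho : measurable_fun [set: MR * MR] (fun st => f st.1 st.2 : MR) ->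
  (forall x y, 0 <= f x y)%R -> mass (square_cut rho (qturn f)) = mass (square_cut rho f).
Proof.
move=> mf f0; rewrite cut_qturn; apply: mass_rot; first exact: measurable_cut.
by move=> st; exact: cut_ge0.
Qed.

(** [slices_mass] for the four sides; quarter turns preserve the mass of the square, so the 8 is 2
    times four equal terms. *)
Lemma area_mean u v rho : (0 < rho)%R ->
  (forall x y, (`|x| <= rho)%R -> (`|y| <= rho)%R -> cr_at u v x y) ->
  measurable_fun [set: MR * MR] (fun st => abs2 u v st.1 st.2 : MR) ->
  (rho ^+ 2 * abs2 u v 0 0)%:E <= 8%:E * mass (square_cut rho (abs2 u v)).
Proof.
move=> r0 H mp.
have mean s : (0 < s <= rho)%R -> (2 * abs2 u v 0 0 <=
  \sum_(k <- iota 0 4) itg (-1) 1 (fun t => iter k (@qturn R) (abs2 u v) s (s * t)))%R.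
  move=> /andP[s0 sr]; rewrite !big_cons big_nil addr0 !addrA.
  have [cu cv] : cont2 u 0 0 /\ cont2 v 0 0 by apply: cr_cont2; apply: H; rewrite normr0 ltW.
  apply: square_mean => // x y hx hy _.
  by apply: H; [exact: le_trans hx sr|exact: le_trans hy sr].
have p0 : (forall x y, 0 <= abs2 u v x y)%R by move=> x y; exact: addr_ge0.
move: (abs2 u v) p0 mean mp => phi p0 mean mp {H}.
have I0 k x y : (0 <= iter k (@qturn R) phi x y)%R by elim: k x y => [|k ih] x y; [exact: p0|exact: ih].
have mI k : measurable_fun [set: MR * MR] (fun st => iter k (@qturn R) phi st.1 st.2 : MR).
  by elim: k => [//|k ih]; exact: measurable_qturn ih.
have MI k : mass (square_cut rho (iter k (@qturn R) phi)) = mass (square_cut rho phi).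
  by elim: k => [//|k ih]; rewrite iterS mass_qturn.
have := slices_mass r0 (p0 0 0)%R _ _ mean.
move=> /(_ mI I0); rewrite (eq_bigr (fun=> mass (square_cut rho phi))); last by move=> k _; exact: MI.
have m0 := mass_ge0 rho p0.
rewrite !big_cons big_nil /= => /le_trans; apply.
have -> : 8%:E = 2%:E * (1 + (1 + (1 + (1 + 0)))) :> \bar R.
  by rewrite -!EFinD -EFinM; congr EFin; ring.
by rewrite -muleA !ge0_muleDl ?mul1e ?mul0e// ?adde_ge0.
Qed.

End area_mean.

(** * Mean values in several variables, one complex coordinate at a time *)

Section iterated_mean.
Variable R : realType.
Local Open Scope ereal_scope.
Local Notation leb := (@lebesgue_measure R).
Local Notation MR := (measurableTypeR R).
Local Notation T n := (n.-tuple (measurableTypeR R)).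

Definition upd n (x : T n) (j : 'I_n) (s : R) : T n :=
  [tuple if i == j then s else tnth x i | i < n].

Definition inbox n rho (x0 x : T n) := [forall i, `|tnth x i - tnth x0 i| <= rho]%R.

Lemma measurable_inbox n rho (x0 : T n) : measurable [set x | inbox rho x0 x].
Proof.
have -> : [set x | inbox rho x0 x] = \bigcap_(i in [set: 'I_n])
    ((fun x : T n => tnth x i) @^-1` `[(tnth x0 i - rho)%R, (tnth x0 i + rho)%R]%classic).
  apply/seteqP; split => x /=.
    by move=> /forallP h i _ /=; rewrite in_itv /= -ler_distlC distrC; exact: h.
  move=> h; apply/forallP => i.
  by have := h i I; rewrite /= in_itv /= -ler_distlC distrC.
apply: fin_bigcap_measurable => // i _.
by rewrite -[X in measurable X]setTI; apply: measurable_tnth.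
Qed.

Lemma cons_tuple_inbox n rho a0 a (x0 x : T n) :
  inbox rho [tuple of a0 :: x0] [tuple of a :: x] = (`|a - a0| <= rho)%R && inbox rho x0 x.
Proof.
apply/forallP/andP => [h|[h /forallP h'] i].
  split; first exact: (h ord0).
  by apply/forallP => i; have := h (lift ord0 i); rewrite !tnthS.
by case: (unliftP ord0 i) => [j|] ->; rewrite ?tnthS ?tnth0.
Qed.

Lemma upd_cons0 n a s (x : T n) : upd [tuple of a :: x] ord0 s = [tuple of s :: x].
Proof.
apply: eq_from_tnth => i; rewrite tnth_mktuple.
by case: (unliftP ord0 i) => [j|] ->; rewrite ?eqxx ?tnth0// eq_sym (negbTE (neq_lift _ _)) !tnthS.
Qed.

Lemma upd_consS n a s (x : T n) j : upd [tuple of a :: x] (lift ord0 j) s = [tuple of a :: upd x j s].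
Proof.
apply: eq_from_tnth => i; rewrite tnth_mktuple.
case: (unliftP ord0 i) => [k|] ->; first by rewrite !tnthS tnth_mktuple (inj_eq lift_inj).
by rewrite (negbTE (neq_lift _ _)) !tnth0.
Qed.

Lemma measurable_cons2 n : measurable_fun [set: (MR * MR) * (T n * T n)]
  (fun u => ([tuple of u.1.1 :: u.2.1], [tuple of u.1.2 :: u.2.2]) : T n.+1 * T n.+1).
Proof.
have m11 : measurable_fun [set: (MR * MR) * (T n * T n)] (fun u => u.1.1).
  exact: (measurableT_comp measurable_fst measurable_fst).
have m12 : measurable_fun [set: (MR * MR) * (T n * T n)] (fun u => u.1.2).
  exact: (measurableT_comp measurable_snd measurable_fst).
have m21 : measurable_fun [set: (MR * MR) * (T n * T n)] (fun u => u.2.1).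
  exact: (measurableT_comp measurable_fst measurable_snd).
have m22 : measurable_fun [set: (MR * MR) * (T n * T n)] (fun u => u.2.2).
  exact: (measurableT_comp measurable_snd measurable_snd).
by apply: measurable_fun_pair => /=; exact: measurable_cons.
Qed.

Definition int2 n (F : T n * T n -> \bar R) := \int[ltm R n]_x \int[ltm R n]_y F (x, y).

Lemma int2S n (F : T n.+1 * T n.+1 -> \bar R) : measurable_fun [set: T n.+1 * T n.+1] F ->
  (forall u, 0 <= F u) ->
  int2 F = \int[leb]_a \int[leb]_b int2 (fun xy => F ([tuple of a :: xy.1], [tuple of b :: xy.2])).
Proof.
move=> mF F0; rewrite /int2.
have m1 : measurable_fun [set: T n.+1] (fun x => \int[ltm R n.+1]_y F (x, y)).
  exact: (@measurable_fun_fubini_tonelli_F _ _ _ _ _ (ltm R n.+1)).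
rewrite (ltmS_int m1); last by move=> x; exact: integral_ge0.
apply: eq_integral => a _.
have mG := measurableT_comp mF (@measurable_cons2 n).
transitivity (\int[ltm R n]_x \int[leb]_b \int[ltm R n]_y F ([tuple of a :: x], [tuple of b :: y])).
  apply: eq_integral => x _; rewrite (ltmS_int (f := fun y => F ([tuple of a :: x], y)))//.
  by apply: (measurableT_comp mF).
rewrite (@fubini_tonelli _ _ (T n) MR R (ltm R n) leb
  (fun u => \int[ltm R n]_y F ([tuple of a :: u.1], [tuple of u.2 :: y])))//.
- have := @measurable_fun_fubini_tonelli_F _ _ (T n * MR)%type (T n) R (ltm R n)
    (fun u => F ([tuple of a :: u.1.1], [tuple of u.1.2 :: u.2])).
  apply => //.
  have mh : measurable_fun [set: (T n * MR) * T n]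
      (fun u => ((a, u.1.2), (u.1.1, u.2)) : (MR * MR) * (T n * T n)).
    apply: measurable_fun_pair => /=; apply: measurable_fun_pair => //=.
    + exact: (measurableT_comp measurable_snd measurable_fst).
    + exact: (measurableT_comp measurable_fst measurable_fst).
  exact: (measurableT_comp mG mh).
- by move=> u; exact: integral_ge0.
Qed.

Definition cutbox n rho (x0 y0 : T n) (F : T n * T n -> \bar R) (u : T n * T n) : \bar R :=
  if inbox rho x0 u.1 && inbox rho y0 u.2 then F u else 0.

Lemma cutbox_ge0 n rho (x0 y0 : T n) F u : (forall u, 0 <= F u) -> 0 <= cutbox rho x0 y0 F u.
Proof. by move=> F0; rewrite /cutbox; case: ifP. Qed.

Lemma measurable_cutbox n rho (x0 y0 : T n) F : measurable_fun [set: T n * T n] F ->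
  measurable_fun [set: T n * T n] (cutbox rho x0 y0 F).
Proof.
move=> mF; apply: measurable_fun_ifT => //.
have mb (z0 : T n) : measurable_fun [set: T n] (inbox rho z0).
  apply: (measurable_fun_bool true); rewrite setTI; exact: measurable_inbox.
apply: measurable_and; first exact: (measurableT_comp (mb x0) measurable_fst).
exact: (measurableT_comp (mb y0) measurable_snd).
Qed.

Lemma iterated_scale_le (c : R) (K L : MR * MR -> \bar R) : (0 <= c)%R ->
  measurable_fun [set: MR * MR] K -> measurable_fun [set: MR * MR] L ->
  (forall ab, 0 <= K ab) -> (forall ab, c%:E * K ab <= L ab) ->
  c%:E * \int[leb]_a \int[leb]_b K (a, b) <= \int[leb]_a \int[leb]_b L (a, b).
Proof.
move=> c0 mK mL K0 KL.
have L0 ab : 0 <= L ab by apply: le_trans (KL ab); rewrite mule_ge0// lee_fin.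
have mK1 := @measurable_fun_fubini_tonelli_F _ _ _ _ _ leb _ mK K0.
have mL1 := @measurable_fun_fubini_tonelli_F _ _ _ _ _ leb _ mL L0.
have iK a : 0 <= \int[leb]_b K (a, b) by apply: integral_ge0 => b _; exact: K0.
rewrite -ge0_integralZl//.
apply: ge0_le_integral.
- by [].
- by move=> a _; rewrite mule_ge0 ?lee_fin// iK.
- by apply: emeasurable_funM => //; exact: mK1.
- exact: mL1.
move=> a _; rewrite -ge0_integralZl//; last by apply: (measurableT_comp mK).
apply: ge0_le_integral.
- by [].
- by move=> b _; rewrite mule_ge0 ?lee_fin// K0.
- by apply: emeasurable_funM => //; apply: (measurableT_comp mK).
- by apply: (measurableT_comp mL).
- by move=> b _; exact: KL.
Qed.

Lemma measurable_int2_cons n (C : T n.+1 * T n.+1 -> \bar R) :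
  measurable_fun [set: T n.+1 * T n.+1] C -> (forall u, 0 <= C u) ->
  measurable_fun [set: MR * MR] (fun ab : MR * MR =>
    int2 (fun xy : T n * T n => C ([tuple of ab.1 :: xy.1], [tuple of ab.2 :: xy.2]))).
Proof.
move=> mC C0; have mG := measurableT_comp mC (@measurable_cons2 n).
have m1 : measurable_fun [set: (MR * MR) * T n] (fun u => \int[ltm R n]_y
    C ([tuple of u.1.1 :: u.2], [tuple of u.1.2 :: y])).
  apply: (@measurable_fun_fubini_tonelli_F _ _ ((MR * MR) * T n)%type (T n) R (ltm R n)
    (fun u => C ([tuple of u.1.1.1 :: u.1.2], [tuple of u.1.1.2 :: u.2]))); last by move=> u; exact: C0.
  have mh : measurable_fun [set: ((MR * MR) * T n) * T n]
      (fun u => (u.1.1, (u.1.2, u.2)) : (MR * MR) * (T n * T n)).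
    apply: measurable_fun_pair => /=.
      exact: (measurableT_comp measurable_fst measurable_fst).
    apply: measurable_fun_pair => //=.
    exact: (measurableT_comp measurable_snd measurable_fst).
  exact: (measurableT_comp mG mh).
apply: (@measurable_fun_fubini_tonelli_F _ _ (MR * MR)%type (T n) R (ltm R n)
    (fun u => \int[ltm R n]_y C ([tuple of u.1.1 :: u.2], [tuple of u.1.2 :: y]))); first exact: m1.
by move=> u; apply: integral_ge0 => y _; exact: C0.
Qed.

Lemma measurable_cons_slice n (F : T n.+1 * T n.+1 -> \bar R) a b :
  measurable_fun [set: T n.+1 * T n.+1] F ->
  measurable_fun [set: T n * T n] (fun xy => F ([tuple of a :: xy.1], [tuple of b :: xy.2])).
Proof.
move=> mF; have mh : measurable_fun [set: T n * T n] (fun xy => ((a, b), xy) : (MR * MR) * (T n * T n)).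
  by apply: measurable_fun_pair.
exact: (measurableT_comp (measurableT_comp mF (@measurable_cons2 n)) mh).
Qed.

Lemma measurable_cons_cut n rho a0 b0 (x1 y1 : T n) (F : T n.+1 * T n.+1 -> \bar R) :
  measurable_fun [set: T n.+1 * T n.+1] F ->
  measurable_fun [set: MR * MR] (fun ab : MR * MR =>
    if (`|ab.1 - a0| <= rho)%R && (`|ab.2 - b0| <= rho)%R
    then F ([tuple of ab.1 :: x1], [tuple of ab.2 :: y1]) else 0).
Proof.
move=> mF; apply: measurable_fun_ifT; last exact: measurable_cst.
- apply: measurable_and; apply: measurable_fun_ler => //; apply: measurableT_comp => //;
    apply: measurable_funB => //.
- have mh : measurable_fun [set: MR * MR] (fun ab => (ab, (x1, y1)) : (MR * MR) * (T n * T n)).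
    by apply: measurable_fun_pair.
  exact: (measurableT_comp (measurableT_comp mF (@measurable_cons2 n)) mh).
Qed.

(** Induction on the number of coordinates: the mean in the first variable is taken with the others
    at the centre, and the induction hypothesis treats the others for each value of the first. The
    one-variable hypothesis is therefore asked only at points whose [j]-th coordinates are
    central. *)
Lemma iterated_mean n (c rho : R) (F : T n * T n -> \bar R) (x0 y0 : T n) :
  (0 <= c)%R -> (0 <= rho)%R -> measurable_fun [set: T n * T n] F -> (forall u, 0 <= F u) ->
  (forall j x y, inbox rho x0 x -> inbox rho y0 y -> tnth x j = tnth x0 j -> tnth y j = tnth y0 j ->
    c%:E * F (x, y) <= \int[leb]_s \int[leb]_t
      (if (`|s - tnth x0 j| <= rho)%R && (`|t - tnth y0 j| <= rho)%R
       then F (upd x j s, upd y j t) else 0)) ->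
  (c ^+ n)%:E * F (x0, y0) <= int2 (cutbox rho x0 y0 F).
Proof.
move=> c0 r0; elim: n F x0 y0 => [|n ih] F x0 y0 mF F0 H.
  rewrite expr0 mul1e /int2 ltm0_int; last 2 first.
  - apply: (@measurable_fun_fubini_tonelli_F _ _ _ _ _ (ltm R 0)); first exact: measurable_cutbox.
    by move=> u; exact: cutbox_ge0.
  - by move=> x; apply: integral_ge0 => y _; exact: cutbox_ge0.
  rewrite ltm0_int; last 2 first.
  - by apply: (measurableT_comp (measurable_cutbox _ _ _ mF)).
  - by move=> y; exact: cutbox_ge0.
  rewrite [x0]tuple0 [y0]tuple0 /cutbox /= ifT//.
  by apply/andP; split; apply/forallP => -[].
have mC := measurable_cutbox rho x0 y0 mF.
have C0 u : 0 <= cutbox rho x0 y0 F u by exact: cutbox_ge0.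
rewrite int2S//.
set a0 := thead x0; set b0 := thead y0.
pose x1 : T n := [tuple of behead x0]; pose y1 : T n := [tuple of behead y0].
have xE : x0 = [tuple of a0 :: x1] by exact: tuple_eta.
have yE : y0 = [tuple of b0 :: y1] by exact: tuple_eta.
have cn0 : (0 <= c ^+ n)%R by rewrite exprn_ge0.
pose K (ab : MR * MR) : \bar R :=
  if (`|ab.1 - a0| <= rho)%R && (`|ab.2 - b0| <= rho)%R
  then F ([tuple of ab.1 :: x1], [tuple of ab.2 :: y1]) else 0.
have K0 ab : 0 <= K ab by rewrite /K; case: ifP.
have mK : measurable_fun [set: MR * MR] K by exact: measurable_cons_cut.
have h0 : c%:E * F (x0, y0) <= \int[leb]_a \int[leb]_b K (a, b).
  have in0 (z : T n.+1) : inbox rho z z by apply/forallP => i; rewrite subrr normr0.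
  have := H ord0 x0 y0 (in0 _) (in0 _) erefl erefl.
  move=> /le_trans; apply; rewrite le_eqVlt; apply/orP; left; apply/eqP.
  apply: eq_integral => s _; apply: eq_integral => t _; rewrite /K /=.
  by rewrite [in upd x0 _ _]xE [in upd y0 _ _]yE !upd_cons0.
rewrite exprSr EFinM -muleA.
apply: le_trans (lee_wpmul2l _ h0) _; first by rewrite lee_fin.
have mL := measurable_int2_cons mC C0.
apply: (iterated_scale_le cn0 mK mL K0) => -[a b].
have I20 : 0 <= int2 (fun xy => cutbox rho x0 y0 F ([tuple of a :: xy.1], [tuple of b :: xy.2])).
  by apply: integral_ge0 => x _; apply: integral_ge0 => y _; exact: C0.
rewrite /K /=; case: ifPn => [/andP[ha hb]|_]; last by rewrite mule0.
apply: le_trans (ih (fun xy => F ([tuple of a :: xy.1], [tuple of b :: xy.2])) x1 y1 _ _ _) _.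
- exact: measurable_cons_slice.
- by move=> u; exact: F0.
- move=> j x y hx hy xj yj.
  have := H (lift ord0 j) [tuple of a :: x] [tuple of b :: y].
  rewrite {1}xE {1}yE !cons_tuple_inbox ha hb hx hy => /(_ isT isT).
  rewrite [in tnth x0 _]xE [in tnth y0 _]yE !tnthS => /(_ xj yj).
  under eq_integral do under eq_integral do rewrite !upd_consS.
  by [].
rewrite le_eqVlt; apply/orP; left; apply/eqP.
apply: eq_integral => x _; apply: eq_integral => y _; rewrite /cutbox /=.
by rewrite [in inbox _ x0]xE [in inbox _ y0]yE !cons_tuple_inbox ha hb.
Qed.

End iterated_mean.

(** * The measure on the tube domain *)

Section tube_measure.
Variable R : realType.
Variable n : nat.
Local Notation leb := (@lebesgue_measure R).
Local Notation MR := (measurableTypeR R).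
Local Notation T := (n.-tuple (measurableTypeR R)).
Implicit Types (Omega : set 'rV[R]_n) (P : mpoly.mpoly n R) (s : R).

Lemma rv_ball_coord (x y : 'rV[R]_n) e : 0 < e -> (forall j, `|x 0 j - y 0 j| < e) -> ball x e y.
Proof. by move=> e0 h; split => // i j; rewrite ord1; exact: h. Qed.

Lemma open_coord Omega (x : 'rV[R]_n) : open Omega -> Omega x ->
  exists2 e, 0 < e & forall y : 'rV[R]_n, (forall j, `|y 0 j - x 0 j| < e) -> Omega y.
Proof.
move=> oO Ox; have /nbhs_ballP[e /= e0 he] := open_nbhs_nbhs (conj oO Ox).
by exists e => // y hy; apply/he/rv_ball_coord => // j; rewrite distrC.
Qed.

Lemma coord_open Omega : (forall x : 'rV[R]_n, Omega x ->
  exists2 e, 0 < e & forall y : 'rV[R]_n, (forall j, `|y 0 j - x 0 j| < e) -> Omega y) -> open Omega.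
Proof.
move=> h; rewrite openE => x /h[e e0 H]; apply/nbhs_ballP; exists e => //= y [_ hy].
by apply: H => j; rewrite distrC; exact: hy.
Qed.

Lemma row_of_tupleE (y : T) j : row_of_tuple y 0 j = tnth y j.
Proof. by rewrite mxE. Qed.

Definition tuple_of_row (y : 'rV[R]_n) : T := [tuple y 0 j | j < n].

Lemma row_of_tupleK (y : 'rV[R]_n) : row_of_tuple (tuple_of_row y) = y.
Proof. by apply/rowP => j; rewrite mxE tnth_mktuple. Qed.

(** The sigma-algebra on tuples is generated by the coordinates, so an open set is exhibited as a
    countable union of open cubes with rational centre and radius 1 / (k + 1). *)
Lemma measurable_open_rows Omega : open Omega -> measurable [set y : T | Omega (row_of_tuple y)].
Proof.
move=> oO.
pose B (c : n.-tuple rat * nat) : set T :=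
  [set y | forall j, `|tnth y j - ratr (tnth c.1 j)| < c.2.+1%:R^-1].
have mB c : measurable (B c).
  have -> : B c = \bigcap_(j in [set: 'I_n]) ((fun y : T => tnth y j) @^-1`
      `](ratr (tnth c.1 j) - c.2.+1%:R^-1), (ratr (tnth c.1 j) + c.2.+1%:R^-1)[%classic).
    apply/seteqP; split => y /=.
      by move=> h j _ /=; rewrite in_itv /= -ltr_distlC distrC; exact: h.
    by move=> h j; have := h j I; rewrite /= in_itv /= -ltr_distlC distrC.
  apply: fin_bigcap_measurable => // i _.
  by rewrite -[X in measurable X]setTI; apply: measurable_tnth.
have -> : [set y : T | Omega (row_of_tuple y)] =
    \bigcup_(c in [set c | B c `<=` [set y : T | Omega (row_of_tuple y)]]) B c.
  apply/seteqP; split => [y /= Oy|y [c /= cO By]]; last exact: cO.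
  have [e e0 he] := open_coord oO Oy.
  have [k ke] : exists k : nat, k.+1%:R^-1 < e / 2.
    have := truncnS_gt (e / 2)^-1; set k := Num.truncn _ => hk; exists k.
    by rewrite -[ltRHS]invrK ltf_pV2 ?posrE ?invr_gt0 ?divr_gt0.
  have k0 : 0 < k.+1%:R^-1 :> R by rewrite invr_gt0.
  have qP j : exists q : rat, `|tnth y j - ratr q| < k.+1%:R^-1.
    have : tnth y j - k.+1%:R^-1 < tnth y j + k.+1%:R^-1 by rewrite ltrD2l gtrN.
    by move=> /rat_in_itvoo[q]; rewrite in_itv /= -ltr_distlC => hq; exists q.
  pose c : n.-tuple rat := [tuple sval (cid (qP j)) | j < n].
  have yc j : `|tnth y j - ratr (tnth c j)| < k.+1%:R^-1.
    by rewrite tnth_mktuple; case: cid.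
  exists (c, k) => //= z hz; apply: he => j; rewrite !mxE.
  have -> : tnth z j - tnth y j = (tnth z j - ratr (tnth c j)) - (tnth y j - ratr (tnth c j)) by ring.
  apply: le_lt_trans (ler_normB _ _) _; rewrite (splitr e); apply: ltrD.
    exact: lt_trans (hz j) ke.
  exact: lt_trans (yc j) ke.
rewrite bigcup_mkcond; apply: countable_bigcupT_measurable; first exact: countableP.
by move=> c; case: ifP.
Qed.

Lemma measurable_mpoly_eval P : measurable_fun [set: T] (fun y => mpoly_eval P (row_of_tuple y) : MR).
Proof.
rewrite /mpoly_eval; under eq_fun do rewrite mpoly.mevalE.
apply: measurable_sum => m; apply: measurable_funM; first exact: measurable_cst.
apply: measurable_prod => i _; under eq_fun do rewrite row_of_tupleE.
by apply: measurable_funX; exact: measurable_tnth.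
Qed.

Lemma Im_tube_point (w : T * T) : map_mx (@complex.Im R) (tube_point w) = row_of_tuple w.2.
Proof. by apply/rowP => j; rewrite !mxE. Qed.

Lemma tube_pointP Omega (w : T * T) : tube Omega (tube_point w) = Omega (row_of_tuple w.2).
Proof. by rewrite /tube /= Im_tube_point. Qed.

Definition tube_set Omega : set (T * T) := [set w | Omega (row_of_tuple w.2)].

Lemma measurable_tube_set Omega : open Omega -> measurable (tube_set Omega).
Proof.
move=> oO; rewrite (_ : tube_set Omega = setT `*` [set y : T | Omega (row_of_tuple y)]).
  by apply: measurableX => //; exact: measurable_open_rows.
by apply/seteqP; split => [w|w []].
Qed.

Definition weight P s (y : T) : \bar R := (mpoly_eval P (row_of_tuple y) `^ s)%:E.

Lemma weight_ge0 P s y : (0 <= weight P s y)%E.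
Proof. by rewrite lee_fin powR_ge0. Qed.

Lemma measurable_weight P s : measurable_fun [set: T] (weight P s).
Proof.
apply/measurable_EFinP; apply: (@measurableT_comp _ _ _ _ _ _ (fun x : MR => x `^ s)); first exact: measurable_powR.
exact: measurable_mpoly_eval.
Qed.

(** Density of the tube measure with respect to Lebesgue measure on all pairs of tuples. *)
Definition tweight Omega P s (w : T * T) : \bar R := ((fun w => weight P s w.2) \_ (tube_set Omega)) w.

Lemma tweight_ge0 Omega P s w : (0 <= tweight Omega P s w)%E.
Proof. by rewrite /tweight patchE; case: ifP => // _; exact: weight_ge0. Qed.

Lemma measurable_tweight Omega P s : open Omega -> measurable_fun [set: T * T] (tweight Omega P s).
Proof.
move=> oO; apply/(measurable_restrictT _ (measurable_tube_set oO)).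
by apply/measurable_funTS; apply: (measurableT_comp (measurable_weight P s)); exact: measurable_snd.
Qed.

Lemma lam2_package : exists m : {sigma_finite_measure set (T * T)%type -> \bar R},
  m = (ltm R n \x ltm R n)%E :> (set (T * T)%type -> \bar R).
Proof.
apply: sigma_finite_package => //; first exact: measure_semi_sigma_additive.
have /sigma_finiteP[F [FT ndF F1]] := sigma_finiteT (ltm R n).
exists (fun k => F k `*` F k).
  apply/seteqP; split => // w _.
  have : [set: T] w.1 by []; rewrite {1}FT => -[k _ Fk].
  have : [set: T] w.2 by []; rewrite {1}FT => -[l _ Fl].
  have ndF' i j : (i <= j)%N -> F i `<=` F j by move=> ij; apply/subsetPset/ndF.
  by exists (maxn k l) => //; split; [apply: ndF' Fk; exact: leq_maxl|apply: ndF' Fl; exact: leq_maxr].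
move=> k; have [mF Ff] := F1 k; split; first exact: measurableX.
by rewrite product_measure1E// lte_mul_pinfty// ge0_fin_numE.
Qed.

Definition lam2 : {sigma_finite_measure set (T * T)%type -> \bar R} := sval (cid lam2_package).

Lemma lam2E : lam2 = (ltm R n \x ltm R n)%E :> (set (T * T)%type -> \bar R).
Proof. exact: svalP (cid lam2_package). Qed.

Lemma lam2_int (F : T * T -> \bar R) : measurable_fun [set: T * T] F -> (forall w, 0 <= F w)%E ->
  (\int[lam2]_w F w = int2 F)%E.
Proof. by move=> mF F0; rewrite lam2E fubini_tonelli1. Qed.

Lemma tube_package Omega P s : open Omega ->
  exists m : {sigma_finite_measure set (T * T)%type -> \bar R},
    m = (fun A => \int[lam2]_(w in A) tweight Omega P s w)%E :> (set (T * T)%type -> \bar R).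
Proof.
move=> oO; have mw := measurable_tweight P s oO; have w0 := tweight_ge0 Omega P s.
apply: sigma_finite_package.
- by rewrite integral_set0.
- by move=> A; apply: integral_ge0 => w _; exact: w0.
- exact: semi_sigma_additive_nng_induced.
have /sigma_finiteP[F [FT ndF F1]] := sigma_finiteT lam2.
(* The density is finite but may be unbounded, so the exhausting sets are cut down to where it is at
   most [k]. *)
pose E k : set (T * T) := F k `&` [set w | (tweight Omega P s w <= k%:R%:E)%E].
have mE k : measurable (E k).
  have [mF _] := F1 k; apply: measurableI => //.
  rewrite -[X in measurable X]setTI; exact: emeasurable_fun_infty_c.
exists E.
  apply/seteqP; split => // w _.
  have : [set: T * T] w by []; rewrite {1}FT => -[k _ Fk].
  have [m hm] : exists m : nat, (tweight Omega P s w <= m%:R%:E)%E.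
    rewrite /tweight patchE; case: ifP => _; last by exists 0%N.
    by exists (Num.truncn (mpoly_eval P (row_of_tuple w.2) `^ s)).+1; rewrite lee_fin ltW// truncnS_gt.
  have ndF' i j : (i <= j)%N -> F i `<=` F j by move=> ij; apply/subsetPset/ndF.
  exists (maxn k m) => //; split.
  - by apply: ndF' Fk; exact: leq_maxl.
  - by apply: le_trans hm _; rewrite lee_fin ler_nat leq_maxr.
move=> k; split => //.
have [mF Ff] := F1 k.
apply: (@le_lt_trans _ _ (\int[lam2]_(w in E k) k%:R%:E)%E).
  by apply: ge0_le_integral => //; [exact: measurable_funTS|move=> w [_ ?]].
rewrite integral_cst// lte_mul_pinfty// ?lee_fin//.
by apply: le_lt_trans Ff; apply: le_measure; rewrite ?inE// => w [].
Qed.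

Definition tmu Omega P s (oO : open Omega) : {sigma_finite_measure set (T * T)%type -> \bar R} :=
  sval (cid (tube_package P s oO)).

Lemma tmuE Omega P s (oO : open Omega) A :
  tmu P s oO A = (\int[lam2]_(w in A) tweight Omega P s w)%E.
Proof. by have := svalP (cid (tube_package P s oO)); rewrite /tmu => ->. Qed.

(** Integration against a density, deduced from the values of the measure on sets: both sides are
    iterated integrals of the density over the region 0 <= l < G(w). *)
Lemma tmu_int Omega P s (oO : open Omega) (G : T * T -> R) : mfn G -> (forall w, 0 <= G w) ->
  (\int[tmu P s oO]_w (G w)%:E = \int[lam2]_w ((G w)%:E * tweight Omega P s w))%E.
Proof.
move=> mG G0; have mw := measurable_tweight P s oO; have w0 := tweight_ge0 Omega P s.
have -> : (\int[tmu P s oO]_w (G w)%:E = \int[tmu P s oO]_w (Num.max (G w - 0) 0)%:E)%E.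
  by apply: eq_integral => w _; rewrite subr0 max_l.
rewrite excess_dist//.
pose A : set ((T * T) * MR) := [set wl | 0 <= wl.2 /\ wl.2 < G wl.1].
have mA : measurable A.
  rewrite (_ : A = (snd @^-1` (`[0, +oo[%classic : set MR)) `&`
     [set wl : (T * T) * MR | ((EFin \o snd) wl < (EFin \o (G \o fst)) wl)%E]); last first.
    by apply/seteqP; split => -[u l] /=; rewrite !in_itv /= andbT lte_fin.
  apply: measurableI.
    by rewrite -[X in measurable X]setTI; apply: measurable_snd.
  rewrite -[X in measurable X]setTI; apply: measurable_lte => //.
    by apply/measurable_EFinP; exact: measurable_snd.
  by apply/measurable_EFinP; apply: (measurableT_comp mG); exact: measurable_fst.
pose K (wl : (T * T) * MR) : \bar R := ((\1_A wl)%:E * tweight Omega P s wl.1)%E.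
have mK : measurable_fun [set: (T * T) * MR] K.
  apply: emeasurable_funM; first by apply/measurable_EFinP; exact: measurable_indic.
  by apply: (measurableT_comp mw); exact: measurable_fst.
have K0 wl : (0 <= K wl)%E by rewrite mule_ge0// lee_fin.
have := @fubini_tonelli _ _ (T * T)%type MR R lam2 leb K mK K0.
rewrite /fubini_F /fubini_G.
have E1 w : (\int[leb]_l K (w, l) = (G w)%:E * tweight Omega P s w)%E.
  have -> : (fun l => K (w, l)) = (fun l => tweight Omega P s w * (\1_(`[0%R, G w[%classic) l)%:E)%E.
    apply/funext => l; rewrite /K muleC /= !indicE mem_setE in_itv /=; congr (_ * _%:R%:E)%E.
    have [/andP h|h] := boolP (0 <= l < G w); first by rewrite mem_set.
    by rewrite memNset// => -[/= al lG]; rewrite al lG in h.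
  rewrite ge0_integralZl//; last first.
    by apply/measurable_EFinP; exact: measurable_indic.
  rewrite integral_indic// setIT muleC; congr (_ * _)%E.
  transitivity (leb (`[0, G w[%classic : set R)); first by [].
  rewrite lebesgue_measure_itv /= lte_fin.
  by case: ltgtP (G0 w) => // [_ _|<- _//]; rewrite sube0.
have E2 l : (\int[lam2]_w K (w, l) = if (0 <= l)%R then dist (tmu P s oO) G l else 0)%E.
  case: ifPn => l0; last first.
    apply: integral0_eq => w _; rewrite /K indicE memNset ?mul0e// => -[/= h _].
    by rewrite h in l0.
  rewrite /dist tmuE [RHS]integral_mkcond; apply: eq_integral => w _.
  rewrite patchE /K indicE; case: ifPn => h.
    by rewrite mem_set ?mul1e//; split => //; rewrite inE in h.
  by rewrite memNset ?mul0e// => -[_ /= hl]; rewrite notin_setE in h.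
under eq_integral do rewrite E1.
under [X in _ = X -> _]eq_integral do rewrite E2.
move=> ->; rewrite [LHS]integral_mkcond; apply: eq_integral => l _.
by rewrite patchE mem_setE in_itv /= andbT.
Qed.

Lemma tube_measureE r Omega P nu (oO : open Omega) E :
  tube_measure r Omega P nu E = tmu P (nu - n%:R / r%:R) oO (@tube_point R n @^-1` E).
Proof.
rewrite tmuE; transitivity (\int[lam2]_(w in @tube_point R n @^-1` (tube Omega `&` E))
  weight P (nu - n%:R / r%:R) w.2)%E; first by rewrite lam2E /tube_measure -!ltmE.
rewrite /tweight -integral_mkcondr; congr integral.
by apply/seteqP; split => w /=; rewrite tube_pointP => -[].
Qed.

Definition modulus (f : 'rV[R[i]^o]_n -> R[i]^o) (w : T * T) : R := complex.Re `|f (tube_point w)|.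

Lemma modulus_ge0 f w : 0 <= modulus f w. Proof. exact: Re_norm_ge0. Qed.

Lemma distribution_tube r Omega P nu (oO : open Omega) f :
  distribution_function (tube_measure r Omega P nu) f = dist (tmu P (nu - n%:R / r%:R) oO) (modulus f).
Proof. by apply/funext => l; rewrite /distribution_function (tube_measureE _ _ _ oO). Qed.

Lemma rearrangement_tube r Omega P nu (oO : open Omega) f :
  rearrangement (tube_measure r Omega P nu) f = rea (dist (tmu P (nu - n%:R / r%:R) oO) (modulus f)).
Proof. by apply/funext => t; rewrite /rearrangement (distribution_tube _ _ _ oO). Qed.

Lemma maximal_tube r Omega P nu (oO : open Omega) f :
  maximal_rearrangement (tube_measure r Omega P nu) f =
  mrea (dist (tmu P (nu - n%:R / r%:R) oO) (modulus f)).
Proof. by apply/funext => t; rewrite /maximal_rearrangement (rearrangement_tube _ _ _ oO). Qed.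

Definition coord_measurable (f : 'rV[R[i]^o]_n -> R[i]^o) :=
  measurable_fun [set: T * T] (fun w => complex.Re (f (tube_point w)) : MR) /\
  measurable_fun [set: T * T] (fun w => complex.Im (f (tube_point w)) : MR).

Lemma tube_measurableT Omega f : open Omega -> (forall z, ~ tube Omega z -> f z = 0) ->
  tube_measurable Omega f <-> coord_measurable f.
Proof.
move=> oO f0; have -> : tube_measurable Omega f = (
    measurable_fun (tube_set Omega) (fun w : T * T => complex.Re (f (tube_point w)) : MR) /\
    measurable_fun (tube_set Omega) (fun w : T * T => complex.Im (f (tube_point w)) : MR)).
  rewrite /tube_measurable (_ : @tube_point R n @^-1` tube Omega = tube_set Omega)//.
  by apply/seteqP; split => w; rewrite /preimage /= tube_pointP.
have mT := measurable_tube_set oO.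
have key (g : R[i]^o -> R) : g 0 = 0 -> measurable_fun (tube_set Omega) (fun w : T * T => g (f (tube_point w)) : MR) <->
   measurable_fun [set: T * T] (fun w : T * T => g (f (tube_point w)) : MR).
  move=> g0; rewrite (measurable_restrictT _ mT).
  rewrite (_ : patch _ _ _ = (fun w : T * T => g (f (tube_point w)) : MR))//.
  apply/funext => w; rewrite patchE; case: ifPn => //; rewrite notin_setE => h.
  by rewrite f0// tube_pointP.
by split => -[h1 h2]; split; apply/key.
Qed.

Lemma mfn_modulus f : coord_measurable f -> mfn (modulus f).
Proof.
move=> [h1 h2]; rewrite /mfn (_ : modulus f = fun w => Num.sqrt
    (complex.Re (f (tube_point w)) ^+ 2 + complex.Im (f (tube_point w)) ^+ 2)); last first.
  by apply/funext => w; rewrite /modulus normc_def.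
apply: (measurableT_comp (continuous_measurable_fun (@sqrt_continuous R))).
by apply: measurable_funD; exact: measurable_funX.
Qed.

Lemma measurable_abs1 f : coord_measurable f ->
  measurable_fun [set: T * T] (fun w => abs1 (f (tube_point w)) : MR).
Proof. by move=> [h1 h2]; apply: measurable_funD; exact: measurableT_comp. Qed.

Lemma lorentz_finiteE r Omega P nu (oO : open Omega) (p q : \bar R) f : (1 <= q)%E ->
  lorentz_finite (tube_measure r Omega P nu) p q f <->
  (LN p q (rea (dist (tmu P (nu - n%:R / r%:R)%R oO) (modulus f))) < +oo)%E.
Proof.
move=> q1; rewrite /lorentz_finite /LN (rearrangement_tube _ _ _ oO).
case: q q1 => [a|//|//]; rewrite lee_fin => a1; split => h.
  by rewrite poweR_lty.
have a0 : 0 < a by exact: lt_le_trans a1.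
set I := lorentz_integral _ _ _ in h *.
have I0 : (0 <= I)%E.
  apply: integral_ge0 => t; rewrite /= in_itv /= andbT => t0.
  by rewrite mule_ge0 ?poweR_ge0// lee_fin invr_ge0 ltW.
have := I0; rewrite le_eqVlt => /predU1P[<-//|I1].
by rewrite ltey; apply/eqP => Ioo; move: h; rewrite Ioo poweRyr ?gt_eqF ?invr_gt0.
Qed.

Lemma lorentz_normE r Omega P nu (oO : open Omega) p q f :
  lorentz_norm (tube_measure r Omega P nu) p q f =
  LN p q (mrea (dist (tmu P (nu - n%:R / r%:R) oO) (modulus f))).
Proof. by rewrite /lorentz_norm /LN (maximal_tube _ _ _ oO). Qed.

End tube_measure.

(** * Point evaluations *)

Section point_evaluation.
Variables (R : realType) (n : nat).
Local Notation leb := (@lebesgue_measure R).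
Local Notation MR := (measurableTypeR R).
Local Notation T := (n.-tuple (measurableTypeR R)).
Local Open Scope complex_scope.
Implicit Types (Omega : set 'rV[R]_n) (f : 'rV[R[i]^o]_n -> R[i]^o).

Definition shift_coord (x : T) (j : 'I_n) (s : R) : T := upd x j (s + tnth x j).

Lemma tube_point_shift (x y : T) j s t :
  tube_point (shift_coord x j s, shift_coord y j t) =
  tube_point (x, y) + (s +i* t) *: (delta_mx 0 j : 'rV[R[i]^o]_n).
Proof.
have E (a b : R[i]) (c : bool) : (if c then b + a else a) = a + b * c%:R.
  by case: c; rewrite ?mulr1 ?mulr0 ?addr0// addrC.
apply/rowP => i; rewrite !mxE !tnth_mktuple eqxx /=.
transitivity (if i == j then (s +i* t) + (tnth x i +i* tnth y i) else tnth x i +i* tnth y i).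
  by case: eqP => [->|].
exact: E.
Qed.

Lemma measurable_shift_coord (x y : T) j : measurable_fun [set: MR * MR]
  (fun st : MR * MR => (shift_coord x j st.1, shift_coord y j st.2) : T * T).
Proof.
have m1 (z : T) : measurable_fun [set: MR] (fun s : MR => shift_coord z j s : T).
  apply/measurable_fun_tnthP => i; rewrite (_ : _ \o _ = fun s : MR => if i == j then s + tnth z j else tnth z i).
    by case: (i == j) => //; apply: measurable_funD.
  by apply/funext => s /=; rewrite tnth_mktuple.
apply: measurable_fun_pair => /=.
  exact: (measurableT_comp (m1 x) measurable_fst).
exact: (measurableT_comp (m1 y) measurable_snd).
Qed.

Lemma inbox_shift rho (x0 x : T) j s : inbox rho x0 x -> tnth x j = tnth x0 j -> `|s| <= rho ->
  inbox rho x0 (shift_coord x j s).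
Proof.
move=> /forallP hx xj hs; apply/forallP => i; rewrite tnth_mktuple; case: eqP => [->|_]; last exact: hx.
by rewrite xj addrK.
Qed.

Lemma mass_shift (F : T * T -> \bar R) (x y : T) j rho : measurable_fun [set: T * T] F -> (forall u, 0 <= F u)%E ->
  mass (fun st => if (`|st.1| <= rho)%R && (`|st.2| <= rho)%R
    then F (shift_coord x j st.1, shift_coord y j st.2) else 0)%E =
  (\int[leb]_s \int[leb]_t
      (if (`|s - tnth x j| <= rho)%R && (`|t - tnth y j| <= rho)%R
       then F (upd x j s, upd y j t) else 0))%E.
Proof.
move=> mF F0; pose K (st : MR * MR) : \bar R :=
  if (`|st.1 - tnth x j| <= rho)%R && (`|st.2 - tnth y j| <= rho)%R
  then F (upd x j st.1, upd y j st.2) else 0%E.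
have mK : measurable_fun [set: MR * MR] K.
  apply: measurable_fun_ifT => //.
    apply: measurable_and; apply: measurable_fun_ler => //; apply: measurableT_comp => //;
      apply: measurable_funB => //.
  apply: (measurableT_comp mF); have mb := measurable_shift_coord x y j.
  rewrite (_ : (fun _ => _) = (fun st : MR * MR => (shift_coord x j st.1, shift_coord y j st.2)) \o
    (fun st : MR * MR => (st.1 - tnth x j, st.2 - tnth y j) : MR * MR)).
    by apply: (measurableT_comp mb); apply: measurable_fun_pair; apply: measurable_funB.
  by apply/funext => -[s t]; rewrite /= /shift_coord !subrK.
have K0 st : (0 <= K st)%E by rewrite /K; case: ifP.
rewrite /mass.
have mK1 := @measurable_fun_fubini_tonelli_F _ _ _ _ _ leb _ mK K0.
have iK0 s : (0 <= \int[leb]_t K (s, t))%E by apply: integral_ge0 => t _; exact: K0.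
have := @lebesgue_affine R 1 (tnth x j) (fun s => \int[leb]_t K (s, t))%E (oner_neq0 _) mK1 iK0.
rewrite normr1 invr1 mul1e => h.
transitivity (\int[leb]_s \int[leb]_t K (s, t))%E; last exact: erefl.
rewrite -h; apply: eq_integral => s _.
have mKs : measurable_fun [set: MR] (fun t => K (1 * s + tnth x j, t)) by apply: (measurableT_comp mK).
have := @lebesgue_affine R 1 (tnth y j) (fun t => K (1 * s + tnth x j, t)) (oner_neq0 _) mKs (fun t => K0 _).
rewrite normr1 invr1 mul1e => <-; apply: eq_integral => t _.
by rewrite /K /= !mul1r !addrK.
Qed.

(** Each complex coordinate contributes one factor [rho ^+ 2 / 8] from [area_mean]. *)
Lemma box_mean Omega f rho (x0 y0 : T) : 0 < rho -> coord_measurable f ->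
  holomorphic_on (tube Omega) f ->
  (forall y : T, inbox rho y0 y -> Omega (row_of_tuple y)) ->
  (((rho ^+ 2 / 8) ^+ n)%:E * (abs1 (f (tube_point (x0, y0))))%:E <=
   \int[lam2 R n]_w cutbox rho x0 y0 (fun w => (abs1 (f (tube_point w)))%:E) w)%E.
Proof.
move=> r0 mf hf box.
have mF : measurable_fun [set: T * T] (fun w => (abs1 (f (tube_point w)))%:E).
  by apply/measurable_EFinP; exact: measurable_abs1.
have F0 w : (0 <= (abs1 (f (tube_point w)))%:E)%E by rewrite lee_fin abs1_ge0.
rewrite lam2_int; [|exact: measurable_cutbox|by move=> w; exact: cutbox_ge0].
apply: iterated_mean => //.
- by rewrite divr_ge0// exprn_ge0// ltW.
- exact: ltW.
move=> j x y hx hy xj yj; rewrite -xj -yj; have /= <- := mass_shift x y j rho mF F0.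
pose z := tube_point (x, y); pose w : 'rV[R[i]^o]_n := delta_mx 0 j.
pose u s t := complex.Re (f (z + (s +i* t) *: w)); pose v s t := complex.Im (f (z + (s +i* t) *: w)).
have E s t : abs2 u v s t = abs1 (f (tube_point (shift_coord x j s, shift_coord y j t))).
  by rewrite tube_point_shift.
have E0 : abs1 (f (tube_point (x, y))) = abs2 u v 0 0.
  by rewrite /abs2 /u /v [0 +i* 0](_ : _ = 0)// scale0r addr0.
rewrite {1}E0.
have := @area_mean R u v rho r0.
move=> /(_ _ _)/wrap[].
- move=> s t hs ht; have hz : tube Omega (z + (s +i* t) *: w).
    by rewrite -tube_point_shift tube_pointP /=; apply: box; exact: inbox_shift.
  have [h1 h2] := has_cdiff_line (differentiable_has_cdiff (hf _ hz)).
  by exists (complex.Re ('d f (z + (s +i* t) *: w) w)), (complex.Im ('d f (z + (s +i* t) *: w) w)).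
- under eq_fun do rewrite E.
  exact: (measurableT_comp (measurable_abs1 mf) (measurable_shift_coord x y j)).
rewrite -(@lee_pmul2l _ (8^-1)%:E) ?lte_fin// muleA -!EFinM mulVf// mul1e mulrA [_^-1 * _]mulrC => /le_trans.
apply; rewrite le_eqVlt; apply/orP; left; apply/eqP; congr mass.
by apply/funext => st; rewrite /square_cut E.
Qed.

Lemma measurable_box rho (x0 y0 : T) :
  measurable [set w : T * T | inbox rho x0 w.1 && inbox rho y0 w.2].
Proof.
rewrite (_ : [set w | _] = [set x | inbox rho x0 x] `*` [set y | inbox rho y0 y]).
  by apply: measurableX; exact: measurable_inbox.
by apply/seteqP; split => w /=; [move/andP|move=> [-> ->]].
Qed.

(** Lebesgue measure is replaced by the weighted one at the cost of a lower bound [d] for the weight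
    on the box; the factor 2 is the price of [abs1] against the modulus. *)
Lemma box_mean_tmu Omega P s (oO : open Omega) f rho (x0 y0 : T) (d tau : R) : 0 < rho -> 0 < d -> 0 < tau ->
  coord_measurable f -> holomorphic_on (tube Omega) f ->
  (forall y : T, inbox rho y0 y -> Omega (row_of_tuple y)) ->
  (forall y : T, inbox rho y0 y -> d <= mpoly_eval P (row_of_tuple y) `^ s) ->
  (tmu P s oO [set w | inbox rho x0 w.1 && inbox rho y0 w.2] <= tau%:E)%E ->
  (((rho ^+ 2 / 8) ^+ n * d * abs1 (f (tube_point (x0, y0))))%:E <=
   2%:E * (tau%:E * mrea (dist (tmu P s oO) (modulus f)) tau))%E.
Proof.
move=> r0 d0 tau0 mf hf box dP tauP; pose B := [set w : T * T | inbox rho x0 w.1 && inbox rho y0 w.2].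
have mB : measurable B by exact: measurable_box.
have mM := mfn_modulus mf.
have M0 w : 0 <= modulus f w by exact: modulus_ge0.
apply: (@le_trans _ _ (2%:E * \int[tmu P s oO]_(w in B) (modulus f w)%:E)%E); last first.
  by apply: lee_wpmul2l; [rewrite lee_fin ler0n|exact: integral_le_mrea].
have mMB : mfn (modulus f \_ B).
  by apply/(measurable_restrictT _ mB); exact: measurable_funTS.
have -> : (\int[tmu P s oO]_(w in B) (modulus f w)%:E = \int[tmu P s oO]_w ((modulus f \_ B) w)%:E)%E.
  by rewrite integral_mkcond; apply: eq_integral => w _; rewrite !patchE; case: ifP.
rewrite tmu_int//; last by move=> w; rewrite patchE; case: ifP.
have mw := measurable_tweight P s oO.
have mA : measurable_fun [set: T * T] (fun w => (abs1 (f (tube_point w)))%:E).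
  by apply/measurable_EFinP; exact: measurable_abs1.
have A0 w : (0 <= (abs1 (f (tube_point w)))%:E)%E by rewrite lee_fin abs1_ge0.
have mC := measurable_cutbox rho x0 y0 mA.
have C0 w : (0 <= cutbox rho x0 y0 (fun w => (abs1 (f (tube_point w)))%:E) w)%E by exact: cutbox_ge0.
have mW : measurable_fun [set: T * T] (fun w => ((modulus f \_ B) w)%:E * tweight Omega P s w)%E.
  by apply: emeasurable_funM => //; exact/measurable_EFinP.
have W0 w : (0 <= ((modulus f \_ B) w)%:E * tweight Omega P s w)%E.
  by rewrite mule_ge0 ?tweight_ge0// lee_fin patchE; case: ifP.
rewrite -ge0_integralZl//.
have := @box_mean Omega f rho x0 y0 r0 mf hf box.
move=> /(lee_wpmul2l (ltac:(rewrite lee_fin; exact: ltW) : (0 <= d%:E)%E)).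
rewrite -!EFinM mulrA [d * _]mulrC => /le_trans; apply.
rewrite -ge0_integralZl//; last by rewrite lee_fin ltW.
apply: ge0_le_integral.
- exact: measurableT.
- by move=> w _; rewrite mule_ge0// lee_fin ltW.
- by apply: emeasurable_funM.
- by apply: emeasurable_funM.
move=> w _; rewrite /cutbox; case: ifPn => wB; last by rewrite mule0 mule_ge0// lee_fin ler0n.
rewrite patchE mem_set// /tweight patchE mem_set; last by case/andP : wB => _ /box.
rewrite /weight -!EFinM lee_fin.
have a0 := abs1_ge0 (f (tube_point w)); have h2 := abs1_le_normc (f (tube_point w)).
have hd := dP w.2 (proj2 (andP wB)).
rewrite mulrA mulrC; apply: ler_pM => //; exact: ltW.
Qed.

End point_evaluation.

(** * Locally uniform bounds for point evaluations *)

Section local_bound.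
Variables (R : realType) (n : nat).
Local Notation leb := (@lebesgue_measure R).
Local Notation MR := (measurableTypeR R).
Local Notation T := (n.-tuple (measurableTypeR R)).
Implicit Types (Omega : set 'rV[R]_n) (f : 'rV[R[i]^o]_n -> R[i]^o) (P : mpoly.mpoly n R).

Definition coord_cont (g : 'rV[R]_n -> R) (y0 : 'rV[R]_n) := forall e, 0 < e -> exists2 d, 0 < d &
  forall y : 'rV[R]_n, (forall j, `|y 0 j - y0 0 j| <= d) -> `|g y - g y0| <= e.

Lemma coord_cont_cst c y0 : coord_cont (fun=> c) y0.
Proof. by move=> e e0; exists 1 => // y _; rewrite subrr normr0 ltW. Qed.

Lemma coord_cont_proj j y0 : coord_cont (fun y => y 0 j) y0.
Proof. by move=> e e0; exists e. Qed.

Lemma coord_contD g h y0 : coord_cont g y0 -> coord_cont h y0 -> coord_cont (fun y => g y + h y) y0.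
Proof.
move=> cg ch e e0; have e2 : 0 < e / 2 by rewrite divr_gt0.
have [d d0 hd] := cg _ e2; have [d' d'0 hd'] := ch _ e2.
exists (Num.min d d'); first by rewrite lt_min d0.
move=> y hy; rewrite opprD addrACA (splitr e); apply: le_trans (ler_normD _ _) _.
by apply: lerD; [apply: hd|apply: hd'] => j; apply: le_trans (hy j) _; rewrite ge_min lexx ?orbT.
Qed.

Lemma coord_contM g h y0 : coord_cont g y0 -> coord_cont h y0 -> coord_cont (fun y => g y * h y) y0.
Proof.
move=> cg ch e e0.
pose K := 1 + `|g y0| + `|h y0|; have K0 : 0 < K by rewrite /K -addrA ltr_pwDl// addr_ge0.
pose e' := Num.min 1 (e / (2 * K)); have e'0 : 0 < e' by rewrite lt_min ltr01 divr_gt0// mulr_gt0.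
have [d d0 hd] := cg _ e'0; have [d' d'0 hd'] := ch _ e'0.
exists (Num.min d d'); first by rewrite lt_min d0.
move=> y hy.
have hg : `|g y - g y0| <= e' by apply: hd => j; apply: le_trans (hy j) _; rewrite ge_min lexx.
have hh : `|h y - h y0| <= e' by apply: hd' => j; apply: le_trans (hy j) _; rewrite ge_min lexx orbT.
have -> : g y * h y - g y0 * h y0 = (g y - g y0) * h y + g y0 * (h y - h y0) by ring.
have e'1 : e' <= 1 by rewrite /e' ge_min lexx.
have e'K : e' * K <= e / 2.
  have : e' <= e / (2 * K) by rewrite /e' ge_min lexx orbT.
  rewrite -(ler_pM2r K0) => /le_trans; apply; rewrite le_eqVlt; apply/orP; left; apply/eqP.
  by field; rewrite gt_eqF.
have hy1 : `|h y| <= K.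
  rewrite -[h y](subrK (h y0)); apply: le_trans (ler_normD _ _) _.
  by rewrite /K lerD2r (le_trans hh)// (le_trans e'1)// lerDl.
have gy1 : `|g y0| <= K by rewrite /K addrAC lerDr addr_ge0.
apply: le_trans (ler_normD _ _) _; rewrite !normrM (splitr e); apply: lerD.
  by apply: le_trans e'K; apply: ler_pM.
by apply: le_trans e'K; rewrite mulrC; apply: ler_pM.
Qed.

Lemma mpoly_eval_cont P y0 : coord_cont (mpoly_eval P) y0.
Proof.
have : forall (k : mpoly.multinom n -> 'I_n -> nat) (s : seq (mpoly.multinom n)), coord_cont (fun y : 'rV[R]_n =>
    \sum_(m <- s) mpoly.mcoeff m P * \prod_i (y 0 i) ^+ k m i) y0.
  move=> k; elim=> [|m s ih].
    by move=> e e0; exists 1 => // y _; rewrite !big_nil subrr normr0 ltW.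
  move=> e e0; have : coord_cont (fun y => mpoly.mcoeff m P * \prod_i (y 0 i) ^+ k m i +
    \sum_(m <- s) mpoly.mcoeff m P * \prod_i (y 0 i) ^+ k m i) y0.
    apply: coord_contD ih; apply: coord_contM; first exact: coord_cont_cst.
    have cX i l : coord_cont (fun y => y 0 i ^+ l) y0.
      elim: l => [|l ihk]; first exact: coord_cont_cst.
      move=> e' e'0; have := coord_contM (coord_cont_proj i y0) ihk e'0.
      by move=> [d d0 hd]; exists d => // y hy; rewrite !exprS; exact: hd.
    have : forall r : seq 'I_n, coord_cont (fun y => \prod_(i <- r) y 0 i ^+ k m i) y0.
      elim=> [|i r ihr]; first by move=> e' e'0; exists 1 => // y _; rewrite !big_nil subrr normr0 ltW.
      move=> e' e'0; have := coord_contM (cX i (k m i)) ihr e'0.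
      by move=> [d d0 hd]; exists d => // y hy; rewrite !big_cons; exact: hd.
    exact.
  by move=> /(_ e e0)[d d0 hd]; exists d => // y hy; rewrite !big_cons; exact: hd.
move=> h e e0; have [d d0 hd] := h (fun m i => mpoly.fun_of_multinom m i) (mpoly.msupp P) e e0; exists d => // y hy.
Qed.

(** The exponent may have either sign, so both endpoint values enter each bound. *)
Lemma powR_between (a b x s : R) : 0 < a -> a <= x <= b ->
  Num.min (a `^ s) (b `^ s) <= x `^ s <= Num.max (a `^ s) (b `^ s).
Proof.
move=> a0 /andP[ax xb]; have x0 := lt_le_trans a0 ax; have b0 := lt_le_trans x0 xb.
have [s0|/ltW s0] := leP 0 s.
  have h1 : a `^ s <= x `^ s by rewrite ge0_ler_powR// nnegrE ltW.
  have h2 : x `^ s <= b `^ s by rewrite ge0_ler_powR// nnegrE ltW.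
  by rewrite ge_min h1 le_max h2 orbT.
have e y : 0 < y -> y `^ s = (y `^ (- s))^-1 by move=> y0; rewrite powRN invrK.
have s0' : 0 <= - s by rewrite oppr_ge0.
have h1 : a `^ (- s) <= x `^ (- s) by rewrite ge0_ler_powR// nnegrE ltW.
have h2 : x `^ (- s) <= b `^ (- s) by rewrite ge0_ler_powR// nnegrE ltW.
have k1 : x `^ s <= a `^ s by rewrite !e// lef_pV2 ?posrE ?powR_gt0.
have k2 : b `^ s <= x `^ s by rewrite !e// lef_pV2 ?posrE ?powR_gt0.
by rewrite ge_min k2 orbT le_max k1.
Qed.

Lemma ltm_inbox m rho (x0 : m.-tuple MR) : 0 <= rho ->
  ltm R m [set x | inbox rho x0 x] = ((2 * rho) ^+ m)%:E.
Proof.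
move=> r0; elim: m x0 => [|m ih] x0.
  have -> : [set x : 0.-tuple MR | inbox rho x0 x] = setT.
    by apply/seteqP; split => x // _; apply/forallP => -[].
  by rewrite ltmE /= diracT.
have mI k (z : k.-tuple MR) : measurable_fun [set: k.-tuple MR] (fun x => (\1_[set x | inbox rho z x] x)%:E : \bar R).
  by apply/measurable_EFinP; apply: measurable_indic; exact: measurable_inbox.
have iE k (z : k.-tuple MR) : ltm R k [set x | inbox rho z x] =
    (\int[ltm R k]_x (\1_[set x | inbox rho z x] x)%:E)%E.
  by rewrite integral_indic ?setIT//; exact: measurable_inbox.
rewrite iE (ltmS_int (mI _ _)); last by move=> x; rewrite lee_fin.
pose a0 := thead x0; pose x1 : m.-tuple MR := [tuple of behead x0].
have xE : x0 = [tuple of a0 :: x1] by exact: tuple_eta.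
transitivity (\int[leb]_a (((2 * rho) ^+ m)%:E * (\1_(`[a0 - rho, a0 + rho]%classic) a)%:E))%E.
  apply: eq_integral => a _; rewrite -(ih x1) iE muleC.
  have ha : a \in `[a0 - rho, a0 + rho] = (`|a - a0| <= rho).
    by rewrite in_itv /= -ler_distlC distrC.
  rewrite indicE mem_setE ha.
  have inE1 k (z z' : k.-tuple MR) : \1_[set x | inbox rho z x] z' = (inbox rho z z')%:R :> R.
    rewrite indicE; congr (_%:R); have [h|h] := boolP (inbox rho z z'); first by rewrite mem_set.
    by rewrite memNset//=; exact/negP.
  pose pt (y : m.-tuple MR) : m.+1.-tuple MR := [tuple of a :: y].
  have E y : \1_[set x | inbox rho x0 x] (pt y) = (`|a - a0| <= rho)%R%:R * \1_[set x | inbox rho x1 x] y :> R.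
    by rewrite !inE1 {1}xE cons_tuple_inbox -natrM mulnb.
  under eq_integral do rewrite E EFinM.
  rewrite ge0_integralZl; [by []|exact: measurableT|exact: mI| |by rewrite lee_fin].
  by move=> y _; rewrite lee_fin.
rewrite ge0_integralZl//; last 2 first.
- by apply/measurable_EFinP; exact: measurable_indic.
- by rewrite lee_fin exprn_ge0// mulr_ge0.
rewrite integral_indic// setIT.
transitivity (((2 * rho) ^+ m)%:E * leb (`[(a0 - rho)%R, (a0 + rho)%R]%classic : set R))%E; first by [].
rewrite lebesgue_measure_itv /= lte_fin.
case: ifPn => h.
  by rewrite -EFinB -EFinM exprSr; congr (_ * _)%:E; ring.
have -> : rho = 0 by apply/eqP; rewrite eq_le r0 andbT; move: h; rewrite -leNgt; lra.
by rewrite mulr0 mule0 expr0n /= .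
Qed.

Lemma lam2_box rho (x0 y0 : T) : 0 <= rho ->
  lam2 R n [set w | inbox rho x0 w.1 && inbox rho y0 w.2] = ((2 * rho) ^+ n * (2 * rho) ^+ n)%:E.
Proof.
move=> r0; rewrite (_ : [set w | _] = [set x | inbox rho x0 x] `*` [set y | inbox rho y0 y]).
  rewrite lam2E product_measure1E; [|exact: measurable_inbox|exact: measurable_inbox].
  by rewrite [X in (X * _)%E]ltm_inbox// [X in (_ * X)%E]ltm_inbox.
by apply/seteqP; split => w /=; [move/andP|move=> [-> ->]].
Qed.

Lemma tmu_box_le Omega P s (oO : open Omega) rho (x0 y0 : T) M : 0 <= rho -> 0 <= M ->
  (forall y : T, inbox rho y0 y -> Omega (row_of_tuple y) -> mpoly_eval P (row_of_tuple y) `^ s <= M) ->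
  (tmu P s oO [set w | inbox rho x0 w.1 && inbox rho y0 w.2] <=
   (M * ((2 * rho) ^+ n * (2 * rho) ^+ n))%:E)%E.
Proof.
move=> r0 M0 h; rewrite tmuE.
have mB := @measurable_box R n rho x0 y0.
apply: (@le_trans _ _ (\int[lam2 R n]_(w in [set w | inbox rho x0 w.1 && inbox rho y0 w.2]) M%:E)%E).
  apply: ge0_le_integral => //.
  - by move=> w _; exact: tweight_ge0.
  - by apply: measurable_funTS; exact: measurable_tweight.
  - move=> w /= /andP[_ hw]; rewrite /tweight patchE; case: ifPn => wO; last by rewrite lee_fin.
    by rewrite lee_fin; apply: h => //; rewrite inE in wO.
rewrite integral_cst// EFinM; apply: lee_wpmul2l; first by rewrite lee_fin.
by rewrite -(lam2_box x0 y0 r0).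
Qed.

Lemma inbox_row rho (y0 y : T) : inbox rho y0 y <->
  forall j, `|row_of_tuple y 0 j - row_of_tuple y0 0 j| <= rho.
Proof.
split=> [/forallP h j|h]; first by rewrite !row_of_tupleE.
by apply/forallP => j; have := h j; rewrite !row_of_tupleE.
Qed.

Lemma inbox_trans r1 r2 (x y z : T) : inbox r1 x y -> inbox r2 y z -> inbox (r1 + r2) x z.
Proof.
move=> /forallP h1 /forallP h2; apply/forallP => i.
have -> : tnth z i - tnth x i = (tnth z i - tnth y i) + (tnth y i - tnth x i) by ring.
by apply: le_trans (ler_normD _ _) _; rewrite addrC lerD.
Qed.

(** The box mean bounds f by a multiple of tau f**(tau), and [mrea_bound] bounds f**(tau) by the
    norm. The same constants serve every [x], since the weight depends on [y] alone, and every [y]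
    in a box about [y0]. *)
Lemma point_bound Omega P s (oO : open Omega) (p q : \bar R) (y0 : T) : (1 < p)%E -> (1 <= q)%E ->
  Omega (row_of_tuple y0) -> 0 < mpoly_eval P (row_of_tuple y0) ->
  exists rho C, [/\ 0 < rho, 0 <= C, forall y, inbox rho y0 y -> Omega (row_of_tuple y) &
    forall f, coord_measurable f -> holomorphic_on (tube Omega) f ->
    forall x y, inbox rho y0 y ->
    ((abs1 (f (tube_point (x, y))))%:E <= C%:E * LN p q (mrea (dist (tmu P s oO) (modulus f))))%E].
Proof.
move=> p1 q1 Oy Dy; set a := mpoly_eval P (row_of_tuple y0) in Dy.
have [d1 d10 h1] := open_coord oO Oy.
have a20 : 0 < a / 2 by rewrite divr_gt0.
have [d2 d20 h2] := mpoly_eval_cont P (row_of_tuple y0) a20.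
(* A box of radius [rho] about any point of the [rho]-box stays within distance [2 * rho] of [y0],
   where the cone condition holds and the determinant lies between [a / 2] and [2 * a]. *)
pose rho := Num.min (d1 / 3) (d2 / 2).
have r0 : 0 < rho by rewrite lt_min !divr_gt0.
have hO y : inbox (rho + rho) y0 y -> Omega (row_of_tuple y).
  move=> /inbox_row h; apply: h1 => j; apply: le_lt_trans (h j) _.
  have : rho <= d1 / 3 by rewrite ge_min lexx.
  lra.
have hD y : inbox (rho + rho) y0 y -> a / 2 <= mpoly_eval P (row_of_tuple y) <= 2 * a.
  move=> /inbox_row h; have : `|mpoly_eval P (row_of_tuple y) - a| <= a / 2.
    apply: h2 => j; apply: le_trans (h j) _.
    have : rho <= d2 / 2 by rewrite ge_min lexx orbT.
    lra.
  by rewrite ler_norml => /andP[]; lra.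
pose m := Num.min ((a / 2) `^ s) ((2 * a) `^ s); pose M := Num.max ((a / 2) `^ s) ((2 * a) `^ s).
have m0 : 0 < m by rewrite lt_min !powR_gt0 ?mulr_gt0.
have M0 : 0 < M by rewrite lt_max powR_gt0.
pose tau := M * ((2 * rho) ^+ n * (2 * rho) ^+ n).
have tau0 : 0 < tau by rewrite !mulr_gt0// exprn_gt0// mulr_gt0.
pose c := (rho ^+ 2 / 8) ^+ n * m.
have c0 : 0 < c by rewrite mulr_gt0// exprn_gt0// divr_gt0// exprn_gt0.
have in0 (y : T) : inbox rho y y by apply/forallP => j; rewrite subrr normr0 ltW.
pose w := tau `^ inv_exponent p; have w0 : 0 < w by rewrite powR_gt0.
(* Combines c |f| <= 2 tau f**(tau) with w f**(tau) <= 4 N, where N is the norm of f. *)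
exists rho, (8 * tau / (w * c)); split => //.
- by apply: ltW; rewrite divr_gt0// mulr_gt0.
- by move=> y hy; apply: hO; exact: inbox_trans hy (in0 y).
move=> f mf hf x y hy.
have := @box_mean_tmu R n Omega P s oO f rho x y m tau r0 m0 tau0 mf hf.
move=> /(_ _ _ _)/wrap[].
- by move=> y' hy'; apply: hO; exact: inbox_trans hy hy'.
- move=> y' hy'; have := powR_between s a20 (hD y' (inbox_trans hy hy')).
  by move=> /andP[].
- apply: tmu_box_le; rewrite ?ltW// => y' hy' _.
  by have := powR_between s a20 (hD y' (inbox_trans hy hy')) => /andP[].
rewrite -/c => h.
have hb := @mrea_bound R (dist (tmu P s oO) (modulus f)) p q tau p1 q1 tau0.
set X := mrea _ tau in h hb *; set N := LN _ _ _ in hb *.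
have -> : ((8 * tau / (w * c))%:E * N = (c^-1)%:E * (2%:E * (tau%:E * ((w^-1)%:E * (4%:E * N)))))%E.
  rewrite !muleA -!EFinM; congr (_%:E * _)%E; field; by rewrite !gt_eqF.
rewrite -(@lee_pmul2l _ c%:E) ?lte_fin// [leRHS]muleA -!EFinM mulfV ?gt_eqF// mul1e.
apply: (le_trans h); apply: lee_wpmul2l; first by rewrite lee_fin.
apply: lee_wpmul2l; first by rewrite lee_fin ltW.
by rewrite lee_pdivlMl.
Qed.

End local_bound.

(** * Completeness *)

Section sequential_banach.
Variables (R : realType) (V : lmodType R[i]) (A : set V) (N : V -> \bar R).
Local Open Scope complex_scope.
Hypotheses (A0 : A 0) (AL : forall a x y, A x -> A y -> A (a *: x + y)).
Hypotheses (N0 : forall x, A x -> (0 <= N x)%E) (Nfin : forall x, A x -> (N x < +oo)%E)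
  (ND : forall x y, A x -> A y -> (N (x + y) <= N x + N y)%E)
  (NZ : forall a x, A x -> (N (a *: x) = (complex.Re `|a|)%:E * N x)%E)
  (Ndef : forall x, A x -> N x = 0%E -> x = 0)
  (Ncomp : forall u : nat -> V, (forall k, A (u k)) ->
    (forall e, 0 < e -> exists K, forall k l, (K <= k)%N -> (K <= l)%N -> (N (u k - u l) <= e%:E)%E) ->
    exists2 v, A v & forall e, 0 < e -> exists K, forall k, (K <= k)%N -> (N (u k - v) <= e%:E)%E).

Definition in_space : {pred V} := fun x => `[< A x >].

Lemma in_spaceP x : reflect (A x) (x \in in_space).
Proof. exact: asboolP. Qed.

Lemma in_space_submod : submod_closed in_space.
Proof.
split; first exact/in_spaceP.
by move=> a x y /in_spaceP Ax /in_spaceP Ay; apply/in_spaceP; exact: AL.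
Qed.

#[local] HB.instance Definition _ := GRing.isSubmodClosed.Build R[i] V in_space in_space_submod.

(** The subset [A] as a type of its own, to carry a normed module structure over [R[i]]; its norm is
    the real number given by [N], embedded in [R[i]]. *)
Record space := Space { space_val : V; space_valP : space_val \in in_space }.

#[local] HB.instance Definition _ := [isSub for space_val].
#[local] HB.instance Definition _ := [Choice of space by <:].
#[local] HB.instance Definition _ := [SubChoice_isSubLmodule of space by <:].

Lemma space_in (x : space) : A (space_val x).
Proof. exact/in_spaceP/space_valP. Qed.

Lemma space_valB (x y : space) : space_val (x - y) = space_val x - space_val y.
Proof. exact: (raddfB (\val : space -> V)). Qed.

Lemma space_valZ a (x : space) : space_val (a *: x) = a *: space_val x.
Proof. exact: (linearZ_LR (\val : {linear space -> V}) a x). Qed.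

Definition space_norm (x : space) : R[i] := (fine (N (space_val x)))%:C.

Lemma space_normE (x : space) : N (space_val x) = (complex.Re (space_norm x))%:E.
Proof. by rewrite /space_norm /= fineK// ge0_fin_numE; [exact/Nfin/space_in|exact/N0/space_in]. Qed.

Lemma space_ler_normD (x y : space) : space_norm (x + y) <= space_norm x + space_norm y.
Proof.
have h := ND (space_in x) (space_in y); rewrite -(raddfD (\val : space -> V)) in h.
rewrite /space_norm -rmorphD lecR -lee_fin EFinD.
by have := h; rewrite !space_normE.
Qed.

Lemma space_normrZ (l : R[i]) (x : space) : space_norm (l *: x) = `|l| * space_norm x.
Proof.
have h := NZ l (space_in x); rewrite -space_valZ !space_normE -EFinM in h.
have {h} [h] := h; rewrite [RHS](_ : _ = (complex.Re `|l| * complex.Re (space_norm x))%:C).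
  by rewrite -h.
by rewrite rmorphM /= [in LHS]normcRe.
Qed.

Lemma space_normr0_eq0 (x : space) : space_norm x = 0 -> x = 0.
Proof.
move=> h; have x0 : space_val x = 0 by apply: Ndef; [exact: space_in|rewrite space_normE h].
by apply/val_inj; rewrite /= x0; exact/esym/(raddf0 (\val : space -> V)).
Qed.

#[local] HB.instance Definition _ := Lmodule_isNormed.Build R[i] space space_ler_normD space_normrZ space_normr0_eq0.

Lemma space_normRe (x : space) : `|x| = (complex.Re `|x|)%:C.
Proof. by []. Qed.

Lemma space_ball (x y : space) (e : R) : ball x e%:C y <-> complex.Re `|x - y| < e.
Proof. by rewrite -ball_normE /ball_ /= space_normRe ltcR. Qed.

(** A Cauchy filter contains balls of radius 2^-k. Any two of them meet, so their centres form a
    Cauchy sequence, and its limit is a limit of the filter. *)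
Lemma space_complete (F : set_system space) : ProperFilter F -> cauchy F -> cvg F.
Proof.
move=> FF /cauchyP Fc.
have /choice[u Hu] : forall k : nat, exists x : space, F (ball x (2^-1 ^+ k)%:C).
  by move=> k; apply: Fc; rewrite ltcR exprn_gt0// invr_gt0.
have small e : 0 < e -> exists K, forall k, (K <= k)%N -> (2^-1 : R) ^+ k < e.
  move=> e0; have : (GRing.exp (2^-1 : R)) @ \oo --> 0.
    by apply: cvg_expr; rewrite gtr0_norm ?invr_gt0// invf_lt1// ltr1n.
  move=> /cvgrPdist_lt/(_ e e0)[K _ HK]; exists K => k /HK.
  by rewrite /= sub0r normrN gtr0_norm// exprn_gt0// invr_gt0.
have tri (x y z : space) : complex.Re `|x - z| <= complex.Re `|x - y| + complex.Re `|y - z|.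
  have := ler_normD (x - y) (y - z); rewrite addrA subrK space_normRe [X in _ <= X + _]space_normRe.
  by rewrite [X in _ <= _ + X]space_normRe -rmorphD lecR.
have sym (x y : space) : complex.Re `|x - y| = complex.Re `|y - x| by rewrite distrC.
have NE (x y : space) : N (space_val x - space_val y) = (complex.Re `|x - y|)%:E.
  by rewrite -space_valB space_normE.
have [v Av Hv] : exists2 v : V, A v & forall e, 0 < e ->
    exists K, forall k, (K <= k)%N -> (N (space_val (u k) - v) <= e%:E)%E.
  apply: Ncomp => [k|e e0]; first exact: space_in.
  have [K HK] := small (e / 2) (divr_gt0 e0 (ltr0n R 2)).
  exists K => k l Kk Kl; rewrite NE lee_fin.
  have [z [/space_ball zk /space_ball zl]] := filter_ex (filterI (Hu k) (Hu l)).
  apply: le_trans (tri _ z _) _; rewrite (splitr e) (sym z).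
  by apply: lerD; apply: ltW; [exact: lt_trans zk (HK k Kk)|exact: lt_trans zl (HK l Kl)].
pose w := Space (introT (in_spaceP v) Av).
suff cw (e : R) : 0 < e -> F (ball w e%:C).
  by apply/cvg_ex; exists w; apply/cvg_ballP => e' /posc[E /cw]; rewrite -E.
move=> e0.
have e2 : 0 < e / 2 by rewrite divr_gt0.
have [K HK] := small _ e2; have [L HL] := Hv _ e2.
pose k := maxn K L; apply: filterS (Hu k) => z /space_ball zk.
apply/space_ball; apply: le_lt_trans (tri _ (u k) _) _; rewrite (splitr e).
apply: ler_ltD; last by apply: lt_trans zk _; apply: HK; exact: leq_maxl.
by have := HL k (leq_maxr _ _); rewrite -[v]/(space_val w) NE lee_fin sym.
Qed.

#[local] HB.instance Definition _ := Uniform_isComplete.Build space space_complete.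

Lemma sequential_banach : banach_space A N.
Proof.
exists (space : completeNormedModType R[i]), (\val : {linear space -> V}).
split; first exact: val_inj.
- apply/seteqP; split => [_ [x _ <-]|x Ax]; first exact: space_in.
  by exists (Space (introT (in_spaceP x) Ax)).
- by move=> b; rewrite [LHS]space_normE.
Qed.

End sequential_banach.

(** * The Bergman-Lorentz space as a Banach space *)

Section bergman_space.
Variables (R : realType) (n : nat).
Local Notation MR := (measurableTypeR R).
Local Notation T := (n.-tuple (measurableTypeR R)).
Local Notation FT := ('rV[R[i]^o]_n -> R[i]^o).
Variables (Omega : set 'rV[R]_n) (P : mpoly.mpoly n R) (s : R) (p q : \bar R).
Hypotheses (oO : open Omega) (P0 : forall y, Omega y -> 0 < mpoly_eval P y)
  (p1 : (1 < p)%E) (q1 : (1 <= q)%E).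
Local Notation mu := (tmu P s oO).
Implicit Types (f g : FT).
Local Open Scope complex_scope.

Definition bnorm f := LN p q (mrea (dist mu (modulus f))).

Definition bspace : set FT := [set f | [/\ forall z, ~ tube Omega z -> f z = 0,
  holomorphic_on (tube Omega) f, coord_measurable f & (bnorm f < +oo)%E]].

(** Membership is defined by f* and the norm by f**; Hardy's inequality makes the two finiteness
    conditions equivalent. *)
Lemma bergman_lorentzE r nu : nu - n%:R / r%:R = s ->
  bergman_lorentz r Omega P nu p q = bspace.
Proof.
move=> sE; apply/seteqP; split=> f [f0 hf mf Nf]; split => //.
- exact/(tube_measurableT oO f0).
- have {}mf := proj1 (tube_measurableT oO f0) mf.
  rewrite /bnorm LN_rea_fin//.
  by rewrite -sE; apply/lorentz_finiteE.
- exact/(tube_measurableT oO f0).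
- apply/(lorentz_finiteE _ _ _ oO) => //; rewrite sE.
  by rewrite -LN_rea_fin.
Qed.

Lemma modulusD f g w : modulus (f + g) w <= modulus f w + modulus g w.
Proof.
rewrite /modulus -lecR rmorphD /= -!normcRe; exact: ler_normD.
Qed.

Lemma modulusZ a f w : modulus (a *: f) w = complex.Re `|a| * modulus f w.
Proof.
rewrite /modulus; have : `|(a *: f) (tube_point w)| = `|a| * `|f (tube_point w)| :> R[i] by exact: normrM.
by rewrite normcRe [`|a|]normcRe [X in _ * X]normcRe -rmorphM => /complexI.
Qed.

Lemma coord_measurableD f g : coord_measurable f -> coord_measurable g -> coord_measurable (f + g).
Proof.
move=> [f1 f2] [g1 g2]; split.
  apply: (eq_measurable_fun (fun w => complex.Re (f (tube_point w)) + complex.Re (g (tube_point w)) : MR)).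
    by move=> w _ /=; rewrite -raddfD.
  exact: measurable_funD.
apply: (eq_measurable_fun (fun w => complex.Im (f (tube_point w)) + complex.Im (g (tube_point w)) : MR)).
  by move=> w _ /=; rewrite -raddfD.
exact: measurable_funD.
Qed.

Lemma ReM (a b : R[i]) : complex.Re (a * b) = complex.Re a * complex.Re b - complex.Im a * complex.Im b.
Proof. by case: a b => [? ?] [? ?]. Qed.

Lemma ImM (a b : R[i]) : complex.Im (a * b) = complex.Re a * complex.Im b + complex.Im a * complex.Re b.
Proof. by case: a b => [? ?] [? ?]. Qed.

Lemma coord_measurableZ a f : coord_measurable f -> coord_measurable (a *: f).
Proof.
move=> [f1 f2]; have mc (c : R) (h : T * T -> MR) : measurable_fun setT h -> measurable_fun setT (fun w => c * h w : MR).
  by move=> mh; apply: measurable_funM.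
split.
  apply: (eq_measurable_fun (fun w => complex.Re a * complex.Re (f (tube_point w)) -
      complex.Im a * complex.Im (f (tube_point w)) : MR)).
    by move=> w _ /=; rewrite [RHS]ReM.
  by apply: measurable_funB; exact: mc.
apply: (eq_measurable_fun (fun w => complex.Re a * complex.Im (f (tube_point w)) +
    complex.Im a * complex.Re (f (tube_point w)) : MR)).
  by move=> w _ /=; rewrite [RHS]ImM.
by apply: measurable_funD; exact: mc.
Qed.

Lemma bnorm_ge0 f : (0 <= bnorm f)%E.
Proof. by apply: LN_ge0 => t; exact: mrea_ge0. Qed.

Lemma mrea_fin f t : (bnorm f < +oo)%E -> 0 < t -> (mrea (dist mu (modulus f)) t < +oo)%E.
Proof.
move=> Nf t0; have := @mrea_bound R (dist mu (modulus f)) p q t p1 q1 t0.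
have w0 : 0 < t `^ inv_exponent p by rewrite powR_gt0.
rewrite -lee_pdivlMl// => /le_lt_trans; apply.
by rewrite lte_mul_pinfty ?lee_fin ?invr_ge0 ?ltW// lte_mul_pinfty.
Qed.

Lemma bnormD f g : coord_measurable f -> coord_measurable g -> (bnorm f < +oo)%E -> (bnorm g < +oo)%E ->
  (bnorm (f + g)%R <= bnorm f + bnorm g)%E.
Proof.
move=> mf mg Nf Ng; have m_f := mfn_modulus mf; have m_g := mfn_modulus mg.
have m_fg := mfn_modulus (coord_measurableD mf mg).
apply: le_trans (LN_add _ q1 _ _ _ _ _ _).
- apply: LN_mono => //.
  + exact: measurable_mrea.
  + by apply: emeasurable_funD; exact: measurable_mrea.
  + by move=> t; exact: mrea_ge0.
  + by move=> t t0; apply: mrea_subadditive => // w; exact: modulusD.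
- exact: measurable_mrea.
- exact: measurable_mrea.
- by move=> t; exact: mrea_ge0.
- by move=> t; exact: mrea_ge0.
- by move=> t; exact: mrea_fin.
- by move=> t; exact: mrea_fin.
Qed.

Lemma bnormZ a f : coord_measurable f -> (bnorm (a *: f)%R = (complex.Re `|a|%R)%:E * bnorm f)%E.
Proof.
move=> mf; rewrite /bnorm -LN_scale//; last 3 first.
- exact: Re_norm_ge0.
- exact: measurable_mrea.
- by move=> t; exact: mrea_ge0.
have -> : modulus (a *: f) = fun w => complex.Re `|a| * modulus f w.
  by apply/funext => w; exact: modulusZ.
apply/eqP; rewrite eq_le; apply/andP.
have mm := mfn_modulus mf.
have E t : 0 < t -> mrea (dist mu (fun w => complex.Re `|a| * modulus f w)) t =
    ((complex.Re `|a|)%:E * mrea (dist mu (modulus f)) t)%E.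
  by move=> t0; apply: mrea_scale => //; [exact: Re_norm_ge0|move=> w; exact: modulus_ge0].
have mM : measurable_fun (`]0, +oo[%classic : set MR) (fun t => (complex.Re `|a|)%:E * mrea (dist mu (modulus f)) t)%E.
  by apply: emeasurable_funM => //; exact: measurable_mrea.
have M0 t : 0 < t -> (0 <= (complex.Re `|a|)%:E * mrea (dist mu (modulus f)) t)%E.
  by move=> t0; rewrite mule_ge0 ?lee_fin ?Re_norm_ge0// mrea_ge0.
split; apply: LN_mono => //.
- exact: measurable_mrea.
- by move=> t; exact: mrea_ge0.
- by move=> t t0; rewrite E.
- exact: measurable_mrea.
- by move=> t t0; rewrite E.
Qed.

Lemma bspace0 : bspace 0.
Proof.
have m0 : coord_measurable (0 : FT) by split; exact: measurable_cst.
split; [by []|by move=> z _; exact: differentiable_cst|by []|].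
have := bnormZ 0 m0; rewrite scale0r => ->.
by rewrite normr0 mul0e ltry.
Qed.

Lemma bspace_linear a f g : bspace f -> bspace g -> bspace (a *: f + g).
Proof.
move=> [f0 hf mf Nf] [g0 hg mg Ng].
have maf := coord_measurableZ a mf.
have Naf : (bnorm (a *: f) < +oo)%E.
  rewrite (bnormZ a mf); apply: lte_mul_pinfty; [|by []|exact: Nf].
  by rewrite lee_fin Re_norm_ge0.
split.
- by move=> z hz; rewrite !fctE f0// g0// scaler0 addr0.
- by move=> z hz; apply: differentiableD; [apply: differentiableZ; exact: hf|exact: hg].
- exact: coord_measurableD.
- exact: le_lt_trans (bnormD maf mg Naf Ng) (lte_add_pinfty Naf Ng).
Qed.

Definition re_tuple (z : 'rV[R[i]^o]_n) : T := [tuple complex.Re (z 0 j) | j < n].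
Definition im_tuple (z : 'rV[R[i]^o]_n) : T := [tuple complex.Im (z 0 j) | j < n].

Lemma tube_pointK z : tube_point (re_tuple z, im_tuple z) = z.
Proof. by apply/rowP => j; rewrite !mxE !tnth_mktuple; case: (z 0 j). Qed.

Lemma point_bound_cbox z0 : tube Omega z0 -> exists rho C, [/\ 0 < rho, 0 <= C,
  forall z, cbox z0 rho z -> tube Omega z & forall f, coord_measurable f -> holomorphic_on (tube Omega) f ->
  forall z, cbox z0 rho z -> ((abs1 (f z))%:E <= C%:E * bnorm f)%E].
Proof.
move=> Oz; have := Oz; rewrite -{1}(tube_pointK z0) tube_pointP => Oy.
have [rho [C [r0 C0 hO hC]]] := point_bound s oO p1 q1 Oy (P0 Oy).
have inb z : cbox z0 rho z -> inbox rho (im_tuple z0) (im_tuple z).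
  move=> hz; apply/forallP => j; rewrite !tnth_mktuple; apply: le_trans (hz j).
  by rewrite /abs1 -raddfB lerDr.
exists rho, C; split => //.
  by move=> z /inb/hO; rewrite -(tube_pointK z) tube_pointP /= tube_pointK.
move=> f mf hf z /inb hz; have := hC f mf hf (re_tuple z) (im_tuple z) hz.
by rewrite tube_pointK.
Qed.

(** Values at single points are bounded by the norm, so the function vanishes everywhere and not
    merely almost everywhere. *)
Lemma bnorm_eq0 f : bspace f -> bnorm f = 0%E -> f = 0.
Proof.
move=> [f0 hf mf _] Nf; apply/funext => z.
have [hz|hz] := pselect (tube Omega z); last exact: f0.
have [rho [C [r0 C0 _ hC]]] := point_bound_cbox hz.
have := hC f mf hf z (cbox_center z (ltW r0)); rewrite Nf mule0 lee_fin => h.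
have {}h : abs1 (f z) = 0 by apply/eqP; rewrite eq_le h abs1_ge0.
by have := normc_le_abs1 (f z); rewrite h normr_le0 => /eqP.
Qed.

Lemma cauchy_le_cvg (u : nat -> R) (l : R) :
  (forall e, 0 < e -> exists K, forall k, (K <= k)%N -> `|u k - l| <= e) -> u @ \oo --> l.
Proof.
move=> h; apply/cvgrPdist_lt => e e0; have [K HK] := h _ (divr_gt0 e0 (ltr0n R 2)).
exists K => // k Kk; rewrite /= distrC; apply: le_lt_trans (HK k Kk) _.
by rewrite ltr_pdivrMr// ltr_pMr// ltr1n.
Qed.

Lemma Re_norm_dist (a b : R[i]) : `|complex.Re `|a| - complex.Re `|b| | <= abs1 (a - b).
Proof.
have key (x y : R[i]) : complex.Re `|x| - complex.Re `|y| <= abs1 (x - y).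
  rewrite lerBlDl; apply: (@le_trans _ _ (complex.Re `|y| + complex.Re `|x - y|)).
    have := ler_normD y (x - y); rewrite addrC subrK normcRe [X in _ <= X + _]normcRe.
    by rewrite [X in _ <= _ + X]normcRe -rmorphD lecR.
  by rewrite lerD2l Re_norm_le_abs1.
by rewrite ler_norml key andbT lerNl opprB -abs1N opprB key.
Qed.

Lemma bspace_complete (u : nat -> FT) : (forall k, bspace (u k)) ->
  (forall e, 0 < e -> exists K, forall k l, (K <= k)%N -> (K <= l)%N -> (bnorm (u k - u l)%R <= e%:E)%E) ->
  exists2 v, bspace v & forall e, 0 < e -> exists K, forall k, (K <= k)%N -> (bnorm (u k - v)%R <= e%:E)%E.
Proof.
move=> Au cu.
have AB k l : bspace (u k - u l).
  by rewrite addrC -scaleN1r; apply: bspace_linear.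
have loc z0 : tube Omega z0 -> exists rho, [/\ 0 < rho, forall z, cbox z0 rho z -> tube Omega z &
   forall e, 0 < e -> exists K, forall k l z, (K <= k)%N -> (K <= l)%N -> cbox z0 rho z ->
     abs1 (u k z - u l z) <= e].
  move=> /point_bound_cbox[rho [C [r0 C0 hO hC]]]; exists rho; split => // e e0.
  have C1 : 0 < C + 1 by rewrite ltr_wpDl.
  have [K HK] := cu _ (divr_gt0 e0 C1); exists K => k l z Kk Kl hz.
  have [_ hf mf _] := AB k l; have := hC _ mf hf z hz.
  move=> h; have := le_trans h (lee_wpmul2l (ltac:(rewrite lee_fin; exact: C0) : (0 <= C%:E)%E) (HK k l Kk Kl)).
  rewrite -EFinM lee_fin => /le_trans; apply.
  by rewrite mulrA ler_pdivrMr// mulrC ler_pM2l// lerDl.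
have /choice[v Hv] : forall z, exists l, forall e, 0 < e -> exists K, forall k, (K <= k)%N -> abs1 (u k z - l) <= e.
  move=> z; have [Oz|nOz] := pselect (tube Omega z); last first.
    exists 0 => e e0; exists 0%N => k _; have [-> //] := Au k.
    by rewrite subrr /abs1 /= normr0 addr0 ltW.
  have [rho [r0 _ h]] := loc z Oz; apply: complex_cauchy_limit => e e0.
  have [K HK] := h e e0; exists K => k l Kk Kl; apply: HK => //.
  exact: cbox_center (ltW r0).
have v0 z : ~ tube Omega z -> v z = 0.
  move=> nOz; have : abs1 (v z) <= 0.
    apply/ler_addgt0Pr => e e0; rewrite add0r; have [K HK] := Hv z e e0.
    by have := HK K (leqnn K); have [-> // _ _ _] := Au K; rewrite sub0r abs1N.
  move=> h; have := le_trans (normc_le_abs1 (v z)) (ltac:(rewrite lecR; exact: h) : (abs1 (v z))%:C <= 0%:C).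
  by rewrite normr_le0 => /eqP.
have hv : holomorphic_on (tube Omega) v.
  move=> z0 Oz; have [rho [r0 hO h]] := loc z0 Oz.
  apply: (@holomorphic_limit R n u v z0 rho r0).
    by move=> k w /hO Ow; have [_ hf _ _] := Au k; exact: hf.
  move=> e e0; have e2 : 0 < e / 2 by rewrite divr_gt0.
  have [K HK] := h _ e2; exists K => k w Kk hw.
  have [L HL] := Hv w _ e2; set l := maxn K L.
  have -> : u k w - v w = (u k w - u l w) + (u l w - v w) by rewrite addrA subrK.
  apply: le_trans (abs1D _ _) _; rewrite (splitr e); apply: lerD.
    by apply: HK => //; exact: leq_maxl.
  by apply: HL; exact: leq_maxr.
have reim (c : R[i]) : `|complex.Re c| <= abs1 c /\ `|complex.Im c| <= abs1 c.
  by rewrite /abs1 lerDl lerDr.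
have mv : coord_measurable v.
  split; [apply: (@measurable_fun_cvg _ _ _ _ (fun k w => complex.Re (u k (tube_point w)) : MR))|
          apply: (@measurable_fun_cvg _ _ _ _ (fun k w => complex.Im (u k (tube_point w)) : MR))].
  - by move=> k; have [_ _ [] ] := Au k.
  - move=> w _; apply: cauchy_le_cvg => e e0; have [K HK] := Hv (tube_point w) e e0.
    exists K => k Kk; apply: le_trans (HK k Kk); rewrite -raddfB; exact: (proj1 (reim _)).
  - by move=> k; have [_ _ [] ] := Au k.
  - move=> w _; apply: cauchy_le_cvg => e e0; have [K HK] := Hv (tube_point w) e e0.
    exists K => k Kk; apply: le_trans (HK k Kk); rewrite -raddfB; exact: (proj2 (reim _)).
have mB k : coord_measurable (u k - v).
  have [_ _ mk _] := Au k; rewrite -scaleN1r; apply: coord_measurableD => //.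
  exact: coord_measurableZ.
have lim e : 0 < e -> exists K, forall k, (K <= k)%N -> (bnorm (u k - v)%R <= e%:E)%E.
  move=> e0; have [K HK] := cu e e0; exists K => k Kk.
  (* For fixed [k], [u k - u (l + K)] tends pointwise to [u k - v] as [l] grows; the shift by [K]
     puts every term under the Cauchy bound [e]. *)
  apply: (@LN_fatou R p q (fun l => mrea (dist mu (modulus (u k - u (l + K)%N)))) (mrea (dist mu (modulus (u k - v)))) e%:E q1).
  - by rewrite lee_fin ltW.
  - by move=> l; exact: measurable_mrea.
  - exact: measurable_mrea.
  - by move=> t; exact: mrea_ge0.
  - by move=> l t; exact: mrea_ge0.
  - move=> t t0; apply: mrea_fatou => //.
    + by move=> l; have [_ _ mkl _] := AB k (l + K)%N; exact: mfn_modulus.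
    + exact: mfn_modulus.
    + move=> w; apply: cauchy_le_cvg => d d0; have [L HL] := Hv (tube_point w) d d0.
      exists L => l Ll; apply: le_trans (HL (l + K)%N (leq_trans Ll (leq_addr _ _))).
      rewrite /modulus -abs1N (_ : - (u (l + K)%N (tube_point w) - v (tube_point w)) =
        (u k - u (l + K)%N) (tube_point w) - (u k - v) (tube_point w)); last first.
        by rewrite !fctE opprB opprD opprK addrACA subrr add0r addrC.
      exact: Re_norm_dist.
  - by move=> l; apply: HK => //; rewrite leq_addl.
exists v => //; split => //.
have [K HK] := lim 1 ltr01; have BK := HK K (leqnn K).
have Nk : (bnorm (u K - v)%R < +oo)%E by apply: le_lt_trans BK _; rewrite ltry.
(* Finiteness of the norm of [v] is inherited from one member of the sequence. *)
have -> : v = (-1) *: (u K - v) + u K by rewrite scaleN1r opprB subrK.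
have [_ _ mK NK] := Au K.
have N1 : (bnorm ((-1) *: (u K - v))%R < +oo)%E.
  have := bnormZ (-1) (mB K); rewrite normrN1 [complex.Re 1]/= => ->; rewrite mul1e; exact: Nk.
exact: le_lt_trans (bnormD (coord_measurableZ (-1) (mB K)) mK N1 NK) (lte_add_pinfty N1 NK).
Qed.

Theorem bspace_banach : banach_space bspace bnorm.
Proof.
apply: sequential_banach.
- exact: bspace0.
- exact: bspace_linear.
- by move=> f _; exact: bnorm_ge0.
- by move=> f [].
- by move=> f g [_ _ mf Nf] [_ _ mg Ng]; exact: bnormD.
- by move=> a f [_ _ mf _]; exact: bnormZ.
- by move=> f; exact: bnorm_eq0.
- exact: bspace_complete.
Qed.

End bergman_space.

(** * Euclidean Jordan algebras *)

Section polarization.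
Variables (R : realType) (V : zmodType) (T : V -> V -> V -> R).

(** Inclusion-exclusion over [a + b + c], the three pairwise sums and [a], [b], [c] isolates the sum
    of [T] over the six orders of its arguments; symmetry in the first two pairs these terms. *)
Lemma polarize : (forall a a' b c, T (a + a') b c = T a b c + T a' b c) ->
  (forall a b b' c, T a (b + b') c = T a b c + T a b' c) ->
  (forall a b c c', T a b (c + c') = T a b c + T a b c') ->
  (forall a b c, T a b c = T b a c) -> (forall x, T x x x = 0) ->
  forall a b c, T a b c + T b c a + T c a b = 0.
Proof.
move=> T1 T2 T3 sym diag a b c.
have h := diag (a + b + c).
have hab := diag (a + b); have hbc := diag (b + c); have hac := diag (a + c).
have ha := diag a; have hb := diag b; have hc := diag c.
rewrite !(T1, T2, T3) in h hab hbc hac.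
have s1 := sym a b c; have s2 := sym b c a; have s3 := sym c a b.
clear - h hab hbc hac ha hb hc s1 s2 s3.
lra.
Qed.

End polarization.

Section jordan.
Variables (R : realType) (n : nat).
Local Notation V := 'rV[R]_n.
Variables (mul : V -> V -> V) (e : V) (ip : V -> V -> R).
Implicit Types (x y z u v w : V).
Hypotheses (mulL : forall a x y z, mul (a *: x + y) z = a *: mul x z + mul y z)
  (mulC : forall x y, mul x y = mul y x)
  (jordan : forall x y, mul (mul x x) (mul x y) = mul x (mul (mul x x) y))
  (mule : forall x, mul e x = x)
  (ipP : inner_product ip)
  (ipA : forall x y z, ip (mul x y) z = ip y (mul x z)).

Lemma jmulDl x y z : mul (x + y) z = mul x z + mul y z.
Proof. by have := mulL 1 x y z; rewrite !scale1r. Qed.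

Lemma jmul0v z : mul 0 z = 0.
Proof. by have := jmulDl 0 0 z; rewrite addr0 => /esym/eqP; rewrite -subr_eq0 addrK => /eqP. Qed.

Lemma jmulZl a x z : mul (a *: x) z = a *: mul x z.
Proof. by have := mulL a x 0 z; rewrite jmul0v !addr0. Qed.

Lemma jmulDr x y z : mul x (y + z) = mul x y + mul x z.
Proof. by rewrite mulC jmulDl !(mulC x). Qed.

Lemma jmulZr a x z : mul x (a *: z) = a *: mul x z.
Proof. by rewrite mulC jmulZl (mulC x). Qed.

Lemma jmulv0 x : mul x 0 = 0.
Proof. by rewrite mulC jmul0v. Qed.

Lemma jmulNl x y : mul (- x) y = - mul x y.
Proof. by rewrite -scaleN1r jmulZl scaleN1r. Qed.

Lemma jmulNr x y : mul x (- y) = - mul x y.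
Proof. by rewrite mulC jmulNl (mulC x). Qed.

Lemma mul_suml (I : Type) (r : seq I) (F : I -> V) z : mul (\sum_(i <- r) F i) z = \sum_(i <- r) mul (F i) z.
Proof. by elim: r => [|i r ih]; rewrite ?big_nil ?jmul0v// !big_cons jmulDl ih. Qed.

Lemma mul_sumr (I : Type) (r : seq I) (F : I -> V) z : mul z (\sum_(i <- r) F i) = \sum_(i <- r) mul z (F i).
Proof. by rewrite mulC mul_suml; apply: eq_bigr => i _; rewrite mulC. Qed.

(** Coordinatewise polarization of the Jordan identity, both sides of which are cubic in [x]. *)
Lemma linearized a b c y :
  mul (mul a b) (mul c y) + mul (mul b c) (mul a y) + mul (mul c a) (mul b y) =
  mul c (mul (mul a b) y) + mul a (mul (mul b c) y) + mul b (mul (mul c a) y).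
Proof.
apply/rowP => j.
pose T a b c : R := (mul (mul a b) (mul c y)) 0 j - (mul c (mul (mul a b) y)) 0 j.
have := @polarize R V T.
move=> /(_ _ _ _ _ _)/wrap[].
- by move=> a1 a2 b1 c1; rewrite /T !(jmulDl, jmulDr) !mxE; ring.
- by move=> a1 a2 b1 c1; rewrite /T !(jmulDl, jmulDr) !mxE; ring.
- by move=> a1 a2 b1 c1; rewrite /T !(jmulDl, jmulDr) !mxE; ring.
- by move=> a1 b1 c1; rewrite /T (mulC a1 b1).
- by move=> x; rewrite /T jordan subrr.
move=> /(_ a b c); rewrite /T !mxE; lra.
Qed.

(** The linearized identity read as one between multiplication operators, applied to [a]: L_{(bc)y}
    = L_{cy} L_b + L_{bc} L_y + L_{by} L_c - L_b L_y L_c - L_c L_y L_b. *)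
Lemma mul_mul_mul a b c y :
  mul (mul (mul b c) y) a = mul (mul c y) (mul b a) + mul (mul b c) (mul y a) + mul (mul b y) (mul c a)
    - mul b (mul y (mul c a)) - mul c (mul y (mul b a)).
Proof.
have := linearized a b c y.
rewrite (mulC (mul a b)) (mulC (mul c a)) (mulC (mul b c) y) (mulC (mul a b) y) (mulC (mul c a) y).
rewrite (mulC a b) (mulC a y) (mulC a (mul y (mul b c))).
by move=> /rowP h; apply/rowP => j; have := h j; rewrite !mxE; lra.
Qed.

Definition op_comm u v := forall w, mul u (mul v w) = mul v (mul u w).

Local Notation pow := (jordan_pow mul e).
Local Notation ev := (jordan_horner mul e).

(** By [mul_mul_mul], multiplication by x (x u) is a polynomial in the multiplications by x, x^2, u
    and x u, so an operator that commutes with these commutes with it. *)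
Lemma comm_step x u v k1 : k1 = mul x u -> op_comm x v -> op_comm (mul x x) v -> op_comm u v -> op_comm k1 v ->
  op_comm (mul x k1) v.
Proof.
move=> k1E cx cxx cu ck w.
have E a : mul (mul x k1) a = mul k1 (mul x a) + mul k1 (mul x a) + mul (mul x x) (mul u a)
    - mul x (mul x (mul u a)) - mul u (mul x (mul x a)).
  by have := mul_mul_mul a x u x; rewrite (mulC (mul x u) x) (mulC u x) -k1E.
by rewrite !E !(cx, cxx, cu, ck) !(jmulDr, jmulNr).
Qed.

Lemma comm_pow x k : op_comm (pow x k) x /\ op_comm (pow x k) (mul x x).
Proof.
have cxx : op_comm x (mul x x) by move=> w; rewrite jordan.
(* Two consecutive powers are carried along, because [comm_step] obtains the power k + 2 from k and
   k + 1. *)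
suff [] : (op_comm (pow x k) x /\ op_comm (pow x k) (mul x x)) /\
          (op_comm (pow x k.+1) x /\ op_comm (pow x k.+1) (mul x x)) by [].
elim: k => [|k [[h1 h2] [h3 h4]]].
  split; first by split=> w; rewrite /= !mule.
  by rewrite /jordan_pow /= mulC mule; split.
split=> //; split.
  by apply: (comm_step (u := pow x k)) => // w; rewrite jordan.
by apply: (comm_step (u := pow x k)).
Qed.

Lemma ev_widen x (p : {poly R}) N : (size p <= N)%N -> ev x p = \sum_(k < N) p`_k *: pow x k.
Proof.
move=> pN; rewrite /jordan_horner (big_ord_widen N (fun k => p`_k *: pow x k) pN).
rewrite big_mkcond /=; apply: eq_bigr => k _; case: ltnP => // kp.
by rewrite nth_default// scale0r.
Qed.

Lemma evL x (a : R) (p q : {poly R}) : ev x (a *: p + q) = a *: ev x p + ev x q.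
Proof.
pose N := maxn (size p) (size q).
have hp : (size p <= N)%N by exact: leq_maxl.
have hq : (size q <= N)%N by exact: leq_maxr.
have hpq : (size (a *: p + q)%R <= N)%N.
  apply: leq_trans (size_polyD _ _) _; rewrite geq_max hq andbT.
  exact: leq_trans (size_scale_leq _ _) hp.
rewrite (ev_widen x hp) (ev_widen x hq) (ev_widen x hpq) scaler_sumr -big_split /=.
by apply: eq_bigr => k _; rewrite coefD coefZ scalerDl scalerA.
Qed.

Lemma ev0 x : ev x 0 = 0.
Proof. by rewrite /jordan_horner size_poly0 big_ord0. Qed.

Lemma evD x (p q : {poly R}) : ev x (p + q) = ev x p + ev x q.
Proof. by have := evL x 1 p q; rewrite !scale1r. Qed.

Lemma evZ x a (p : {poly R}) : ev x (a *: p) = a *: ev x p.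
Proof. by have := evL x a p 0; rewrite ev0 !addr0. Qed.

Lemma evC x c : ev x c%:P = c *: e.
Proof. by rewrite (ev_widen x (size_polyC_leq1 c)) big_ord1 coefC /=. Qed.

Lemma evMX x (p : {poly R}) : ev x (p * 'X) = mul x (ev x p).
Proof.
have h : (size (p * 'X)%R <= (size p).+1)%N.
  by have [->|p0] := eqVneq p 0; [rewrite mul0r size_poly0|rewrite size_mulX].
rewrite (ev_widen x h) big_ord_recl coefMX /= scale0r add0r mul_sumr.
by apply: eq_bigr => k _; rewrite coefMX /= jmulZr.
Qed.

Lemma ev_comm x (p : {poly R}) : op_comm (ev x p) x.
Proof.
move=> w; rewrite !mul_suml mul_sumr; apply: eq_bigr => k _.
by rewrite !jmulZl jmulZr (proj1 (comm_pow x k)).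
Qed.

(** Multiplications by p(x) and by x commute ([ev_comm]), which replaces associativity in the
    induction on the degree. *)
Lemma evM x (p q : {poly R}) : ev x (p * q) = mul (ev x p) (ev x q).
Proof.
elim/poly_ind: q => [|q c ih]; first by rewrite mulr0 ev0 jmulv0.
rewrite mulrDr mulrA !evD !evMX ih evC jmulDr jmulZr (mulC _ e) mule -ev_comm.
by rewrite mulrC mul_polyC evZ.
Qed.

Lemma ip0l w : ip 0 w = 0.
Proof. by have [h _ _] := ipP; have := h 1 0 0 w; rewrite scale1r addr0 mul1r => /esym/eqP; rewrite -subr_eq0 addrK => /eqP. Qed.

Lemma ipDl u v w : ip (u + v) w = ip u w + ip v w.
Proof. by have [h _ _] := ipP; have := h 1 u v w; rewrite scale1r mul1r. Qed.

Lemma ipZl a u w : ip (a *: u) w = a * ip u w.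
Proof. by have [h _ _] := ipP; have := h a u 0 w; rewrite addr0 ip0l addr0. Qed.

Lemma ipC u v : ip u v = ip v u.
Proof. by have [_ h _] := ipP. Qed.

Lemma ipDr u v w : ip u (v + w) = ip u v + ip u w.
Proof. by rewrite ipC ipDl !(ipC u). Qed.

Lemma ipZr a u w : ip u (a *: w) = a * ip u w.
Proof. by rewrite ipC ipZl ipC. Qed.

Lemma ipNl u v : ip (- u) v = - ip u v.
Proof. by rewrite -scaleN1r ipZl mulN1r. Qed.

Lemma ipNr u v : ip u (- v) = - ip u v.
Proof. by rewrite ipC ipNl ipC. Qed.

Lemma ip_suml (I : Type) (r : seq I) (F : I -> V) w : ip (\sum_(i <- r) F i) w = \sum_(i <- r) ip (F i) w.
Proof. by elim: r => [|i r ih]; rewrite ?big_nil ?ip0l// !big_cons ipDl ih. Qed.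

Lemma ip_gt0 u : u != 0 -> 0 < ip u u.
Proof. by have [_ _ h] := ipP; exact: h. Qed.

Lemma ip_ge0 u : 0 <= ip u u.
Proof. by have [->|/ip_gt0/ltW//] := eqVneq u 0; rewrite ip0l. Qed.

Lemma ip_eq0 u : ip u u = 0 -> u = 0.
Proof. by move=> h; apply/eqP; apply: contraT => /ip_gt0; rewrite h ltxx. Qed.

Lemma minpoly_exists x : exists P, jordan_minpoly mul e x P.
Proof.
pose good k := `[< exists Q : {poly R}, [/\ Q != 0, ev x Q = 0 & size Q = k] >].
have ex : exists k, good k.
  pose A : 'M[R]_(n.+1, n) := \matrix_k pow x k.
  (* The first n + 1 powers are linearly dependent in dimension n. *)
  have : ~~ row_free A by rewrite /row_free neq_ltn ltnS rank_leq_col.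
  rewrite -kermx_eq0 => /rowV0Pn[u /sub_kermxP uA u0].
  pose Q := \poly_(k < n.+1) u 0 (inord k).
  exists (size Q); apply/asboolP; exists Q; split => //.
    apply: contra u0 => /eqP Q0; apply/eqP/rowP => j; rewrite mxE.
    have := congr1 (fun p : {poly R} => p`_j) Q0; rewrite coef_poly ltn_ord coef0.
    by rewrite inord_val.
  rewrite (ev_widen x (size_poly _ _)); transitivity (u *m A) => //.
  rewrite mulmx_sum_row; apply: eq_bigr => k _.
  by rewrite coef_poly ltn_ord inord_val rowK.
case: (ex_minnP ex) => k /asboolP[Q [Q0 evQ sQ]] min.
have l0 : lead_coef Q != 0 by rewrite lead_coef_eq0.
exists ((lead_coef Q)^-1 *: Q); split.
- by rewrite monicE lead_coefZ mulVf.
- by rewrite evZ evQ scaler0.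
- move=> S S0 evS; rewrite size_scale ?invr_neq0// sQ; apply: min; apply/asboolP.
  by exists S.
Qed.

Lemma size_quadratic (a b : R) : size (('X - a%:P) ^+ 2 + (b ^+ 2)%:P) = 3%N.
Proof.
have sd1 : size (('X - a%:P) ^+ 2) = 3%N by rewrite size_exp_XsubC.
by rewrite size_polyDl// sd1 (leq_ltn_trans (size_polyC_leq1 _)).
Qed.

(** The forbidden quadratic factor excludes double roots when [b = 0] and pairs of conjugate roots
    when [b] is nonzero. A complex root supplies the factor to split off. *)
Lemma split_real (p : {poly R}) : p \is monic ->
  (forall a b Q, p != Q * (('X - a%:P) ^+ 2 + (b ^+ 2)%:P)) ->
  exists2 s : seq R, uniq s & p = \prod_(l <- s) ('X - l%:P).
Proof.
move: {2}(size p) (leqnn (size p)) => N; elim: N p => [|N ih] p.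
  by rewrite leqn0 size_poly_eq0 => /eqP -> /monic_neq0; rewrite eqxx.
move=> pN mp nq; have [sp|sp] := leqP (size p) 1.
  exists [::] => //; rewrite big_nil.
  by move: mp; rewrite (size1_polyC sp) monicE lead_coefC => /eqP ->.
pose pc : {poly R[i]} := map_poly (real_complex R) p.
have spc : size pc != 1%N by rewrite size_map_poly gtn_eqF.
have [z zr] := closed_rootP pc spc.
have real_root a : root p a -> exists2 s : seq R, uniq s & p = \prod_(l <- s) ('X - l%:P).
  move=> /factor_theorem[Q pE].
  have mQ : Q \is monic by move: mp; rewrite pE monicMr// monicXsubC.
  have [||s us QE] := ih Q _ mQ.
  - by rewrite -ltnS; apply: leq_trans pN; rewrite pE size_Mmonic ?monicXsubC ?monic_neq0// size_XsubC addn2.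
  - move=> b c S; apply/negP => /eqP QE; have := nq b c (S * ('X - a%:P)).
    by rewrite pE QE mulrAC eqxx.
  exists (a :: s); last by rewrite big_cons pE QE mulrC.
  rewrite /= us andbT; apply/negP => sa.
  have : root Q a by rewrite QE root_prod_XsubC.
  move=> /factor_theorem[S SE]; have := nq a 0 S.
  by rewrite expr0n /= addr0 pE SE -mulrA -expr2 eqxx.
have [b0|b0] := eqVneq (complex.Im z) 0.
  apply: (real_root (complex.Re z)); move: zr; rewrite (_ : z = (real_complex R) (complex.Re z)).
    by rewrite /pc fmorph_root.
  by case: (z) b0 => [a b] /= ->.
set a := complex.Re z; set b := complex.Im z in b0.
pose d : {poly R} := ('X - a%:P) ^+ 2 + (b ^+ 2)%:P.
have sd : size d = 3%N by exact: size_quadratic.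
have d0 : d != 0 by rewrite -size_poly_eq0 sd.
have rE : p %% d = (p %% d)`_1 *: 'X + ((p %% d)`_0)%:P.
  have sr : (size (p %% d)%R <= 2)%N by rewrite -ltnS -sd ltn_modp.
  apply/polyP => -[|[|k]]; rewrite !coefE /= ?mulr0 ?add0r ?mulr1 ?addr0//.
  by rewrite nth_default// (leq_trans sr).
have zE : z = (real_complex R) a + 'i%C * (real_complex R) b.
  by rewrite [LHS]complexE /a /b; case: (z).
have dz : root (map_poly (real_complex R) d) z.
  rewrite /d rmorphD rmorphXn rmorphB /= map_polyX !map_polyC /=.
  rewrite rootE !hornerE /= zE.
  rewrite addrAC subrr add0r exprMn sqr_i mulN1r -rmorphXn /= addNr//.
have rz : root (map_poly (real_complex R) (p %% d)) z.
  have := divp_eq p d => E; move: zr; rewrite /pc {1}E rmorphD rmorphM /= !rootE hornerD hornerM.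
  by rewrite (eqP dz) mulr0 add0r.
have [r1 r0] : (p %% d)`_1 = 0 /\ (p %% d)`_0 = 0.
  move: rz; rewrite {1}rE rmorphD /= linearZ /= map_polyX map_polyC rootE !hornerE /=.
  rewrite [z]complexE -/a -/b eq_complex /= => /andP[].
  rewrite !(mul0r, mul1r, mulr0, subr0, add0r, addr0) => /eqP h1 /eqP h2.
  have r1 : (p %% d)`_1 = 0.
    by move: h2 => /eqP; rewrite mulf_eq0 (negbTE b0) orbF => /eqP.
  by move: h1; rewrite r1 mul0r add0r.
have := nq a b (p %/ d); rewrite -/d => /negP[]; apply/eqP.
by rewrite {1}(divp_eq p d) rE r1 r0 scale0r addr0 addr0.
Qed.

(** If P = Q ((X - a)^2 + b^2), then Q P is a sum of two squares of polynomials. The inner product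
    of p(x)^2 with [e] is the squared norm of p(x), so both squared polynomials vanish at [x], and
    (X - a) Q contradicts the minimality of P. *)
Lemma minpoly_splits x (P : {poly R}) : jordan_minpoly mul e x P ->
  exists2 s : seq R, uniq s & P = \prod_(l <- s) ('X - l%:P).
Proof.
move=> [mP evP min]; apply: split_real => // a b Q; apply/negP => /eqP PE.
have ipe (p : {poly R}) : ip (ev x (p * p)) e = ip (ev x p) (ev x p).
  by rewrite evM ipA mulC mule.
have E : Q * P = (('X - a%:P) * Q) * (('X - a%:P) * Q) + (b *: Q) * (b *: Q).
  rewrite PE -!mul_polyC; move: ('X - a%:P) => X; rewrite rmorphXn /=; ring.
have : ip (ev x (Q * P)) e = 0 by rewrite evM evP jmulv0 ip0l.
rewrite E evD ipDl !ipe => /eqP; rewrite paddr_eq0 ?ip_ge0// => /andP[/eqP/ip_eq0 h _].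
have P0 := monic_neq0 mP.
have Q0 : Q != 0 by apply: contra P0 => /eqP Q0; rewrite PE Q0 mul0r.
have XQ0 : ('X - a%:P) * Q != 0 by rewrite mulf_neq0// polyXsubC_eq0.
have := min _ XQ0 h; rewrite PE size_mul//; last by rewrite -size_poly_eq0 size_quadratic.
by rewrite size_quadratic size_mul ?polyXsubC_eq0// size_XsubC add2n addn3 /= ltnn.
Qed.

(** Lagrange interpolation polynomial of the node [l] among the nodes [s]. *)
Definition lagrange (s : seq R) (l : R) : {poly R} :=
  \prod_(m <- rem l s) ((l - m)^-1 *: ('X - m%:P)).

Lemma lagrange_eval (s : seq R) l m : uniq s -> l \in s -> m \in s ->
  (lagrange s l).[m] = (l == m)%:R.
Proof.
move=> us ls ms; rewrite /lagrange horner_prod; have [<-|lm] := eqVneq l m.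
  rewrite big1_seq// => k /andP[_ ]; rewrite mem_rem_uniq// inE /= => /andP[kl _].
  by rewrite hornerZ hornerXsubC mulVf// subr_eq0 eq_sym.
apply/eqP; rewrite prodf_seq_eq0; apply/hasP; exists m.
  by rewrite mem_rem_uniq// inE /= eq_sym lm.
by rewrite hornerZ hornerXsubC subrr mulr0 eqxx.
Qed.

Lemma size_lagrange (s : seq R) l : (size (lagrange s l) <= (size (rem l s)).+1)%N.
Proof.
rewrite /lagrange; elim: (rem l s) => [|m t ih]; first by rewrite big_nil size_poly1.
rewrite big_cons; apply: leq_trans (size_polyMleq _ _) _; rewrite -subn1 leq_subLR.
apply: leq_trans (leq_add (size_scale_leq _ _) ih) _.
by rewrite size_XsubC.
Qed.

Definition spectral_dec x (s : seq R) (c : R -> V) := [/\ uniq s,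
  jordan_minpoly mul e x (\prod_(l <- s) ('X - l%:P)),
  forall l m, l \in s -> m \in s -> mul (c l) (c m) = (l == m)%:R *: c l,
  forall l, l \in s -> c l != 0 & forall p : {poly R}, ev x p = \sum_(l <- s) p.[l] *: c l].

(** The idempotents are the Lagrange polynomials of the roots of the minimal polynomial, evaluated
    at [x]. Polynomials with equal values at the roots differ by a multiple of it, hence agree at
    [x]; a Lagrange polynomial has smaller degree, so its value at [x] is nonzero. *)
Lemma spectral x : exists s c, spectral_dec x s c.
Proof.
have [P mP] := minpoly_exists x; have [s us PE] := minpoly_splits mP.
exists s, (fun l => ev x (lagrange s l)).
have ev_vanish (p : {poly R}) : (forall l, l \in s -> p.[l] = 0) -> ev x p = 0.
  move=> pl; have : (P %| p)%R.
    rewrite PE; apply: uniq_roots_dvdp; first by apply/allP => l /pl; rewrite rootE => ->.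
    by rewrite uniq_rootsE.
  by move=> /dvdpP[q ->]; have [_ evP _] := mP; rewrite evM evP jmulv0.
have ev_eq (p q : {poly R}) : (forall l, l \in s -> p.[l] = q.[l]) -> ev x p = ev x q.
  move=> pq; apply/eqP; rewrite -subr_eq0 -scaleN1r addrC -evL; apply/eqP/ev_vanish => l ls.
  by rewrite !hornerE pq// mulN1r addNr.
have evS (p : {poly R}) : ev x p = \sum_(l <- s) p.[l] *: ev x (lagrange s l).
  rewrite (ev_eq _ (\sum_(l <- s) p.[l] *: lagrange s l)).
    move: (lagrange s) => F; elim: (s) => [|l t ih]; first by rewrite !big_nil ev0.
    by rewrite !big_cons evL ih.
  move=> m ms; rewrite horner_sum (bigD1_seq m)//= hornerZ lagrange_eval// eqxx mulr1.
  rewrite big1_seq ?addr0// => l /andP[lm ls].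
  by rewrite hornerZ lagrange_eval// (negbTE lm) mulr0.
split => //.
- by rewrite -PE.
- move=> l m ls ms; rewrite -evM -evZ; apply: ev_eq => k ks.
  rewrite hornerM hornerZ !lagrange_eval//.
  have [lm|lm] := eqVneq l m; first by rewrite lm mul1r; case: (m == k); rewrite ?mulr1 ?mulr0.
  rewrite mul0r; have [lk|lk] := eqVneq l k; last by rewrite mul0r.
  by rewrite -lk eq_sym (negbTE lm) mulr0.
- move=> l ls; apply/negP => /eqP c0.
  have L0 : lagrange s l != 0.
    by apply/eqP => L0; have := lagrange_eval us ls ls; rewrite L0 horner0 eqxx => /eqP; rewrite eq_sym oner_eq0.
  have [_ _ min] := mP; have := min _ L0 c0; rewrite PE size_prod_XsubC.
  have := size_lagrange s l; rewrite size_rem// prednK; last by case: (s) ls.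
  by move=> /leq_ltn_trans h /h; rewrite ltnn.
Qed.

(* The operator L of multiplication by c satisfies 2 L^3 - 3 L^2 + L = 0, hence
   L = L^2 + 4 (L - L^2)^2. *)
Lemma idempotent_psd c w : mul c c = c -> 0 <= ip (mul c w) w.
Proof.
move=> cc; set L := mul c.
have E a : L a = L (L a) + L (L a) + L (L a) - L (L (L a)) - L (L (L a)).
  by have := mul_mul_mul a c c c; rewrite !cc.
have sy u v : ip (L u) v = ip u (L v) by rewrite ipA.
have E3 := congr1 (fun v => ip v w) (E w).
have E4 := congr1 (fun v => ip v w) (E (L w)).
rewrite /= !(ipDl, ipNl) in E3 E4.
have h1 := ip_ge0 (L w); have h2 := ip_ge0 (L w - L (L w)).
rewrite !(ipDl, ipNl, ipDr, ipNr) in h2.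
rewrite !sy in h1 h2 E3 E4 *; move: h1 h2 E3 E4.
move: (ip w (L w)) (ip w (L (L w))) (ip w (L (L (L w)))) (ip w (L (L (L (L w))))) => a1 a2 a3 a4.
by move=> h1 h2 E3 E4; lra.
Qed.

Lemma sum_idempotents x s c : spectral_dec x s c -> \sum_(l <- s) c l = e.
Proof.
move=> [us _ _ _ evS]; have := evS 1; rewrite -[1]/(1%:P) evC scale1r => ->.
by apply: eq_bigr => l _; rewrite hornerC scale1r.
Qed.

Lemma spectral_sum x s c : spectral_dec x s c -> x = \sum_(l <- s) l *: c l.
Proof.
move=> [us _ _ _ evS]; have := evS 'X; rewrite -[X in ev x X]mul1r evMX -[1]/(1%:P) evC scale1r mulC mule => {1}->.
by apply: eq_bigr => l _; rewrite hornerX.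
Qed.

Definition qf x w := ip (mul x w) w.

Lemma qfD x y w : qf (x + y) w = qf x w + qf y w.
Proof. by rewrite /qf jmulDl ipDl. Qed.

Lemma qfZ a x w : qf (a *: x) w = a * qf x w.
Proof. by rewrite /qf jmulZl ipZl. Qed.

Lemma qfN x w : qf (- x) w = - qf x w.
Proof. by rewrite -scaleN1r qfZ mulN1r. Qed.

Lemma qfe w : qf e w = ip w w.
Proof. by rewrite /qf mule. Qed.

Lemma qf_sum (s : seq R) (F : R -> V) w : qf (\sum_(l <- s) F l) w = \sum_(l <- s) qf (F l) w.
Proof. by rewrite /qf mul_suml ip_suml. Qed.

Lemma qf_spectral x s c w (p : {poly R}) : spectral_dec x s c ->
  qf (ev x p) w = \sum_(l <- s) p.[l] * qf (c l) w.
Proof. by move=> [_ _ _ _ ->]; rewrite qf_sum; apply: eq_bigr => l _; rewrite qfZ. Qed.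

Lemma qf_idempotent_ge0 x s c l w : spectral_dec x s c -> l \in s -> 0 <= qf (c l) w.
Proof.
move=> [_ _ cc _ _] ls; apply: idempotent_psd.
by rewrite cc// eqxx scale1r.
Qed.

Lemma qf_ge x s c a w : spectral_dec x s c -> (forall l, l \in s -> a <= l) ->
  a * ip w w <= qf x w.
Proof.
move=> sx al; rewrite -qfe -(sum_idempotents sx) {1}(spectral_sum sx) !qf_sum mulr_sumr.
rewrite big_seq [leRHS]big_seq; apply: ler_sum => l ls; rewrite qfZ.
by apply: ler_wpM2r; [exact: (qf_idempotent_ge0 _ sx)|exact: al].
Qed.

Lemma qf_eig x s c l : spectral_dec x s c -> l \in s -> qf x (c l) = l * ip (c l) (c l).
Proof.
move=> sx ls; have [us _ cc _ _] := sx; rewrite /qf {1}(spectral_sum sx) mul_suml (bigD1_seq l)//=.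
rewrite big1_seq; first by rewrite addr0 jmulZl cc// eqxx scale1r ipZl.
by move=> m /andP[ml ms]; rewrite jmulZl cc// (negbTE ml) scale0r scaler0.
Qed.

Lemma qf_square z w : 0 <= qf (mul z z) w.
Proof.
have [s [c sz]] := spectral z.
have -> : mul z z = ev z ('X * 'X).
  by rewrite evMX -[X in ev z X]mul1r evMX -[1]/(1%:P) evC scale1r (mulC z e) mule.
rewrite (qf_spectral _ _ sz) big_seq; apply: sumr_ge0 => l ls.
by rewrite hornerM hornerX mulr_ge0 ?(qf_idempotent_ge0 _ sz)// -expr2 sqr_ge0.
Qed.

Lemma qf_bound x : exists2 K, 0 < K & forall w, `|qf x w| <= K * ip w w.
Proof.
have [s [c sx]] := spectral x.
exists (1 + \sum_(l <- s) `|l|); first by rewrite ltr_pwDl// sumr_ge0.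
move=> w; rewrite {1}(spectral_sum sx) qf_sum; apply: le_trans (ler_norm_sum _ _ _) _.
rewrite -qfe -(sum_idempotents sx) qf_sum mulr_sumr big_seq [leRHS]big_seq; apply: ler_sum => l ls.
rewrite qfZ normrM [X in _ * X]ger0_norm ?(qf_idempotent_ge0 _ sx)//.
apply: ler_wpM2r; first exact: (qf_idempotent_ge0 _ sx).
by rewrite (big_rem l)//= addrCA lerDl addr_ge0// sumr_ge0.
Qed.

Definition pd x := forall w, w != 0 -> 0 < qf x w.

Lemma pd_eig x s c l : spectral_dec x s c -> pd x -> l \in s -> 0 < l.
Proof.
move=> sx px ls; have [_ _ _ c0 _] := sx; have := px _ (c0 l ls).
by rewrite (qf_eig sx ls) pmulr_lgt0// ip_gt0// c0.
Qed.

Lemma seq_lower_bound (s : seq R) : (forall l, l \in s -> 0 < l) ->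
  exists2 a, 0 < a & forall l, l \in s -> a <= l.
Proof.
elim: s => [|l t ih] sp; first by exists 1.
have [|a a0 al] := ih; first by move=> m mt; apply: sp; rewrite inE mt orbT.
exists (Num.min l a); first by rewrite lt_min a0 sp// mem_head.
by move=> m; rewrite inE => /orP[/eqP ->|/al h]; rewrite ge_min ?lexx ?h ?orbT.
Qed.

Lemma pdD x y : pd x -> pd y -> pd (x + y).
Proof. by move=> px py w w0; rewrite qfD addr_gt0; [|exact: px|exact: py]. Qed.

Lemma pdZ a x : 0 < a -> pd x -> pd (a *: x).
Proof. by move=> a0 px w w0; rewrite qfZ mulr_gt0// px. Qed.

Lemma pd_e : pd e.
Proof. by move=> w w0; rewrite qfe ip_gt0. Qed.

(** The quadratic forms of the basis vectors are bounded by [qf_bound], so that of a vector with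
    small coordinates is dominated by the form of [d *: e]. *)
Lemma pd_near d : 0 < d -> exists2 eta, 0 < eta & forall h : V, (forall j, `|h 0 j| <= eta) ->
  pd (d *: e + h) /\ pd (d *: e - h).
Proof.
move=> d0.
have /choice[K HK] : forall j : 'I_n, exists K, 0 < K /\ forall w, `|qf (delta_mx 0 j) w| <= K * ip w w.
  by move=> j; have [K K0 HK] := qf_bound (delta_mx 0 j); exists K.
pose S := 1 + \sum_j K j; have S0 : 0 < S by rewrite ltr_pwDl// sumr_ge0// => j _; rewrite ltW// (proj1 (HK j)).
exists (d / (2 * S)); first by rewrite divr_gt0// mulr_gt0.
move=> h hh.
have b w : w != 0 -> `|qf h w| < d * ip w w.
  move=> w0; have i0 := ip_gt0 w0.
  apply: (@le_lt_trans _ _ (\sum_j d / (2 * S) * (K j * ip w w))).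
    rewrite {1}(row_sum_delta h) /qf mul_suml ip_suml; apply: le_trans (ler_norm_sum _ _ _) _.
    apply: ler_sum => j _; rewrite jmulZl ipZl normrM; apply: ler_pM => //.
    exact: (proj2 (HK j)).
  rewrite -mulr_sumr -mulr_suml mulrA ltr_pM2r//.
  apply: (@le_lt_trans _ _ (d / (2 * S) * S)).
    by rewrite ler_pM2l ?divr_gt0 ?mulr_gt0// /S lerDr.
  rewrite invfM mulrA -mulrA mulVf ?gt_eqF// mulr1 ltr_pdivrMr//.
  by rewrite ltr_pMr// ltr1n.
split=> w w0; rewrite qfD ?qfN qfZ qfe; have := b w w0; rewrite ltr_norml => /andP[]; lra.
Qed.

Lemma pd_square x : pd x -> exists z, x = mul z z.
Proof.
move=> px; have [s [c sx]] := spectral x.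
exists (\sum_(l <- s) Num.sqrt l *: c l); have [us _ cc _ _] := sx.
rewrite mul_suml [LHS](spectral_sum sx) big_seq [RHS]big_seq; apply: eq_bigr => l ls.
rewrite jmulZl mul_sumr (bigD1_seq l)//= big1_seq ?addr0.
  by rewrite jmulZr cc// eqxx scale1r scalerA -expr2 sqr_sqrtr// ltW// (pd_eig sx px).
by move=> m /andP[ml ms]; rewrite jmulZr cc// eq_sym (negbTE ml) scale0r scaler0.
Qed.

Lemma pd_sub x : pd x -> exists2 a, 0 < a & pd (x - a *: e).
Proof.
move=> px; have [s [c sx]] := spectral x.
have [a a0 al] := seq_lower_bound (fun l => @pd_eig x s c l sx px).
exists (a / 2); first by rewrite divr_gt0.
move=> w w0; rewrite qfD qfN qfZ qfe subr_gt0; apply: lt_le_trans (qf_ge w sx al).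
by rewrite ltr_pM2r ?ip_gt0// ltr_pdivrMr// ltr_pMr// ltr1n.
Qed.

(** If [x] is interior, [x - d *: e] is still a square for some [d > 0], and squares are positive
    semidefinite. Conversely, positive definiteness is an open condition, and positive definite
    elements have square roots by the spectral theorem. *)
Lemma interior_squares x : interior [set mul z z | z in setT] x <-> pd x.
Proof.
split; last first.
  move=> /pd_sub[a a0 pa]; apply/nbhs_ballP; have [eta eta0 H] := pd_near a0.
  exists eta => //= y [_ yx].
  have [|z zE] := @pd_square y; last by exists z.
  have -> : y = (x - a *: e) + (a *: e + (y - x)).
    by rewrite addrA subrK addrC subrK.
  by apply: pdD => //; apply: (H (y - x) _).1 => j; rewrite !mxE distrC; exact/ltW/yx.
move=> /nbhs_ballP[eps /= eps0 H].
pose S := 1 + \sum_j `|e 0 j|; have S0 : 0 < S by rewrite ltr_pwDl// sumr_ge0.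
have eS j : `|e 0 j| < S.
  by rewrite /S (bigD1 j)//= addrCA ltrDl ltr_pwDl// sumr_ge0.
pose d := eps / S; have d0 : 0 < d by rewrite divr_gt0.
have [|z _ zE] := H (x - d *: e).
  split => // i j; rewrite ord1 -ball_normE /=.
  have -> : x 0 j - (x - d *: e) 0 j = d * e 0 j by rewrite !mxE; ring.
  by rewrite normrM gtr0_norm// /d mulrAC ltr_pdivrMr// ltr_pM2l.
move=> w w0; have -> : x = mul z z + d *: e by rewrite zE subrK.
by rewrite qfD qfZ qfe ltr_wpDl ?qf_square// mulr_gt0// ip_gt0.
Qed.

(** * Bounds on the determinant through regular elements *)

Section determinant.
Variables (r : nat) (D : V -> R).
Hypotheses (rankP : jordan_rank mul e r)
  (detP : forall x P, jordan_minpoly mul e x P -> (size P).-1 = r -> D x = (-1) ^+ r * P`_0)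
  (Dcont : forall (x : V) d, 0 < d -> exists2 eta, 0 < eta &
     forall y : V, (forall j, `|y 0 j - x 0 j| <= eta) -> `|D y - D x| <= d).

Definition regular x := exists2 P, jordan_minpoly mul e x P & (size P).-1 = r.

Lemma det_spectral x s c : spectral_dec x s c -> regular x -> size s = r /\ D x = \prod_(l <- s) l.
Proof.
move=> [us mP _ _ _] [Q mQ sQ].
have sz : (size (\prod_(l <- s) ('X - l%:P))%R).-1 = r.
  rewrite -sQ; congr _.-1; apply/eqP; rewrite eqn_leq.
  have [m1 e1 min1] := mP; have [m2 e2 min2] := mQ.
  by rewrite (min1 _ (monic_neq0 m2) e2) (min2 _ (monic_neq0 m1) e1).
have ss : size s = r by rewrite -sz size_prod_XsubC.
split => //; rewrite (detP mP sz) -horner_coef0 horner_prod -ss.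
elim: (s) => [|l t ih]; first by rewrite !big_nil mulr1.
by rewrite /= !big_cons -ih hornerXsubC sub0r exprS; ring.
Qed.

Lemma regular_independent x : (forall Q : {poly R}, Q != 0 -> ev x Q = 0 -> (r < size Q)%N) -> regular x.
Proof.
move=> h; have [P mP] := minpoly_exists x; exists P => //.
have [m1 e1 _] := mP; have [mx _] := rankP; apply/eqP; rewrite eqn_leq (mx _ _ mP) /=.
have := h _ (monic_neq0 m1) e1; case: (size P) => //.
Qed.

(** The structure constants of the bilinear product lift it to rows of polynomials in [t], so powers
    along a line are polynomial in [t]. *)
Lemma pow_poly x y : exists X : nat -> 'rV[{poly R}]_n,
  forall k t, map_mx (horner_eval t) (X k) = pow (x + t *: y) k.
Proof.
pose Z : 'rV[{poly R}]_n := \row_j ((x 0 j)%:P + (y 0 j) *: 'X).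
pose M (A B : 'rV[{poly R}]_n) : 'rV[{poly R}]_n :=
  \row_j \sum_a \sum_b (mul (delta_mx 0 a) (delta_mx 0 b) 0 j)%:P * (A 0 a * B 0 b).
have ZE t : map_mx (horner_eval t) Z = x + t *: y.
  by apply/rowP => j; rewrite !mxE /horner_eval !hornerE mulrC.
have ME t A B : map_mx (horner_eval t) (M A B) = mul (map_mx (horner_eval t) A) (map_mx (horner_eval t) B).
  rewrite [in RHS](row_sum_delta (map_mx (horner_eval t) A)) mul_suml.
  apply/rowP => j; rewrite !mxE /horner_eval horner_sum summxE; apply: eq_bigr => a _.
  rewrite jmulZl mxE [map_mx _ B]row_sum_delta mul_sumr horner_sum summxE mulr_sumr; apply: eq_bigr => b _.
  transitivity (mul (delta_mx 0 a) (delta_mx 0 b) 0 j * ((A 0 a).[t] * (B 0 b).[t])); first by rewrite !hornerE.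
  have -> : map_mx (horner^~ t) A 0 a = (A 0 a).[t] by rewrite mxE.
  have -> : map_mx (horner^~ t) B 0 b = (B 0 b).[t] by rewrite mxE.
  by rewrite jmulZr [in RHS]mxE; ring.
exists (fun k => iter k (M Z) (map_mx polyC e)) => k t.
elim: k => [|k ih]; first by apply/rowP => j; rewrite !mxE /horner_eval hornerC.
by rewrite iterS ME ZE ih.
Qed.

(* On the line from y to a regular element, regularity holds wherever a certain
   nonzero polynomial, built from the first r powers, does not vanish. *)
Lemma regular_dense y eta : 0 < eta -> exists2 y', regular y' & forall j, `|y' 0 j - y 0 j| <= eta.
Proof.
move=> eta0; have [_ [x0 [P [mP sP]]]] := rankP.
have [X XE] := pow_poly y (x0 - y).
pose W t : 'M[R]_(r, n) := \matrix_(k < r) pow (y + t *: (x0 - y)) k.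
have reg t : row_free (W t) -> regular (y + t *: (x0 - y)).
  move=> fW; apply: regular_independent => Q Q0 evQ; rewrite ltnNge; apply/negP => sQ.
  have : (\row_(k < r) Q`_k) *m W t = 0.
    rewrite mulmx_sum_row -[RHS]evQ (ev_widen _ sQ); apply: eq_bigr => k _.
    by rewrite mxE rowK.
  move=> /eqP; rewrite -[X in _ == X](mul0mx _ (W t)) => /eqP/(row_free_inj fW)/rowP h.
  move: Q0 => /negP; apply; apply/eqP/polyP => k; rewrite coef0.
  have [kr|kr] := ltnP k r; first by have := h (Ordinal kr); rewrite !mxE.
  by rewrite nth_default// (leq_trans sQ).
have fW1 : row_free (W 1).
  rewrite -kermx_eq0; apply/rowV0P => u /sub_kermxP uW; apply/eqP; apply: contraT => u0.
  pose Q := \poly_(k < r) (if insub k is Some i then u 0 i else 0).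
  have Qk (k : 'I_r) : Q`_k = u 0 k by rewrite coef_poly ltn_ord valK.
  have Q0 : Q != 0.
    apply: contra u0 => /eqP Q0; apply/eqP/rowP => k; rewrite -Qk Q0 coef0 mxE//.
  have evQ : ev x0 Q = 0.
    rewrite (ev_widen x0 (size_poly _ _)); transitivity (u *m W 1) => //.
    rewrite mulmx_sum_row; apply: eq_bigr => k _.
    by rewrite Qk rowK scale1r addrC subrK.
  have [mm _ min] := mP; have := min _ Q0 evQ; rewrite leqNgt => /negP; case.
  apply: leq_ltn_trans (size_poly _ _) _.
  by rewrite -sP prednK// size_poly_gt0 monic_neq0.
have /row_freeP[B WB] := fW1.
(* The right inverse [B] at [t = 1] makes the matrix of powers square, with determinant 1 there. *)
pose p : {poly R} := \det ((\matrix_(k < r) X k) *m map_mx polyC B).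
have pE t : p.[t] = \det (W t *m B).
  rewrite -[LHS]/(horner_eval t p) -det_map_mx map_mxM; congr (\det (_ *m _)).
    by apply/matrixP => i j; rewrite !mxE -(XE i t) mxE.
  by apply/matrixP => i j; rewrite 2!mxE; exact: hornerC.
have p0 : p != 0.
  by apply/eqP => p0; have := pE 1; rewrite p0 horner0 WB det1 => /eqP; rewrite eq_sym oner_eq0.
pose S := 1 + \sum_j `|(x0 - y) 0 j|; have S0 : 0 < S by rewrite ltr_pwDl// sumr_ge0.
have dS j : `|(x0 - y) 0 j| <= S.
  by rewrite /S (bigD1 j)//= addrCA lerDl addr_ge0// sumr_ge0.
have [t tS pt] : exists2 t, 0 < t <= eta / S & p.[t] != 0.
  (* One point more than a nonzero [p] can have roots, all in []0, eta / S]]. *)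
  pose ts := [seq (eta / S) / k.+1%:R | k <- iota 0 (size p)].
  have uts : uniq ts.
    rewrite map_inj_uniq ?iota_uniq// => i j /(mulfI (lt0r_neq0 (divr_gt0 eta0 S0)))/invr_inj/eqP.
    by rewrite eqr_nat => /eqP[].
  have : ~~ all (root p) ts.
    by apply/negP => h; have := max_poly_roots p0 h uts; rewrite size_map size_iota ltnn.
  move=> /allPn[_ /mapP[k _ ->] h]; exists (eta / S / k.+1%:R) => //.
  rewrite divr_gt0 ?divr_gt0//= ler_pdivrMr// ler_peMr ?ler1n// ltW// divr_gt0//.
exists (y + t *: (x0 - y)).
  apply: reg; apply/row_freeP; exists (B *m invmx (W t *m B)).
  by rewrite mulmxA mulmxV// unitmxE -pE unitfE.
move=> j; have -> : (y + t *: (x0 - y)) 0 j - y 0 j = t * (x0 - y) 0 j by rewrite !mxE; ring.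
have /andP[t0 te] := tS; rewrite normrM gtr0_norm//.
apply: (@le_trans _ _ (eta / S * S)); last by rewrite divfK ?gt_eqF.
by apply: ler_pM => //; exact: ltW.
Qed.

(** The determinant is the product of the eigenvalues only at regular elements. A regular [y'] close
    to [y] still satisfies [pd (y' - a *: e)], so its [r] eigenvalues are at least [a]; continuity
    of [D] carries the bound back to [y]. *)
Lemma det_lower y a : 0 < a -> pd (y - a *: e) -> a ^+ r <= D y.
Proof.
move=> a0 pya; apply/ler_addgt0Pr => d d0.
have [a' a'0 pya'] := pd_sub pya.
have [eta eta0 H] := pd_near a'0; have [eta' eta'0 H'] := Dcont y d0.
have [|y' ry hy] := @regular_dense y (Num.min eta eta'); first by rewrite lt_min eta0.
have he j : `|(y' - y) 0 j| <= eta by rewrite !mxE; apply: le_trans (hy j) _; rewrite ge_min lexx.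
have pya2 : pd (y' - a *: e).
  have -> : y' - a *: e = (y - a *: e - a' *: e) + (a' *: e + (y' - y)).
    by apply/rowP => j; rewrite !mxE; ring.
  by apply: pdD => //; exact: (H _ he).1.
have [s [c sy]] := spectral y'; have [sr Dy'] := det_spectral sy ry.
have al l : l \in s -> a <= l.
  move=> ls; have [_ _ _ c0 _] := sy; have := pya2 _ (c0 l ls).
  rewrite qfD qfN qfZ qfe (qf_eig sy ls) subr_gt0 ltr_pM2r ?ip_gt0 ?c0//.
  exact: ltW.
have : a ^+ r <= D y'.
  rewrite Dy' -sr; elim: (s) al => [|l t ih] al; first by rewrite big_nil.
  rewrite big_cons exprS; apply: ler_pM; rewrite ?exprn_ge0 ?(ltW a0)//.
    by apply: al; rewrite mem_head.
  by apply: ih => m mt; apply: al; rewrite inE mt orbT.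
have : `|D y' - D y| <= d by apply: H' => j; apply: le_trans (hy j) _; rewrite ge_min lexx orbT.
rewrite ler_norml => /andP[]; lra.
Qed.

Lemma det_gt0 y : pd y -> 0 < D y.
Proof. by move=> /pd_sub[a a0 pya]; apply: lt_le_trans (det_lower a0 pya); rewrite exprn_gt0. Qed.

(** For a regular [y'] near [y] one eigenvalue is at most [2 * eps], since otherwise [y - eps *: e]
    would be positive definite, and the other [r.-1] are at most [2 * rho]. Passing from [y'] back
    to [y] raises the factor 2 to 3. *)
Lemma det_upper y rho eps : 0 < eps -> 0 < rho -> pd y -> pd (rho *: e - y) -> ~ pd (y - eps *: e) ->
  D y <= 3 * eps * (2 * rho) ^+ r.-1.
Proof.
move=> e0 r0 py pry ny.
have [a a0 pya] := pd_sub py.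
(* The margin [d] serves three times: [d <= a] keeps [y'] positive definite, [d <= rho] keeps its
   eigenvalues under [2 * rho], and [d <= eps] turns a lower bound [2 * eps] on its eigenvalues into
   positivity of [y - eps *: e]. *)
pose d := Num.min a (Num.min eps rho); have d0 : 0 < d by rewrite !lt_min a0 e0.
have da : d <= a by rewrite ge_min lexx.
have de : d <= eps by rewrite !ge_min lexx orbT.
have dr : d <= rho by rewrite !ge_min lexx !orbT.
have q0 : 0 < eps * (2 * rho) ^+ r.-1 by rewrite mulr_gt0// exprn_gt0// mulr_gt0.
have [eta eta0 H] := pd_near d0; have [eta' eta'0 H'] := Dcont y q0.
have [|y' ry hy] := @regular_dense y (Num.min eta eta'); first by rewrite lt_min eta0.
have he j : `|(y' - y) 0 j| <= eta by rewrite !mxE; apply: le_trans (hy j) _; rewrite ge_min lexx.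
have [h1 h2] := H _ he.
have le_pd (x : V) (a1 a2 : R) : a1 <= a2 -> pd (x + a1 *: e) -> pd (x + a2 *: e).
  move=> aa px w w0; have := px w w0; rewrite !qfD !qfZ qfe => /lt_le_trans; apply.
  by rewrite lerD2l ler_pM2r// ip_gt0.
have py' : pd y'.
  have := pdD pya h1; rewrite (_ : _ + _ = y' + (d - a) *: e); last by apply/rowP => j; rewrite !mxE; ring.
  by move=> /(le_pd _ _ 0); rewrite subr_le0 scale0r addr0; apply.
have pry' : pd ((2 * rho) *: e - y').
  have := pdD pry h2; rewrite (_ : _ + _ = - y' + (rho + d) *: e); last by apply/rowP => j; rewrite !mxE; ring.
  move=> /(le_pd _ _ (2 * rho)); rewrite [(2 * rho) *: e - y']addrC; apply.
  by rewrite mulr2n mulrDl mul1r lerD2l.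
have [s [c sy]] := spectral y'; have [sr Dy'] := det_spectral sy ry.
have s0 l : l \in s -> 0 < l by exact: pd_eig sy py'.
have s2 l : l \in s -> l <= 2 * rho.
  move=> ls; have [_ _ _ c0 _] := sy; have := pry' _ (c0 l ls).
  rewrite qfD qfN qfZ qfe (qf_eig sy ls) subr_gt0 ltr_pM2r ?ip_gt0 ?c0//.
  exact: ltW.
have [l ls le2] : exists2 l, l \in s & l <= 2 * eps.
  apply: contrapT => nl; apply: ny.
  have gl l : l \in s -> 2 * eps <= l.
    by move=> ls; rewrite leNgt; apply/negP => h; apply: nl; exists l => //; exact: ltW.
  have : pd (y - (2 * eps - d) *: e).
    move=> w w0; have := h2 w w0; have := qf_ge w sy gl.
    rewrite !(qfD, qfN, qfZ, qfe); lra.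
  have le1 : - (2 * eps - d) <= - eps by lra.
  by move: (le_pd y _ _ le1); rewrite !scaleNr.
have : D y' <= 2 * eps * (2 * rho) ^+ r.-1.
  rewrite Dy' (big_rem l)//=; apply: ler_pM => //.
  - exact/ltW/s0.
  - by rewrite big_seq; apply: prodr_ge0 => m /mem_rem/s0/ltW.
  - rewrite -sr -(size_rem ls).
    have : {in rem l s, forall m, 0 <= m <= 2 * rho}.
      by move=> m /mem_rem ms; rewrite ltW ?s0// s2.
    elim: (rem l s) => [|m t ih] tm; first by rewrite big_nil.
    have /andP[m0 m2] := tm m (mem_head _ _).
    rewrite big_cons exprS; apply: ler_pM => //.
      by rewrite big_seq; apply: prodr_ge0 => k kt; have /andP[] := tm k (ltac:(rewrite inE kt orbT; exact: isT)).
    by apply: ih => k kt; apply: tm; rewrite inE kt orbT.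
have : `|D y' - D y| <= eps * (2 * rho) ^+ r.-1.
  by apply: H' => j; apply: le_trans (hy j) _; rewrite ge_min lexx orbT.
rewrite ler_norml => /andP[]; lra.
Qed.

End determinant.

Lemma cauchy_schwarz u v : ip u v ^+ 2 <= ip u u * ip v v.
Proof.
have [->|v0] := eqVneq v 0; first by rewrite ipC !ip0l mulr0 expr0n.
have vv := ip_gt0 v0; have := ip_ge0 (ip v v *: u - ip u v *: v).
rewrite !(ipDl, ipDr, ipNl, ipNr, ipZl, ipZr) (ipC v u) => h.
rewrite -(ler_pM2l vv); move: h; move: (ip u u) (ip u v) (ip v v) => a b c; rewrite expr2; lra.
Qed.

(** The Gram matrix of the standard basis is invertible because [ip] is definite. *)
Lemma coord_riesz (j : 'I_n) : exists g, forall w, w 0 j = ip g w.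
Proof.
pose G : 'M[R]_n := \matrix_(a, b) ip (delta_mx 0 a) (delta_mx 0 b).
have GE u w : ip u w = (u *m G *m w^T) 0 0.
  rewrite {1}(row_sum_delta u) ip_suml mxE -[RHS]/(\sum_b (u *m G) 0 b * w^T b 0).
  under [RHS]eq_bigr do rewrite mxE mulr_suml.
  rewrite exchange_big /=; apply: eq_bigr => a _.
  rewrite ipZl {1}(row_sum_delta w) ipC ip_suml mulr_sumr; apply: eq_bigr => b _.
  by rewrite ipZl ipC !mxE; ring.
have Gu : G \in unitmx.
  rewrite -row_free_unit -kermx_eq0; apply/rowV0P => u /sub_kermxP uG.
  by apply: ip_eq0; rewrite GE uG mul0mx mxE.
exists (delta_mx 0 j *m invmx G) => w.
by rewrite GE mulmxKV// -rowE !mxE.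
Qed.

(** The eigenvalues of [y] lie in []0, rho]], so the norm of [y] is at most [rho] times that of [e],
    and Cauchy-Schwarz bounds each coordinate. This places order intervals inside small boxes. *)
Lemma order_interval_bounded : exists2 C, 0 < C & forall rho y, 0 < rho -> pd y -> pd (rho *: e - y) ->
  forall j, `|y 0 j| <= C * rho.
Proof.
have /choice[g gE] : forall j : 'I_n, exists g, forall w : V, w 0 j = ip g w by exact: coord_riesz.
pose S := 1 + \sum_j ip (g j) (g j).
have S1 j : ip (g j) (g j) <= S.
  by rewrite /S (bigD1 j)//= addrCA lerDl addr_ge0// sumr_ge0// => k _; exact: ip_ge0.
have S0 : 0 < S by rewrite ltr_pwDl// sumr_ge0// => k _; exact: ip_ge0.
pose E := 1 + ip e e; have E0 : 0 < E by rewrite ltr_pwDl// ip_ge0.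
exists (Num.sqrt (S * E)); first by rewrite sqrtr_gt0 mulr_gt0.
move=> rho y r0 py pry j.
have [s [c sy]] := spectral y.
have yy : ip y y <= rho ^+ 2 * E.
  have -> : ip y y = qf (ev y ('X * 'X)) e.
    rewrite /qf mulC mule evMX -[X in ev y X]mul1r evMX -[1]/(1%:P) evC scale1r (mulC y e) mule.
    by rewrite ipA (mulC y e) mule.
  rewrite (qf_spectral _ _ sy); apply: (@le_trans _ _ (rho ^+ 2 * ip e e)); last first.
    by rewrite ler_pM2l ?exprn_gt0// lerDr.
  rewrite -qfe -{2}(sum_idempotents sy) qf_sum mulr_sumr big_seq [leRHS]big_seq; apply: ler_sum => l ls.
  apply: ler_wpM2r; first exact: (qf_idempotent_ge0 _ sy).
  have l0 := pd_eig sy py ls.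
  have lr : l <= rho.
    have [_ _ _ c0 _] := sy; have := pry _ (c0 l ls).
    rewrite qfD qfN qfZ qfe (qf_eig sy ls) subr_gt0 ltr_pM2r ?ip_gt0 ?c0//.
    exact: ltW.
  by rewrite hornerM hornerX expr2; apply: ler_pM => //; exact: ltW.
have C0 : 0 <= Num.sqrt (S * E) * rho by rewrite mulr_ge0 ?sqrtr_ge0// ltW.
have SE0 : 0 <= S * E by rewrite mulr_ge0// ltW.
have : `|y 0 j| ^+ 2 <= (Num.sqrt (S * E) * rho) ^+ 2.
  rewrite real_normK ?num_real// exprMn sqr_sqrtr// gE.
  apply: le_trans (cauchy_schwarz _ _) _.
  by rewrite -mulrA [E * _]mulrC; apply: ler_pM => //; exact: ip_ge0.
by rewrite ler_sqr// nnegrE.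
Qed.

End jordan.

(** * Lower bounds on a strip *)

Section strip.
Variable R : realType.
Local Notation leb := (@lebesgue_measure R).
Implicit Types (u v : R -> R -> R) (x y s t k : R).

Lemma cr_inv_comp u v x y : (u x y != 0) || (v x y != 0) -> cr_at u v x y ->
  cr_at (fun x y => u x y / (u x y ^+ 2 + v x y ^+ 2)) (fun x y => - v x y / (u x y ^+ 2 + v x y ^+ 2)) x y.
Proof.
move=> /sqr2_gt0 n0 [a [b [hu hv]]].
have hn := has_gradV (A := fun x y => u x y ^+ 2 + v x y ^+ 2) (lt0r_neq0 n0)
  (has_gradD (has_gradM hu hu) (has_gradM hv hv)).
have h1 := has_gradM hu hn; have h2 := has_gradM (has_gradN hv) hn.
set p := u x y in n0 h1 h2; set q := v x y in n0 h1 h2.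
exists ((a * (q ^+ 2 - p ^+ 2) - 2 * b * p * q) / (p ^+ 2 + q ^+ 2) ^+ 2).
exists ((2 * a * p * q + b * (q ^+ 2 - p ^+ 2)) / (p ^+ 2 + q ^+ 2) ^+ 2).
by split; [apply: has_grad_eq h1 _ _|apply: has_grad_eq h2 _ _]; field; rewrite gt_eqF.
Qed.

(* Real and imaginary parts of (4 + (z - i)^2) / 4 at z = t + i s. *)
Definition denU t s : R := 1 + (t ^+ 2 - (1 - s) ^+ 2) / 4.
Definition denV t s : R := t * (s - 1) / 2.

Lemma cr_den t s : cr_at denU denV t s.
Proof.
have ht := has_grad_fst t s; have hs := has_grad_snd t s.
have c1 := has_grad_cst (1 : R) t s; have c4 := has_grad_cst (4^-1 : R) t s.
have c2 := has_grad_cst (2^-1 : R) t s; have cN := has_grad_cst (- 1 : R) t s.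
have hr := has_gradD c1 (has_gradN hs).
have h1 := has_gradD c1 (has_gradM (has_gradD (has_gradM ht ht) (has_gradN (has_gradM hr hr))) c4).
have h2 := has_gradM (has_gradM ht (has_gradD hs cN)) c2.
exists (t / 2), ((s - 1) / 2).
by split; [apply: has_grad_eq h1 _ _|apply: has_grad_eq h2 _ _]; field.
Qed.

Lemma denU_ge t s : 0 <= s <= 1 -> (3 + t ^+ 2) / 4 <= denU t s.
Proof. by move=> /andP[s0 s1]; rewrite /denU; nra. Qed.

Lemma denU_gt0 t s : 0 <= s <= 1 -> 0 < denU t s.
Proof.
by move=> /(denU_ge t); apply: lt_le_trans; rewrite divr_gt0// ltr_wpDr// sqr_ge0.
Qed.

(** Real and imaginary parts of the k-th power of 4 / (4 + (z - i)^2) at z = t + i s; the poles 3 i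
    and -i lie outside the strip. *)
Fixpoint ker (k : nat) : (R -> R -> R) * (R -> R -> R) :=
  if k is l.+1 then
    let d t s := denU t s ^+ 2 + denV t s ^+ 2 in
    ((fun t s => (ker l).1 t s * (denU t s / d t s) - (ker l).2 t s * (- denV t s / d t s)),
     (fun t s => (ker l).1 t s * (- denV t s / d t s) + (ker l).2 t s * (denU t s / d t s)))
  else ((fun _ _ => 1), (fun _ _ => 0)).

Lemma cr_ker l t s : 0 <= s <= 1 -> cr_at (ker l).1 (ker l).2 t s.
Proof.
move=> hs; elim: l => [|l ih] /=.
  by exists 0, 0; rewrite oppr0; split; exact: has_grad_cst.
by apply: cr_atM ih (cr_inv_comp _ (cr_den t s)); rewrite gt_eqF// denU_gt0.
Qed.

Lemma abs2_mul (a b c d : R) : `|a * c - b * d| + `|a * d + b * c| <= (`|a| + `|b|) * (`|c| + `|d|).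
Proof.
have h1 := ler_normB (a * c) (b * d); have h2 := ler_normD (a * d) (b * c).
by move: h1 h2; rewrite !normrM; lra.
Qed.

Lemma abs2_ker l t s : 0 <= s <= 1 -> abs2 (ker l).1 (ker l).2 t s <= (8 / (3 + t ^+ 2)) ^+ l.
Proof.
move=> hs; elim: l => [|l ih]; first by rewrite /abs2 /= normr1 normr0 addr0 expr0.
rewrite /abs2 /=; apply: le_trans (abs2_mul _ _ _ _) _.
rewrite [leRHS]exprSr; apply: ler_pM; rewrite ?addr_ge0//.
have u0 := denU_gt0 t hs; have ug := denU_ge t hs; move: u0 ug.
set U := denU t s; set V := denV t s => u0 ug.
have n0 : 0 < U ^+ 2 + V ^+ 2 by rewrite ltr_wpDr ?sqr_ge0// exprn_gt0.
have t0 : 0 < 3 + t ^+ 2 by rewrite ltr_wpDr ?sqr_ge0.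
apply: (@le_trans _ _ (2 / U)).
  rewrite !normrM normrN normfV (gtr0_norm n0) (gtr0_norm u0) -mulrDl ler_pdivrMr// mulrAC ler_pdivlMr//.
  have : `|V| ^+ 2 = V ^+ 2 by rewrite real_normK// num_real.
  by move: (normr_ge0 V) => v0 <-; nra.
rewrite ler_pdivrMr// mulrAC ler_pdivlMr//; lra.
Qed.

Lemma ker1 l t : (ker l).1 t 1 = (4 / (4 + t ^+ 2)) ^+ l /\ (ker l).2 t 1 = 0.
Proof.
have t0 : 0 < 4 + t ^+ 2 by rewrite ltr_wpDr ?sqr_ge0.
have U1 : denU t 1 = (4 + t ^+ 2) / 4 by rewrite /denU subrr expr0n /= subr0; field.
have V1 : denV t 1 = 0 by rewrite /denV subrr mulr0 mul0r.
elim: l => [|l [ih1 ih2]] //=; rewrite ih1 ih2 U1 V1 oppr0 !(mul0r, mulr0) !(subr0, addr0); split => //.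
rewrite [RHS]exprSr expr0n /= addr0; congr (_ * _); field; by rewrite gt_eqF.
Qed.

Local Notation w t := ((1 + t ^+ 2)^-1 : R).

Lemma int_w : (\int[leb]_t (w t)%:E <= pi%:E)%E.
Proof.
pose f (t : measurableTypeR R) := (w t)%:E.
have f0 t : (0 <= f t)%E by rewrite lee_fin invr_ge0 ltW// sqr1_gt0.
have mf : measurable_fun [set: measurableTypeR R] f.
  apply/measurable_EFinP; apply: continuous_measurable_fun => t.
  by apply: (@cont_on_inv1 R t t t); rewrite lexx.
pose h (t : measurableTypeR R) := (f \_ (`[0%R, +oo[%classic : set (measurableTypeR R))) t.
have mh : measurable_fun setT h.
  apply/(@measurable_restrictT _ _ (measurableTypeR R) _ _ f) => //.
  exact: measurable_funTS.
have h0 t : (0 <= h t)%E by rewrite /h patchE; case: ifP.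
have mhN : measurable_fun setT (fun t : measurableTypeR R => h (- 1 * t + 0)%R).
  by apply: (measurableT_comp mh); exact: measurable_affine.
have hh : (\int[leb]_t h t = (pi / 2)%:E)%E.
  by rewrite -integral0y_oneDsqr [RHS]integral_mkcond.
apply: (@le_trans _ _ (\int[leb]_t (h t + h (- 1 * t + 0)%R))%E).
  apply: ge0_le_integral => //.
  - by move=> t _; exact: f0.
  - by apply: emeasurable_funD.
  move=> t _; rewrite /h !patchE !mem_setE !in_itv /= !andbT mulN1r addr0 oppr_ge0.
  case: (leP 0 t) => t0; first by rewrite leeDl//; case: ifP => // _; exact: f0.
  by rewrite (ltW t0) add0e /f sqrrN.
rewrite ge0_integralD; [|by []|by move=> t _; exact: h0|exact: mh|by move=> t _; exact: h0|exact: mhN].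
rewrite (lebesgue_affine 0 (a := -1))// hh normrN1 invr1 mul1e -EFinD lee_fin.
by rewrite -splitr.
Qed.

Lemma itg_int a b (f : R -> R) : cont_on a b f -> (itg a b f)%:E = (\int[leb]_(x in `[a, b]) (f x)%:E)%E.
Proof. by move=> cf; rewrite /itg /Rintegral fineK//; apply: integrable_fin_num => //; exact: cont_on_integrable. Qed.

Lemma itg_w a b : itg a b (fun t => w t) <= pi.
Proof.
rewrite -lee_fin itg_int; last exact: cont_on_inv1.
apply: le_trans int_w; apply: ge0_subset_integral => //.
  apply/measurable_EFinP; apply: continuous_measurable_fun => t.
  by apply: (@cont_on_inv1 R t t t); rewrite lexx.
by move=> t _; rewrite lee_fin invr_ge0 ltW// sqr1_gt0.
Qed.

Lemma expr_small x e : 0 <= x < 1 -> 0 < e -> exists l, x ^+ l < e.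
Proof.
move=> /andP[x0 x1] e0; have /cvgrPdist_lt/(_ e e0)[N _ HN] := cvg_expr (ltac:(rewrite ger0_norm//) : `|x| < 1).
by exists N; have := HN N (leqnn N); rewrite /= sub0r normrN ger0_norm// exprn_ge0.
Qed.

Lemma cont_on_Z a b (c : R) (f : R -> R) : cont_on a b f -> cont_on a b (fun t => c * f t).
Proof. by move=> cf x hx; apply: cvgM; [exact: cvg_cst|exact: cf]. Qed.

Lemma itgZ a b (c : R) (f : R -> R) : cont_on a b f -> itg a b (fun t => c * f t) = c * itg a b f.
Proof. by move=> cf; rewrite /itg RintegralZl//; exact: cont_on_integrable. Qed.

Lemma cont_on_B a b (f g : R -> R) : cont_on a b f -> cont_on a b g -> cont_on a b (fun t => f t - g t).
Proof. by move=> cf cg x hx; apply: cvgB; [exact: cf|exact: cg]. Qed.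

(** The order of the quantifiers is the point: [C] is fixed by the data at height 1, whereas the
    bound [M'] on the whole strip comes later and only decides how far out the vertical sides are
    placed. The form integrated is the real part of (u + i v) times the kernel times dz. *)
Lemma strip_bound (kappa M del : R) : 0 < kappa -> 0 <= M -> 0 < del -> exists2 C, 0 < C &
  forall u v M', (forall t s, 0 <= s <= 1 -> cr_at u v t s) ->
  (forall t s, 0 <= s <= 1 -> abs2 u v t s <= M') ->
  (forall t, `|u t 1| <= M) -> (forall t, `|t| <= del -> kappa <= u t 1) ->
  (1 <= C%:E * \int[leb]_t (w t * abs2 u v t 0)%:E)%E.
Proof.
move=> k0 M0 d0.
(* The values of 4 / (4 + t^2) at t = del / 2 and t = del: a lower bound near the centre and an
   upper bound on the tail. As [q < m], a high power makes the tail negligible. *)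
pose m : R := 16 / (16 + del ^+ 2); pose q : R := 4 / (4 + del ^+ 2).
have d20 : 0 < del ^+ 2 by rewrite exprn_gt0.
have m0 : 0 < m by rewrite divr_gt0// addr_gt0.
have q0 : 0 < q by rewrite divr_gt0// addr_gt0.
have qm : q / m < 1.
  rewrite ltr_pdivrMr// mul1r /q /m ltr_pdivrMr ?addr_gt0// mulrAC ltr_pdivlMr ?addr_gt0//.
  lra.
(* [(M + kappa) * 4 * q ^+ l * w t] will dominate the loss from the tail at height 1, and [w] has
   integral at most [pi]. *)
pose A := (M + kappa) * 4 * pi; have A0 : 0 < A by rewrite !mulr_gt0 ?pi_gt0// ltr_wpDl.
have qm0 : 0 <= q / m < 1 by rewrite divr_ge0 ?ltW.
have e0 : 0 < kappa * del * m / A / 2 by do 2!apply: divr_gt0 => //; do 2!apply: mulr_gt0 => //.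
have [l Hl] := expr_small qm0 e0.
have {}Hl : A * q ^+ l < kappa * del * m ^+ l.+1 / 2.
  move: Hl; rewrite expr_div_n ltr_pdivrMr ?exprn_gt0// => h.
  rewrite mulrC -ltr_pdivlMr//; apply: (lt_le_trans h).
  by rewrite le_eqVlt exprS; apply/orP; left; apply/eqP; field; rewrite gt_eqF.
pose c := kappa * del * m ^+ l.+1 / 2.
have c0 : 0 < c by apply: divr_gt0 => //; apply: mulr_gt0; [exact: mulr_gt0|exact: exprn_gt0].
(* The integral at height 0 will be at least [c / 2], and there the kernel is at most
   [8 * 3 ^+ l * w t], because 8 / 3 <= 3. *)
exists (2 / c * (8 * 3 ^+ l)); first by apply: mulr_gt0; [exact: divr_gt0|apply: mulr_gt0 => //; exact: exprn_gt0].
move=> u v M' cuv bM' bM bk.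
have M'0 : 0 <= M'.
  by apply: le_trans (bM' 0 0 _); rewrite ?lexx ?ler01// addr_ge0.
(* Chosen so that each vertical side contributes at most [c / 4]; [S] is then so large that the
   kernel is below [eps] there. *)
pose eps := Num.min 1 (c / (4 * (M' + 1))).
have M10 : 0 < M' + 1 by rewrite ltr_wpDl.
have eps0 : 0 < eps by rewrite lt_min ltr01 divr_gt0// mulr_gt0.
pose S := del + 1 + 8 / eps.
have e80 : 0 < 8 / eps by rewrite divr_gt0.
have S1 : 1 <= S by rewrite /S; lra.
have Sd : del <= S by rewrite /S; lra.
have SS : - S <= S by lra.
have Se : (8 / (3 + S ^+ 2)) ^+ l.+1 <= eps.
  have S2 : 8 / eps <= S ^+ 2 by rewrite expr2; rewrite /S in S1 *; nra.
  have S30 : 0 < 3 + S ^+ 2 by rewrite ltr_wpDr ?sqr_ge0.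
  have h : 8 / (3 + S ^+ 2) <= eps.
    rewrite ler_pdivrMr// -ler_pdivrMl// mulrC; lra.
  have h1 : 8 / (3 + S ^+ 2) <= 1 by apply: le_trans h _; rewrite ge_min lexx.
  apply: le_trans h; rewrite exprS ler_piMr ?divr_ge0 ?(ltW S30)//.
  by rewrite exprn_ile1// divr_ge0 ?(ltW S30).
pose U := (ker l.+1).1; pose V := (ker l.+1).2.
pose A1 t s := u t s * U t s - v t s * V t s.
pose B1 t s := - (u t s * V t s + v t s * U t s).
have crP t s : 0 <= s <= 1 -> exists a b, has_grad A1 t s a (- b) /\ has_grad B1 t s (- b) (- a).
  move=> hs; have [a [b [h1 h2]]] := cr_atM (cuv t s hs) (cr_ker l.+1 t hs).
  by exists a, b; split => //; exact: has_gradN.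
have hs0 : 0 <= (0 : R) <= 1 by rewrite lexx ler01.
have hs1 : 0 <= (1 : R) <= 1 by rewrite lexx ler01.
have cA a b s : 0 <= s <= 1 -> cont_on a b (A1 ^~ s).
  by move=> hs t _; have [? [? [h _]]] := crP t s hs; exact: has_grad_cont1 h.
have cB t : cont_on 0 1 (B1 t).
  by move=> s hs; have [? [? [_ h]]] := crP t s hs; exact: has_grad_cont2 h.
have G := @green_closed R A1 B1 (- S) S 0 1 SS ler01.
have {}G := G (fun t s _ hs => let: ex_intro a (ex_intro b h) := crP t s hs in
   ex_intro _ a (ex_intro _ (- b) (ex_intro _ (- a) h))).
have side t : t ^+ 2 = S ^+ 2 -> `|itg 0 1 (B1 t)| <= M' * eps.
  move=> tS; have -> : M' * eps = M' * eps * (1 - 0) by rewrite subr0 mulr1.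
  apply: itg_bound => // s hs; rewrite /B1 normrN; apply: (@le_trans _ _ (abs2 u v t s * abs2 U V t s)).
    by apply: le_trans (abs2_mul _ _ _ _); rewrite lerDr.
  apply: ler_pM; rewrite ?addr_ge0//; first exact: bM'.
  by apply: le_trans (abs2_ker _ _ hs) _; rewrite tS.
have sideM : M' * eps <= c / 4.
  have : eps <= c / (4 * (M' + 1)) by rewrite ge_min lexx orbT.
  move=> /(ler_wpM2l M'0)/le_trans; apply.
  rewrite mulrA ler_pdivrMr ?mulr_gt0// [leRHS](_ : _ = (M' + 1) * c); last by field.
  by rewrite ler_pM2r// lerDl.
(* On the tail u >= -M gives u g >= kappa g - (M + kappa) g; one factor of the kernel g supplies the
   weight [4 * w t], and the other [l] are at most [q]. *)
have top : 2 * c - A * q ^+ l <= itg (- S) S (A1 ^~ 1).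
  pose g t := (4 / (4 + t ^+ 2)) ^+ l.+1 : R.
  have t40 t : 0 < 4 + t ^+ 2 :> R by rewrite ltr_wpDr ?sqr_ge0.
  have cg a b : cont_on a b g.
    move=> t _; have [a' [b' [h _]]] := cr_ker l.+1 t hs1.
    have := has_grad_cont1 h; rewrite (_ : (ker l.+1).1 ^~ 1 = g)//.
    by apply/funext => t'; have [] := ker1 l.+1 t'.
  have gS : del * m ^+ l.+1 <= itg (- S) S g.
    have g0 a b : a <= b -> 0 <= itg a b g.
      move=> ab; have <- : itg a b (fun=> 0) = 0 :> R by rewrite itg_cst// mul0r.
      apply: itg_le => [||t _]; [exact: cont_on_cst|exact: cg|].
      by rewrite exprn_ge0// divr_ge0// ltW.
    have le1 : - S <= - (del / 2) by clear - Sd d0; lra.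
    have le2 : - (del / 2) <= del / 2 by clear - d0; lra.
    have le3 : del / 2 <= S by clear - Sd d0; lra.
    rewrite (itg_split le1 (le_trans le2 le3) (cg _ _)) (itg_split le2 le3 (cg _ _)).
    have h1 := g0 _ _ le1; have h3 := g0 _ _ le3.
    have : m ^+ l.+1 * (del / 2 - - (del / 2)) <= itg (- (del / 2)) (del / 2) g.
      rewrite -itg_cst//; apply: itg_le => [||t /andP[ta tb]]; [exact: cont_on_cst|exact: cg|].
      have m4 : m <= 4 / (4 + t ^+ 2).
        rewrite /m ler_pdivrMr ?addr_gt0// mulrAC ler_pdivlMr//.
        have a1 : 0 <= del / 2 - t by rewrite subr_ge0.
        have a2 : 0 <= t + del / 2 by clear - ta; lra.
        by have := mulr_ge0 a1 a2; clear; lra.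
      by rewrite lerXn2r// nnegrE ?(ltW m0)// divr_ge0// ltW.
    by rewrite (_ : del / 2 - - (del / 2) = del); [rewrite mulrC; lra|field].
  have ckg a b : cont_on a b (fun t => kappa * g t).
    exact: cont_on_Z (cg a b).
  have cw a b : cont_on a b (fun t => (M + kappa) * 4 * q ^+ l * w t).
    exact: cont_on_Z (@cont_on_inv1 R a b).
  have : itg (- S) S (fun t => kappa * g t - (M + kappa) * 4 * q ^+ l * w t) <= itg (- S) S (A1 ^~ 1).
    apply: itg_le => [||t _]; [|exact: cA|].
      by apply: cont_on_B; [exact: ckg|exact: cw].
    rewrite /A1 /U /V; have [-> ->] := ker1 l.+1 t; rewrite mulr0 subr0 -/(g t).
    have gt0 : 0 <= g t by rewrite exprn_ge0// divr_ge0// ltW.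
    have w0 : 0 < w t by rewrite invr_gt0 sqr1_gt0.
    have K0 : 0 <= (M + kappa) * 4 * q ^+ l * w t.
      by rewrite !mulr_ge0 ?exprn_ge0// ?ltW// ltr_wpDl.
    have [td|td] := leP `|t| del.
      by have := ler_wpM2r gt0 (bk t td); move: K0; clear; lra.
    have gq : g t <= 4 * q ^+ l * w t.
      have t2 : del ^+ 2 <= t ^+ 2.
        by rewrite -[t ^+ 2]real_normK ?num_real// lerXn2r ?nnegrE// ltW.
      have gw : 4 / (4 + t ^+ 2) <= 4 * w t.
        by rewrite ler_pM2l// lef_pV2 ?posrE ?sqr1_gt0// lerD2r ler1n.
      have gq : (4 / (4 + t ^+ 2)) ^+ l <= q ^+ l.
        have p0 : 0 <= 4 / (4 + t ^+ 2) by rewrite divr_ge0// ltW.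
        rewrite lerXn2r ?nnegrE ?(ltW q0)// /q ler_pM2l//.
        by rewrite lef_pV2 ?posrE ?(addr_gt0 _ d20)// lerD2l.
      rewrite /g exprS [leRHS]mulrAC; apply: ler_pM => //; rewrite ?exprn_ge0 ?divr_ge0 ?(ltW (t40 t))//.
    have := bM t; rewrite ler_norml => /andP[uM _].
    have := ler_wpM2r gt0 uM; have := ler_wpM2l (addr_ge0 M0 (ltW k0)) gq.
    by rewrite [(M + kappa) * (_ / _)]mulrA [(M + kappa) * (4 * _)]mulrA !mulrDl; clear; lra.
  rewrite itgB//; apply: le_trans.
  rewrite (itgZ _ (cg _ _)) (itgZ _ (@cont_on_inv1 R _ _)); have h1 := ler_wpM2l (ltW k0) gS.
  have h2 : (M + kappa) * 4 * q ^+ l * itg (- S) S (fun t => w t) <= A * q ^+ l.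
    rewrite /A -[leRHS]mulrA [pi * _]mulrC mulrA; apply: ler_wpM2l; last exact: itg_w.
    by rewrite !mulr_ge0 ?exprn_ge0// ?ltW// ltr_wpDl.
  by rewrite /c; lra.
have bot : c / 2 <= itg (- S) S (A1 ^~ 0).
  have := side S erefl; have := side (- S) (sqrrN S); rewrite !ler_norml => /andP[a1 a2] /andP[a3 a4].
  by rewrite -/c in Hl; lra.
have cuv1 a b : cont_on a b (fun t => abs2 u v t 0).
  move=> t _; have [a' [b' [h1 h2]]] := cuv t 0 hs0.
  apply: cvgD; apply: cvg_norm; [exact: has_grad_cont1 h1|exact: has_grad_cont1 h2].
have cwa a b : cont_on a b (fun t => w t * abs2 u v t 0).
  exact: cont_on_M (@cont_on_inv1 R a b) (cuv1 a b).
have : itg (- S) S (A1 ^~ 0) <= itg (- S) S (fun t => 8 * 3 ^+ l * (w t * abs2 u v t 0)).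
  apply: itg_le => [||t _]; [exact: cA|exact: cont_on_Z (cwa _ _)|].
  apply: (@le_trans _ _ (abs2 u v t 0 * abs2 U V t 0)).
    apply: le_trans (ler_norm _) _; apply: le_trans (abs2_mul _ _ _ _); by rewrite lerDl.
  rewrite [leRHS]mulrA [leRHS]mulrC; apply: ler_wpM2l; first exact: addr_ge0.
  apply: le_trans (abs2_ker _ _ hs0) _.
  have t30 : 0 < 3 + t ^+ 2 by rewrite ltr_wpDr ?sqr_ge0.
  have p0 : 0 <= 8 / (3 + t ^+ 2) by rewrite divr_ge0// ltW.
  rewrite exprS mulrAC; apply: ler_pM.
  - by rewrite mulr_ge0// exprn_ge0.
  - by rewrite invr_ge0 ltW.
  - rewrite ler_pM2l// lerXn2r ?nnegrE// ler_pdivrMr//.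
    by have := sqr_ge0 t; clear; lra.
  - by rewrite lef_pV2 ?posrE ?sqr1_gt0// lerD2r ler1n.
rewrite (itgZ _ (cwa _ _)) => h.
have {}h : 1 <= 2 / c * (8 * 3 ^+ l) * itg (- S) S (fun t => w t * abs2 u v t 0).
  rewrite -mulrA mulrAC ler_pdivlMr//; lra.
apply: (@le_trans _ _ ((2 / c * (8 * 3 ^+ l))%:E * (itg (- S) S (fun t => w t * abs2 u v t 0))%:E)%E).
  by rewrite -EFinM lee_fin.
apply: lee_wpmul2l; first by rewrite lee_fin !mulr_ge0 ?exprn_ge0 ?invr_ge0 ?(ltW c0).
rewrite itg_int//; apply: ge0_subset_integral => //.
  apply/measurable_EFinP; apply: continuous_measurable_fun => t.
  by apply: (cwa t t t); rewrite lexx.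
by move=> t _; rewrite lee_fin mulr_ge0 ?addr_ge0// invr_ge0 ltW// sqr1_gt0.
Qed.

End strip.

(** * Divergence of the weight near the apex *)

Section shells.
Variables (R : realType) (n r : nat).
Local Notation MR := (measurableTypeR R).
Local Notation T := (n.-tuple (measurableTypeR R)).
Local Notation V := 'rV[R]_n.
Variables (Omega : set V) (P : mpoly.mpoly n R) (e : V) (s rho : R).
Hypotheses (n0 : (0 < n)%N) (oO : open Omega) (s1 : s <= -1) (rho0 : 0 < rho) (Oe : Omega e)
  (OD : forall x y : V, Omega x -> Omega y -> Omega (x + y))
  (OZ : forall (a : R) (x : V), 0 < a -> Omega x -> Omega (a *: x))
  (lower : forall (y : V) (a : R), 0 < a -> Omega (y - a *: e) -> a ^+ r <= mpoly_eval P y)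
  (upper : forall (y : V) (eps : R), 0 < eps -> Omega y -> Omega (rho *: e - y) -> ~ Omega (y - eps *: e) ->
     mpoly_eval P y <= 3 * eps * (2 * rho) ^+ r.-1)
  (bounded : exists2 C : R, 0 < C & forall y : V, Omega y -> Omega (rho *: e - y) -> forall j, `|y 0 j| <= C * rho).
Local Notation vol := (ltm R n).

Lemma open_affine (W : set V) (a : R) (b : V) : open W -> `|a| = 1 -> open [set x : V | W (a *: x + b)].
Proof.
move=> oW a1; apply: coord_open => x /= Wx; have [d d0 h] := open_coord oW Wx.
exists d => // y hy; apply: h => j; have := hy j; rewrite !mxE.
have -> : a * y 0 j + b 0 j - (a * x 0 j + b 0 j) = a * (y 0 j - x 0 j) by ring.
by rewrite normrM a1 mul1r.
Qed.

(** The points between [eps *: e] and [rho *: e] in the order of the cone. *)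
Definition slab (eps : R) : set V := [set y | Omega (y - eps *: e) /\ Omega (rho *: e - y)].

Lemma open_slab eps : open (slab eps).
Proof.
have h1 := @open_affine Omega 1 (- (eps *: e)) oO (normr1 R).
have h2 := @open_affine Omega (-1) (rho *: e) oO (normrN1 R).
rewrite (_ : slab eps = [set x | Omega (1 *: x + - (eps *: e))] `&` [set x | Omega (-1 *: x + rho *: e)]).
  exact: openI.
by apply/seteqP; split => y /=; rewrite /slab /= scale1r scaleN1r [- y + _]addrC.
Qed.

Local Notation K eps := [set y : T | slab eps (row_of_tuple y)].

Lemma measurable_slab eps : measurable (K eps).
Proof. apply: measurable_open_rows; exact: open_slab. Qed.

Lemma slab_mono a b : 0 <= a -> a <= b -> slab b `<=` slab a.
Proof.
move=> a0; rewrite le_eqVlt => /predU1P[->//|ab] y [h1 h2]; split => //.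
have -> : y - a *: e = (y - b *: e) + (b - a) *: e by rewrite scalerBl addrA subrK.
by apply: OD => //; apply: OZ; rewrite ?subr_gt0.
Qed.

Lemma slab0 a y : 0 <= a -> slab a y -> Omega y /\ Omega (rho *: e - y).
Proof. by move=> a0 /(slab_mono (lexx 0) a0)[]; rewrite scale0r subr0. Qed.

Lemma vol_indic (A : set T) : measurable A -> vol A = (\int[vol]_y (\1_A y)%:E)%E.
Proof. by move=> mA; rewrite integral_indic// setIT. Qed.

(** The map y -> l y + eps e with l = (rho - eps) / rho fixes [rho *: e] and carries [slab 0] onto
    [slab eps]. *)
Lemma vol_slab eps : 0 <= eps < rho -> (vol (K eps) = (((rho - eps) / rho) ^+ n)%:E * vol (K 0))%E.
Proof.
move=> /andP[e0 er]; pose l := (rho - eps) / rho.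
have l0 : 0 < l by rewrite divr_gt0// subr_gt0.
have ll : l * rho = rho - eps by rewrite divfK ?gt_eqF.
pose b : T := tuple_of_row (eps *: e).
have rowE y : row_of_tuple (aff l b y) = l *: row_of_tuple y + eps *: e.
  by apply/rowP => j; rewrite !mxE !tnth_mktuple !mxE.
have inv x : Omega (l *: x) -> Omega x.
  move=> h; have := OZ (ltac:(by rewrite invr_gt0) : 0 < l^-1) h.
  by rewrite scalerA mulVf ?gt_eqF// scale1r.
have E (y : T) : K eps (aff l b y) <-> K 0 y.
  rewrite /= rowE /slab /= scale0r subr0 addrK.
  have -> : rho *: e - (l *: row_of_tuple y + eps *: e) = l *: (rho *: e - row_of_tuple y).
    by rewrite scalerBr scalerA ll scalerBl opprD addrA addrAC.
  by split=> -[h1 h2]; split; [exact: inv|exact: inv|exact: OZ|exact: OZ].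
have mi a : measurable_fun [set: T] (fun y => (\1_(K a) y)%:E : \bar R).
  by apply/measurable_EFinP; apply: measurable_indic; exact: measurable_slab.
have := @ltm_affine R n l b (fun y => (\1_(K eps) y)%:E) (lt0r_neq0 l0) (mi eps).
move=> /(_ _)/wrap[]; first by move=> y; rewrite lee_fin.
rewrite -(vol_indic (measurable_slab eps)) (_ : (fun y => _) = (fun y => (\1_(K 0) y)%:E)); last first.
  apply/funext => y; rewrite !indicE; have [h|h] := pselect (K 0 y).
    by rewrite (mem_set h) (mem_set ((E y).2 h)).
  by rewrite (memNset h) memNset// => /(E y).1.
rewrite -(vol_indic (measurable_slab 0)) => ->.
rewrite gtr0_norm// muleA -EFinM mulfV ?mul1e// expf_neq0// gt_eqF//.
Qed.

Lemma vol_slab0 : exists2 v, 0 < v & vol (K 0) = v%:E.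
Proof.
have [C C0 HC] := bounded.
have r20 : 0 < rho / 2 by rewrite divr_gt0.
have s0 : slab 0 ((rho / 2) *: e).
  split; first by rewrite scale0r subr0; exact: OZ.
  by rewrite -scalerBl {1}(splitr rho) addrK; exact: OZ.
have [d d0 hd] := open_coord (open_slab (eps := 0)) s0.
have Cr : 0 <= C * rho by rewrite mulr_ge0// ltW.
have up : (vol (K 0) <= ((2 * (C * rho)) ^+ n)%:E)%E.
  rewrite -(ltm_inbox [tuple 0 | _ < n] Cr); apply: le_measure; rewrite ?inE//.
  - exact: measurable_slab.
  - exact: measurable_inbox.
  - move=> y /slab0 -/(_ (lexx 0))[h1 h2]; apply/forallP => j; rewrite tnth_mktuple subr0.
    by have := HC _ h1 h2 j; rewrite row_of_tupleE.
have d20 : 0 < d / 2 by rewrite divr_gt0.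
have lo : (((2 * (d / 2)) ^+ n)%:E <= vol (K 0))%E.
  rewrite -(ltm_inbox (tuple_of_row ((rho / 2) *: e)) (ltW d20)); apply: le_measure; rewrite ?inE//.
  - exact: measurable_inbox.
  - exact: measurable_slab.
  - move=> y /inbox_row h; apply: hd => j; rewrite row_of_tupleK in h.
    by apply: le_lt_trans (h j) _; rewrite ltr_pdivrMr// ltr_pMr// ltr1n.
have fin : vol (K 0) \is a fin_num.
  rewrite ge0_fin_numE//; exact: le_lt_trans up (ltry _).
exists (fine (vol (K 0))); last by rewrite fineK.
rewrite -lte_fin fineK//; apply: lt_le_trans lo; rewrite lte_fin exprn_gt0// mulr_gt0//.
Qed.

Lemma vol_slab_fin eps : 0 <= eps -> (vol (K eps) < +oo)%E.
Proof.
move=> e0; have [v _ vE] := vol_slab0; apply: (@le_lt_trans _ _ (vol (K 0))); last by rewrite vE ltry.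
apply: le_measure; rewrite ?inE; [exact: measurable_slab|exact: measurable_slab|].
by move=> y; apply: slab_mono.
Qed.

Lemma powR_antitone (a b : R) : 0 < a -> a <= b -> b `^ s <= a `^ s.
Proof.
move=> a0 ab; have b0 := lt_le_trans a0 ab.
have sn : 0 <= - s by rewrite oppr_ge0 (le_trans s1)// lerN10.
have inv y : 0 < y -> y `^ s = (y `^ (- s))^-1 by move=> y0; rewrite powRN invrK.
by rewrite !inv// lef_pV2 ?posrE ?powR_gt0// ge0_ler_powR// nnegrE ltW.
Qed.

(** The determinant is at least [eps ^+ r] on the slab and the exponent is negative, so the weight
    is bounded on a set of finite volume. *)
Lemma weight_slab eps : 0 < eps -> (\int[vol]_(y in K eps) weight P s y < +oo)%E.
Proof.
move=> e0; apply: (@le_lt_trans _ _ (\int[vol]_(y in K eps) ((eps ^+ r) `^ s)%:E)%E).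
  apply: ge0_le_integral.
  - exact: measurable_slab.
  - by move=> y _; exact: weight_ge0.
  - by apply: measurable_funTS; exact: measurable_weight.
  - exact: measurable_cst.
  - move=> y [h _]; rewrite lee_fin; apply: powR_antitone; first exact: exprn_gt0.
    exact: lower.
rewrite integral_cst; last exact: measurable_slab.
by rewrite lte_mul_pinfty ?lee_fin ?powR_ge0//; apply: vol_slab_fin; exact: ltW.
Qed.

Lemma powR_ge_inv (x : R) : 0 < x <= 1 -> x^-1 <= x `^ s.
Proof.
by move=> /andP[x0 x1]; rewrite -powR_inv1 ?(ltW x0)//; apply: ger_powR; rewrite ?x0.
Qed.

Lemma subrX_ge (a b : R) m : 0 <= b -> b <= a -> (a - b) * b ^+ m <= a ^+ m.+1 - b ^+ m.+1.
Proof.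
move=> b0 ab; rewrite mulrBl -exprS lerD2r exprS; apply: ler_wpM2l; first exact: le_trans ab.
by apply: lerXn2r; rewrite ?nnegrE// (le_trans b0).
Qed.

(** By the scaling law of slabs, the shell between two successive ones has volume of order [eps k],
    while the weight there is at least of order 1 / eps k; the products are bounded below
    independently of [k]. *)
Lemma weight_shell : exists eps : nat -> R, exists2 c, 0 < c &
  forall k, 0 < eps k /\ (\int[vol]_(y in K (eps k)) weight P s y + c%:E <= \int[vol]_(y in K (eps k.+1)) weight P s y)%E.
Proof.
have [v v0 vE] := vol_slab0.
pose B := 3 * (2 * rho) ^+ r.-1.
have B0 : 0 < B by rewrite mulr_gt0// exprn_gt0// mulr_gt0.
(* The bound [B^-1] keeps the determinant at most 1 on the shells, where a power with exponent
   [s <= -1] dominates the inverse; the bound [rho / 2] keeps the ratio [b] below at least 1/2. *)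
pose eps0 := Num.min (rho / 2) B^-1.
have eps00 : 0 < eps0 by rewrite lt_min divr_gt0// invr_gt0.
pose eps k : R := eps0 / 2 ^+ k.
have ek0 k : 0 < eps k by rewrite divr_gt0// exprn_gt0.
have eS k : eps k.+1 = eps k / 2 by rewrite /eps exprSr invfM mulrA.
have ele k : eps k <= eps0.
  by rewrite ler_pdivrMr ?exprn_gt0// ler_peMr ?(ltW eps00)// exprn_ege1// ler1n.
have erho k : eps k <= rho / 2 by apply: le_trans (ele k) _; rewrite ge_min lexx.
have eB k : B * eps k <= 1.
  by rewrite -ler_pdivlMl// mulr1; apply: le_trans (ele k) _; rewrite ge_min lexx orbT.
exists eps; exists (v / (2 * rho * B * 2 ^+ n.-1)).
  by apply: divr_gt0 => //; apply: mulr_gt0; [apply: mulr_gt0 => //; exact: mulr_gt0|exact: exprn_gt0].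
move=> k; split => //.
have mK a := measurable_slab a.
have sub : K (eps k) `<=` K (eps k.+1).
  move=> y; apply: slab_mono; first exact: ltW.
  by rewrite eS ler_pdivrMr// ler_peMr ?ler1n// ltW.
have mS : measurable (K (eps k.+1) `\` K (eps k)) by exact: measurableD.
rewrite -[in leRHS](setDUK sub) ge0_integral_setU //=; last 3 first.
- by apply: measurable_funTS; exact: measurable_weight.
- by move=> y _; exact: weight_ge0.
- by apply/disj_setPS => y [] /= h [_ /(_ h)].
apply: leeD => //.
have l1 a : 0 < a -> a <= rho / 2 -> 0 <= a < rho.
  by move=> a0 ar; rewrite ltW//; apply: le_lt_trans ar _; rewrite ltr_pdivrMr// ltr_pMr// ltr1n.
have volS : ((v * (eps k / (2 * rho) / 2 ^+ n.-1))%:E <= vol (K (eps k.+1) `\` K (eps k)))%E.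
  rewrite measureD//; last exact: vol_slab_fin (ltW (ek0 _)).
  have -> : K (eps k.+1) `&` K (eps k) = K (eps k) by apply/setIidPr.
  rewrite [X in (_ <= _ - X)%E](vol_slab (l1 _ (ek0 k) (erho k))).
  rewrite [X in (_ <= X - _)%E](vol_slab (l1 _ (ek0 k.+1) (erho k.+1))) vE.
  rewrite -!EFinM -EFinB lee_fin -mulrBl mulrC; apply: ler_wpM2r; first exact: ltW.
  set a := (rho - eps k.+1) / rho; set b := (rho - eps k) / rho.
  have ab : a - b = eps k / (2 * rho) by rewrite /a /b eS; field; rewrite gt_eqF.
  have b2 : 2^-1 <= b.
    by rewrite /b ler_pdivlMr//; have := erho k; lra.
  have b0 : 0 <= b by apply: le_trans b2; rewrite invr_ge0.
  have eb : b <= a by rewrite -subr_ge0 ab divr_ge0 ?(ltW (ek0 k))// mulr_ge0// ltW.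
  have := subrX_ge n.-1 b0 eb; rewrite prednK// ab; apply: le_trans.
  apply: ler_wpM2l; first by rewrite divr_ge0 ?(ltW (ek0 k))// mulr_ge0// ltW.
  by rewrite -exprVn; apply: lerXn2r; rewrite ?nnegrE ?invr_ge0.
apply: (@le_trans _ _ (\int[vol]_(y in K (eps k.+1) `\` K (eps k)) ((B * eps k)^-1)%:E)%E); last first.
  apply: ge0_le_integral => //.
  - by move=> y _; rewrite lee_fin invr_ge0 mulr_ge0// ltW.
  - by apply: measurable_funTS; exact: measurable_weight.
  move=> y [[h1 h2] h3]; rewrite lee_fin.
  have [hO _] := slab0 (ltW (ek0 k.+1)) (conj h1 h2).
  have D0 : 0 < mpoly_eval P (row_of_tuple y).
    by apply: lt_le_trans (lower (ek0 k.+1) h1); rewrite exprn_gt0.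
  have DB : mpoly_eval P (row_of_tuple y) <= B * eps k.
    have -> : B * eps k = 3 * eps k * (2 * rho) ^+ r.-1 by rewrite /B; ring.
    by apply: upper => // h; apply: h3.
  apply: (@le_trans _ _ (mpoly_eval P (row_of_tuple y))^-1).
    by rewrite lef_pV2 ?posrE// mulr_gt0.
  by apply: powR_ge_inv; rewrite D0 (le_trans DB (eB k)).
rewrite integral_cst//; apply: (@le_trans _ _ (((B * eps k)^-1)%:E * (v * (eps k / (2 * rho) / 2 ^+ n.-1))%:E)%E).
  rewrite -EFinM lee_fin le_eqVlt; apply/orP; left; apply/eqP; field.
  by rewrite !gt_eqF// exprn_gt0.
by apply: lee_wpmul2l => //; rewrite lee_fin invr_ge0 mulr_ge0// ltW.
Qed.

(** The mass is large but finite: it will determine the argument at which f** is evaluated. *)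
Lemma weight_unbounded M : exists2 E : set T, measurable E /\
    (forall y, E y -> Omega (row_of_tuple y) /\ Omega (rho *: e - row_of_tuple y)) &
  (M%:E <= \int[vol]_(y in E) weight P s y < +oo)%E.
Proof.
have [eps [c c0 H]] := weight_shell.
have J k : ((k%:R * c)%:E <= \int[vol]_(y in K (eps k)) weight P s y)%E.
  elim: k => [|k ih]; first by rewrite mul0r; apply: integral_ge0 => y _; exact: weight_ge0.
  apply: le_trans (H k).2; rewrite -natr1 mulrDl mul1r EFinD; exact: leeD.
pose k := Num.bound `|M / c|.
have Mk : M <= k%:R * c.
  by rewrite -ler_pdivrMr//; apply: le_trans (ler_norm _) _; apply/ltW/archi_boundP/normr_ge0.
exists (K (eps k)).
  split; first exact: measurable_slab.
  by move=> y /slab0; apply; apply/ltW/(H k).1.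
rewrite (weight_slab (H k).1) andbT; apply: le_trans (J k); by rewrite lee_fin.
Qed.

End shells.

(** * Triviality *)

Section translation.
Variables (R : realType) (n : nat).
Local Notation leb := (@lebesgue_measure R).
Local Notation MR := (measurableTypeR R).
Local Notation T := (n.-tuple (measurableTypeR R)).
Variable v : T.

(** Horizontal translation by [t] times [v]; it preserves the tube measure, whose density depends on
    the second component only. *)
Definition slide (t : R) (w : T * T) : T * T := (aff 1 [tuple t * tnth v j | j < n] w.1, w.2).

Lemma slideK t w : slide (- t) (slide t w) = w.
Proof.
case: w => x y; congr (_, _); apply: eq_from_tnth => i; rewrite /= !tnth_mktuple; ring.
Qed.

Lemma measurable_slide_joint : measurable_fun [set: (T * T) * MR] (fun wt : (T * T) * MR => slide wt.2 wt.1 : T * T).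
Proof.
apply: measurable_fun_pair; last exact: (measurableT_comp measurable_snd measurable_fst).
apply/measurable_fun_tnthP => i.
apply: (eq_measurable_fun (fun wt : (T * T) * MR => tnth wt.1.1 i + wt.2 * tnth v i : MR)).
  by move=> wt _ /=; rewrite !tnth_mktuple mul1r.
apply: measurable_funD.
  apply: (measurableT_comp (measurable_tnth i)).
  exact: (measurableT_comp measurable_fst measurable_fst).
by apply: measurable_funM => //; exact: measurable_snd.
Qed.

Lemma measurable_slide t : measurable_fun [set: T * T] (slide t : T * T -> T * T).
Proof.
apply: measurable_fun_pair; last exact: measurable_snd.
exact: (measurableT_comp (measurable_aff _ _) measurable_fst).
Qed.

Lemma lam2_slide t (H : T * T -> \bar R) : measurable_fun [set: T * T] H -> (forall w, 0 <= H w)%E ->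
  (\int[lam2 R n]_w H (slide t w) = \int[lam2 R n]_w H w)%E.
Proof.
move=> mH H0; rewrite (lam2_int (measurableT_comp mH (measurable_slide t)) (fun w => H0 _)) (lam2_int mH H0) /int2.
have mh : measurable_fun [set: T] (fun x => \int[ltm R n]_y H (x, y))%E.
  exact: (@measurable_fun_fubini_tonelli_F _ _ T T R (ltm R n) H mH H0).
have := @ltm_affine R n 1 [tuple t * tnth v j | j < n] _ (oner_neq0 R) mh.
move=> /(_ _)/wrap[]; first by move=> x; apply: integral_ge0.
by rewrite normr1 expr1n invr1 mul1e.
Qed.

Lemma tweight_slide Omega P s t w : tweight Omega P s (slide t w) = tweight Omega P s w.
Proof. by rewrite /tweight !patchE; congr (if _ then _ else _); rewrite !mem_setE. Qed.

End translation.

(** * Lower bounds along horizontal lines and their averages *)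

Section strip_lower_bound.
Variables (R : realType) (n : nat).
Local Notation leb := (@lebesgue_measure R).
Local Notation MR := (measurableTypeR R).
Local Notation T := (n.-tuple (measurableTypeR R)).
Local Notation FT := ('rV[R[i]^o]_n -> R[i]^o).
Variables (Omega : set 'rV[R]_n) (P : mpoly.mpoly n R) (s : R) (p q : \bar R).
Hypotheses (oO : open Omega) (P0 : forall y, Omega y -> 0 < mpoly_eval P y)
  (p1 : (1 < p)%E) (q1 : (1 <= q)%E)
  (OD : forall x y : 'rV[R]_n, Omega x -> Omega y -> Omega (x + y))
  (OZ : forall (a : R) (x : 'rV[R]_n), 0 < a -> Omega x -> Omega (a *: x)).
Local Notation mu := (tmu P s oO).
Local Notation bsp := (bspace P s p q oO).
Local Notation N := (bnorm P s p q oO).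
Local Open Scope complex_scope.

(** The hypothesis is averaged over [A] and the integrals are exchanged. For each [t] the translate
    of [A] has the same measure [tau], so the inner integral is at most 2 tau f**(tau); the weight
    contributes [pi], and [tau] cancels. *)
Lemma box_mass_bound (f : FT) (v : T) (A : set (T * T)) (C tau : R) : coord_measurable f ->
  measurable A -> mu A = tau%:E -> 0 < tau -> 0 < C ->
  (forall w, A w -> (1 <= C%:E * \int[leb]_t ((1 + t ^+ 2)^-1 * abs1 (f (tube_point (slide v t w))))%:E)%E) ->
  (1 <= (2 * pi * C)%:E * mrea (dist mu (modulus f)) tau)%E.
Proof.
move=> mf mA At t0 C0 hA; have mabs := measurable_abs1 mf.
have mw := measurable_tweight P s oO; have w0 := tweight_ge0 Omega P s.
pose X := mrea (dist mu (modulus f)) tau.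
have X0 : (0 <= X)%E by exact: mrea_ge0.
have m1 : measurable_fun [set: T * T] (fun w => (\1_A w : MR)) by exact: measurable_indic.
have tauE : (tau%:E = \int[lam2 R n]_w ((\1_A w)%:E * tweight Omega P s w))%E.
  rewrite -(@tmu_int R n Omega P s oO (fun w => \1_A w) m1)//.
  by rewrite integral_indic// setIT.
pose D t : set (T * T) := slide v (- t) @^-1` A.
have mD t : measurable (D t).
  by rewrite -[X in measurable X]setTI; exact: measurable_slide.
have muD t : mu (D t) = tau%:E.
  rewrite tauE -(@lam2_slide R n v (- t) (fun w => (\1_A w)%:E * tweight Omega P s w)%E); last 2 first.
  - by apply: emeasurable_funM => //; apply/measurable_EFinP.
  - by move=> w; rewrite mule_ge0// lee_fin.
  under eq_integral do rewrite tweight_slide.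
  have m2 : measurable_fun [set: T * T] (fun w => (\1_(D t) w : MR)) by exact: measurable_indic.
  rewrite -(@tmu_int R n Omega P s oO (fun w => \1_(D t) w) m2)//.
  by rewrite integral_indic// setIT.
pose wt (t : R) := (1 + t ^+ 2)^-1.
have wt0 t : 0 <= wt t by rewrite invr_ge0 ltW// sqr1_gt0.
have mwt : measurable_fun [set: MR] (wt : MR -> MR).
  by apply: continuous_measurable_fun => t; apply: (@cont_on_inv1 R t t t); rewrite lexx.
pose K (u : (T * T) * MR) : \bar R := ((\1_A u.1 * (wt u.2 * abs1 (f (tube_point (slide v u.2 u.1)))))%:E *
  tweight Omega P s u.1)%E.
have K0 u : (0 <= K u)%E by rewrite mule_ge0// lee_fin mulr_ge0// mulr_ge0// abs1_ge0.
have mK : measurable_fun [set: (T * T) * MR] K.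
  apply: emeasurable_funM; last exact: (measurableT_comp mw measurable_fst).
  apply/measurable_EFinP; apply: measurable_funM; first exact: (measurableT_comp m1 measurable_fst).
  apply: measurable_funM; first exact: (measurableT_comp mwt measurable_snd).
  exact: (measurableT_comp mabs (measurable_slide_joint v)).
have inner t : (\int[lam2 R n]_w K (w, t) <= (wt t)%:E * (2%:E * (tau%:E * X)))%E.
  pose G w := \1_(D t) w * abs1 (f (tube_point w)).
  have G0 w : 0 <= G w by rewrite mulr_ge0// abs1_ge0.
  have mG : mfn G by apply: measurable_funM => //; exact: measurable_indic.
  have KE : (fun w => K (w, t)) = (fun w => (wt t)%:E * ((G (slide v t w))%:E * tweight Omega P s (slide v t w)))%E.
    apply/funext => w; rewrite /K /G tweight_slide muleA -EFinM; congr (_%:E * _)%E.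
    have -> : \1_(D t) (slide v t w) = \1_A w :> R.
      have DA : D t (slide v t w) = A w by rewrite /D /preimage /= slideK.
      rewrite !indicE; have [h|h] := pselect (A w).
        by rewrite (mem_set h) mem_set// DA.
      by rewrite (memNset h) memNset// DA.
    ring.
  rewrite KE ge0_integralZl//; last 3 first.
  - apply: (@measurableT_comp _ _ _ _ _ _ (fun w => (G w)%:E * tweight Omega P s w)%E); last exact: measurable_slide.
    by apply: emeasurable_funM => //; exact/measurable_EFinP.
  - by move=> w _; rewrite mule_ge0// lee_fin.
  - by rewrite lee_fin.
  apply: lee_wpmul2l; first by rewrite lee_fin.
  rewrite (@lam2_slide R n v t (fun w => (G w)%:E * tweight Omega P s w)%E); last 2 first.
  - by apply: emeasurable_funM => //; exact/measurable_EFinP.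
  - by move=> w; rewrite mule_ge0// lee_fin.
  rewrite -(@tmu_int R n Omega P s oO G mG G0).
  have mm := mfn_modulus mf.
  apply: (@le_trans _ _ (\int[mu]_w (2%:E * ((fun w => (modulus f w)%:E) \_ (D t)) w))%E).
    apply: ge0_le_integral => //.
    - by move=> w _; rewrite lee_fin.
    - exact/measurable_EFinP.
    - apply: emeasurable_funM => //; apply/(measurable_restrictT _ (mD t)).
      by apply: measurable_funTS; exact/measurable_EFinP.
    move=> w _; rewrite /G patchE indicE; case: ifPn => h; last by rewrite mul0r mule0.
    by rewrite mul1r -EFinM lee_fin; exact: abs1_le_normc.
  rewrite ge0_integralZl//; last 2 first.
  - apply/(measurable_restrictT _ (mD t)); apply: measurable_funTS; exact/measurable_EFinP.
  - by move=> w _; rewrite patchE; case: ifPn => // _; rewrite lee_fin modulus_ge0.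
  apply: lee_wpmul2l => //; rewrite -integral_mkcond.
  apply: integral_le_mrea => //; first by move=> w; exact: modulus_ge0.
  by rewrite muD.
have outer : (tau%:E <= C%:E * (pi%:E * (2%:E * (tau%:E * X))))%E.
  apply: (@le_trans _ _ (C%:E * \int[lam2 R n]_w \int[leb]_t K (w, t))%E); last first.
    apply: lee_wpmul2l; first by rewrite lee_fin ltW.
    have := @fubini_tonelli _ _ (T * T)%type MR R (lam2 R n) leb K mK K0.
    rewrite /fubini_F /fubini_G => ->.
    apply: (@le_trans _ _ (\int[leb]_t ((2%:E * (tau%:E * X)) * (wt t)%:E))%E).
      apply: ge0_le_integral => //.
      - by move=> t _; apply: integral_ge0.
      - exact: (@measurable_fun_fubini_tonelli_G _ _ (T * T)%type MR R (lam2 R n) K mK K0).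
      - by apply: emeasurable_funM => //; exact/measurable_EFinP.
      - by move=> t _; rewrite muleC; exact: inner.
    have Y0 : (0 <= 2%:E * (tau%:E * X))%E.
      by apply: mule_ge0 => //; apply: mule_ge0 => //; rewrite lee_fin ltW.
    rewrite ge0_integralZl//; last 2 first.
    - exact/measurable_EFinP.
    - by move=> t _; rewrite lee_fin.
    by rewrite muleC; apply: lee_wpmul2r => //; exact: int_w.
  rewrite tauE -ge0_integralZl//; last 3 first.
  - exact: (@measurable_fun_fubini_tonelli_F _ _ (T * T)%type MR R leb K mK K0).
  - by move=> w _; apply: integral_ge0.
  - by rewrite lee_fin ltW.
  apply: ge0_le_integral => //.
  - by move=> w _; rewrite mule_ge0// lee_fin.
  - by apply: emeasurable_funM => //; exact/measurable_EFinP.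
  - apply: emeasurable_funM => //.
    exact: (@measurable_fun_fubini_tonelli_F _ _ (T * T)%type MR R leb K mK K0).
  move=> w _; have -> : (fun t => K (w, t)) = (fun t => ((\1_A w)%:E * tweight Omega P s w) *
      (wt t * abs1 (f (tube_point (slide v t w))))%:E)%E.
    by apply/funext => t; rewrite /K EFinM muleAC.
  rewrite ge0_integralZl//; last 3 first.
  - apply/measurable_EFinP; apply: measurable_funM => //.
    have mp : measurable_fun [set: MR] (fun t : MR => (w, t) : (T * T) * MR).
      by apply: measurable_fun_pair => //; exact: measurable_cst.
    exact: (measurableT_comp mabs (measurableT_comp (measurable_slide_joint v) mp)).
  - by move=> t _; rewrite lee_fin mulr_ge0// abs1_ge0.
  - by rewrite mule_ge0// lee_fin.
  have [wA|wA] := pselect (A w); last by rewrite indicE memNset// mul0e mul0e mule0.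
  rewrite indicE mem_set// mul1e muleCA -[leLHS]mule1.
  by apply: lee_wpmul2l => //; exact: hA.
have E : (C%:E * (pi%:E * (2%:E * (tau%:E * X))) = tau%:E * ((2 * pi * C)%:E * X))%E.
  by rewrite !muleA -!EFinM; congr (_%:E * _)%E; ring.
by move: outer; rewrite E -{1}[tau%:E]mule1 lee_pmul2l// lte_fin.
Qed.

Definition cvec (v : T) : 'rV[R[i]^o]_n := \row_j (tnth v j)%:C.

Lemma tube_point_line (x y v : T) t s' :
  tube_point (x, y) + (t +i* s') *: cvec v = tube_point (slide v t (x, aff s' y v)).
Proof.
apply/rowP => j; rewrite !mxE /= !tnth_mktuple.
by apply/eqP; rewrite eq_complex /= !mulr0 subr0 add0r mul1r [tnth x j + _]addrC addrC [s' * _ + _]addrC !eqxx.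
Qed.

Lemma row_aff (a : R) (y v : T) : row_of_tuple (aff a y v) = a *: row_of_tuple v + row_of_tuple y.
Proof. by apply/rowP => j; rewrite !mxE tnth_mktuple. Qed.

(** Compactness of the segment from [y] to [y + v], with point bounds that are uniform in [x]. The
    result depends on [y] without control and serves only as the bound [M'] of [strip_bound]. *)
Lemma vertical_bound (f : FT) (y v : T) : bsp f -> Omega (row_of_tuple y) -> Omega (row_of_tuple v) ->
  exists M, forall x s', 0 <= s' <= 1 -> abs1 (f (tube_point (x, aff s' y v))) <= M.
Proof.
move=> [f0 hf mf Nf] Oy Ov.
have O1 a : 0 <= a -> Omega (row_of_tuple (aff a y v)).
  rewrite le_eqVlt row_aff => /predU1P[<-|a0]; first by rewrite scale0r add0r.
  by apply: OD => //; exact: OZ.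
have N0 : (0 <= N f)%E by exact: bnorm_ge0.
have NE : N f = (fine (N f))%:E by rewrite fineK// ge0_fin_numE.
have := @segment_compact R 0 1 => /compact_near_coveringP cov.
have hcov : forall a : R, `[0%R, 1%R]%classic a -> \forall s' \near a & M \near +oo,
    forall x, abs1 (f (tube_point (x, aff s' y v))) <= M.
  move=> a; rewrite /= in_itv /= => /andP[a0 _].
  have Oa := O1 a a0.
  have [rho [C [r0 C0 _ hC]]] := point_bound s oO p1 q1 Oa (P0 Oa).
  pose W := 1 + \sum_j `|tnth v j|; have W0 : 0 < W by rewrite ltr_pwDl// sumr_ge0.
  have vW j : `|tnth v j| <= W.
    by rewrite /W (bigD1 j)//= addrCA lerDl addr_ge0// sumr_ge0.
  have rW : 0 < rho / W by rewrite divr_gt0.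
  exists (ball a (rho / W), [set M | C * fine (N f) < M]); first split => /=.
  - exact: nbhsx_ballx.
  - by apply: nbhs_pinfty_gt; exact: num_real.
  move=> [b M] [/= ab CM] x; apply: le_trans (ltW CM).
  have := hC f mf hf x (aff b y v); rewrite -/(N f) NE -EFinM lee_fin; apply.
  apply/forallP => j; rewrite !tnth_mktuple opprD addrACA subrr addr0 -mulrBl normrM distrC.
  apply: le_trans (ler_pM (normr_ge0 _) (normr_ge0 _) (ltW ab) (vW j)) _.
  by rewrite divfK ?gt_eqF.
have [M [_ HM]] := cov R (pinfty_nbhs R) (fun M s' => forall x, abs1 (f (tube_point (x, aff s' y v))) <= M) _ hcov.
exists (M + 1) => x s' hs'.
by apply: (HM (M + 1)); rewrite ?ltrDl//= in_itv.
Qed.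

(** [eta] and [C] are chosen before [x] and [y]: [point_bound] at [v] controls f at heights near
    [v], and [strip_bound] yields a constant that depends on nothing else. *)
Lemma line_bound (f : FT) (x0 v : T) : bsp f -> Omega (row_of_tuple v) ->
  0 < complex.Re (f (tube_point (x0, v))) ->
  exists eta C, [/\ 0 < eta, 0 < C & forall x y, inbox eta x0 x -> Omega (row_of_tuple y) ->
    (forall j, `|tnth y j| <= eta) ->
    (1 <= C%:E * \int[leb]_t ((1 + t ^+ 2)^-1 * abs1 (f (tube_point (slide v t (x, y)))))%:E)%E].
Proof.
move=> bf Ov; set z := tube_point (x0, v); set k := complex.Re (f z) => k0.
have [f0 hf mf Nf] := bf.
have N0 : (0 <= N f)%E by exact: bnorm_ge0.
have NE : N f = (fine (N f))%:E by rewrite fineK// ge0_fin_numE.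
have [rho [C [r0 C0 _ hC]]] := point_bound s oO p1 q1 Ov (P0 Ov).
have Oz : tube Omega z by rewrite tube_pointP.
have k20 : 0 < k / 2 by rewrite divr_gt0.
have [m m0 hm] : exists2 m, 0 < m & forall z' : 'rV[R[i]^o]_n, (forall j, abs1 (z' 0 j - z 0 j) <= m) -> k / 2 <= complex.Re (f z').
  have hd := differentiable_has_cdiff (hf z Oz).
  have [L L0 HL] := linear_abs1_bound ('d f z).
  have [del del0 H] := hd 1 ltr01; pose m := Num.min (del / 2) (k / 2 / (1 + L)).
  have L1 : 0 < 1 + L by rewrite ltr_pwDl// ltW.
  have m0 : 0 < m by rewrite lt_min !divr_gt0.
  exists m => // z' hz'; pose h := z' - z.
  have hm j : abs1 (h 0 j) <= m.
    have -> : h 0 j = z' 0 j - z 0 j by rewrite /h 2!mxE.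
    exact: hz'.
  have md : m < del.
    by rewrite gt_min ltr_pdivrMr// ltr_pMr// ltr1n.
  have := H h m (ltW m0) md hm; rewrite subrK mul1r => h1.
  have h2 := HL h m (ltW m0) hm.
  have h3 : m * (1 + L) <= k / 2 by rewrite -ler_pdivlMr// /m ge_min lexx orbT.
  have h4 : abs1 (f z' - f z) <= k / 2.
    rewrite -[f z' - f z](subrK ('d f z h)); apply: le_trans (abs1D _ _) _.
    by apply: le_trans h3; rewrite mulrDr mulr1; exact: lerD.
  have : `|complex.Re (f z' - f z)| <= k / 2 by apply: le_trans h4; rewrite /abs1 lerDl.
  by rewrite raddfB -/k ler_norml => /andP[h5 _]; lra.
pose W := 1 + \sum_j `|tnth v j|; have W0 : 0 < W by rewrite ltr_pwDl// sumr_ge0.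
have vW j : `|tnth v j| <= W.
  by rewrite /W (bigD1 j)//= addrCA lerDl addr_ge0// sumr_ge0.
(* Displacements by t v, by x - x0 and by y are allowed one third of [m] each. *)
pose del := m / 3 / W; have del0 : 0 < del by rewrite !divr_gt0.
pose M := C * fine (N f).
have M0 : 0 <= M by rewrite mulr_ge0// fine_ge0.
have [C' C'0 HC'] := strip_bound k20 M0 del0.
pose eta := Num.min rho (m / 3).
have eta0 : 0 < eta by rewrite lt_min r0 divr_gt0.
have er : eta <= rho by rewrite ge_min lexx.
have em : eta <= m / 3 by rewrite ge_min lexx orbT.
exists eta, C'; split => // x y hx Oy hy.
have [M' HM'] := vertical_bound bf Oy Ov.
pose u t s' := complex.Re (f (tube_point (x, y) + (t +i* s') *: cvec v)).
pose w t s' := complex.Im (f (tube_point (x, y) + (t +i* s') *: cvec v)).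
have absE t s' : abs2 u w t s' = abs1 (f (tube_point (slide v t (x, aff s' y v)))).
  by rewrite /abs2 /u /w tube_point_line.
have aff0 : aff 0 y v = y by apply: eq_from_tnth => j; rewrite tnth_mktuple mul0r add0r.
have := HC' u w M' _ _ _ _; move=> /(_ _ _ _ _)/wrap[].
- move=> t s' /andP[s0 _].
  have Ot : tube Omega (tube_point (x, y) + (t +i* s') *: cvec v).
    rewrite tube_point_line tube_pointP /slide /= row_aff.
    move: s0; rewrite le_eqVlt => /predU1P[<-|s0]; first by rewrite scale0r add0r.
    by apply: OD => //; exact: OZ.
  have [h1 h2] := has_cdiff_line (differentiable_has_cdiff (hf _ Ot)).
  by exists (complex.Re ('d f (tube_point (x, y) + (t +i* s') *: cvec v) (cvec v))),
    (complex.Im ('d f (tube_point (x, y) + (t +i* s') *: cvec v) (cvec v))).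
- by move=> t s' hs'; rewrite absE; exact: HM'.
- move=> t; apply: (@le_trans _ _ (abs2 u w t 1)); first by rewrite /abs2 lerDl.
  rewrite absE /slide /=; set x' := aff _ _ _.
  have := hC f mf hf x' (aff 1 y v); rewrite -/(N f) NE -EFinM lee_fin; apply.
  by apply/forallP => j; rewrite tnth_mktuple mul1r addrAC subrr add0r (le_trans (hy j)).
- move=> t ht; rewrite /u tube_point_line; apply: hm => j.
  rewrite !mxE !tnth_mktuple /abs1 /= !mul1r [tnth x j + _]addrC -addrA [tnth v j + _]addrC addrK.
  have h1 : `|t * tnth v j| <= m / 3.
    rewrite normrM; apply: le_trans (ler_pM (normr_ge0 _) (normr_ge0 _) ht (vW j)) _.
    by rewrite divfK ?gt_eqF.
  have h2 : `|tnth x j - tnth x0 j| <= m / 3 by have /forallP := hx => /(_ j)/le_trans; apply.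
  have h3 : `|tnth y j| <= m / 3 by exact: le_trans (hy j) em.
  by have := ler_normD (t * tnth v j) (tnth x j - tnth x0 j); lra.
move=> /le_trans; apply; apply: lee_wpmul2l; first by rewrite lee_fin ltW.
rewrite le_eqVlt; apply/orP; left; apply/eqP; apply: eq_integral => t _.
by rewrite absE aff0.
Qed.

End strip_lower_bound.

(** * Triviality for finite p *)

Section trivial_space.
Variables (R : realType) (n : nat).
Local Notation leb := (@lebesgue_measure R).
Local Notation MR := (measurableTypeR R).
Local Notation T := (n.-tuple (measurableTypeR R)).
Local Notation FT := ('rV[R[i]^o]_n -> R[i]^o).
Variables (Omega : set 'rV[R]_n) (P : mpoly.mpoly n R) (s : R) (p q : \bar R).
Hypotheses (oO : open Omega) (P0 : forall y, Omega y -> 0 < mpoly_eval P y)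
  (p1 : (1 < p)%E) (q1 : (1 <= q)%E)
  (OD : forall x y : 'rV[R]_n, Omega x -> Omega y -> Omega (x + y))
  (OZ : forall (a : R) (x : 'rV[R]_n), 0 < a -> Omega x -> Omega (a *: x)).
Local Notation mu := (tmu P s oO).
Local Notation bsp := (bspace P s p q oO).
Local Notation N := (bnorm P s p q oO).
Local Open Scope complex_scope.

Lemma tmu_product (x0 : T) eta (E : set T) : 0 <= eta -> measurable E ->
  (forall y, E y -> Omega (row_of_tuple y)) ->
  mu [set w | inbox eta x0 w.1 /\ E w.2] = (((2 * eta) ^+ n)%:E * \int[ltm R n]_(y in E) weight P s y)%E.
Proof.
move=> eta0 mE EO; set A := [set w | _].
have mB := measurable_inbox eta x0.
have mA : measurable A.
  rewrite (_ : A = [set x | inbox eta x0 x] `*` E); first exact: measurableX.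
  by apply/seteqP; split.
have mt := measurable_tweight P s oO.
rewrite tmuE integral_mkcond lam2_int; last 2 first.
- by apply/(measurable_restrictT _ mA); exact: measurable_funTS.
- by move=> w; rewrite patchE; case: ifP => // _; exact: tweight_ge0.
have J0 : (0 <= \int[ltm R n]_(y in E) weight P s y)%E by apply: integral_ge0 => y _; exact: weight_ge0.
transitivity (\int[ltm R n]_x ((\int[ltm R n]_(y in E) weight P s y) * (\1_[set x | inbox eta x0 x] x)%:E))%E.
  rewrite /int2; apply: eq_integral => x _.
  have [hx|hx] := boolP (inbox eta x0 x); last first.
    rewrite indicE memNset ?mule0//; last exact/negP.
    apply: integral0_eq => y _; rewrite patchE memNset// => -[/= h _].
    by rewrite h in hx.
  rewrite indicE mem_set// mule1 [RHS]integral_mkcond; apply: eq_integral => y _.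
  rewrite !patchE; have [hy|hy] := pselect (E y); last by rewrite !memNset// => -[].
  rewrite (mem_set hy) mem_set// /tweight patchE mem_set//; exact: EO.
rewrite ge0_integralZl//; last by apply/measurable_EFinP; exact: measurable_indic.
by rewrite integral_indic// setIT muleC [X in (X * _)%E = _]ltm_inbox.
Qed.

Lemma bspace_trivial_finite (a : R) (f : FT) : p = a%:E ->
  (forall eta M : R, 0 < eta -> exists2 E : set T, measurable E /\
     (forall y, E y -> Omega (row_of_tuple y) /\ forall j, `|tnth y j| <= eta) &
     (M%:E <= \int[ltm R n]_(y in E) weight P s y < +oo)%E) ->
  bsp f -> f = 0.
Proof.
move=> pa hW bf; apply/funext => z; apply: contrapT => fz0.
have Oz : tube Omega z by have [f0 _ _ _] := bf; apply: contrapT => /f0.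
pose x0 := re_tuple z; pose v := im_tuple z.
have zE : tube_point (x0, v) = z := tube_pointK z.
(* Multiplication by the conjugate of [f z] makes the value at [z] a positive real, as [line_bound]
   asks for a positive real part. *)
pose g : FT := ((f z)^* )%C *: f + 0.
have bg : bsp g.
  by apply: bspace_linear; [exact: p1|exact: q1|exact: bf|apply: bspace0].
have gz : 0 < complex.Re (g (tube_point (x0, v))).
  rewrite zE; have -> : g z = ((f z)^* )%C * f z by exact: addr0.
  case: (f z) fz0 => b c fz0 /=; have : (b != 0) || (c != 0).
    by apply: contra_notT fz0; rewrite negb_or !negbK => /andP[/eqP -> /eqP ->].
  by move=> /sqr2_gt0; rewrite !expr2 mulNr opprK.
have Ov : Omega (row_of_tuple v) by rewrite -(tube_pointP Omega (x0, v)) zE.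
have [eta [C [eta0 C0 H]]] := line_bound P0 p1 q1 OD OZ bg Ov gz.
have [_ _ mg Ng] := bg.
have N0 : (0 <= N g)%E by exact: bnorm_ge0.
have NE : N g = (fine (N g))%:E by rewrite fineK// ge0_fin_numE.
pose K := 2 * pi * C * (4 * fine (N g)).
have C20 : 0 <= 2 * pi * C by rewrite !mulr_ge0 ?pi_ge0// ltW.
have K0 : 0 <= K by rewrite mulr_ge0// mulr_ge0// fine_ge0.
have K10 : 0 < K + 1 by rewrite ltr_wpDl.
pose b := (2 * eta) ^+ n; have b0 : 0 < b by rewrite exprn_gt0// mulr_gt0.
(* The mass is chosen so that [tau] is at least (K + 1)^a, while the lower and upper bounds for g**
   at [tau] together give tau^(1/a) <= K. *)
have [E [mE hE] /andP[ME Ef]] := hW eta ((K + 1) `^ a / b) eta0.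
pose J := (\int[ltm R n]_(y in E) weight P s y)%E.
have JE : J = (fine J)%:E.
  by rewrite fineK// ge0_fin_numE//; apply: integral_ge0 => y _; exact: weight_ge0.
pose tau := b * fine J.
have tK : (K + 1) `^ a <= tau.
  by rewrite /tau mulrC -ler_pdivrMr// -lee_fin -JE.
have tau0 : 0 < tau by apply: lt_le_trans tK; rewrite powR_gt0.
have muA : mu [set w | inbox eta x0 w.1 /\ E w.2] = tau%:E.
  rewrite tmu_product//; [|exact: ltW|by move=> y /hE[]].
  by rewrite -/J JE -EFinM.
have mA : measurable [set w : T * T | inbox eta x0 w.1 /\ E w.2].
  rewrite (_ : [set w | _] = [set x | inbox eta x0 x] `*` E); last by apply/seteqP; split.
  by apply: measurableX => //; exact: measurable_inbox.
have := box_mass_bound mg mA muA tau0 C0 (v := v).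
move=> /(_ _)/wrap[]; first by move=> [x y] /= [hx /hE[Oy hy]]; exact: H.
have := @mrea_bound R (dist mu (modulus g)) p q tau p1 q1 tau0.
have mr0 := mrea_ge0 (dist mu (modulus g)) tau0.
move: mr0; set X := mrea _ tau => X0.
rewrite {1}pa /= -/(N g) NE => h1 h2.
have t10 : 0 < tau `^ a^-1 by rewrite powR_gt0.
have h3 : ((tau `^ a^-1)%:E <= K%:E)%E.
  have := lee_wpmul2l (ltac:(rewrite lee_fin; exact: ltW) : (0 <= (tau `^ a^-1)%:E)%E) h2.
  rewrite mule1 muleCA => /le_trans; apply.
  rewrite /K [leRHS]EFinM; apply: lee_wpmul2l; first by rewrite lee_fin.
  by rewrite EFinM.
have a0 : 0 < a by move: p1; rewrite pa lte_fin; apply: lt_trans.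
have h4 : K + 1 <= tau `^ a^-1.
  have {1}<- : ((K + 1) `^ a) `^ a^-1 = K + 1 by rewrite -powRrM mulfV ?gt_eqF// powRr1// ltW.
  by apply: ge0_ler_powR => //; rewrite ?nnegrE ?invr_ge0 ?powR_ge0 ?(ltW a0) ?(ltW tau0).
by move: h3; rewrite lee_fin => h3; have := le_trans h4 h3; rewrite gerDl ler10.
Qed.

End trivial_space.

(** * Triviality for infinite p and finite q *)

Section infinite_exponent.
Variables (R : realType).
Local Notation leb := (@lebesgue_measure R).
Local Notation MR := (measurableTypeR R).

Lemma measurable_invt (t0 : R) : measurable_fun (`]0, t0]%classic : set MR) (fun t : MR => (t^-1)%:E : \bar R).
Proof.
apply: (measurable_funS _ _ (@measurable_winv R)) => //.
by move=> t; rewrite /= !in_itv /= andbT => /andP[].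
Qed.

Lemma int_inv_unbounded (t0 : R) : 0 < t0 -> (\int[leb]_(t in `]0%R, t0]) (t^-1)%:E = +oo)%E.
Proof.
move=> t00; apply/eqyP => M M0.
(* Each dyadic block contributes at least 1/2, its length divided by its right end. *)
have key k : ((k%:R / 2)%:E <= \int[leb]_(t in (`](t0 / 2 ^+ k)%R, t0]%classic : set MR)) (t^-1)%:E)%E.
  elim: k => [|k ih].
    by rewrite mul0r; apply: integral_ge0 => t /=; rewrite in_itv /= expr0 divr1 => /andP[h1 h2]; have := lt_le_trans h1 h2; rewrite ltxx.
  set a := t0 / 2 ^+ k.+1; set b := t0 / 2 ^+ k in ih.
  have ab : b = 2 * a by rewrite /a /b exprS; field; rewrite expf_neq0.
  have a0 : 0 < a by rewrite divr_gt0// exprn_gt0.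
  have bt : b <= t0 by rewrite ler_pdivrMr ?exprn_gt0// ler_peMr ?(ltW t00)// exprn_ege1// ler1n.
  have ab' : a <= b by rewrite ab ler_peMl ?(ltW a0)// ler1n.
  have U : (`]a, t0]%classic : set MR) = `]a, b]%classic `|` `]b, t0]%classic.
    by rewrite -itv_bndbnd_setU// bnd_simp.
  have mU : measurable_fun (`]a, t0]%classic : set MR) (fun t : MR => (t^-1)%:E : \bar R).
    apply: (measurable_funS _ _ (@measurable_invt t0)) => //.
    by move=> t /=; rewrite !in_itv /= => /andP[h ->]; rewrite (lt_trans a0).
  rewrite U ge0_integral_setU //=; last 3 first.
  - by rewrite -U.
  - move=> t; rewrite !in_itv /= lee_fin invr_ge0 => -[/andP[h _]|/andP[h _]].
      exact/ltW/(lt_trans a0).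
    exact/ltW/(lt_trans (lt_le_trans a0 ab')).
  - apply/disj_setPS => t []; rewrite /= !in_itv /= => /andP[_ h] /andP[h' _].
    by have := lt_le_trans h' h; rewrite ltxx.
  rewrite -natr1 mulrDl EFinD addeC; apply: leeD => //.
  apply: (@le_trans _ _ (\int[leb]_(t in (`]a, b]%classic : set MR)) (b^-1)%:E)%E).
    rewrite integral_cst//=; have -> : leb (`]a, b]%classic : set MR) = (b - a)%:E.
      transitivity (leb (`]a, b]%classic : set R)); first by [].
      by rewrite lebesgue_measure_itv /= lte_fin ab ltr_pMl// ltr1n -EFinB.
    by rewrite -EFinM lee_fin le_eqVlt ab; apply/orP; left; apply/eqP; field; rewrite gt_eqF.
  apply: ge0_le_integral => //.
  - by move=> t _; rewrite lee_fin invr_ge0 (le_trans (ltW a0)).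
  - apply: (measurable_funS _ _ (@measurable_invt t0)) => //.
    by move=> t /=; rewrite !in_itv /= => /andP[h h']; rewrite (lt_trans a0)//= (le_trans h').
  - move=> t /=; rewrite in_itv /= => /andP[h h']; rewrite lee_fin lef_pV2 ?posrE ?(lt_trans a0 h)//.
    exact: lt_le_trans ab'.
pose k := Num.bound `|2 * M|.
have Mk : M <= k%:R / 2.
  rewrite ler_pdivlMr// mulrC; apply: le_trans (ler_norm _) _; exact/ltW/archi_boundP.
apply: (@le_trans _ _ (k%:R / 2)%:E); first by rewrite lee_fin.
apply: (le_trans (key k)); apply: ge0_subset_integral => //.
- exact: measurable_invt.
- by move=> t /=; rewrite in_itv /= => /andP[h _]; rewrite lee_fin invr_ge0 ltW.
- move=> t /=; rewrite !in_itv /= => /andP[h ->]; rewrite andbT; apply: le_lt_trans h.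
  by rewrite divr_ge0 ?(ltW t00)// exprn_ge0.
Qed.

Lemma LN_rea_infty (m : R -> \bar R) (a : R) : 1 <= a -> (LN +oo a%:E (rea m) < +oo)%E ->
  forall t, 0 < t -> rea m t = 0%E.
Proof.
move=> a1 Nf t0 t00; have a0 : 0 < a by exact: lt_le_trans a1.
apply/eqP; rewrite eq_le rea_ge0 andbT leNgt; apply/negP => c0.
set c := rea m t0 in c0.
have I : (lorentz_integral +oo a (rea m) = +oo)%E.
  apply/eqP; rewrite -leye_eq.
  apply: (@le_trans _ _ (\int[leb]_(t in `]0%R, t0]) (c `^ a * (t^-1)%:E))%E).
    rewrite ge0_integralZl//; last 3 first.
    - exact: measurable_invt.
    - by move=> t /=; rewrite in_itv /= => /andP[h _]; rewrite lee_fin invr_ge0 ltW.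
    - exact: poweR_ge0.
    by rewrite int_inv_unbounded// gt0_muley// poweR_gt0.
  apply: (@le_trans _ _ (\int[leb]_(t in `]0%R, t0]) lint +oo a (rea m) t)%E).
    apply: ge0_le_integral => //.
    - by move=> t /=; rewrite in_itv /= => /andP[h _]; rewrite mule_ge0 ?poweR_ge0// lee_fin invr_ge0 ltW.
    - by apply: emeasurable_funM; [exact: measurable_cst|exact: measurable_invt].
    - apply: (measurable_funS _ _ (@measurable_lint R +oo a (rea m) _)) => //.
        by move=> t; rewrite /= !in_itv /= andbT => /andP[].
      by apply: measurable_funTS; exact: measurable_rea.
    - move=> t /=; rewrite in_itv /= => /andP[h h'].
      rewrite /lint /inv_exponent powRr0 mul1e; apply: lee_wpmul2r; first by rewrite lee_fin invr_ge0 ltW.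
      have := @gt0_ler_poweR R a (ltW a0) c (rea m t).
      by rewrite !in_itv /= !leey !andbT !rea_ge0 => /(_ isT isT); apply; exact: rea_ni.
  apply: ge0_subset_integral => //.
  - by apply: measurable_lint; apply: measurable_funTS; exact: measurable_rea.
  - by move=> t; exact: lint_ge0.
  - by move=> t; rewrite /= !in_itv /= andbT => /andP[].
by move: Nf; rewrite /LN I poweRyr ?gt_eqF ?invr_gt0.
Qed.

Lemma mrea_rea0 (m : R -> \bar R) t : (forall t, 0 < t -> rea m t = 0%E) -> mrea m t = 0%E.
Proof.
move=> h; rewrite /mrea (_ : (\int[leb]_(u in _) _ = 0)%E) ?mule0//.
by apply: integral0_eq => u /=; rewrite in_itv /= => /andP[u0 _]; exact: h.
Qed.

End infinite_exponent.

Section infinite_exponent_bergman.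
Variables (R : realType) (n : nat).
Local Notation FT := ('rV[R[i]^o]_n -> R[i]^o).
Variables (Omega : set 'rV[R]_n) (P : mpoly.mpoly n R) (s : R) (a : R).
Hypotheses (oO : open Omega) (P0 : forall y, Omega y -> 0 < mpoly_eval P y) (a1 : 1 <= a).

Lemma bspace_trivial_infinite (f : FT) : bspace P s +oo a%:E oO f -> f = 0.
Proof.
move=> bf; have p1 : (1 < +oo :> \bar R)%E by rewrite ltry.
have q1 : (1 <= a%:E)%E by rewrite lee_fin.
apply: (bnorm_eq0 P0 p1 q1 bf); have [_ _ mf Nf] := bf.
set m := dist (tmu P s oO) (modulus f).
have mr0 t : mrea m t = 0%E.
  apply: mrea_rea0; apply: LN_rea_infty a1 _.
  by rewrite -LN_rea_fin.
(* Written as a multiple by 0, so that homogeneity of the functional gives the value 0. *)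
have -> : bnorm P s +oo a%:E oO f = LN +oo a%:E (fun t => 0%:E * mrea m t)%E.
  by rewrite /bnorm -/m; congr LN; apply/funext => t; rewrite mr0 mule0.
rewrite LN_scale ?mul0e//; first exact: measurable_mrea.
by move=> t; exact: mrea_ge0.
Qed.

End infinite_exponent_bergman.

(** * Properties of the cone drawn from its Jordan algebra *)

Section symmetric_cone_facts.
Variables (R : realType) (n r : nat) (Omega : set 'rV[R]_n).
Variables (mul : 'rV[R]_n -> 'rV[R]_n -> 'rV[R]_n) (e : 'rV[R]_n) (D : mpoly.mpoly n R).
Hypothesis hJ : jordan_structure Omega mul e r D.

Lemma cone_structure : [/\ open Omega, Omega e,
  forall x y : 'rV[R]_n, Omega x -> Omega y -> Omega (x + y) &
  forall (a : R) (x : 'rV[R]_n), 0 < a -> Omega x -> Omega (a *: x)] /\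
  forall y, Omega y -> 0 < mpoly_eval D y.
Proof.
have [[mulL mulC jordan mule [ip ipP ipA]] OE rk dt] := hJ.
have OP x : Omega x <-> pd mul ip x.
  by rewrite OE; exact: (interior_squares mulL mulC jordan mule ipP ipA).
split; first split.
- by rewrite OE; exact: open_interior.
- by apply/OP; exact: pd_e.
- by move=> x y /OP hx /OP hy; apply/OP; exact: pdD.
- by move=> a x a0 /OP hx; apply/OP; exact: pdZ.
- move=> y /OP; apply: (det_gt0 mulL mulC jordan mule ipP ipA rk dt).
  exact: mpoly_eval_cont.
Qed.

Lemma cone_weight s eta M : (0 < n)%N -> s <= -1 -> 0 < eta ->
  exists2 E : set (n.-tuple (measurableTypeR R)), measurable E /\
     (forall y, E y -> Omega (row_of_tuple y) /\ forall j, `|tnth y j| <= eta) &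
     (M%:E <= \int[ltm R n]_(y in E) weight D s y < +oo)%E.
Proof.
move=> n0 s1 eta0; have [[oO Oe OD OZ] _] := cone_structure.
have [[mulL mulC jordan mule [ip ipP ipA]] OE rk dt] := hJ.
have OP x : Omega x <-> pd mul ip x.
  by rewrite OE; exact: (interior_squares mulL mulC jordan mule ipP ipA).
have Dc := @mpoly_eval_cont R n D.
have [C C0 HC] := order_interval_bounded mulL mulC jordan mule ipP ipA.
(* The order interval below [rho *: e] then lies in the box of radius [eta] about 0. *)
pose rho := eta / C; have rho0 : 0 < rho by rewrite divr_gt0.
have lower (y : 'rV[R]_n) (a : R) : 0 < a -> Omega (y - a *: e) -> a ^+ r <= mpoly_eval D y.
  by move=> a0 /OP; exact: (det_lower mulL mulC jordan mule ipP ipA rk dt Dc).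
have upper (y : 'rV[R]_n) (eps : R) : 0 < eps -> Omega y -> Omega (rho *: e - y) ->
    ~ Omega (y - eps *: e) -> mpoly_eval D y <= 3 * eps * (2 * rho) ^+ r.-1.
  move=> eps0 /OP h1 /OP h2 h3.
  apply: (det_upper mulL mulC jordan mule ipP ipA rk dt Dc eps0 rho0 h1 h2).
  by move=> /OP.
have bounded : exists2 C : R, 0 < C & forall y : 'rV[R]_n, Omega y -> Omega (rho *: e - y) ->
    forall j, `|y 0 j| <= C * rho.
  by exists C => // y /OP h1 /OP h2; exact: HC.
have [E [mE hE] ME] := weight_unbounded n0 oO s1 rho0 Oe OD OZ lower upper bounded M.
exists E => //; split => // y /hE[h1 h2]; split => // j.
have := HC rho (row_of_tuple y) rho0 ((OP _).1 h1) ((OP _).1 h2) j.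
by rewrite row_of_tupleE mulrC divfK ?gt_eqF.
Qed.

End symmetric_cone_facts.

Theorem theorem1p1 (R : realType) (n r : nat) (Omega : set 'rV[R]_n)
    (mul : 'rV[R]_n -> 'rV[R]_n -> 'rV[R]_n) (e : 'rV[R]_n)
    (D : mpoly.mpoly n R) (nu : R) (p q : \bar R)
    (hOmega : irreducible_symmetric_cone Omega)
    (hJ : jordan_structure Omega mul e r D)
    (hp : (1 < p)%E) (hq : (1 <= q)%E) :
  (nu <= n%:R / r%:R - 1 -> ~ (p = +oo%E /\ q = +oo%E) ->
     bergman_lorentz r Omega D nu p q = [set 0]) /\
  (n%:R / r%:R - 1 < nu ->
     banach_space (bergman_lorentz r Omega D nu p q)
       (lorentz_norm (tube_measure r Omega D nu) p q)).
Proof.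
have [n0 _] := hOmega; have [[oO Oe OD OZ] P0] := cone_structure hJ.
pose s := nu - n%:R / r%:R.
rewrite (@bergman_lorentzE R n Omega D s p q oO hp hq r nu erefl).
split=> [hnu pq|_]; last first.
  rewrite (_ : lorentz_norm _ p q = bnorm D s p q oO); first exact: bspace_banach.
  by apply/funext => f; exact: lorentz_normE.
have s1 : s <= -1 by rewrite /s lerBlDr addrC.
apply/seteqP; split => [f bf|_ ->]; last exact: bspace0.
case: p hp pq bf => [a hp pq bf|hp pq bf|//].
  apply: (bspace_trivial_finite P0 hp hq OD OZ erefl _ bf) => eta M eta0.
  exact: (cone_weight hJ).
(* The case where p and q are both infinite is excluded by hypothesis: constants on the tube belong
   to that space. *)
case: q hq pq bf => [a hq _ bf|_ pq _|//]; last by case: pq.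
by apply: (bspace_trivial_infinite P0 _ bf); rewrite -lee_fin.
Qed.
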